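(* Let $n\ge1$, let $\lambda$ be a partition with at most $n$ parts, let $1\le k\le n$ and let $T\in\mathsf{KN}(\lambda,n)$ (regarded as an element of the type $C_{n-k+1}$ crystal $\mathsf{KN}_{[k,n]}(\lambda,n)$). Then $$\xi^{A_{2n-1}}_{[k,2n-k]}(E(T))=E\bigl(\xi^{C_n}_{[k,n]}(T)\bigr).$$ Moreover, on $\mathsf{SSYT}(\lambda^A,n,\overline n)$ one has $\xi^{A_{2n-1}}_{[k,2n-k]}=\mathsf{reversal}^{A_{2n-1}}_{[k,2n-k]}$, and $$\xi^{C_n}_{[k,n]}=E^{-1}\,\mathsf{reversal}^{A_{2n-1}}_{[k,2n-k]}\,E .$$
   Context: **Type A crystals.** Semistandard tableaux have rows weakly increasing left to right and columns strictly increasing top to bottom. The reading word reads columns from right to left, each from top to bottom. $\mathsf{SSYT}(\mu,m)$ is the set of semistandard tableaux of shape $\mu$ with entries in $[m]$. Operators $e_i,f_i$ ($1\le i<m$): in the reading word replace each $i$ by $+$ and each $i+1$ by $-$, ignore other letters, successively cancel adjacent pairs $+-$; there remains $-^r+^s$; $f_i$ changes the letter $i$ at the leftmost remaining $+$ into $i+1$ ($0$ if $s=0$), $e_i$ changes the letter $i+1$ at the rightmost remaining $-$ into $i$ ($0$ if $r=0$). **KN tableaux.** $\mathcal C_n=\{1<\dots<n<\overline n<\dots<\overline1\}$. A strictly increasing column $C$ of length at most $n$ in $\mathcal C_n$ is admissible if, with $z_1>\dots>z_m$ the unbarred letters $z$ with $z,\overline z\in C$, there are unbarred letters $t_1>\dots>t_m$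 with $t_1$ the largest letter such that $t_1<z_1$ and $t_1,\overline{t_1}\notin C$, and, for $i\ge2$, $t_i$ the largest letter such that $t_i<\min(t_{i-1},z_i)$ and $t_i,\overline{t_i}\notin C$. Then $lC$ (resp. $rC$) is obtained from $C$ by replacing each $z_i$ by $t_i$ (resp. $\overline{z_i}$ by $\overline{t_i}$) and reordering. A semistandard tableau in $\mathcal C_n$ is a KN tableau if all its columns are admissible and replacing each column $C$ by the two columns $lC,rC$ gives a semistandard tableau. $\mathsf{KN}(\lambda,n)$ is the set of KN tableaux of shape $\lambda$. Operators $f_i,e_i$ ($1\le i\le n$): in the reading word, for $i<n$ replace $i,\overline{i+1}$ by $+$ and $i+1,\overline i$ by $-$; for $i=n$ replace $n$ by $+$, $\overline n$ by $-$; ignore the other letters and successively cancel adjacent pairs $+-$, so that there remains a word of the form $-^r+^s$; $f_i$ acts on the letter at the leftmost remaining $+$ by $i\mapsto i+1$, $\overline{i+1}\mapsto\overline i$ ($i<n$), $n\mapsto\overline n$ ($i=n$); $e_i$ acts on the letter at the rightmost remaining $-$ by the inverse map; $0$ if no such letter. $\mathsf{KN}_J(\lambda,n)$ denotes the crystal retaining only the operators with index in $J$. **Partial Schützenberger–Lusztig involutions.** For an interval $J$ of nodes, each connected component of the crystal under $e_j,f_j$, $j\in J$, has a unique highest weight element $u^{high}$ (killed by all $e_j$, $j\in J$) and a unique lowest weight element $u^{low}$ (killed by all $f_j$, $j\in J$), and $\xi_J(f_{j_r}\cdots f_{j_1}u^{high})=e_{\theta_J(j_r)}\cdots e_{\theta_J(j_1)}u^{low}$,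 where $\theta_{[p,q]}(j)=p+q-j$ for type $A_{2n-1}$ (so $\theta_{[k,2n-k]}(j)=2n-j$), and $\theta_{[k,n]}(j)=j$ for type $C_n$. Superscripts $A_{2n-1}$, $C_n$ indicate whether it acts on type $A_{2n-1}$ tableaux or on $\mathsf{KN}(\lambda,n)$. **Reversal.** For a skew semistandard tableau $S$ on the alphabet $\{p,\dots,q+1\}$ let $\mathsf{rect}(S)$ be its jeu de taquin rectification; for straight $U$, $\mathsf{evac}(U)$ is obtained by rotating $U$ by $180^\circ$, replacing each $x$ by $p+q+1-x$, and rectifying. $\mathsf{reversal}(S)$ is obtained by rectifying $S$ by slides governed by a standard filling of its inner shape, replacing $\mathsf{rect}(S)$ by $\mathsf{evac}(\mathsf{rect}(S))$, and undoing the slides in reverse order. $\mathsf{reversal}^{A_{2n-1}}_{[p,q]}(T)$ replaces the subtableau of $T$ with letters in $[p,q+1]$ by its reversal, fixing all other entries. **Virtualization.** Identify $\mathcal C_n$ with $[2n]$ via $\overline i\leftrightarrow 2n+1-i$; $\mathsf{SSYT}(\mu,n,\overline n)$ is $\mathsf{SSYT}(\mu,2n)$ under this identification. Write $\lambda=\sum_{i=1}^n\lambda_i\omega_i$ with $\omega_i=(1^i)$, and $\lambda^A=2\lambda_n\omega_n^A+\sum_{i=1}^{n-1}\lambda_i(\omega_i^A+\omega_{2n-i}^A)$, $\omega^A_j=(1^j)\in\mathbb Z^{2n}$. With $f^A_i$ the type $A_{2n-1}$ operators, put $f_i^E=f_i^Af_{2n-i}^A$ ($i<n$), $f_n^E=(f_n^A)^2$.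 $E:\mathsf{KN}(\lambda,n)\to\mathsf{SSYT}(\lambda^A,n,\overline n)$ is Baker's injection, the unique map sending the highest weight tableau of shape $\lambda$ (all entries of row $i$ equal to $i$) to that of shape $\lambda^A$ and satisfying $E(f_i(T))=f_i^E(E(T))$ ($E(0)=0$). $E^{-1}$ is its inverse on its image. *)

(* Defs.v *)
From mathcomp Require Import all_boot.
From Stdlib Require Import ClassicalEpsilon.

Set Implicit Arguments.
Unset Strict Implicit.
Unset Printing Implicit Defensive.

(* A tableau is the list of its rows, top to bottom; letters are positive
   natural numbers and cells are 0-indexed pairs (row, column).  A partition
   is the weakly decreasing list of its nonzero parts. *)
Definition tableau := seq (seq nat).
Definition cell := (nat * nat)%type.

Definition is_partition (mu : seq nat) : bool :=
  sorted geq mu && all (ltn 0) mu.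

(* On a left-justified array of partition shape: from rows to columns, and
   also from columns to rows. *)
Definition transpose (T : tableau) : tableau :=
  [seq [seq nth 0 r c | r <- T & c < size r] | c <- iota 0 (size (head [::] T))].

Definition semistandard (T : tableau) : bool :=
  all (sorted leq) T && all (sorted ltn) (transpose T).

Definition ssyt (mu : seq nat) (m : nat) (T : tableau) : bool :=
  [&& shape T == mu, all (fun x => 1 <= x <= m) (flatten T) & semistandard T].

Definition hw_tableau (mu : seq nat) : tableau :=
  mkseq (fun r => nseq (nth 0 mu r) r.+1) (size mu).

(* Signature rule *)

Definition reading_cells (T : tableau) : seq cell :=
  [seq (r, c) | c <- rev (iota 0 (size (head [::] T))),
                r <- [seq r <- iota 0 (size T) | c < size (nth [::] T r)]].

Definition entry (T : tableau) (x : cell) : nat := nth 0 (nth [::] T x.1) x.2.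

Definition set_entry (T : tableau) (x : cell) (a : nat) : tableau :=
  set_nth [::] T x.1 (set_nth 0 (nth [::] T x.1) x.2 a).

(* A sign is [true] for + and [false] for -; each sign remembers its cell. *)
Definition signed_word (sg : nat -> option bool) (T : tableau) :
    seq (bool * cell) :=
  pmap (fun x => omap (fun s => (s, x)) (sg (entry T x))) (reading_cells T).

(* Prefixing a sign to a reduced word creates at most one adjacent pair +-. *)
Definition cancel_cons (s : bool * cell) (w : seq (bool * cell)) :=
  match s, w with
  | (true, _), (false, _) :: w' => w'
  | _, _ => s :: w
  end.

Definition reduced_word (sg : nat -> option bool) (T : tableau) :
    seq (bool * cell) :=
  foldr cancel_cons [::] (signed_word sg T).

Definition leftmost_plus (sg : nat -> option bool) (T : tableau) : option cell :=
  ohead [seq s.2 | s <- reduced_word sg T & s.1].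

Definition rightmost_minus (sg : nat -> option bool) (T : tableau) :
    option cell :=
  ohead (rev [seq s.2 | s <- reduced_word sg T & ~~ s.1]).

(* [None] plays the role of the 0 of a crystal. *)
Definition act (a : nat -> nat) (T : tableau) (o : option cell) :
    option tableau :=
  omap (fun x => set_entry T x (a (entry T x))) o.

Definition signA (i x : nat) : option bool :=
  if x == i then Some true else if x == i.+1 then Some false else None.

Definition fA (i : nat) (T : tableau) : option tableau :=
  act succn T (leftmost_plus (signA i) T).
Definition eA (i : nat) (T : tableau) : option tableau :=
  act predn T (rightmost_minus (signA i) T).

(* Type C_n.  The alphabet 1 < ... < n < bar n < ... < bar 1 is encoded as
   [2n], the barred letter bar i being 2n+1-i.  In this encoding bar (n+1) = n
   and n+1 = bar n, so that the rule for i < n (i and bar (i+1) are +, i+1 and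
   bar i are -) also gives the rule for i = n, and every map between letters
   (i to i+1, bar (i+1) to bar i, n to bar n) is the successor. *)
Definition bar (n x : nat) : nat := (2 * n).+1 - x.

Definition signC (n i x : nat) : option bool :=
  if (x == i) || (x == bar n i.+1) then Some true
  else if (x == i.+1) || (x == bar n i) then Some false
  else None.

Definition fC (n i : nat) (T : tableau) : option tableau :=
  act succn T (leftmost_plus (signC n i) T).
Definition eC (n i : nat) (T : tableau) : option tableau :=
  act predn T (rightmost_minus (signC n i) T).

(* Kashiwara-Nakashima tableaux *)

Definition col_z (n : nat) (C : seq nat) : seq nat :=
  [seq z <- rev (iota 1 n) | (z \in C) && (bar n z \in C)].

Definition largest_free (n : nat) (C : seq nat) (b : nat) : option nat :=
  ohead [seq t <- rev (iota 1 n) | [&& t < b, t \notin C & bar n t \notin C]].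

(* [b] is t_(i-1); [None] if some t_i does not exist. *)
Fixpoint col_t_from (n : nat) (C : seq nat) (b : nat) (zs : seq nat) :
    option (seq nat) :=
  if zs is z :: zs' then
    if largest_free n C (minn b z) is Some t then
      omap (cons t) (col_t_from n C t zs')
    else None
  else Some [::].

Definition col_t (n : nat) (C : seq nat) : option (seq nat) :=
  col_t_from n C n.+1 (col_z n C).

Definition admissible (n : nat) (C : seq nat) : bool :=
  [&& sorted ltn C, all (fun x => 1 <= x <= 2 * n) C, size C <= n
    & isSome (col_t n C)].

(* Replace the letters of [old] by the corresponding letters of [new]. *)
Definition replace_letters (old new C : seq nat) : seq nat :=
  sort leq [seq (if x \in old then nth 0 new (index x old) else x) | x <- C].

Definition lcol (n : nat) (C : seq nat) : seq nat :=
  replace_letters (col_z n C) (odflt [::] (col_t n C)) C.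
Definition rcol (n : nat) (C : seq nat) : seq nat :=
  replace_letters (map (bar n) (col_z n C))
                  (map (bar n) (odflt [::] (col_t n C))) C.

Definition split_tableau (n : nat) (T : tableau) : tableau :=
  transpose (flatten [seq [:: lcol n C; rcol n C] | C <- transpose T]).

Definition KN (lam : seq nat) (n : nat) (T : tableau) : bool :=
  [&& ssyt lam (2 * n) T, all (admissible n) (transpose T)
    & semistandard (split_tableau n T)].

(* Partial Schuetzenberger-Lusztig involutions *)

Record crystal := Crystal {
  elts : pred tableau;
  ff : nat -> tableau -> option tableau;
  ee : nat -> tableau -> option tableau
}.

Definition SSYT_crystal (mu : seq nat) (m : nat) : crystal :=
  Crystal (ssyt mu m) fA eA.
Definition KN_crystal (lam : seq nat) (n : nat) : crystal :=
  Crystal (KN lam n) (fC n) (eC n).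

Definition interval (p q : nat) : pred nat := fun j => p <= j <= q.

Inductive connected (B : crystal) (J : pred nat) (T : tableau) :
    tableau -> Prop :=
| conn_refl : connected B J T T
| conn_f j U V : connected B J T U -> J j -> ff B j U = Some V ->
    connected B J T V
| conn_e j U V : connected B J T U -> J j -> ee B j U = Some V ->
    connected B J T V.

Definition highest (B : crystal) (J : pred nat) (u : tableau) : Prop :=
  elts B u /\ forall j, J j -> ee B j u = None.
Definition lowest (B : crystal) (J : pred nat) (u : tableau) : Prop :=
  elts B u /\ forall j, J j -> ff B j u = None.

(* [apply_ops g [:: j_1; ...; j_r] u] is g_(j_r) ... g_(j_1) u. *)
Definition apply_ops (g : nat -> tableau -> option tableau) (js : seq nat)
    (u : tableau) : option tableau :=
  foldl (fun o j => obind (g j) o) (Some u) js.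

Definition is_xi (B : crystal) (J : pred nat) (theta : nat -> nat)
    (T T' : tableau) : Prop :=
  exists uhigh ulow js,
    [/\ highest B J uhigh, lowest B J ulow, connected B J uhigh ulow, all J js
      & apply_ops (ff B) js uhigh = Some T /\
        apply_ops (ee B) (map theta js) ulow = Some T'].

Definition xi (B : crystal) (J : pred nat) (theta : nat -> nat) (T : tableau) :
    tableau :=
  epsilon (inhabits [::]) (is_xi B J theta T).

Definition xiA (mu : seq nat) (m p q : nat) : tableau -> tableau :=
  xi (SSYT_crystal mu m) (interval p q) (fun j => p + q - j).
Definition xiC (lam : seq nat) (n k : nat) : tableau -> tableau :=
  xi (KN_crystal lam n) (interval k n) id.

(* Jeu de taquin on skew tableaux: [None], or a position out of range, is an
   empty cell. *)
Definition skew := seq (seq (option nat)).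

Definition sget (S : skew) (x : cell) : option nat :=
  nth None (nth [::] S x.1) x.2.
Definition sset (S : skew) (x : cell) (o : option nat) : skew :=
  set_nth [::] S x.1 (set_nth None (nth [::] S x.1) x.2 o).

(* [x] is the current hole; returns the vacated outer cell as well.  The path
   of the hole is shorter than the number of positions in [S]. *)
Fixpoint slide_rec (fuel : nat) (S : skew) (x : cell) : skew * cell :=
  let down := (x.1.+1, x.2) in
  let right := (x.1, x.2.+1) in
  if fuel is fuel'.+1 then
    match sget S down, sget S right with
    | None, None => (sset S x None, x)
    | Some a, None => slide_rec fuel' (sset S x (Some a)) down
    | None, Some b => slide_rec fuel' (sset S x (Some b)) right
    | Some a, Some b =>
        if a <= b then slide_rec fuel' (sset S x (Some a)) down
        else slide_rec fuel' (sset S x (Some b)) right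
    end
  else (sset S x None, x).

Definition slide (S : skew) (x : cell) : skew * cell :=
  slide_rec (size (flatten S)) S x.

Fixpoint unslide_rec (fuel : nat) (S : skew) (x : cell) : skew :=
  let up := (x.1.-1, x.2) in
  let left := (x.1, x.2.-1) in
  if fuel is fuel'.+1 then
    match (if 0 < x.1 then sget S up else None),
          (if 0 < x.2 then sget S left else None) with
    | None, None => sset S x None
    | Some a, None => unslide_rec fuel' (sset S x (Some a)) up
    | None, Some b => unslide_rec fuel' (sset S x (Some b)) left
    | Some a, Some b =>
        if b <= a then unslide_rec fuel' (sset S x (Some a)) up
        else unslide_rec fuel' (sset S x (Some b)) left
    end
  else sset S x None.

Definition unslide (S : skew) (x : cell) : skew :=
  unslide_rec (x.1 + x.2).+1 S x.

Definition standard_filling (nu : seq nat) (Q : tableau) : bool :=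
  [&& shape Q == nu, perm_eq (flatten Q) (iota 1 (sumn nu)),
      all (sorted ltn) Q & all (sorted ltn) (transpose Q)].

Definition row_filling (nu : seq nat) : tableau :=
  reshape nu (iota 1 (sumn nu)).

Definition cell_of (Q : tableau) (a : nat) : cell :=
  let r := find (fun row => a \in row) Q in (r, index a (nth [::] Q r)).

(* Slides are performed into the cells of [Q] from the largest entry to the
   smallest one. *)
Definition slide_order (Q : tableau) : seq cell :=
  [seq cell_of Q a | a <- rev (iota 1 (size (flatten Q)))].

(* The rectified tableau, with the vacated cells, last one first. *)
Definition rectify (Q : tableau) (S : skew) : skew * seq cell :=
  foldl (fun st x => let: (S', y) := slide st.1 x in (S', y :: st.2))
        (S, [::]) (slide_order Q).

Definition straight_of_skew (S : skew) : tableau :=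
  [seq r <- map (pmap id) S | r != [::]].
Definition skew_of_straight (U : tableau) : skew := map (map Some) U.

Definition rect (nu : seq nat) (S : skew) : tableau :=
  straight_of_skew (rectify (row_filling nu) S).1.

(* The rotation takes place in the bounding rectangle of [U]. *)
Definition rotate (p q : nat) (U : tableau) : skew :=
  let w := size (head [::] U) in
  [seq nseq (w - size r) None ++ [seq Some (p + q + 1 - x) | x <- rev r]
  | r <- rev U].

Definition rotate_inner (U : tableau) : seq nat :=
  let w := size (head [::] U) in
  [seq l <- [seq w - size r | r <- rev U] | 0 < l].

Definition evac (p q : nat) (U : tableau) : tableau :=
  rect (rotate_inner U) (rotate p q U).

Definition skew_reversal (p q : nat) (Q : tableau) (S : skew) : skew :=
  let: (R, vacated) := rectify Q S in
  foldl unslide (skew_of_straight (evac p q (straight_of_skew R))) vacated.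

Definition subtableau (p q : nat) (T : tableau) : skew :=
  [seq [seq (if p <= x <= q.+1 then Some x else None) | x <- r] | r <- T].

Definition inner_shape (p : nat) (T : tableau) : seq nat :=
  [seq l <- [seq count (fun x => x < p) r | r <- T] | 0 < l].

(* [Q] is the standard filling of [inner_shape p T] governing the slides. *)
Definition reversal (p q : nat) (Q T : tableau) : tableau :=
  let S := skew_reversal p q Q (subtableau p q T) in
  [seq [seq (if p <= entry T (r, c) <= q.+1
             then odflt 0 (sget S (r, c)) else entry T (r, c))
       | c <- iota 0 (size (nth [::] T r))]
  | r <- iota 0 (size T)].

(* Virtualization *)

(* Coefficient of omega_i in lam, whose i-th part is [nth 0 lam i.-1]. *)
Definition omega_coef (lam : seq nat) (i : nat) : nat :=
  nth 0 lam i.-1 - nth 0 lam i.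

(* [omega j r] is the r-th part of (1^j). *)
Definition lamA (n : nat) (lam : seq nat) : seq nat :=
  let omega j r : nat := (r <= j) in
  [seq l <- [seq 2 * omega_coef lam n * omega n r +
                 sumn [seq omega_coef lam i * (omega i r + omega (2 * n - i) r)
                      | i <- iota 1 n.-1]
            | r <- iota 1 (2 * n)] | 0 < l].

Definition fE (n i : nat) (T : tableau) : option tableau :=
  if i < n then obind (fA i) (fA (2 * n - i) T) else obind (fA n) (fA n T).

(* [E] is only constrained on KN(lam, n), its domain. *)
Definition is_baker (n : nat) (lam : seq nat) (E : tableau -> tableau) : Prop :=
  [/\ forall T, KN lam n T -> ssyt (lamA n lam) (2 * n) (E T),
      E (hw_tableau lam) = hw_tableau (lamA n lam)
    & forall T i, KN lam n T -> 1 <= i <= n ->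
        omap E (fC n i T) = fE n i (E T)].

Definition baker_inv (n : nat) (lam : seq nat) (E : tableau -> tableau)
    (X : tableau) : tableau :=
  epsilon (inhabits [::]) (fun T => KN lam n T /\ E T = X).

(* Main.v *)
Require Import Defs.
From mathcomp Require Import all_boot.
From mathcomp Require Import zify.
From Stdlib Require Import ClassicalEpsilon FunctionalExtensionality.

(** Everything is read off signs.  In a column the letters i and i+1 leave at
    most one uncancelled sign, so f_i and e_i only see the sequence of the
    signs of the columns, read from right to left.

    Type A.  A jeu de taquin slide changes the signs of two neighbouring
    columns by at most one cancellation, and it commutes with lowering a letter
    ([slides_lower]).  Hence rectification commutes with the crystal operators
    ([rects_lowered], [rects_raised]).  A half turn that complements the letters
    exchanges f_j and e_(p+q-j), so evacuation does so as well
    ([evac_raises]).  It preserves the shape: in a highest weight tableau of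
    straight shape the row lengths count the letters, in a lowest weight one
    they count them backwards, and two such tableaux of the same shape are
    equal ([evac_support], [highest_uniq], [lowest_uniq]).  Transported through
    the slides, reversal exchanges f_j and e_(p+q-j) on the letters p, ..., q+1
    and sends highest to lowest weight elements, which characterizes the
    involution ([xi_reversal]).

    Type C.  In a column C read the pairs z, bar z as opening brackets and the
    letters t with neither t nor bar t in C as closing brackets, from n down to
    1.  The greedily chosen letters t are the closing brackets that are matched,
    and C is admissible exactly when no opening bracket stays open ([col_tE],
    [admissibleP]).  Replace each column C by rC followed by the
    complement of the bars of lC.  A comparison of the letters i, i+1 and their
    bars shows that these two columns carry the signs of C: exactly those of
    f_i, up to cancellations for f_(2n-i), and twice for i = n ([sign_split],
    [pair_signs], [pair_signs_last]).  It also shows that f_i on C amounts to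
    f_i f_(2n-i) on the two columns ([low_move], [high_move], [last_move],
    [step_raises]), and that the conditions on neighbouring columns persist
    ([step_kn], [step_kn_back]).

    Put these columns of T in disjoint horizontal strips: this is a skew
    tableau, and its rectification is E(T), for the highest weight tableau
    by comparing weights ([base_rect]), and then for all T because
    rectification commutes with the operators ([baker_step],
    [baker_rects]).  The slides can be undone, so E is injective
    ([baker_inj]).  Signs are preserved too, so an operator of type C
    kills T exactly when each of the corresponding two operators of type A kills
    E(T) ([baker_ep], [baker_ph]).

    Therefore E sends highest and lowest weight elements for [k,n] to such
    elements for [k,2n-k], and a word in the f_j to the word in which each j is
    replaced by 2n-j, j.  The diagram automorphism turns the latter into the
    word in the e_j that corresponds to the same word of type C.  So E maps
    xi(T) to the involution of E(T) ([is_xi_E]).  That the word in the e_j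
    does not vanish on the lowest weight element of type C is read off its
    image ([e_word_lift]). *)

Set Implicit Arguments.
Unset Strict Implicit.
Unset Printing Implicit Defensive.

(** * Words of signs *)

(** Effect of one more sign on the number of uncancelled signs + of a word,
    when the sign is appended at the right; [push_left] is the effect on
    the number of uncancelled signs - when it is prepended at the left.
    [None] is a letter without sign. *)
Definition push_right (o : option bool) (p : nat) : nat :=
  match o with Some true => p.+1 | Some false => p.-1 | None => p end.
Definition push_left (o : option bool) (e : nat) : nat :=
  match o with Some true => e.-1 | Some false => e.+1 | None => e end.

(** The numbers of uncancelled signs, written phi and epsilon in crystal
    theory. *)
Definition phi (w : seq (option bool)) : nat :=
  foldl (fun p o => push_right o p) 0 w.
Definition eps (w : seq (option bool)) : nat := foldr push_left 0 w.

Arguments phi : simpl never.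
Arguments eps : simpl never.

Lemma eps_cons o u : eps (o :: u) = push_left o (eps u).
Proof. by []. Qed.

(** A word first cancels up to [eps w] of the signs + that precede it. *)
Lemma foldl_push (w : seq (option bool)) p :
  foldl (fun p o => push_right o p) p w = phi w + (p - eps w).
Proof.
elim: w p => [|o w IH] p /=; first by rewrite /phi /eps /=; lia.
rewrite IH {2}/phi /= IH eps_cons.
by case: o => [[]|] /=; lia.
Qed.

Lemma phi_cat u v : phi (u ++ v) = phi v + (phi u - eps v).
Proof. by rewrite {1}/phi foldl_cat foldl_push. Qed.

Lemma phi_cons o u : phi (o :: u) = phi u + (push_right o 0 - eps u).
Proof. by rewrite {1}/phi /= foldl_push. Qed.

Lemma foldr_push (w : seq (option bool)) e :
  foldr push_left e w = eps w + (e - phi w).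
Proof.
elim: w e => [|o w IH] e /=; first by rewrite subn0.
rewrite IH phi_cons eps_cons.
by case: o => [[]|] /=; lia.
Qed.

Lemma eps_cat u v : eps (u ++ v) = eps u + (eps v - phi u).
Proof. by rewrite {1}/eps foldr_cat foldr_push. Qed.

Definition signs (sg : nat -> option bool) (S : cell -> nat) (cs : seq cell) :=
  [seq sg (S x) | x <- cs].

Definition reduced (sg : nat -> option bool) (S : cell -> nat) (cs : seq cell) :=
  foldr cancel_cons [::]
    (pmap (fun x => omap (fun s => (s, x)) (sg (S x))) cs).

(** The cell on which the signature rule acts, described without reducing
    the word: no sign + survives before it and no sign - after it. *)
Definition balanced_at sg S cs (x : cell) := exists u v,
  [/\ cs = u ++ x :: v, phi (signs sg S u) = 0 & eps (signs sg S v) = 0].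

(** The reduced word is a block of minuses followed by a block of pluses;
    what was cancelled around its leftmost + and its rightmost - is
    balanced, by induction on the word. *)
Lemma reduced_form sg S cs : exists ms ps : seq cell,
  [/\ reduced sg S cs = map (pair false) ms ++ map (pair true) ps,
      size ms = eps (signs sg S cs), size ps = phi (signs sg S cs),
      forall x ps', ps = x :: ps' ->
        sg (S x) = Some true /\ balanced_at sg S cs x
    & forall x ms', ms = rcons ms' x ->
        sg (S x) = Some false /\ balanced_at sg S cs x].
Proof.
elim: cs => [|y cs [ms [ps [Er Em Ep Hp Hm]]]].
  by exists [::], [::]; split=> // x [].
have bal0 : eps (signs sg S cs) = 0 -> balanced_at sg S (y :: cs) y.
  by move=> e0; exists [::], cs.
have epsu u x v : cs = u ++ x :: v -> phi (signs sg S u) = 0 ->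
    eps (signs sg S v) = 0 ->
    size ms = eps (signs sg S u) + (sg (S x) == Some false).
  rewrite Em => -> pu ev.
  rewrite /signs map_cat eps_cat /= -/(signs sg S v) -/(signs sg S u) pu.
  rewrite eps_cons ev.
  by case: (sg (S x)) => [[]|] /=; lia.
rewrite /reduced /= -/(signs sg S cs).
have ext x b : (sg (S x) = Some b -> balanced_at sg S cs x ->
    (forall u v, cs = u ++ x :: v -> phi (signs sg S u) = 0 ->
       eps (signs sg S v) = 0 -> push_right (sg (S y)) 0 <= eps (signs sg S u)) ->
    sg (S x) = Some b /\ balanced_at sg S (y :: cs) x).
  move=> sx [u [v [E1 E2 E3]]] H; split=> //; exists (y :: u), v; split=> //=.
    by rewrite E1.
  by rewrite phi_cons E2; have := H _ _ E1 E2 E3; lia.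
case Es: (sg (S y)) => [[]|] /=; rewrite -/(reduced sg S cs) Er phi_cons eps_cons.
- case: ms Em Er Hm epsu => [|m ms] Em Er Hm epsu /=.
    exists [::], (y :: ps); split=> //=.
    + by case: ps {Er Ep Hp}.
    + by rewrite -Em.
    + by rewrite -Em Ep /=; lia.
    + by move=> x ps' [<- _]; split=> //; apply: bal0.
    + by move=> x; case.
  exists ms, ps; split=> //=.
  + by rewrite -Em.
  + by rewrite -Em Ep /=; lia.
  + move=> x ps' E; have [sx B] := Hp x ps' E.
    apply: ext => // u v E1 E2 E3.
    by have := epsu _ _ _ E1 E2 E3; rewrite sx Es /= ; lia.
  + move=> x ms' E; have [|sx B] := Hm x (m :: ms').
      by rewrite E.
    apply: ext => // u v E1 E2 E3.
    by have := epsu _ _ _ E1 E2 E3; rewrite sx Es /= E size_rcons; lia.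
- exists (y :: ms), ps; split=> //=.
  + by rewrite Em.
  + by rewrite Ep; lia.
  + by move=> x ps' E; have [sx B] := Hp x ps' E; apply: ext; rewrite // Es.
  + move=> x ms'; case: ms {Er epsu} Em Hm => [|m ms] Em Hm.
      by case: ms' => [|? []] //= [<-]; split=> //; apply: bal0.
    case: ms' => [|m' ms'] //= [_ E]; have [sx B] := Hm x ms' E.
    by apply: ext; rewrite // Es.
- exists ms, ps; split=> //=.
  + by rewrite Ep; lia.
  + by move=> x ps' E; have [sx B] := Hp x ps' E; apply: ext; rewrite // Es.
  + by move=> x ms' E; have [sx B] := Hm x ms' E; apply: ext; rewrite // Es.
Qed.

(** If two balanced cells carried the same sign, the stretch between them
    would have to cancel it. *)
Lemma balanced_uniq sg S cs x y b :
  sg (S x) = Some b -> sg (S y) = Some b ->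
  balanced_at sg S cs x -> balanced_at sg S cs y -> x = y.
Proof.
move=> sx sy [u [v [E1 pu ev]]] [u' [v' [E2 pu' ev']]].
(* no two balanced positions, the first strictly before the second *)
have aux a c u0 m v0 : sg (S a) = Some b -> sg (S c) = Some b ->
    phi (signs sg S u0) = 0 -> eps (signs sg S (m ++ c :: v0)) = 0 ->
    phi (signs sg S (u0 ++ a :: m)) = 0 -> eps (signs sg S v0) = 0 -> False.
  move=> sa sc; rewrite /signs !map_cat /= sa sc !phi_cat !eps_cat phi_cons eps_cons.
  by case: b {sx sy sa sc} => /=; lia.
move: E2; rewrite {1}E1 => E2.
have [lt|gt|eq] := ltngtP (size u) (size u'); last first.
- have := congr1 (drop (size u)) E2; rewrite drop_size_cat //.
  by rewrite eq drop_size_cat // => -[].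
- have Eu: u = u' ++ drop (size u') u.
    rewrite -{1}(cat_take_drop (size u') u); congr (_ ++ _).
    have := congr1 (take (size u')) E2.
    by rewrite take_cat gt take_size_cat.
  have := congr1 (drop (size u')) E2; rewrite drop_cat gt drop_size_cat //.
  case Em: (drop (size u') u) => [|z m] /=.
    by move: Em => /(congr1 size); rewrite size_drop /=; lia.
  case=> Ez Ev; subst z v'.
  by case: (aux _ _ _ _ _ sy sx pu' ev' _ ev); rewrite -Em -Eu.
- have Eu: u' = u ++ drop (size u) u'.
    rewrite -{1}(cat_take_drop (size u) u'); congr (_ ++ _).
    have := congr1 (take (size u)) E2.
    by rewrite take_size_cat // take_cat lt.
  have := congr1 (drop (size u)) E2; rewrite drop_size_cat // drop_cat lt.
  case Em: (drop (size u) u') => [|z m] /=.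
    by move: Em => /(congr1 size); rewrite size_drop /=; lia.
  case=> Ez Ev; subst z v.
  by case: (aux _ _ _ _ _ sx sy pu ev _ ev'); rewrite -Em -Eu.
Qed.

Lemma filter_map_pair (b : bool) (xs : seq cell) :
  [seq s.2 | s <- [seq (b, x) | x <- xs] & s.1] = if b then xs else [::].
Proof. by case: b; elim: xs => //= x xs ->. Qed.

Lemma filter_map_pairN (b : bool) (xs : seq cell) :
  [seq s.2 | s <- [seq (b, x) | x <- xs] & ~~ s.1] = if b then [::] else xs.
Proof. by case: b; elim: xs => //= x xs ->. Qed.

Lemma leftmost_plusP sg T :
  match leftmost_plus sg T with
  | Some x => sg (entry T x) = Some true /\
              balanced_at sg (entry T) (reading_cells T) x
  | None => phi (signs sg (entry T) (reading_cells T)) = 0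
  end.
Proof.
rewrite /leftmost_plus /reduced_word /signed_word -/(reduced _ _ _).
have [ms [ps [-> _ <- Hp _]]] := reduced_form sg (entry T) (reading_cells T).
rewrite filter_cat map_cat filter_map_pair filter_map_pair /=.
by case: ps Hp => [|x ps] Hp //=; apply: (Hp x ps).
Qed.

Lemma rightmost_minusP sg T :
  match rightmost_minus sg T with
  | Some x => sg (entry T x) = Some false /\
              balanced_at sg (entry T) (reading_cells T) x
  | None => eps (signs sg (entry T) (reading_cells T)) = 0
  end.
Proof.
rewrite /rightmost_minus /reduced_word /signed_word -/(reduced _ _ _).
have [ms [ps [-> <- _ _ Hm]]] := reduced_form sg (entry T) (reading_cells T).
rewrite filter_cat map_cat filter_map_pairN filter_map_pairN /= cats0.
case/lastP: ms Hm => [|ms x] Hm //=; rewrite rev_rcons /=; exact: (Hm x ms).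
Qed.

(** * Sequences of column signs *)

(** Columns are read from right to left, so the word of the columns below c
    is a suffix of the whole word, and the word of the columns from c on is
    a prefix. *)
Fixpoint eps_below (g : nat -> option bool) (c : nat) : nat :=
  if c is c'.+1 then push_left (g c') (eps_below g c') else 0.
Fixpoint phi_from (g : nat -> option bool) (c d : nat) : nat :=
  if d is d'.+1 then push_right (g c) (phi_from g c.+1 d') else 0.

Lemma eq_eps_below g g' c :
  (forall d, d < c -> g d = g' d) -> eps_below g c = eps_below g' c.
Proof. by elim: c => //= c IH H; rewrite IH ?H // => d /ltnW; apply: H. Qed.

Lemma eq_phi_from g g' c d :
  (forall b, c <= b < c + d -> g b = g' b) -> phi_from g c d = phi_from g' c d.
Proof.
elim: d c => //= d IH c H; rewrite IH ?H //; first by lia.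
by move=> b Hb; apply: H; lia.
Qed.

Lemma eps_below_None g c d :
  (forall b, c <= b < c + d -> g b = None) -> eps_below g (c + d) = eps_below g c.
Proof.
elim: d => [|d IH] H; first by rewrite addn0.
by rewrite addnS /= H ?IH //; [move=> b Hb; apply: H; lia | lia].
Qed.

Lemma phi_from_None g c d :
  (forall b, c <= b < c + d -> g b = None) -> phi_from g c d = 0.
Proof.
elim: d c => //= d IH c H; rewrite IH ?H //; first by lia.
by move=> b Hb; apply: H; lia.
Qed.

(** [balanced_at] for columns: f acts in the column c if b is [true], e if
    b is [false]. *)
Definition acts_at (N : nat) (g : nat -> option bool) (b : bool) (c : nat) :=
  [/\ c < N, g c = Some b, phi_from g c.+1 (N - c.+1) = 0 & eps_below g c = 0].

Lemma phi_fromS N g c : c < N ->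
  phi_from g c (N - c) = push_right (g c) (phi_from g c.+1 (N - c.+1)).
Proof. by move=> H; rewrite -(subnSK H). Qed.

(** At the cut just left of the acting column phi exceeds epsilon, and this
    persists further to the left: a sign + raises phi and raises epsilon by
    at most one, a sign - lowers both. *)
Lemma acts_plus_lt N g c d : acts_at N g true c -> d <= c ->
  eps_below g d < phi_from g d (N - d).
Proof.
move=> [cN gc p0 e0] dc; rewrite -(subKn dc).
move: (c - d) (leq_subr d c) => k.
elim: k => [|k IH] kc; first by rewrite subn0 phi_fromS // gc p0 e0.
have {}IH := IH (ltnW kc).
have Ek : c - k = (c - k.+1).+1 by lia.
rewrite phi_fromS; last by lia.
by move: IH; rewrite Ek /=; case: (g _) => [[]|] /=; lia.
Qed.

Lemma acts_minus_lt N g c d : acts_at N g false c -> c < d <= N ->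
  phi_from g d (N - d) < eps_below g d.
Proof.
move=> [cN gc p0 e0]; elim: d => [|d IH] // /andP [cd dN].
move: cd; rewrite ltnS leq_eqVlt => /orP [/eqP <-|cd].
  by rewrite p0 /= gc e0.
have := IH; rewrite cd ltnW // phi_fromS // => /(_ isT) /=.
by case: (g d) => [[]|] /=; lia.
Qed.

(** Move a cut from the left end of the columns to the right: the excess of
    phi over epsilon is positive at first and not at the end; it stops
    being positive at the column where f acts. *)
Lemma acts_plusP N g :
  0 < phi_from g 0 N <-> exists c, acts_at N g true c.
Proof.
split=> [H|[c /acts_plus_lt H]]; last by have := H 0; rewrite subn0; apply.
suff aux k c : c + k = N -> eps_below g c < phi_from g c k ->
    exists c, acts_at N g true c by exact: (aux N 0).
elim: k c => [|k IH] c cN //= lt.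
have IH' := IH c.+1; rewrite addSnnS in IH'; have {}IH' := IH' cN.
have ck : k = N - c.+1 by lia.
move: lt IH'; rewrite /=; case gc: (g c) => [[]|] /= lt IH';
  try by apply: IH'; lia.
case e0: (eps_below g c) => [|e]; last by apply: IH'; lia.
case p0: (phi_from g c.+1 k) => [|p]; last by apply: IH'; lia.
by exists c; rewrite /acts_at -ck p0; split=> //; lia.
Qed.

Lemma acts_minusP N g :
  0 < eps_below g N <-> exists c, acts_at N g false c.
Proof.
split=> [H|[c A]]; last first.
  have [cN _ _ _] := A; have := acts_minus_lt A (d := N).
  by rewrite cN leqnn => /(_ isT); lia.
suff aux c : c <= N -> phi_from g c (N - c) < eps_below g c ->
    exists c, acts_at N g false c by apply: (aux N); rewrite // subnn.
elim: c => [|c IH] cN //= lt.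
have {}IH := IH (ltnW cN); rewrite phi_fromS // in IH.
move: lt IH; case gc: (g c) => [[]|] /= lt IH; try by apply: IH; lia.
case p0: (phi_from g c.+1 (N - c.+1)) => [|p]; last by apply: IH; lia.
case e0: (eps_below g c) => [|e]; last by apply: IH; lia.
by exists c.
Qed.

(** The second acting column would contradict [acts_plus_lt] or
    [acts_minus_lt] at the cut next to the first. *)
Lemma acts_at_uniq N g b c c' :
  acts_at N g b c -> acts_at N g b c' -> c = c'.
Proof.
have aux c1 c2 : acts_at N g b c1 -> acts_at N g b c2 -> c2 <= c1.
  move=> A1 A2; rewrite leqNgt; apply/negP => lt.
  case: b A1 A2 => A1 A2.
    by have := acts_plus_lt A2 lt; case: A1 => _ _ -> _.
  have := acts_minus_lt A1 (d := c2); case: A2 => c2N _ _ ->.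
  by rewrite lt ltnW // => /(_ isT).
by move=> A1 A2; apply/eqP; rewrite eqn_leq !aux.
Qed.

(** * Jeu de taquin slides of skew fillings *)

(** A filling of the quadrant, with 0 for an empty cell. Functions make the
    slides and the skew shapes free of bookkeeping on lists; they are
    linked to arrays further below. *)
Definition filling := cell -> nat.

Definition upd (S : filling) (x : cell) (a : nat) : filling :=
  fun y => if y == x then a else S y.

(** The sign that a column with set of letters P contributes for f_i: i
    lies just above i+1 in a column, and then their signs cancel. *)
Definition sign_of (i : nat) (P : pred nat) : option bool :=
  if P i then if P i.+1 then None else Some true
  else if P i.+1 then Some false else None.

Definition occurs (N : nat) (S : filling) (c : nat) : pred nat :=
  fun a => has (fun r => S (r, c) == a) (iota 0 N).

Definition col_sign (N i : nat) (S : filling) (c : nat) : option bool :=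
  sign_of i (occurs N S c).

(** The operator f_i. It acts in the column [acts_at] finds, where the
    letter i is unique. *)
Definition raises (N i : nat) (S S' : filling) : Prop := exists r c,
  [/\ r < N, S (r, c) = i, acts_at N (col_sign N i S) true c
    & S' = upd S (r, c) i.+1].

Definition down_closed (P : pred cell) : Prop := forall r c r' c',
  r' <= r -> c' <= c -> P (r, c) -> P (r', c').

(** Skew tableaux of inner shape mu, with a set E of extra empty cells that
    belong to the outer shape: none, or the hole of a slide in progress.
    The bound N makes the sums over rows and columns finite. *)
Record young (N : nat) (mu : pred cell) (S : filling) (E : pred cell) : Prop := Young {
  young_inner : down_closed mu;
  young_disj : forall x, mu x -> S x = 0;
  young_outer : down_closed (fun x => [|| mu x, S x != 0 | E x]);
  young_row : forall r c c', c < c' -> S (r, c) != 0 -> S (r, c') != 0 ->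
    S (r, c) <= S (r, c');
  young_col : forall r r' c, r < r' -> S (r, c) != 0 -> S (r', c) != 0 ->
    S (r, c) < S (r', c);
  young_box : forall r c, S (r, c) != 0 -> r < N /\ c < N
}.

Definition skewt N mu S := young N mu S pred0.
Definition holed N mu S (h : cell) :=
  [/\ young N mu S (pred1 h), ~~ mu h & S h = 0].

Definition below (x : cell) : cell := (x.1.+1, x.2).
Definition right (x : cell) : cell := (x.1, x.2.+1).

Definition shift (S : filling) (h d : cell) : filling := upd (upd S h (S d)) d 0.

(** [slides S h R y]: the hole h moves by jeu de taquin to the outer cell
    y, and turns S into R. *)
Inductive slides : filling -> cell -> filling -> cell -> Prop :=
| slides_stop S h : S (below h) = 0 -> S (right h) = 0 -> slides S h S h
| slides_down S h R y : S (below h) != 0 ->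
    S (right h) = 0 \/ S (below h) <= S (right h) ->
    slides (shift S h (below h)) (below h) R y -> slides S h R y
| slides_right S h R y : S (right h) != 0 ->
    S (below h) = 0 \/ S (right h) < S (below h) ->
    slides (shift S h (right h)) (right h) R y -> slides S h R y.

Lemma occursP N S c a :
  reflect (exists2 r, r < N & S (r, c) = a) (occurs N S c a).
Proof.
apply: (iffP hasP) => [[r]|[r rN /eqP Sr]].
  by rewrite mem_iota add0n => rN /eqP; exists r.
by exists r; rewrite // mem_iota add0n.
Qed.

Lemma slides_below_inv S h R y : slides S h R y -> S (below h) != 0 ->
  S (right h) = 0 \/ S (below h) <= S (right h) ->
  slides (shift S h (below h)) (below h) R y.
Proof.
case=> {S h R y} [S h -> //|S h R y //|S h R y b0 [->|lt] //].
by move=> _ _ [E|le]; [rewrite E in b0 | move: le; rewrite leqNgt lt].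
Qed.

Lemma updE S x a y : upd S x a y = if y == x then a else S y.
Proof. by []. Qed.

Lemma shiftE S h d y :
  shift S h d y = if y == d then 0 else if y == h then S d else S y.
Proof. by []. Qed.

Section Young.
Variables (N : nat) (mu : pred cell).
Implicit Types (S : filling) (E : pred cell).

Lemma inner_mono S E r c r' c' : young N mu S E ->
  r' <= r -> c' <= c -> ~~ mu (r', c') -> ~~ mu (r, c).
Proof. by move=> Y rr cc; apply: contra; apply: (young_inner Y). Qed.

Lemma filled_not_inner S E x : young N mu S E -> S x != 0 -> ~~ mu x.
Proof. by move=> Y; apply: contra => /(young_disj Y) ->. Qed.

Lemma filled_between S E r c r' c' : young N mu S E -> r' <= r -> c' <= c ->
  S (r, c) != 0 -> ~~ mu (r', c') -> ~~ E (r', c') -> S (r', c') != 0.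
Proof.
move=> Y rr cc nz nmu nE.
have := young_outer Y rr cc; rewrite nz orbT => /(_ isT).
by rewrite (negPf nmu) (negPf nE) orbF.
Qed.

Lemma filled_belowl S E r r' c : young N mu S E -> ~~ mu (r, c) ->
  r < r' -> (forall x, E x -> x = (r, c)) -> S (r', c) != 0 -> S (r.+1, c) != 0.
Proof.
move=> Y nmu lt HE nz; apply: (filled_between Y lt (leqnn c) nz).
  exact: (inner_mono Y (leqnSn r) (leqnn c) nmu).
by apply/negP => /HE [] /eqP; rewrite gtn_eqF.
Qed.

Lemma filled_rightl S E r c c' : young N mu S E -> ~~ mu (r, c) ->
  c < c' -> (forall x, E x -> x = (r, c)) -> S (r, c') != 0 -> S (r, c.+1) != 0.
Proof.
move=> Y nmu lt HE nz; apply: (filled_between Y (leqnn r) lt nz).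
  exact: (inner_mono Y (leqnn r) (leqnSn c) nmu).
by apply/negP => /HE [] /eqP; rewrite gtn_eqF.
Qed.

Lemma outer_shift S h d : S h = 0 -> S d != 0 ->
  (fun x => [|| mu x, shift S h d x != 0 | pred1 d x]) =1
  (fun x => [|| mu x, S x != 0 | pred1 h x]).
Proof.
move=> h0 d0 x; rewrite shiftE /=; case: (x =P d) => [->|_].
  by rewrite d0 !orbT.
by case: (x =P h) => [->|_]; rewrite ?d0 ?orbT.
Qed.

Lemma eq_down_closed (P Q : pred cell) : P =1 Q -> down_closed P -> down_closed Q.
Proof. by move=> E H r c r' c' rr cc; rewrite -!E; apply: H. Qed.

Lemma holed_shift S h d : holed N mu S h -> S d != 0 -> d <> h ->
  (forall r c c', c < c' -> shift S h d (r, c) != 0 -> shift S h d (r, c') != 0 ->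
     shift S h d (r, c) <= shift S h d (r, c')) ->
  (forall r r' c, r < r' -> shift S h d (r, c) != 0 -> shift S h d (r', c) != 0 ->
     shift S h d (r, c) < shift S h d (r', c)) ->
  h.1 <= d.1 -> h.2 <= d.2 ->
  holed N mu (shift S h d) d.
Proof.
move=> [Y nmu h0] d0 dh Hr Hc le1 le2; split; last by rewrite shiftE eqxx.
- split=> //.
  + exact: young_inner Y.
  + move=> x mux; rewrite shiftE; case: eqP => // _; case: eqP => [xh|_].
      by rewrite xh (negPf nmu) in mux.
    exact: (young_disj Y mux).
  + apply: eq_down_closed (young_outer Y) => x; exact/esym/outer_shift.
  + move=> r c; rewrite shiftE; case: ((r, c) =P d) => // _.
    case: ((r, c) =P h) => [E|_].
      have := young_box Y (r := d.1) (c := d.2); rewrite -surjective_pairing.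
      by move=> /(_ d0) []; move: le1 le2; rewrite -E /=; lia.
    by move=> nz; apply: (young_box Y).
- exact: (filled_not_inner Y d0).
Qed.

Lemma pred1P (h x : cell) : pred1 h x -> x = h.
Proof. by move/eqP. Qed.

Ltac cell_case := case: eqP => [[? ?]|?]; try subst.

(** Moving the hole down preserves the conditions on rows: the letter that
    moves up is at most its new right neighbour by the slide rule, and its
    new left neighbours are above letters that are at most equal to it. *)
Lemma holed_below S h : holed N mu S h -> S (below h) != 0 ->
  S (right h) = 0 \/ S (below h) <= S (right h) ->
  holed N mu (shift S h (below h)) (below h).
Proof.
case: h => r c H d0 le; have [Y nmu h0] := H.
apply: (holed_shift H d0) => /=; [by case; lia | | | by [] | by []].
- move=> r0 c1 c2 lt; rewrite !shiftE /below /=.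
  have [//|_] := (r0, c1) =P _; have [//|_] := (r0, c2) =P _.
  have [[Er E1]|_] := (r0, c1) =P _; have [[Er' E2]|_] := (r0, c2) =P _;
    try subst; [lia | | | exact: (young_row Y lt)].
  + move=> _ nz.
    have nz1 := filled_rightl Y nmu lt (@pred1P _) nz.
    case: le => /= [e0|le]; first by rewrite e0 in nz1.
    apply: (leq_trans le _); move: lt; rewrite leq_eqVlt => /orP [/eqP <- //|lt].
    exact: (young_row Y lt nz1 nz).
  + move=> nz _.
    have nz1 : S (r.+1, c1) != 0.
      apply: (filled_between Y (leqnn _) (ltnW lt) d0).
        exact: (inner_mono Y (leqnSn r) (leqnn _) (filled_not_inner Y nz)).
      by apply/negP => /pred1P [] /eqP; rewrite gtn_eqF.
    apply: (leq_trans _ (young_row Y lt nz1 d0)).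
    exact: ltnW (young_col Y (ltnSn r) nz nz1).
- move=> r1 r2 c1 lt; rewrite !shiftE /below /=.
  have [//|nd1] := (r1, c1) =P _; have [//|nd2] := (r2, c1) =P _.
  have [[Er E1]|_] := (r1, c1) =P _; have [[Er' E2]|_] := (r2, c1) =P _;
    try subst; [lia | | | exact: (young_col Y lt)].
  + move=> _ nz; apply: (young_col Y _ d0 nz).
    by rewrite ltn_neqAle lt andbT; apply/eqP => E; rewrite -E in nd2.
  + by move=> nz _; apply: (young_col Y _ nz d0); apply: ltnW.
Qed.

(** The row condition compares the column of the hole with the next column,
    where the column condition applies. *)
Lemma above_hole_lt S r c r' : holed N mu S (r, c) -> S (r, c.+1) != 0 ->
  r' < r -> S (r', c) != 0 ->
  [/\ S (r', c.+1) != 0, S (r', c) <= S (r', c.+1)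
    & S (r', c.+1) < S (r, c.+1)].
Proof.
move=> [Y nmu h0] b0 lt nz.
have nz1 : S (r', c.+1) != 0.
  apply: (filled_between Y (ltnW lt) (leqnn _) b0).
    exact: (inner_mono Y (leqnn _) (leqnSn _) (filled_not_inner Y nz)).
  by apply/negP => /pred1P [] _ /eqP; rewrite gtn_eqF.
by split=> //; [apply: (young_row Y (ltnSn _) nz nz1) | apply: (young_col Y lt nz1 b0)].
Qed.

Lemma below_hole_gt S r c r' : holed N mu S (r, c) ->
  S (r.+1, c) = 0 \/ S (r, c.+1) < S (r.+1, c) ->
  r < r' -> S (r', c) != 0 -> S (r, c.+1) < S (r', c).
Proof.
move=> [Y nmu h0] ab lt nz.
have nz1 := filled_belowl Y nmu lt (@pred1P _) nz.
case: ab => [e0|ab]; first by rewrite e0 in nz1.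
apply: (leq_trans ab _); move: lt; rewrite leq_eqVlt => /orP [/eqP <- //|lt].
by apply/ltnW/(young_col Y).
Qed.

(** Moving the hole to the right preserves the conditions on columns, by
    the two lemmas before: the letter that moves left exceeds what is above
    it and is smaller than what is below. *)
Lemma holed_right S h : holed N mu S h -> S (right h) != 0 ->
  S (below h) = 0 \/ S (right h) < S (below h) ->
  holed N mu (shift S h (right h)) (right h).
Proof.
case: h => r c H d0 le; have [Y nmu h0] := H.
apply: (holed_shift H d0) => /=; [by case; lia | | | by [] | by []].
- move=> r0 c1 c2 lt; rewrite !shiftE /right /=.
  have [//|nd1] := (r0, c1) =P _; have [//|nd2] := (r0, c2) =P _.
  have [[Er E1]|_] := (r0, c1) =P _; have [[Er' E2]|_] := (r0, c2) =P _;
    try subst; [lia | | | exact: (young_row Y lt)].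
  + move=> _ nz; apply: (young_row Y _ d0 nz).
    by rewrite ltn_neqAle lt andbT; apply/eqP => E; rewrite -E in nd2.
  + by move=> nz _; apply: (young_row Y _ nz d0); apply: ltnW.
- move=> r1 r2 c1 lt; rewrite !shiftE /right /=.
  have [//|nd1] := (r1, c1) =P _; have [//|nd2] := (r2, c1) =P _.
  have [[Er E1]|_] := (r1, c1) =P _; have [[Er' E2]|_] := (r2, c1) =P _;
    try subst; [lia | | | exact: (young_col Y lt)].
  + by move=> _ nz; apply: (below_hole_gt H).
  + move=> nz _; have [_ le1 lt1] := above_hole_lt H d0 lt nz.
    exact: (leq_ltn_trans le1 lt1).
Qed.

End Young.

Lemma eps_belowS g c : eps_below g c.+1 = push_left (g c) (eps_below g c).
Proof. by []. Qed.

(** The counts only see the product of the two neighbouring signs, except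
    at the cut between them. *)
Lemma eps_below_swap g g' c d :
  (forall b, b <> c -> b <> c.+1 -> g b = g' b) ->
  (forall e, push_left (g c.+1) (push_left (g c) e) =
             push_left (g' c.+1) (push_left (g' c) e)) ->
  d <> c.+1 -> eps_below g d = eps_below g' d.
Proof.
move=> H1 H2 dc.
have lo b : b <= c -> eps_below g b = eps_below g' b.
  by move=> bc; apply: eq_eps_below => a ab; apply: H1; lia.
have [/lo //|cd] := leqP d c.
have -> : d = c.+2 + (d - c.+2) by lia.
elim: (d - c.+2) => [|k IH]; first by rewrite addn0 /= lo // H2.
by rewrite addnS [LHS]eps_belowS [RHS]eps_belowS IH H1 //; lia.
Qed.

Lemma phi_from_swap N g g' c d : c.+1 < N ->
  (forall b, b <> c -> b <> c.+1 -> g b = g' b) ->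
  (forall e, push_right (g c) (push_right (g c.+1) e) =
             push_right (g' c) (push_right (g' c.+1) e)) ->
  d <= N -> d <> c.+1 -> phi_from g d (N - d) = phi_from g' d (N - d).
Proof.
move=> cN H1 H2 dN dc.
have hi b : c.+1 < b -> phi_from g b (N - b) = phi_from g' b (N - b).
  by move=> bc; apply: eq_phi_from => a ab; apply: H1; lia.
have [dc'|cd] := leqP d c; last by apply: hi; lia.
have -> : d = c - (c - d) by lia.
elim: (c - d) (leq_subr d c) => [|k IH] kc.
  rewrite subn0 (@phi_fromS N g c) ?(@phi_fromS N g c.+1); try lia.
  rewrite (@phi_fromS N g' c) ?(@phi_fromS N g' c.+1); try lia.
  by rewrite hi ?H2 //; lia.
have Ek : (c - k.+1).+1 = c - k by lia.
rewrite [LHS]phi_fromS; last by lia.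
rewrite [RHS]phi_fromS; last by lia.
by rewrite Ek IH ?H1 //; lia.
Qed.

Lemma acts_at_swap N g g' c b d : c.+1 < N ->
  (forall b, b <> c -> b <> c.+1 -> g b = g' b) ->
  (forall e, push_left (g c.+1) (push_left (g c) e) =
             push_left (g' c.+1) (push_left (g' c) e)) ->
  (forall e, push_right (g c) (push_right (g c.+1) e) =
             push_right (g' c) (push_right (g' c.+1) e)) ->
  d <> c -> d <> c.+1 -> acts_at N g b d -> acts_at N g' b d.
Proof.
move=> cN H1 H2 H3 dc dc1 [dN gd p0 e0]; split=> //; first by rewrite -H1.
  by rewrite -(phi_from_swap cN H1 H3) //; lia.
by rewrite -(eps_below_swap H1 H2).
Qed.

(** The operator e_i changes the letter i+1 of the cell p. *)
Definition lowers_at N i (S : filling) (p : cell) :=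
  S p = i.+1 /\ acts_at N (col_sign N i S) false p.2.

Section Moves.
Variables (N : nat) (mu : pred cell) (i : nat).
Hypothesis i_gt0 : 0 < i.
Implicit Types (S : filling).

Lemma eq_col_sign S S' c :
  (forall a, 0 < a -> occurs N S c a = occurs N S' c a) ->
  col_sign N i S c = col_sign N i S' c.
Proof. by move=> H; rewrite /col_sign /sign_of !H. Qed.

Lemma occurs_below S h c a : young N mu S (pred1 h) -> S h = 0 ->
  S (below h) != 0 -> 0 < a ->
  occurs N (shift S h (below h)) c a = occurs N S c a.
Proof.
case: h => r0 c0 Y h0 d0 a0; have [rN cN] := young_box Y d0.
apply/occursP/occursP => -[r rN' E].
  move: E; rewrite shiftE /below /=.
  case: eqP => [_ /esym E|_]; first by rewrite E in a0.
  case: eqP => [[_ ->] E|_ E]; [by exists r0.+1 | by exists r].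
case: (altP (r =P r0.+1)) => [Er|ne]; last first.
  exists r => //; rewrite shiftE /below /= !xpair_eqE (negPf ne) /=.
  case: eqP => [Er|] //=; case: eqP => [Ec|] //=.
  by move: a0; rewrite -E Er Ec h0.
case: (altP (c =P c0)) => [Ec|ne]; last first.
  by exists r => //; rewrite shiftE /below !xpair_eqE (negPf ne) !andbF.
rewrite Er Ec in E; rewrite Ec; exists r0; first by rewrite ltnW.
by rewrite shiftE /below /= !xpair_eqE eqxx !andbT ltn_eqF // eqxx.
Qed.

Lemma col_sign_below S h c : holed N mu S h -> S (below h) != 0 ->
  col_sign N i (shift S h (below h)) c = col_sign N i S c.
Proof.
move=> [Y _ h0] d0; apply: eq_col_sign => a a0; exact: occurs_below.
Qed.

Section Right.
Variables (S : filling) (r c : nat).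
Hypothesis H : holed N mu S (r, c).
Let b := S (r, c.+1).
Hypothesis b0 : b != 0.
Hypothesis ab : S (r.+1, c) = 0 \/ b < S (r.+1, c).
Let S' := shift S (r, c) (r, c.+1).

Let Y : young N mu S (pred1 (r, c)). Proof. by case: H. Qed.
Let h0 : S (r, c) = 0. Proof. by case: H. Qed.
Let rN : r < N. Proof. by have [] := young_box Y b0. Qed.
Let cN : c.+1 < N. Proof. by have [] := young_box Y b0. Qed.

Lemma occurs_right_other d a : d <> c -> d <> c.+1 ->
  occurs N S' d a = occurs N S d a.
Proof.
move=> dc dc1; apply: eq_has => r'; rewrite /S' shiftE !xpair_eqE.
by move/eqP: dc => /negPf ->; move/eqP: dc1 => /negPf ->; rewrite !andbF.
Qed.

Lemma occurs_right_new a : 0 < a ->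
  occurs N S' c a = occurs N S c a || (a == b).
Proof.
move=> a0; have nc : (c == c.+1) = false by apply: ltn_eqF.
apply/occursP/orP => [[r' r'N]|[/occursP [r' r'N E]|/eqP ->]].
- rewrite /S' shiftE !xpair_eqE nc andbF eqxx andbT.
  case: eqP => _ E; first by right; rewrite -E.
  by left; apply/occursP; exists r'.
- exists r' => //; rewrite /S' shiftE !xpair_eqE nc andbF eqxx andbT.
  by case: eqP E => // -> ; rewrite h0 => E; rewrite -E in a0.
- by exists r => //; rewrite /S' shiftE !xpair_eqE nc andbF !eqxx.
Qed.

Lemma occurs_right_old a : 0 < a ->
  occurs N S' c.+1 a = occurs N S c.+1 a && (a != b).
Proof.
move=> a0; have nc : (c.+1 == c) = false by apply: gtn_eqF.
have E r' : S' (r', c.+1) = if r' == r then 0 else S (r', c.+1).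
  by rewrite /S' shiftE !xpair_eqE eqxx nc andbF andbT.
apply/occursP/andP => [[r' r'N]|[/occursP [r' r'N E'] ne]].
  rewrite E; case: eqP => [_ E'|ne E']; first by rewrite -E' in a0.
  split; first by apply/occursP; exists r'.
  have nz : S (r', c.+1) != 0 by rewrite E' -lt0n.
  apply/eqP => Eb; move/eqP: ne; rewrite neq_ltn => /orP [] lt.
    by have := young_col Y lt nz b0; rewrite E' -/b Eb ltnn.
  by have := young_col Y lt b0 nz; rewrite E' -/b Eb ltnn.
exists r' => //; rewrite E; case: eqP => // Er.
by rewrite -E' Er eqxx in ne.
Qed.

Lemma occurs_b : occurs N S c.+1 b.
Proof. by apply/occursP; exists r. Qed.

Lemma not_occurs_b : occurs N S c b = false.
Proof.
apply/negP => /occursP [r' _ E].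
have nz : S (r', c) != 0 by rewrite E.
have [lt|lt|Er] := ltngtP r' r.
- by have [_ le lt'] := above_hole_lt H b0 lt nz; have := leq_ltn_trans le lt'; rewrite E ltnn.
- by have := below_hole_gt H ab lt nz; rewrite E ltnn.
- by rewrite Er h0 in nz.
Qed.

(** If b+1 is below b in the column c+1, the cell at its left lies below
    the hole; its letter is at most b+1 by the row condition and larger
    than b by the slide rule. *)
Lemma occurs_b_succ : occurs N S c.+1 b.+1 -> occurs N S c b.+1.
Proof.
move=> /occursP [r' r'N E]; have nz : S (r', c.+1) != 0 by rewrite E.
have lt : r < r'.
  have [//|lt|Er] := ltngtP r r'; last by move: E; rewrite -Er /b; lia.
  by have := young_col Y lt nz b0; rewrite E -/b; lia.
have nz' : S (r', c) != 0.
  apply: (filled_between Y (leqnn _) (leqnSn _) nz).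
    by apply: (inner_mono Y (ltnW lt) (leqnn _)); case: H.
  by apply/negP => /pred1P [] /eqP; rewrite gtn_eqF.
apply/occursP; exists r' => //.
have := young_row Y (ltnSn c) nz' nz; have := below_hole_gt H ab lt nz'.
by rewrite E /b; lia.
Qed.

(** Dually, if b-1 occurs in the column of the hole it lies above it, and
    the right neighbour of that cell is squeezed between b-1 and b. *)
Lemma occurs_b_pred a : 0 < a -> b = a.+1 ->
  occurs N S c a -> occurs N S c.+1 a.
Proof.
move=> a0 Eb /occursP [r' r'N E]; have nz : S (r', c) != 0 by rewrite E; lia.
have lt : r' < r.
  have [//|lt|Er] := ltngtP r' r; last by rewrite Er h0 in nz.
  by have := below_hole_gt H ab lt nz; rewrite E -/b Eb; lia.
have [_ le lt'] := above_hole_lt H b0 lt nz.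
by apply/occursP; exists r' => //; move: le lt'; rewrite E -/b Eb; lia.
Qed.

(** Only the letter b changes column. If b is i, then i+1 cannot be in the
    column c+1 without being in the column c, and if b is i+1, then i
    cannot be in the column c without being in the column c+1. So the pair
    of signs of the two columns changes by a cancellation of + followed by
    -, if at all. *)
Lemma col_sign_right :
  [/\ forall d, d <> c -> d <> c.+1 -> col_sign N i S d = col_sign N i S' d,
      forall e, push_left (col_sign N i S c.+1) (push_left (col_sign N i S c) e) =
             push_left (col_sign N i S' c.+1) (push_left (col_sign N i S' c) e)
    & forall e, push_right (col_sign N i S c) (push_right (col_sign N i S c.+1) e) =
             push_right (col_sign N i S' c) (push_right (col_sign N i S' c.+1) e)].
Proof.
have nb := not_occurs_b; have ob := occurs_b.
suff [P1 P2] : (forall e,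
    push_left (col_sign N i S c.+1) (push_left (col_sign N i S c) e) =
    push_left (col_sign N i S' c.+1) (push_left (col_sign N i S' c) e)) /\
  (forall e, push_right (col_sign N i S c) (push_right (col_sign N i S c.+1) e) =
             push_right (col_sign N i S' c) (push_right (col_sign N i S' c.+1) e)).
  split=> // d dc dc1; apply: eq_col_sign => a _.
  by rewrite occurs_right_other.
rewrite /col_sign /sign_of !occurs_right_new // !occurs_right_old //.
  have [Eb|ne] := eqVneq i b.
    have os := occurs_b_succ; rewrite -Eb in nb ob os; rewrite -Eb nb ob.
    rewrite (gtn_eqF (ltnSn i)) /= orbF andbT.
    by case: (occurs N S c.+1 i.+1) os => [->|_] //; case: (occurs N S c i.+1).
  rewrite orbF andbT.
  have [Eb|ne1] := eqVneq i.+1 b; last by rewrite orbF andbT.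
  have op := occurs_b_pred i_gt0 (esym Eb); rewrite -Eb in nb ob; rewrite nb ob /=.
  by case: (occurs N S c i) op => [->|_] //; case: (occurs N S c.+1 i).
Qed.

Lemma sign_of_minus j (P : pred nat) : sign_of j P = Some false ->
  P j.+1 /\ P j = false.
Proof. by rewrite /sign_of; case: (P j); case: (P j.+1). Qed.

(** A slide to the right keeps the letter on which e_i acts, moved along if
    it is the sliding letter. The exception is a letter i+1 below the hole
    past which the letter i slides: then the letter at the right of that
    i+1 takes over. *)
Lemma right_lowers p : lowers_at N i S p ->
  [/\ b = i, p = (r.+1, c), S (r.+1, c.+1) = i.+1
    & lowers_at N i S' (r.+1, c.+1)] \/
  ~ (b = i /\ p = (r.+1, c)) /\
    lowers_at N i S' (if p == (r, c.+1) then (r, c) else p).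
Proof.
case: p => r1 d [/= Sp A]; have [dN gd p0 e0] := A.
have [H1 H2 H3] := col_sign_right.
have nb := not_occurs_b; have ob := occurs_b.
have nz1 : S (r1, d) != 0 by rewrite Sp.
have S'p : (r1, d) <> (r, c.+1) -> S' (r1, d) = i.+1.
  rewrite /S' shiftE => /eqP/negPf ->.
  by case: eqP => // E; move: Sp; rewrite E h0.
have [o1 o0] := sign_of_minus gd.
have [Ed|dc] := eqVneq d c.
  subst d; have ne : b <> i.+1 by move=> Eb; rewrite -Eb nb in o1.
  have nq : ((r1, c) == (r, c.+1)) = false.
    by rewrite xpair_eqE (ltn_eqF (ltnSn c)) andbF.
  have [Eb|neb] := eqVneq b i; last first.
    right; split; first by case=> /eqP; rewrite (negPf neb).
    rewrite nq; split; first by apply: S'p => /eqP; rewrite nq.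
    have E d : col_sign N i S d = col_sign N i S' d.
      have [->|dc] := eqVneq d c; last have [->|dc1] := eqVneq d c.+1.
      - rewrite /col_sign /sign_of !occurs_right_new // ![_ == b]eq_sym.
        by rewrite (negPf neb) (introF eqP ne) !orbF.
      - rewrite /col_sign /sign_of !occurs_right_old // ![_ == b]eq_sym.
        by rewrite (negPf neb) (introF eqP ne) !andbT.
      - by apply: H1; apply/eqP.
    case: A => ? ? ? ?; split=> //; first by rewrite /= -E.
      by rewrite -(eq_phi_from (g := col_sign N i S)).
    by rewrite -(eq_eps_below (g := col_sign N i S)).
  left; have or1 : occurs N S c.+1 i.+1.
    move: p0; rewrite (phi_fromS _ cN) {1}/col_sign /sign_of -Eb ob.
    by case: (occurs N S c.+1 b.+1).
  have /occursP [r2 r2N E2] := or1; have nz2 : S (r2, c.+1) != 0 by rewrite E2.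
  have lt2 : r < r2.
    have [//|lt|Er] := ltngtP r r2; last by move: E2; rewrite -Er -/b Eb; lia.
    by have := young_col Y lt nz2 b0; rewrite E2 -/b Eb; lia.
  have lt1 : r < r1.
    have [//|lt|Er] := ltngtP r r1; last by move: nz1; rewrite -Er h0.
    have [_ le lt'] := above_hole_lt H b0 lt nz1.
    by move: le lt'; rewrite Sp -/b Eb; lia.
  have nz3 := filled_belowl Y (let: And3 _ h _ := H in h) lt1 (@pred1P _) nz1.
  have nz4 : S (r.+1, c.+1) != 0.
    apply: (filled_between Y lt2 (leqnn _) nz2).
      apply: (inner_mono Y (leqnSn _) (leqnSn _)); by case: H.
    by apply/negP => /pred1P [] /eqP; rewrite gtn_eqF.
  have gt3 := below_hole_gt H ab (ltnSn r) nz3; rewrite -/b Eb in gt3.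
  have gt4 := young_col Y (ltnSn r) b0 nz4; rewrite -/b Eb in gt4.
  have E1 : r1 = r.+1.
    apply/eqP; rewrite eqn_leq lt1 andbT leqNgt; apply/negP => lt.
    by have := young_col Y lt nz3 nz1; rewrite Sp; lia.
  have E4 : S (r.+1, c.+1) = i.+1.
    move: lt2; rewrite leq_eqVlt => /orP [/eqP -> //|lt].
    by have := young_col Y lt nz4 nz2; rewrite E2; lia.
  split=> //; first by rewrite E1.
  split=> /=.
    by rewrite /S' shiftE !xpair_eqE eqxx andbT !(gtn_eqF (ltnSn _)).
  split=> //.
  - rewrite /col_sign /sign_of !occurs_right_old // or1 -Eb eqxx andbF.
    by rewrite gtn_eqF.
  - rewrite -(eq_phi_from (g := col_sign N i S)); last first.
      by move=> d Hd; apply: H1; lia.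
    move: p0; rewrite (phi_fromS _ cN) {1}/col_sign /sign_of or1 -Eb ob.
    by [].
  - have gc' : col_sign N i S' c = None.
      by rewrite /col_sign /sign_of !occurs_right_new // o1 -Eb eqxx orbT.
    rewrite eps_belowS gc' -(eq_eps_below (g := col_sign N i S)) // => d Hd.
    by apply: H1; lia.
right; split; first by case=> _ [_ /eqP]; rewrite (negPf dc).
have [Ed|dc1] := eqVneq d c.+1; last first.
  rewrite xpair_eqE (negPf dc1) andbF; split=> /=.
    by apply: S'p => -[_ /eqP]; rewrite (negPf dc1).
  by apply: (acts_at_swap cN H1 H2 H3) => //; apply/eqP.
subst d; have neb : (i == b) = false.
  by apply/eqP => E; rewrite -E o0 in ob.
have [Eb|ne] := eqVneq i.+1 b; last first.
  have E d : col_sign N i S d = col_sign N i S' d.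
    have [->|dc'] := eqVneq d c; last have [->|dc1] := eqVneq d c.+1.
    - rewrite /col_sign /sign_of !occurs_right_new //.
      by rewrite neb (negPf ne) !orbF.
    - rewrite /col_sign /sign_of !occurs_right_old //.
      by rewrite neb (negPf ne) !andbT.
    - by apply: H1; apply/eqP.
  have nq : ((r1, c.+1) == (r, c.+1)) = false.
    by apply/eqP => E'; move: Sp; rewrite E' -/b => E2; rewrite -E2 eqxx in ne.
  rewrite nq; split; first by apply: S'p => /eqP; rewrite nq.
  case: A => ? ? ? ?; split=> //; first by rewrite /= -E.
    by rewrite -(eq_phi_from (g := col_sign N i S)).
  by rewrite -(eq_eps_below (g := col_sign N i S)).
have Er : r1 = r.
  apply/eqP/negPn; rewrite neq_ltn; apply/negP => /orP [] lt; last first.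
    by have := young_col Y lt b0 nz1; rewrite Sp -/b -Eb ltnn.
  by have := young_col Y lt nz1 b0; rewrite Sp -/b -Eb ltnn.
rewrite Er eqxx; split=> /=.
  by rewrite /S' shiftE !xpair_eqE eqxx (ltn_eqF (ltnSn c)) /= eqxx.
have oc0 : occurs N S c i = false.
  by apply/negP => /(occurs_b_pred i_gt0 (esym Eb)); rewrite o0.
have oc1 : occurs N S c i.+1 = false by rewrite Eb nb.
split=> /=; first exact: ltnW.
- by rewrite /col_sign /sign_of !occurs_right_new // oc0 oc1 neb Eb eqxx.
- rewrite (phi_fromS _ cN) -(eq_phi_from (g := col_sign N i S)); last first.
    by move=> d Hd; apply: H1; lia.
  rewrite p0 /col_sign /sign_of !occurs_right_old // o0 Eb eqxx andbF /=.
  by [].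
- rewrite -(eq_eps_below (g := col_sign N i S)); last first.
    by move=> d Hd; apply: H1; lia.
  by move: e0; rewrite eps_belowS /col_sign /sign_of oc0 oc1.
Qed.

End Right.

Lemma lowers_below S h p : holed N mu S h -> S (below h) != 0 ->
  lowers_at N i S p ->
  lowers_at N i (shift S h (below h)) (if p == below h then h else p).
Proof.
move=> H d0 [Sp A].
have E d : col_sign N i S d = col_sign N i (shift S h (below h)) d.
  by rewrite (col_sign_below _ H d0).
have Ep : (if p == below h then h else p).2 = p.2 by case: eqP => [->|].
split.
  have nh : h != below h.
    by case: h {H d0 E Ep} => a b; rewrite xpair_eqE ltn_eqF.
  rewrite shiftE; case: (p =P below h) => [Eq|ne].
    by rewrite (negPf nh) eqxx -Eq.
  move/eqP/negPf: ne => ->; case: eqP => // Eq.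
  by case: H => _ _; rewrite -Eq Sp.
rewrite Ep; case: A => ? ? ? ?; split=> //; first by rewrite -E.
  by rewrite -(eq_phi_from (g := col_sign N i S)).
by rewrite -(eq_eps_below (g := col_sign N i S)).
Qed.

Lemma shift_upd S h d p a : d <> h -> p <> h ->
  shift (upd S p a) h d = upd (shift S h d) (if p == d then h else p) a.
Proof.
move=> dh ph; apply: functional_extensionality => z; rewrite shiftE !updE shiftE.
case: (p =P d) => [<-|pd]; rewrite ?eqxx.
  by case: (z =P p) => [->|_]; [case: (p =P h) | case: (z =P h)].
case: (d =P p) => [E|_]; first by rewrite E in pd.
case: (z =P d) => [->|_]; first by case: (d =P p) => // E; rewrite E in pd.
by case: (z =P h) => [->|_] //; case: (h =P p) => // E; rewrite E in ph.
Qed.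

Lemma neq_below h : below h <> h.
Proof. by case: h => r c [] /eqP; rewrite gtn_eqF. Qed.

Lemma neq_right h : right h <> h.
Proof. by case: h => r c [] /eqP; rewrite gtn_eqF. Qed.

(** Otherwise the column of the hole would contain i+1; it does not contain
    i, which would force an i in the acting column. So it has a sign -,
    after the one at which e_i acts, which would then not be the last
    uncancelled one. Thus lowering the right neighbour creates no tie for
    the slide. *)
Lemma lowers_right_below S h : holed N mu S h -> lowers_at N i S (right h) ->
  S (below h) <> i.+1.
Proof.
case: h => r c H [Sp [cN gd _ e0]] Sb; have [Y _ h0] := H.
have b0 : S (r, c.+1) != 0 by rewrite Sp.
have [_ o0] := sign_of_minus gd.
have o1 : occurs N S c i.+1.
  by apply/occursP; exists r.+1 => //; have [] := young_box (r := r.+1) (c := c) Y; rewrite ?Sb.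
have /occursP [r' r'N Er'] : occurs N S c i.
  move: e0; rewrite eps_belowS /col_sign /sign_of o1.
  by case: (occurs N S c i).
have nz : S (r', c) != 0 by rewrite Er' -lt0n.
have lt : r' < r.
  have [//|lt|E] := ltngtP r' r; last by rewrite E h0 in nz.
  have nz1 : S (r.+1, c) != 0 by rewrite Sb.
  move: lt; rewrite leq_eqVlt => /orP [/eqP E|lt].
    by move: Er'; rewrite -E Sb; lia.
  by have := young_col Y lt nz1 nz; rewrite Sb Er'; lia.
have [nz1 le lt'] := above_hole_lt H b0 lt nz.
move/negP: o0; apply; apply/occursP; exists r' => //=.
by move: le lt'; rewrite Er' Sp; lia.
Qed.

Lemma eqSn n : (n.+1 == n) = false. Proof. exact: gtn_eqF. Qed.
Lemma eqnS n : (n == n.+1) = false. Proof. exact: ltn_eqF. Qed.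
Lemma eqSSn n : (n.+2 == n) = false. Proof. by rewrite gtn_eqF. Qed.
Lemma eqnSS n : (n == n.+2) = false. Proof. by rewrite ltn_eqF. Qed.
(** Decides equalities between a cell and its neighbours. *)
Definition cellE := (xpair_eqE, eqSS, eqSn, eqnS, eqSSn, eqnSS, eqxx, andbF, andbT).

(** Sliding commutes with e_i. The hole follows the same path before and
    after lowering a letter, except when e_i acts on the letter i+1 below
    the hole and i is at the right of the hole: lowering makes the hole go
    down instead of right. The two paths meet again one step later, and e_i
    then acts one column further to the right. *)
Theorem slides_lower S h R y p : slides S h R y -> holed N mu S h ->
  lowers_at N i S p ->
  exists p', lowers_at N i R p' /\ slides (upd S p i) h (upd R p' i) y.
Proof.
move=> sl; elim: sl p => {S h R y} [S h a0 b0|S h R y a0 ab sl IH|S h R y b0 ab sl IH] p H L.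
- exists p; split=> //; case: L => Sp _; apply: slides_stop; rewrite updE.
    by case: eqP => // E; rewrite E Sp in a0.
  by case: eqP => // E; rewrite E Sp in b0.
- have [p' [L' sl']] := IH _ (holed_below H a0 ab) (lowers_below H a0 L).
  have ph : p <> h by move=> E; case: H L => _ _ h0 [Sp _]; rewrite -E Sp in h0.
  exists p'; split=> //; apply: slides_down; last first.
  + by rewrite shift_upd //; apply: neq_below.
  + have [Sp _] := L; rewrite !updE.
    case: (right h =P p) ab => [Er|_] ab; case: (below h =P p) ab => [Eb|_] ab //.
    * by right.
    * case: ab; rewrite Er Sp // leq_eqVlt => /orP [/eqP E|]; last by right.
      by rewrite -Er in L; case: (lowers_right_below H L).
    * by case: ab => [->|]; [left | rewrite Eb Sp => lt; right; apply: ltnW].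
  + by rewrite updE; case: (below h =P p) => // _; rewrite -lt0n.
- have ph : p <> h by move=> E; case: H L => _ _ h0 [Sp _]; rewrite -E Sp in h0.
  have Hr := holed_right H b0 ab.
  case: h H b0 ab sl IH ph Hr => r c H b0 ab sl IH ph Hr.
  have [[Eb Ep E4 L1]|[nE L1]] := right_lowers H b0 ab L.
  + have [p' [L' sl']] := IH _ Hr L1; exists p'; split=> //.
    apply: slides_down; rewrite /below /right /= ?updE -?Ep ?eqxx.
    * by rewrite -lt0n.
    * by right; rewrite Ep !cellE Eb.
    set F := shift _ _ _; have FD : F (r.+1, c.+1) = i.+1.
      by rewrite /F shiftE !updE Ep !cellE E4.
    apply: slides_right; rewrite /below /right Ep /= ?FD //.
      have -> : F (r.+2, c) = S (r.+2, c) by rewrite /F shiftE !updE Ep !cellE.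
      case: (eqVneq (S (r.+2, c)) 0) => [|nz2]; [by left | right].
      have [Y _ _] := H; have [Sp _] := L.
      have nz3 : S (r.+1, c) != 0 by rewrite -Ep Sp.
      by have := young_col Y (ltnSn _) nz3 nz2; rewrite -Ep Sp.
    (* the lowered tableau now follows the other one along the next move *)
    have nz1 : upd (shift S (r, c) (r, c.+1)) (r.+1, c.+1) i (r.+1, c.+1) = i.
      by rewrite updE eqxx.
    have sl1 := slides_below_inv sl'; rewrite /below /right /= nz1 in sl1.
    rewrite -lt0n in sl1; have {}sl1 := sl1 i_gt0.
    lapply sl1; last first.
      rewrite !(shiftE, updE) !cellE.
      have [->|b1] := eqVneq (S (r, c.+2)) 0; [by left | right].
      by have [Y _ _] := H; rewrite -[i]Eb; apply: (young_row Y (ltnSn _) b0 b1).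
    congr slides; apply: functional_extensionality => z.
    rewrite /F Ep !(shiftE, updE) !cellE.
    have [Ez|zD] := eqVneq z (r.+1, c.+1); first by [].
    have [Ez|zB] := eqVneq z (r, c.+1); first by rewrite Ez !cellE -Eb.
    have [Ez|zC] := eqVneq z (r.+1, c); first by rewrite Ez !cellE E4 -Ep; case: (L).
    by have [Ez|zA] := eqVneq z (r, c); rewrite -?Eb.
  + have [p' [L' sl']] := IH _ Hr L1; exists p'; split=> //.
    apply: slides_right; last first.
    * by rewrite shift_upd //; apply: neq_right.
    * have [Sp _] := L; rewrite !updE.
      case: (right (r, c) =P p) ab => [Er|_] ab; case: (below (r, c) =P p) ab => [Eb|nb] ab //.
      - by move: Eb; rewrite -Er => -[] /eqP; rewrite gtn_eqF.
      - by case: ab => [->|]; [left | rewrite Er Sp => lt; right; lia].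
      - case: ab; rewrite ?Eb Sp // ltnS leq_eqVlt => /orP [/eqP E|]; last by right.
        by case: nE; split; rewrite -?Eb.
    * by rewrite updE; case: (right (r, c) =P p) => // _; rewrite -lt0n.
Qed.
End Moves.

(** * Crystal operators on skew fillings *)

Definition ep N i (S : filling) := eps_below (col_sign N i S) N.
Definition ph N i (S : filling) := phi_from (col_sign N i S) 0 N.

Lemma sign_of_plus j (P : pred nat) : sign_of j P = Some true ->
  P j /\ P j.+1 = false.
Proof. by rewrite /sign_of; case: (P j); case: (P j.+1). Qed.

Lemma eq_acts_at N g g' b c : g =1 g' -> acts_at N g b c -> acts_at N g' b c.
Proof.
move=> E [cN gc p0 e0]; split=> //; first by rewrite -E.
  by rewrite -(eq_phi_from (g := g)).
by rewrite -(eq_eps_below (g := g)).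
Qed.

Section Ops.
Variables (N : nat) (mu : pred cell) (i : nat).
Hypothesis i_gt0 : 0 < i.
Implicit Types (S : filling).

Lemma filled_box S r c : skewt N mu S -> S (r, c) != 0 -> r < N /\ c < N.
Proof. by move=> Y; apply: (young_box Y). Qed.

Lemma filled_in S r c r' c' : skewt N mu S -> r' <= r -> c' <= c ->
  S (r, c) != 0 -> ~~ mu (r', c') -> S (r', c') != 0.
Proof. by move=> Y rr cc nz nmu; apply: (filled_between Y rr cc). Qed.

Lemma row_le S r c c' : skewt N mu S -> c <= c' -> S (r, c) != 0 ->
  S (r, c') != 0 -> S (r, c) <= S (r, c').
Proof. by move=> Y; rewrite leq_eqVlt => /orP [/eqP -> //|]; apply: (young_row Y). Qed.

Lemma row_eq S r c c' c'' : skewt N mu S -> c <= c' <= c'' ->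
  S (r, c) != 0 -> S (r, c'') = S (r, c) -> S (r, c') = S (r, c).
Proof.
move=> Y /andP [le1 le2] nz E; have nz2 : S (r, c'') != 0 by rewrite E.
have nz1 : S (r, c') != 0.
  apply: (filled_in Y (leqnn r) le2 nz2).
  exact: (inner_mono Y (leqnn r) le1 (filled_not_inner Y nz)).
have := row_le Y le1 nz nz1; have := row_le Y le2 nz1 nz2.
by rewrite E => a b; apply/eqP; rewrite eqn_leq a b.
Qed.

Lemma col_inj S r r' c : skewt N mu S -> S (r, c) != 0 ->
  S (r, c) = S (r', c) -> r = r'.
Proof.
move=> Y nz E; have nz' : S (r', c) != 0 by rewrite -E.
have [lt|lt|//] := ltngtP r r'.
  by have := young_col Y lt nz nz'; rewrite E ltnn.
by have := young_col Y lt nz' nz; rewrite E ltnn.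
Qed.

Lemma col_succ S r r' c : skewt N mu S -> S (r, c) = i -> S (r', c) = i.+1 ->
  r' = r.+1.
Proof.
move=> Y E E'; have nz : S (r, c) != 0 by rewrite E -lt0n.
have nz' : S (r', c) != 0 by rewrite E'.
have lt : r < r'.
  have [//|lt|Er] := ltngtP r r'; last by move: E'; rewrite -Er E; lia.
  by have := young_col Y lt nz' nz; rewrite E E'; lia.
apply/eqP; rewrite eqn_leq lt andbT leqNgt; apply/negP => lt'.
have nz1 : S (r.+1, c) != 0.
  apply: (filled_in Y lt (leqnn _) nz').
  exact: (inner_mono Y (leqnSn _) (leqnn _) (filled_not_inner Y nz)).
have := young_col Y (ltnSn r) nz nz1; have := young_col Y lt' nz1 nz'.
by rewrite E E'; lia.
Qed.

Lemma upd_neq0 S x a y : S x != 0 -> a != 0 -> (upd S x a y != 0) = (S y != 0).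
Proof. by move=> nz a0; rewrite updE; case: (y =P x) => [->|//]; rewrite nz a0. Qed.

Lemma skewt_upd S x a : skewt N mu S -> S x != 0 -> a != 0 ->
  (forall c, c < x.2 -> S (x.1, c) != 0 -> S (x.1, c) <= a) ->
  (forall c, x.2 < c -> S (x.1, c) != 0 -> a <= S (x.1, c)) ->
  (forall r, r < x.1 -> S (r, x.2) != 0 -> S (r, x.2) < a) ->
  (forall r, x.1 < r -> S (r, x.2) != 0 -> a < S (r, x.2)) ->
  skewt N mu (upd S x a).
Proof.
case: x => r0 c0 Y nz a0 /= H1 H2 H3 H4; have E y := upd_neq0 y nz a0.
split.
- exact: young_inner Y.
- move=> y muy; rewrite updE; case: (y =P (r0, c0)) => [Ey|_]; last exact: (young_disj Y muy).
  by move: (young_disj Y muy); rewrite Ey => Z; rewrite Z in nz.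
- by apply: eq_down_closed (young_outer Y) => y /=; rewrite E.
- move=> r c c' lt; rewrite !E !updE => n1 n2.
  case: eqP => [[Er Ec]|_]; case: eqP => [[Er' Ec']|_]; subst.
  + by [].
  + exact: H2.
  + exact: H1.
  + exact: (young_row Y lt).
- move=> r r' c lt; rewrite !E !updE => n1 n2.
  case: eqP => [[Er Ec]|_]; case: eqP => [[Er' Ec']|_]; subst.
  + by rewrite ltnn in lt.
  + exact: H4.
  + exact: H3.
  + exact: (young_col Y lt).
- by move=> r c; rewrite E; apply: (young_box Y).
Qed.

(** The letter i raised by f_i has no i+1 below, or the column would have
    no sign, and no i at its right, or the next column would have an
    uncancelled sign +. *)
Lemma skewt_raise S r c : skewt N mu S -> S (r, c) = i ->
  acts_at N (col_sign N i S) true c -> skewt N mu (upd S (r, c) i.+1).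
Proof.
move=> Y E [cN gc p0 _]; have nz : S (r, c) != 0 by rewrite E -lt0n.
have [_ o1] := sign_of_plus gc.
apply: skewt_upd => //=.
- by move=> c' lt nz'; have := young_row Y lt nz' nz; rewrite E; lia.
- move=> c' lt nz'; have := young_row Y lt nz nz'; rewrite E leq_eqVlt.
  case/orP => [/eqP E'|//]; exfalso.
  have Ec1 : S (r, c.+1) = i by rewrite -E; apply: (row_eq Y (c'' := c')); rewrite ?E ?leqnSn -?E' // -lt0n.
  have nz1 : S (r, c.+1) != 0 by rewrite Ec1 -lt0n.
  have [rN c1N] := filled_box Y nz1.
  have oc : occurs N S c.+1 i by apply/occursP; exists r.
  have /occursP [r2 r2N E2] : occurs N S c.+1 i.+1.
    move: p0; rewrite (phi_fromS _ c1N) {1}/col_sign /sign_of oc.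
    by case: (occurs N S c.+1 i.+1).
  have Er2 := col_succ Y Ec1 E2; subst r2.
  have nz2 : S (r.+1, c.+1) != 0 by rewrite E2.
  have nz3 : S (r.+1, c) != 0.
    apply: (filled_in Y (leqnn _) (leqnSn _) nz2).
    exact: (inner_mono Y (leqnSn _) (leqnn _) (filled_not_inner Y nz)).
  move/negP: o1; apply; apply/occursP; exists r.+1 => //.
  have := young_row Y (ltnSn c) nz3 nz2; have := young_col Y (ltnSn r) nz nz3.
  by rewrite E E2; lia.
- by move=> r' lt nz'; have := young_col Y lt nz' nz; rewrite E; lia.
- move=> r' lt nz'; have := young_col Y lt nz nz'; rewrite E leq_eqVlt.
  case/orP => [/eqP E'|//]; move/negP: o1; case; apply/occursP; exists r' => //.
  by have [] := filled_box Y nz'.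
Qed.

(** The mirror image of [skewt_raise]. *)
Lemma skewt_lower S p : skewt N mu S -> lowers_at N i S p ->
  skewt N mu (upd S p i).
Proof.
case: p => r c Y [E [/= cN gc _ e0]].
have nz : S (r, c) != 0 by rewrite E.
have [_ o0] := sign_of_minus gc.
apply: skewt_upd => //=; first by rewrite -lt0n.
- move=> c' lt nz'; have := young_row Y lt nz' nz; rewrite E leq_eqVlt.
  case/orP => [/eqP E'|//]; exfalso.
  case: c E nz gc o0 e0 lt cN => // c E nz gc o0 e0 lt cN.
  have Ec1 : S (r, c) = i.+1 by rewrite -E'; apply: (row_eq Y (c'' := c.+1)); rewrite ?E ?E' ?leqnSn ?andbT.
  have nz1 : S (r, c) != 0 by rewrite Ec1.
  have [rN c1N] := filled_box Y nz1.
  have oc : occurs N S c i.+1 by apply/occursP; exists r.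
  have /occursP [r2 r2N E2] : occurs N S c i.
    move: e0; rewrite eps_belowS {1}/col_sign /sign_of oc.
    by case: (occurs N S c i).
  have Er2 := col_succ Y E2 Ec1; subst r.
  have nz2 : S (r2, c) != 0 by rewrite E2 -lt0n.
  have nz3 : S (r2, c.+1) != 0.
    apply: (filled_in Y (leqnSn _) (leqnn _) nz).
    exact: (inner_mono Y (leqnn _) (leqnSn _) (filled_not_inner Y nz2)).
  move/negP: o0; apply; apply/occursP; exists r2 => //.
  have := young_row Y (ltnSn c) nz2 nz3; have := young_col Y (ltnSn r2) nz3 nz.
  by rewrite E E2; lia.
- by move=> c' lt nz'; have := young_row Y lt nz nz'; rewrite E; lia.
- move=> r' lt nz'; have := young_col Y lt nz' nz; rewrite E ltnS leq_eqVlt.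
  case/orP => [/eqP E'|//]; move/negP: o0; case; apply/occursP; exists r' => //.
  by have [] := filled_box Y nz'.
- by move=> r' lt nz'; have := young_col Y lt nz nz'; rewrite E; lia.
Qed.

Lemma col_sign_upd S r c a d : d <> c ->
  col_sign N i (upd S (r, c) a) d = col_sign N i S d.
Proof.
move=> /eqP/negPf dc; apply: (eq_col_sign i_gt0) => b _; apply: eq_has => r'.
by rewrite updE xpair_eqE dc andbF.
Qed.

(** f_i and e_i are mutually inverse: the sign + at which f_i acts becomes
    the sign - at which e_i acts, as the signs of the other columns do not
    change. *)
Lemma raises_lowers S S' : skewt N mu S -> raises N i S S' ->
  exists2 p, lowers_at N i S' p & S = upd S' p i.
Proof.
move=> Y [r [c [rN E [cN gc p0 e0] ->]]]; exists (r, c); last first.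
  by apply: functional_extensionality => z; rewrite !updE; case: eqP => [->|].
have nz : S (r, c) != 0 by rewrite E -lt0n.
split; first by rewrite updE eqxx.
split=> //=.
- have -> : col_sign N i (upd S (r, c) i.+1) c = Some false; last by [].
  rewrite /col_sign /sign_of.
  have -> : occurs N (upd S (r, c) i.+1) c i = false.
    apply/occursP => -[r' r'N]; rewrite updE xpair_eqE eqxx andbT.
    case: eqP => [_|ne] E'; first by lia.
    by apply: ne; apply: (col_inj Y _ (c := c)); rewrite E' // -lt0n.
  have -> // : occurs N (upd S (r, c) i.+1) c i.+1.
  by apply/occursP; exists r => //; rewrite updE eqxx.
- rewrite -(eq_phi_from (g := col_sign N i S)) // => d Hd.
  by rewrite col_sign_upd //; lia.
- rewrite -(eq_eps_below (g := col_sign N i S)) // => d Hd.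
  by rewrite col_sign_upd //; lia.
Qed.

Lemma lowers_raises S p : skewt N mu S -> lowers_at N i S p ->
  raises N i (upd S p i) S.
Proof.
case: p => r c Y [E [/= cN gc p0 e0]].
have nz : S (r, c) != 0 by rewrite E.
have [rN _] := filled_box Y nz.
exists r, c; split=> //; first by rewrite updE eqxx.
  split=> //=.
  - rewrite /col_sign /sign_of.
    have -> : occurs N (upd S (r, c) i) c i.
      by apply/occursP; exists r => //; rewrite updE eqxx.
    have -> // : occurs N (upd S (r, c) i) c i.+1 = false.
    apply/occursP => -[r' r'N]; rewrite updE xpair_eqE eqxx andbT.
    case: eqP => [_|ne] E'; first by lia.
    by apply: ne; apply: (col_inj Y _ (c := c)); rewrite E'.
  - rewrite -(eq_phi_from (g := col_sign N i S)) // => d Hd.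
    by rewrite col_sign_upd //; lia.
  - rewrite -(eq_eps_below (g := col_sign N i S)) // => d Hd.
    by rewrite col_sign_upd //; lia.
by apply: functional_extensionality => z; rewrite !updE; case: eqP => [->|].
Qed.

Lemma raisesP S : skewt N mu S ->
  0 < ph N i S <-> exists S', raises N i S S'.
Proof.
move=> Y; rewrite /ph acts_plusP; split=> [[c A]|[S' [r [c [_ _ A _]]]]]; last by exists c.
have [_ gc _ _] := A; have [/occursP [r rN E] _] := sign_of_plus gc.
by exists (upd S (r, c) i.+1), r, c.
Qed.

Lemma lowersP S : skewt N mu S ->
  0 < ep N i S <-> exists2 S', skewt N mu S' & raises N i S' S.
Proof.
move=> Y; rewrite /ep acts_minusP; split=> [[c A]|[S' Y' R]].
  have [_ gc _ _] := A; have [/occursP [r rN E] _] := sign_of_minus gc.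
  have L : lowers_at N i S (r, c) by [].
  by exists (upd S (r, c) i); [apply: skewt_lower | apply: lowers_raises].
by have [p [_ A] _] := raises_lowers Y' R; exists p.2.
Qed.

Lemma raises_skewt S S' : skewt N mu S -> raises N i S S' -> skewt N mu S'.
Proof. by move=> Y [r [c [rN E A ->]]]; apply: skewt_raise. Qed.

Lemma raises_fun S S1 S2 : skewt N mu S -> raises N i S S1 -> raises N i S S2 ->
  S1 = S2.
Proof.
move=> Y [r [c [rN E A ->]]] [r' [c' [rN' E' A' ->]]].
have Ec := acts_at_uniq A A'; subst c'.
by have -> : r = r' by apply: (col_inj Y _ (c := c)); rewrite E ?E' // -lt0n.
Qed.

Lemma raises_inj S S1 S2 : skewt N mu S1 -> skewt N mu S2 ->
  raises N i S1 S -> raises N i S2 S -> S1 = S2.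
Proof.
move=> Y1 Y2 R1 R2; have Y := raises_skewt Y1 R1.
have [[r c] [E A] ->] := raises_lowers Y1 R1.
have [[r' c'] [E' A'] ->] := raises_lowers Y2 R2.
have /= Ec := acts_at_uniq A A'; subst c'.
by have -> : r = r' by apply: (col_inj Y _ (c := c)); rewrite E ?E'.
Qed.

End Ops.

(** * Rectification *)

(** In a column letters are distinct, so this is the number of occurrences
    of a. *)
Definition weight N (S : filling) (a : nat) : nat :=
  count (fun c => occurs N S c a) (iota 0 N).

Definition del (mu : pred cell) (x : cell) : pred cell :=
  fun y => mu y && (y != x).

Definition up_val (S : filling) (h : cell) : nat :=
  if 0 < h.1 then S (h.1.-1, h.2) else 0.
Definition left_val (S : filling) (h : cell) : nat :=
  if 0 < h.2 then S (h.1, h.2.-1) else 0.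

(** The reverse slide: a hole at an outer cell travels to an inner corner. *)
Inductive unslides : filling -> cell -> filling -> cell -> Prop :=
| unslides_stop S h : up_val S h = 0 -> left_val S h = 0 -> unslides S h S h
| unslides_up S h R y : up_val S h != 0 ->
    left_val S h = 0 \/ left_val S h <= up_val S h ->
    unslides (shift S h (h.1.-1, h.2)) (h.1.-1, h.2) R y -> unslides S h R y
| unslides_left S h R y : left_val S h != 0 ->
    up_val S h = 0 \/ up_val S h < left_val S h ->
    unslides (shift S h (h.1, h.2.-1)) (h.1, h.2.-1) R y -> unslides S h R y.

Lemma count_swap (P P' : pred nat) N c : c.+1 < N ->
  (forall d, d <> c -> d <> c.+1 -> P d = P' d) ->
  P c + P c.+1 = P' c + P' c.+1 ->
  count P (iota 0 N) = count P' (iota 0 N).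
Proof.
move=> cN H E.
have -> : N = c + (2 + (N - c.+2)) by lia.
rewrite !iotaD !count_cat !add0n /= !addn0; congr (_ + (_ + _)) => //.
  by apply: eq_in_count => d; rewrite mem_iota => Hd; apply: H; lia.
by apply: eq_in_count => d; rewrite mem_iota => Hd; apply: H; lia.
Qed.

Lemma slides_det S h R y R' y' : slides S h R y -> slides S h R' y' ->
  R = R' /\ y = y'.
Proof.
move=> sl; elim: sl R' y' => {S h R y} [S h a0 b0|S h R y a0 ab sl IH|S h R y b0 ab sl IH] R' y' sl'.
- by case: sl' a0 b0 => // {S h R' y'} S h R' y' nz _ _ E0 E1; rewrite ?E0 ?E1 in nz.
- case: sl' a0 ab IH sl => {S h R' y'} [S h -> //|S h R' y' _ _ sl' _ _ IH _|S h R' y' b0 ab' _ nz ab _ _].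
    exact: IH.
  case: ab => [E|le]; first by rewrite E in b0.
  by case: ab' le => [E|lt]; [rewrite E in nz | lia].
- case: sl' b0 ab IH sl => {S h R' y'} [S h _ -> //|S h R' y' b0 ab' _ nz ab _ _|S h R' y' _ _ sl' _ _ IH _].
    case: ab => [E|lt]; first by rewrite E in b0.
    by case: ab' lt => [E|]; [rewrite E in nz | lia].
  exact: IH.
Qed.

Lemma unslides_det S h R y R' y' : unslides S h R y -> unslides S h R' y' ->
  R = R' /\ y = y'.
Proof.
move=> sl; elim: sl R' y' => {S h R y} [S h a0 b0|S h R y a0 ab sl IH|S h R y b0 ab sl IH] R' y' sl'.
- by case: sl' a0 b0 => // {S h R' y'} S h R' y' nz _ _ E0 E1; rewrite ?E0 ?E1 in nz.
- case: sl' a0 ab IH sl => {S h R' y'} [S h -> //|S h R' y' _ _ sl' _ _ IH _|S h R' y' b0 ab' _ nz ab _ _].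
    exact: IH.
  case: ab => [E|le]; first by rewrite E in b0.
  by case: ab' le => [E|lt]; [rewrite E in nz | lia].
- case: sl' b0 ab IH sl => {S h R' y'} [S h _ -> //|S h R' y' b0 ab' _ nz ab _ _|S h R' y' _ _ sl' _ _ IH _].
    case: ab => [E|lt]; first by rewrite E in b0.
    by case: ab' lt => [E|]; [rewrite E in nz | lia].
  exact: IH.
Qed.

Lemma shiftK S h d : S h = 0 -> d <> h -> shift (shift S h d) d h = S.
Proof.
move=> h0 dh; apply: functional_extensionality => z; rewrite !shiftE !eqxx.
case: (z =P h) => [->|_] //.
case: (h =P d) => [E|_]; first by rewrite E in dh.
by case: (z =P d) => [->|].
Qed.

Section Slide.
Variables (N : nat) (mu : pred cell).
Implicit Types (S R : filling).

(** Induction on a slide that keeps the skew shape conditions at hand. *)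
Lemma slides_ind_holed (P : filling -> cell -> filling -> cell -> Prop) :
  (forall S h, holed N mu S h -> S (below h) = 0 -> S (right h) = 0 -> P S h S h) ->
  (forall S h R y, holed N mu S h -> S (below h) != 0 ->
    S (right h) = 0 \/ S (below h) <= S (right h) ->
    P (shift S h (below h)) (below h) R y -> P S h R y) ->
  (forall S h R y, holed N mu S h -> S (right h) != 0 ->
    S (below h) = 0 \/ S (right h) < S (below h) ->
    P (shift S h (right h)) (right h) R y -> P S h R y) ->
  forall S h R y, slides S h R y -> holed N mu S h -> P S h R y.
Proof.
move=> H1 H2 H3 S h R y; elim=> {S h R y} [S h a0 b0|S h R y a0 ab sl IH|S h R y b0 ab sl IH] H.
- exact: H1.
- by apply: H2 => //; apply: IH; apply: holed_below.
- by apply: H3 => //; apply: IH; apply: holed_right.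
Qed.

Lemma slides_holed S h R y : slides S h R y -> holed N mu S h ->
  [/\ holed N mu R y, R (below y) = 0 & R (right y) = 0].
Proof. by move=> sl H; pattern S, h, R, y; apply: slides_ind_holed sl H. Qed.

Lemma holed_skewt R y : holed N mu R y -> R (below y) = 0 -> R (right y) = 0 ->
  skewt N mu R.
Proof.
move=> [Y nmu y0] b0 r0; split; try by case: Y.
move=> r c r' c' rr cc; rewrite !orbF => /orP [m|nz].
  by rewrite (young_inner Y rr cc m).
have := young_outer Y rr cc; rewrite nz orbT => /(_ isT) /or3P [->//|->|/eqP E].
  by rewrite orbT.
rewrite /= in E; subst y; rewrite /below /right /= in b0 r0.
have nE r2 c2 : r' <= r2 -> c' <= c2 -> (r2, c2) <> (r', c') ->
    r2 <= r -> c2 <= c -> R (r2, c2) != 0.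
  move=> r'2 c'2 ne r2r c2c; apply: (filled_between Y r2r c2c nz).
    exact: (inner_mono Y r'2 c'2 nmu).
  by apply/negP => /pred1P.
case: (ltnP r' r) => [lt|ge].
  have : R (r'.+1, c') != 0 by apply: nE => //; case; lia.
  by rewrite b0.
case: (ltnP c' c) => [lt|ge'].
  have : R (r', c'.+1) != 0 by apply: nE => //; case; lia.
  by rewrite r0.
have [Er Ec] : r = r' /\ c = c' by lia.
by rewrite Er Ec y0 in nz.
Qed.

(** A move down leaves every column unchanged, and a move to the right only
    exchanges a letter between two columns whose signs change by a
    cancellation. *)
Lemma slides_weight S h R y : slides S h R y -> holed N mu S h ->
  [/\ forall i, 0 < i -> ep N i R = ep N i S,
      forall i, 0 < i -> ph N i R = ph N i S,
      forall a, 0 < a -> weight N R a = weight N S a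
    & (fun x => (R x != 0) || (x == y)) =1 (fun x => (S x != 0) || (x == h))].
Proof.
move=> sl H; pattern S, h, R, y; apply: slides_ind_holed sl H => {S h R y}.
- by [].
- move=> S h R y H a0 ab [E1 E2 E3 E4]; have [Y nmu h0] := H.
  have E i (i0 : 0 < i) := col_sign_below i0 _ H a0.
  split=> [i i0|i i0|a a_gt0|x].
  + by rewrite E1 //; apply: eq_eps_below => c _; apply: E.
  + by rewrite E2 //; apply: eq_phi_from => c _; apply: E.
  + by rewrite E3 //; apply: eq_count => c; apply: (occurs_below _ Y).
  + rewrite E4 shiftE; case: (x =P below h) => [->|_]; first by rewrite a0 orbT.
    by case: (x =P h) => [->|_]; rewrite ?a0 ?orbT.
- move=> S [r c] R y H b0 ab [E1 E2 E3 E4]; have [Y nmu h0] := H.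
  have [_ cN] := young_box Y b0; rewrite /right /= in cN b0 ab E1 E2 E3 E4 *.
  split=> [i i0|i i0|a a_gt0|x].
  + rewrite E1 //; have [H1 H2 H3] := col_sign_right i0 H b0 ab.
    by apply/esym/(eps_below_swap H1 H2); lia.
  + rewrite E2 //; have [H1 H2 H3] := col_sign_right i0 H b0 ab.
    have := phi_from_swap (d := 0) cN H1 H3 isT.
    by rewrite subn0 => H0; apply/esym/H0.
  + rewrite E3 //; apply: (count_swap cN) => [d dc dc1|].
      exact: occurs_right_other.
    rewrite (occurs_right_new H b0) // (occurs_right_old H b0) //.
    have nb := not_occurs_b H b0 ab; have ob := occurs_b H b0.
    have [->|ne] := eqVneq a (S (r, c.+1)); last by rewrite orbF andbT.
    by rewrite nb ob.
  + rewrite E4 shiftE; case: (x =P (r, c.+1)) => [->|_]; first by rewrite b0 orbT.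
    by case: (x =P (r, c)) => [->|_]; rewrite ?b0 ?orbT.
Qed.

(** The hole moves away from the origin inside the box of size N. *)
Lemma slides_exists S h : holed N mu S h -> exists R y, slides S h R y.
Proof.
move: {2}(N + N - h.1 - h.2) (leqnn (N + N - h.1 - h.2)) => k.
elim: k S h => [|k IH] S h.
  move=> k0 [Y _ _]; exists S, h; apply: slides_stop; apply/eqP.
    by apply/negPn/negP => /(young_box Y) [/= ? ?]; lia.
  by apply/negPn/negP => /(young_box Y) [/= ? ?]; lia.
move=> lek H; have [Y _ _] := H.
have [a0|a0] := eqVneq (S (below h)) 0; have [b0|b0] := eqVneq (S (right h)) 0.
- by exists S, h; apply: slides_stop.
- have ab : S (below h) = 0 \/ S (right h) < S (below h) by left.
  have [] := IH _ (right h) _ (holed_right H b0 ab).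
    by have [? ?] := young_box Y b0; rewrite /=; lia.
  by move=> R [y sl]; exists R, y; apply: slides_right.
- have ab : S (right h) = 0 \/ S (below h) <= S (right h) by left.
  have [] := IH _ (below h) _ (holed_below H a0 ab).
    by have [? ?] := young_box Y a0; rewrite /=; lia.
  by move=> R [y sl]; exists R, y; apply: slides_down.
- case: (leqP (S (below h)) (S (right h))) => lt.
    have ab : S (right h) = 0 \/ S (below h) <= S (right h) by right.
    have [] := IH _ (below h) _ (holed_below H a0 ab).
      by have [? ?] := young_box Y a0; rewrite /=; lia.
    by move=> R [y sl]; exists R, y; apply: slides_down.
  have ab : S (below h) = 0 \/ S (right h) < S (below h) by right.
  have [] := IH _ (right h) _ (holed_right H b0 ab).
    by have [? ?] := young_box Y b0; rewrite /=; lia.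
  by move=> R [y sl]; exists R, y; apply: slides_right.
Qed.

(** A reverse slide retraces each move, since the comparison that decided
    it is forced by the row and column conditions. *)
Lemma slides_unslides S h R y : slides S h R y -> holed N mu S h ->
  forall R' x, unslides S h R' x -> unslides R y R' x.
Proof.
move=> sl H; pattern S, h, R, y; apply: slides_ind_holed sl H => {S h R y}.
- by [].
- move=> S [r c] R y H a0 ab IH R' x us; have [Y nmu h0] := H.
  apply: IH; apply: unslides_up; rewrite /up_val /left_val /below /=.
  + by rewrite shiftE !cellE.
  + case: c H a0 ab us Y nmu h0 => [|c] H a0 ab us Y nmu h0 /=; first by left.
    rewrite !shiftE !cellE /=.
    have [->|nz] := eqVneq (S (r.+1, c)) 0; [by left | right].
    exact: (young_row Y _ nz a0).
  + by rewrite shiftK // => -[]; lia.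
- move=> S [r c] R y H b0 ab IH R' x us; have [Y nmu h0] := H.
  apply: IH; apply: unslides_left; rewrite /up_val /left_val /right /=.
  + by rewrite shiftE !cellE.
  + case: r H b0 ab us Y nmu h0 => [|r] H b0 ab us Y nmu h0 /=; first by left.
    rewrite !shiftE !cellE /=.
    have [->|nz] := eqVneq (S (r, c.+1)) 0; [by left | right].
    exact: (young_col Y _ nz b0).
  + by rewrite shiftK // => -[]; lia.
Qed.

End Slide.

(** [xs] removes the cells of mu one at a time, always an outer corner;
    this is the order in which a standard filling of mu governs the slides. *)
Fixpoint peels (mu : pred cell) (xs : seq cell) : Prop :=
  if xs is x :: xs' then
    [/\ mu x, down_closed (del mu x) & peels (del mu x) xs']
  else forall x, ~~ mu x.

(** Slides into the cells xs; ys are the vacated cells. *)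
Inductive rects : seq cell -> filling -> filling -> seq cell -> Prop :=
| rects_nil S : rects [::] S S [::]
| rects_cons x xs S S' R y ys : slides S x S' y -> rects xs S' R ys ->
    rects (x :: xs) S R (y :: ys).

Section Rects.
Variable (N : nat).
Implicit Types (S R : filling) (mu : pred cell).

Lemma skewt_holed mu S x : skewt N mu S -> mu x -> down_closed (del mu x) ->
  holed N (del mu x) S x.
Proof.
move=> Y mx dc; split; last exact: (young_disj Y mx).
  split=> //; try by case: Y.
    by move=> y /andP [my _]; apply: (young_disj Y).
  apply: eq_down_closed (young_outer Y) => y; rewrite orbF /del /=.
  by case: (y =P x) => [->|_]; rewrite ?mx ?orbT ?andbT ?orbF.
by rewrite /del eqxx andbF.
Qed.

Lemma skewt_slides mu S x R y : skewt N mu S -> mu x -> down_closed (del mu x) ->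
  slides S x R y -> skewt N (del mu x) R.
Proof.
move=> Y mx dc sl; have H := skewt_holed Y mx dc.
by have [H' b r] := slides_holed sl H; apply: holed_skewt H' b r.
Qed.

Lemma unslides_corner mu S x R y : skewt N mu S -> mu x ->
  down_closed (del mu x) -> slides S x R y -> unslides R y S x.
Proof.
move=> Y mx dc sl; have H := skewt_holed Y mx dc.
apply: (slides_unslides sl H); case: x mx dc sl H => r c mx dc sl H.
apply: unslides_stop.
  rewrite /up_val /=; case: ifP => // _; apply: (young_disj Y).
  by apply: (young_inner Y _ _ mx); lia.
rewrite /left_val /=; case: ifP => // _; apply: (young_disj Y).
by apply: (young_inner Y _ _ mx); lia.
Qed.

Lemma rects_exists mu xs S : skewt N mu S -> peels mu xs ->
  exists R ys, rects xs S R ys.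
Proof.
elim: xs mu S => [|x xs IH] mu S Y /=.
  by move=> _; exists S, [::]; apply: rects_nil.
move=> [mx dc pl]; have H := skewt_holed Y mx dc.
have [S' [y sl]] := slides_exists H.
have [R [ys rc]] := IH _ _ (skewt_slides Y mx dc sl) pl.
by exists R, (y :: ys); apply: rects_cons rc.
Qed.

Lemma rects_skewt mu xs S R ys : skewt N mu S -> peels mu xs ->
  rects xs S R ys -> skewt N pred0 R.
Proof.
move=> + + rc; elim: rc mu => {xs S R ys} [S|x xs S S' R y ys sl rc IH] mu Y /=.
  move=> m0; split; try by case: Y.
  by apply: eq_down_closed (young_outer Y) => x; rewrite (negPf (m0 x)).
by move=> [mx dc pl]; apply: IH pl; apply: skewt_slides sl.
Qed.

Lemma rects_det xs S R ys R' ys' : rects xs S R ys -> rects xs S R' ys' ->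
  R = R' /\ ys = ys'.
Proof.
move=> rc; elim: rc R' ys' => {xs S R ys} [S|x xs S S' R y ys sl rc IH] R' ys' rc'.
  by inversion rc'.
inversion rc' as [|x1 xs1 S1 S1' R1 y1 ys1 sl1 rc1]; subst.
have [Es Ey] := slides_det sl sl1; subst S1' y1.
by have [-> ->] := IH _ _ rc1.
Qed.

Lemma rects_weight mu xs S R ys : skewt N mu S -> peels mu xs ->
  rects xs S R ys ->
  [/\ forall i, 0 < i -> ep N i R = ep N i S,
      forall i, 0 < i -> ph N i R = ph N i S
    & forall a, 0 < a -> weight N R a = weight N S a].
Proof.
move=> + + rc; elim: rc mu => {xs S R ys} [S|x xs S S' R y ys sl rc IH] mu Y //=.
move=> [mx dc pl]; have [E1 E2 E3] := IH _ (skewt_slides Y mx dc sl) pl.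
have [F1 F2 F3 _] := slides_weight sl (skewt_holed Y mx dc).
by split=> i i0; rewrite ?E1 ?E2 ?E3 ?F1 ?F2 ?F3.
Qed.

(** Undoing the slides from the vacated cells recovers the skew tableau. *)
Lemma rects_inj mu xs S S' R ys : skewt N mu S -> skewt N mu S' -> peels mu xs ->
  rects xs S R ys -> rects xs S' R ys -> S = S'.
Proof.
move=> + + + rc; elim: rc mu S' => {xs S R ys} [S|x xs S S1 R y ys sl rc IH] mu S' Y Y' /=.
  by move=> _ rc'; inversion rc'.
move=> [mx dc pl] rc'; inversion rc' as [|x1 xs1 S0 S1' R1 y1 ys1 sl1 rc1]; subst.
have Es := IH _ _ (skewt_slides Y mx dc sl) (skewt_slides Y' mx dc sl1) pl rc1.
subst S1'; have U := unslides_corner Y mx dc sl.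
by have [] := unslides_det U (unslides_corner Y' mx dc sl1).
Qed.

(** Rectification commutes with the crystal operators, with the same
    vacated cells. *)
Lemma rects_lowered mu i xs S1 S R ys : 0 < i -> skewt N mu S1 ->
  raises N i S1 S -> peels mu xs -> rects xs S R ys ->
  exists2 R1, rects xs S1 R1 ys & raises N i R1 R.
Proof.
move=> i0 + + + rc; elim: rc mu S1 => {xs S R ys} [S|x xs S S' R y ys sl rc IH] mu S1 Y1 Rs /=.
  by move=> _; exists S1 => //; apply: rects_nil.
move=> [mx dc pl]; have Y := raises_skewt i0 Y1 Rs.
have [p L E1] := raises_lowers i0 Y1 Rs; subst S1.
have [p' [L' sl']] := slides_lower i0 sl (skewt_holed Y mx dc) L.
have Y' := skewt_slides Y mx dc sl.
have [R1 rc1 Rs1] := IH _ _ (skewt_slides Y1 mx dc sl') (lowers_raises i0 Y' L') pl.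
by exists R1 => //; apply: rects_cons rc1.
Qed.

Lemma rects_raised mu i xs S S1 R ys : 0 < i -> skewt N mu S ->
  raises N i S S1 -> peels mu xs -> rects xs S R ys ->
  exists2 R1, rects xs S1 R1 ys & raises N i R R1.
Proof.
move=> i0 Y Rs pl rc; have Y1 := raises_skewt i0 Y Rs.
have [R1 [ys1 rc1]] := rects_exists Y1 pl.
have [R' rc' Rs'] := rects_lowered i0 Y Rs pl rc1.
by have [E1 E2] := rects_det rc rc'; subst R' ys1; exists R1.
Qed.

(** Components of the crystal of skew fillings under the operators with
    index in J. *)
Inductive conn (mu : pred cell) (J : pred nat) (S : filling) : filling -> Prop :=
| conn0 : conn mu J S S
| conn_up j S1 S2 : conn mu J S S1 -> J j -> raises N j S1 S2 -> conn mu J S S2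
| conn_down j S1 S2 : conn mu J S S1 -> J j -> skewt N mu S2 ->
    raises N j S2 S1 -> conn mu J S S2.

Section Conn.
Variable J : pred nat.
Hypothesis J_gt0 : forall j, J j -> 0 < j.

Lemma conn_skewt mu S S' : conn mu J S S' -> skewt N mu S -> skewt N mu S'.
Proof.
elim=> // j S1 S2 _ IH /J_gt0 j0 Rs Y.
by apply: (raises_skewt j0 (IH Y) Rs).
Qed.

Lemma conn_trans mu S S' S'' : conn mu J S S' -> conn mu J S' S'' -> conn mu J S S''.
Proof.
move=> C; elim=> // j S1 S2 _ IH Jj.
  by move=> Rs; apply: conn_up IH Jj Rs.
by move=> Y Rs; apply: conn_down IH Jj Y Rs.
Qed.

Lemma conn_sym mu S S' : skewt N mu S -> conn mu J S S' -> conn mu J S' S.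
Proof.
move=> Y C; elim: C; first exact: conn0.
  move=> j S1 S2 C1 C1' Jj Rs; have Y1 := conn_skewt C1 Y.
  by apply: conn_trans C1'; apply: conn_down (conn0 _ _ _) Jj Y1 Rs.
move=> j S1 S2 C1 C1' Jj Y2 Rs.
by apply: conn_trans C1'; apply: conn_up (conn0 _ _ _) Jj Rs.
Qed.

Lemma rects_conn mu xs S S' R ys : skewt N mu S -> peels mu xs ->
  rects xs S R ys -> conn mu J S S' ->
  exists2 R', rects xs S' R' ys & conn pred0 J R R'.
Proof.
move=> Y pl rc; elim; first by exists R => //; apply: conn0.
  move=> j S1 S2 C1 [R1 rc1 C1'] Jj Rs; have Y1 := conn_skewt C1 Y.
  have [R2 rc2 Rs2] := rects_raised (J_gt0 Jj) Y1 Rs pl rc1.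
  by exists R2 => //; apply: conn_up C1' Jj Rs2.
move=> j S1 S2 C1 [R1 rc1 C1'] Jj Y2 Rs.
have [R2 rc2 Rs2] := rects_lowered (J_gt0 Jj) Y2 Rs pl rc1.
exists R2 => //; apply: conn_down C1' Jj _ Rs2.
exact: rects_skewt Y2 pl rc2.
Qed.

(** A path from the rectification lifts, since an operator vanishes on a
    skew filling exactly when it vanishes on its rectification. *)
Lemma rects_conn_rev mu xs S R R' ys : skewt N mu S -> peels mu xs ->
  rects xs S R ys -> conn pred0 J R R' ->
  exists2 S', rects xs S' R' ys & conn mu J S S'.
Proof.
move=> Y pl rc; elim; first by exists S => //; apply: conn0.
  move=> j R1 R2 C1 [S1 rc1 C1'] Jj Rs; have j0 := J_gt0 Jj.
  have Y1 := conn_skewt C1' Y; have YR := rects_skewt Y1 pl rc1.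
  have [S2 Rs2] : exists S2, raises N j S1 S2.
    apply/(raisesP j Y1); have [_ E _] := rects_weight Y1 pl rc1.
    by rewrite -E //; apply/(raisesP j YR); exists R2.
  have [R2' rc2 Rs2'] := rects_raised j0 Y1 Rs2 pl rc1.
  rewrite (raises_fun j0 YR Rs Rs2').
  by exists S2 => //; apply: conn_up C1' Jj Rs2.
move=> j R1 R2 C1 [S1 rc1 C1'] Jj YR2 Rs; have j0 := J_gt0 Jj.
have Y1 := conn_skewt C1' Y; have YR := rects_skewt Y1 pl rc1.
have [S2 Y2 Rs2] : exists2 S2, skewt N mu S2 & raises N j S2 S1.
  apply/(lowersP j0 Y1); have [E _ _] := rects_weight Y1 pl rc1.
  by rewrite -E //; apply/(lowersP j0 YR); exists R2.
have [R2' rc2 Rs2'] := rects_lowered j0 Y2 Rs2 pl rc1.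
have YR2' := rects_skewt Y2 pl rc2.
rewrite (raises_inj j0 YR2 YR2' Rs Rs2').
by exists S2 => //; apply: conn_down C1' Jj Y2 Rs2.
Qed.

End Conn.
End Rects.

(** * Extremal fillings of straight shape *)

Definition letters (p q : nat) (S : filling) : Prop :=
  forall x, S x != 0 -> p <= S x <= q.+1.

Definition same_support (S S' : filling) : Prop :=
  forall x, (S x != 0) = (S' x != 0).

Definition letter_sum N (S : filling) : nat :=
  \sum_(x : 'I_N * 'I_N) S (val x.1, val x.2).

Lemma total_upd N S r c a : r < N -> c < N ->
  letter_sum N (upd S (r, c) a) + S (r, c) = letter_sum N S + a.
Proof.
move=> rN cN; rewrite /letter_sum.
rewrite (bigD1 (Ordinal rN, Ordinal cN)) //= updE eqxx.
rewrite [in RHS](bigD1 (Ordinal rN, Ordinal cN)) //=.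
rewrite (eq_bigr (fun x : 'I_N * 'I_N => S (val x.1, val x.2))).
  by rewrite /= addnC addnA addnAC.
move=> [r' c'] /= ne; rewrite updE; case: eqP => // -[Er Ec].
by case/eqP: ne; congr pair; apply: val_inj.
Qed.

Lemma sign_of_None i (P : pred nat) : P i = P i.+1 -> sign_of i P = None.
Proof. by rewrite /sign_of => ->; case: (P i.+1). Qed.

Section Ranges.
Variables (N p q : nat) (mu : pred cell).
Hypothesis p_gt0 : 0 < p.
Implicit Types (S : filling).
Notation J := (interval p q).

Lemma J_gt0 j : J j -> 0 < j.
Proof. by rewrite /interval => /andP [pj _]; apply: (leq_trans _ pj). Qed.

Lemma raises_support j S S' : 0 < j -> raises N j S S' -> same_support S S'.
Proof.
move=> j0 [r [c [rN E _ ->]]] x; rewrite upd_neq0 // E -lt0n //.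
Qed.

Lemma raises_letters j S S' : J j -> raises N j S S' ->
  letters p q S <-> letters p q S'.
Proof.
move=> Jj [r [c [rN E _ ->]]]; have /andP [pj jq] := Jj.
have j0 := J_gt0 Jj.
split=> L x; have := L x; rewrite upd_neq0 ?E -?lt0n // updE;
  case: (x =P (r, c)) => [->|_]; rewrite ?E //; lia.
Qed.

Lemma conn_support S S' : conn N mu J S S' -> same_support S S'.
Proof.
elim=> // j S1 S2 _ E /J_gt0 j0; [move=> Rs | move=> _ Rs] => x.
  by rewrite E (raises_support j0 Rs).
by rewrite E (raises_support j0 Rs).
Qed.

Lemma conn_letters S S' : conn N mu J S S' -> letters p q S -> letters p q S'.
Proof.
move=> C L; elim: C => // j S1 S2 _ E Jj; [move=> Rs | move=> _ Rs].
  by apply/(raises_letters Jj Rs).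
by apply/(raises_letters Jj Rs).
Qed.

Lemma raises_total j S S' : 0 < j -> skewt N mu S -> raises N j S S' ->
  letter_sum N S' = (letter_sum N S).+1.
Proof.
move=> j0 Y [r [c [rN E [cN _ _ _] ->]]].
by have := total_upd S j.+1 rN cN; rewrite E; lia.
Qed.

(** The operators e lower the sum of the letters. *)
Lemma to_highest S : skewt N mu S ->
  exists2 H, conn N mu J S H & forall j, J j -> ep N j H = 0.
Proof.
move: {2}(letter_sum N S) (leqnn (letter_sum N S)) => k; elim: k S => [|k IH] S le Y.
  exists S => [|j Jj]; first exact: conn0.
  apply/eqP; rewrite -leqn0 leqNgt; apply/negP => /(lowersP (J_gt0 Jj) Y) [S' Y' Rs].
  by have := raises_total (J_gt0 Jj) Y' Rs; lia.
case: (classic (exists2 j, J j & 0 < ep N j S)) => [[j Jj]|no].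
  have j0 := J_gt0 Jj.
  move=> /(lowersP j0 Y) [S' Y' Rs]; have := raises_total j0 Y' Rs => E.
  have [|H C hi] := IH S' _ Y'; first by lia.
  by exists H => //; apply: (conn_trans _ C); apply: (conn_down (conn0 _ _ _ _) Jj Y' Rs).
exists S => [|j Jj]; first exact: conn0.
by apply/eqP; rewrite -leqn0 leqNgt; apply/negP => lt; apply: no; exists j.
Qed.

End Ranges.

Lemma count_ltn k N : k <= N -> count (fun c => c < k) (iota 0 N) = k.
Proof.
move=> kN; have -> : N = k + (N - k) by lia.
rewrite iotaD count_cat add0n.
have -> : count (fun c => c < k) (iota 0 k) = k.
  rewrite (eq_in_count (a2 := predT)) ?count_predT ?size_iota // => c.
  by rewrite mem_iota add0n => /= ->.
rewrite (eq_in_count (a2 := pred0)) ?count_pred0 ?addn0 // => c.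
by rewrite mem_iota /= => /andP [kc _]; rewrite ltnNge kc.
Qed.

Section Straight.
Variables (N p q : nat).
Implicit Types (S : filling).
Notation J := (interval p q).
Notation straight := (skewt N pred0).

Lemma straight_in S r c r' c' : straight S -> r' <= r -> c' <= c ->
  S (r, c) != 0 -> S (r', c') != 0.
Proof. by move=> Y rr cc nz; apply: (filled_in Y rr cc nz). Qed.

Lemma last_in_row S r c : straight S -> S (r, c) != 0 ->
  exists2 d, c <= d /\ S (r, d) != 0 & forall d', d < d' -> S (r, d') = 0.
Proof.
move=> Y nz; have ex : exists d, S (r, d) != 0 by exists c.
have bd d : S (r, d) != 0 -> d <= N by move=> /(filled_box Y) [_ /ltnW].
case: (ex_maxnP ex bd) => d nzd max; exists d; first by split=> //; apply: max.
move=> d' lt; apply/eqP/negPn/negP => /max; lia.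
Qed.

Lemma last_in_col S r c : straight S -> S (r, c) != 0 ->
  exists2 d, r <= d /\ S (d, c) != 0 & forall d', d < d' -> S (d', c) = 0.
Proof.
move=> Y nz; have ex : exists d, S (d, c) != 0 by exists r.
have bd d : S (d, c) != 0 -> d <= N by move=> /(filled_box Y) [/ltnW].
case: (ex_maxnP ex bd) => d nzd max; exists d; first by split=> //; apply: max.
move=> d' lt; apply/eqP/negPn/negP => /max; lia.
Qed.

Definition row_len S r := count (fun c => S (r, c) != 0) (iota 0 N).

Lemma row_lenP S r c : straight S -> (S (r, c) != 0) = (c < row_len S r).
Proof.
move=> Y; rewrite /row_len.
have [k kN Hk] : exists2 k, k <= N & forall c, (S (r, c) != 0) = (c < k).
  have [z|nz] := eqVneq (S (r, 0)) 0.
    exists 0 => // d; apply/negbTE/negP => nzd.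
    by have := straight_in Y (leqnn r) (leq0n d) nzd; rewrite z.
  have [d [_ nzd] dmax] := last_in_row Y nz; have [_ dN] := filled_box Y nzd.
  exists d.+1 => // d'; rewrite ltnS; case: (leqP d' d) => [le|lt].
    exact: (straight_in Y (leqnn r) le nzd).
  by rewrite dmax.
by rewrite (eq_count Hk) count_ltn.
Qed.

Lemma same_row_len S S' : straight S -> straight S' ->
  row_len S =1 row_len S' -> same_support S S'.
Proof. by move=> Y Y' E [r c]; rewrite !row_lenP // E. Qed.

Hypothesis p_gt0 : 0 < p.

(** By induction on r. If the last letter of row r, say i+1, were larger
    than p+r, its column would have a sign - for i: the rows above consist
    of letters smaller than i, and i is not below i+1. The columns to the
    right end above row r and have no sign, so this - is not cancelled. *)
Lemma highest_row S r c : straight S -> letters p q S ->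
  (forall j, J j -> ep N j S = 0) -> S (r, c) != 0 -> S (r, c) = p + r.
Proof.
move=> Y L hi; elim/ltn_ind: r c => r IH c nz.
have lo d : S (r, d) != 0 -> p + r <= S (r, d).
  move=> nzd; case: r IH nz nzd => [|r] IH nz nzd.
    by have /andP [le _] := L _ nzd; rewrite addn0.
  have nz1 := straight_in Y (leqnSn r) (leqnn d) nzd.
  by have := young_col Y (ltnSn r) nz1 nzd; rewrite (IH r) //; lia.
have [d [cd nzd] dmax] := last_in_row Y nz.
have := row_le Y cd nz nzd; have := lo _ nz.
suff : S (r, d) <= p + r by lia.
rewrite leqNgt; apply/negP => gt.
have /andP [_ leq1] := L _ nzd; have [rN dN] := filled_box Y nzd.
pose i := (S (r, d)).-1; have Ei : S (r, d) = i.+1 by rewrite /i; lia.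
have Ji : J i by rewrite /interval /i; lia.
have small r' d' : r' < r -> S (r', d') <> i /\ S (r', d') <> i.+1.
  move=> lt; case: (eqVneq (S (r', d')) 0) => [->|nz']; first by rewrite /i; lia.
  by rewrite (IH _ lt _ nz') /i; lia.
(* the columns b at the right of d end above row r *)
have right_none b : d.+1 <= b < d.+1 + (N - d.+1) -> col_sign N i S b = None.
  move=> /andP [db _]; apply: sign_of_None.
  have no a r' : S (r', b) = a -> 0 < a -> r' < r.
    move=> E a0; rewrite ltnNge; apply/negP => rr.
    have nz' : S (r', b) != 0 by rewrite E -lt0n.
    by have := straight_in Y rr (leqnn b) nz'; rewrite dmax.
  transitivity false; [|apply: esym]; apply/occursP => -[r' _ E].
    by have [] := small r' b (no i r' E (J_gt0 p_gt0 Ji)).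
  by have [] := small r' b (no i.+1 r' E isT).
have gd : col_sign N i S d = Some false.
  rewrite /col_sign /sign_of.
  have -> : occurs N S d i = false.
    apply/occursP => -[r' _ E].
    have [lt|lt|Er] := ltngtP r' r; last by move: E; rewrite Er Ei; lia.
      by have [] := small r' d lt.
    have nz' : S (r', d) != 0 by rewrite E -lt0n; apply: (J_gt0 p_gt0 Ji).
    by have := young_col Y lt nzd nz'; rewrite E Ei; lia.
  by have -> // : occurs N S d i.+1; apply/occursP; exists r.
have := hi i Ji; rewrite /ep.
have := eps_below_None right_none; rewrite subnKC // => ->.
by rewrite /= gd.
Qed.

(** The shape determines a highest weight filling, by [highest_row]. *)
Lemma highest_uniq S S' : straight S -> straight S' -> letters p q S -> letters p q S' ->
  (forall j, J j -> ep N j S = 0) -> (forall j, J j -> ep N j S' = 0) ->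
  same_support S S' -> S = S'.
Proof.
move=> Y Y' L L' hi hi' E; apply: functional_extensionality => -[r c].
have [z|nz] := eqVneq (S (r, c)) 0.
  by have := E (r, c); rewrite z eqxx => /esym/negbFE/eqP ->.
have nz' : S' (r, c) != 0 by rewrite -E.
by rewrite (highest_row Y) // (highest_row Y').
Qed.

(** Both fillings are connected to the highest weight filling of their
    shape. *)
Lemma conn_straight S S' : straight S -> straight S' ->
  letters p q S -> letters p q S' -> same_support S S' -> conn N pred0 J S S'.
Proof.
move=> Y Y' L L' E.
have [H C hi] := to_highest q p_gt0 Y; have [H' C' hi'] := to_highest q p_gt0 Y'.
have J0 := @J_gt0 p q p_gt0.
have EH : H = H'.
  apply: (highest_uniq _ _ _ _ hi hi').
  - exact: (conn_skewt J0 C Y).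
  - exact: (conn_skewt J0 C' Y').
  - exact: (conn_letters p_gt0 C L).
  - exact: (conn_letters p_gt0 C' L').
  - by move=> x; rewrite -(conn_support p_gt0 C) E (conn_support p_gt0 C').
by apply: (conn_trans C _); rewrite EH; apply: (conn_sym J0 Y' C').
Qed.

(** Dual of [highest_row]: from bottom to top columns consist of q+1, q,
    q-1, ... By induction on columns from the left and on rows from the
    bottom, the first smaller letter x would give its column a sign + for
    x, and the columns at its left, which end with x, x+1, ..., q+1, have
    no sign that cancels it. *)
Lemma lowest_col S c l r : straight S -> letters p q S ->
  (forall j, J j -> ph N j S = 0) -> S (l, c) != 0 ->
  (forall l', l < l' -> S (l', c) = 0) -> r <= l -> S (r, c) + l = q.+1 + r.
Proof.
move=> Y L lo; elim/ltn_ind: c l r => c IHc l r nzl lmax rl.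
rewrite -(subKn rl); move: (l - r) (leq_subr r l) => {rl} k; elim/ltn_ind: k => k IH kl.
set r0 := l - k; have r0l : r0 <= l := leq_subr _ _.
have nz : S (r0, c) != 0 := straight_in Y r0l (leqnn c) nzl.
have [rN cN] := filled_box Y nz; have /andP [px xq] := L _ nz.
have next : r0 < l -> S (r0.+1, c) + l = q.+1 + r0.+1.
  move=> lt; have := IH k.-1; have -> : l - k.-1 = r0.+1 by rewrite /r0; lia.
  by apply; rewrite /r0 in lt; lia.
have nxt : r0 < l -> S (r0, c) < S (r0.+1, c).
  by move=> lt; apply: (young_col Y _ nz) => //; apply: (straight_in Y lt (leqnn c) nzl).
have le : S (r0, c) + l <= q.+1 + r0.
  move: r0l; rewrite leq_eqVlt => /orP [/eqP El|lt]; first by lia.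
  by have := next lt; have := nxt lt; lia.
apply/eqP; rewrite eqn_leq le /= leqNgt; apply/negP => lt.
set x := S (r0, c) in lt nxt px xq nz *.
have Jx : J x by rewrite /interval; lia.
have x0 := J_gt0 p_gt0 Jx.
have gc : col_sign N x S c = Some true.
  rewrite /col_sign /sign_of.
  have -> : occurs N S c x by apply/occursP; exists r0.
  have -> // : occurs N S c x.+1 = false.
  apply/occursP => -[r' _ E]; have nz' : S (r', c) != 0 by rewrite E.
  have Ex : S (r0, c) = x by [].
  have Er' := col_succ x0 Y Ex E; subst r'.
  case: (ltnP r0 l) => [/next|ge]; first by lia.
  by move: E; rewrite lmax.
have left_none b : b < c -> col_sign N x S b = None.
  move=> bc; apply: sign_of_None.
  have nzb : S (r0, b) != 0 := straight_in Y (leqnn _) (ltnW bc) nz.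
  have [l' [r0l' nzl'] l'max] := last_in_col Y nzb.
  have F r' : r' <= l' -> S (r', b) + l' = q.+1 + r' by apply: (IHc b bc).
  have leb := young_row Y bc nzb nz; rewrite -/x in leb.
  have F0 := F _ r0l'.
  have [l'N _] := filled_box Y nzl'.
  (* the column b ends with the letters x, ..., q+1 *)
  have occ a : x <= a <= q.+1 -> occurs N S b a.
    move=> /andP [xa aq]; apply/occursP; exists (a + l' - q.+1); first by lia.
    by have := F (a + l' - q.+1); lia.
  by rewrite !occ //; lia.
have := lo x Jx; rewrite /ph.
have dist k0 : k0 <= c -> phi_from (col_sign N x S) (c - k0) (N - (c - k0)) =
    phi_from (col_sign N x S) c (N - c).
  elim: k0 => [|k0 IHk] k0c; first by rewrite subn0.
  rewrite phi_fromS; last by lia.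
  have -> : (c - k0.+1).+1 = c - k0 by lia.
  by rewrite left_none /= ?IHk //; lia.
by have := dist c (leqnn c); rewrite subnn subn0 => ->; rewrite phi_fromS // gc.
Qed.

Lemma lowest_uniq S S' : straight S -> straight S' -> letters p q S -> letters p q S' ->
  (forall j, J j -> ph N j S = 0) -> (forall j, J j -> ph N j S' = 0) ->
  same_support S S' -> S = S'.
Proof.
move=> Y Y' L L' lo lo' E; apply: functional_extensionality => -[r c].
have E0 x : S x = 0 <-> S' x = 0.
  by have := E x; case: (S x) => [|?]; case: (S' x) => [|?].
have [z|nz] := eqVneq (S (r, c)) 0; first by rewrite z; apply/esym/E0.
have [l [rl nzl] lmax] := last_in_col Y nz.
have nzl' : S' (l, c) != 0 by rewrite -E.
have lmax' l' : l < l' -> S' (l', c) = 0 by move=> lt; apply/E0/lmax.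
have := lowest_col Y L lo nzl lmax rl; have := lowest_col Y' L' lo' nzl' lmax' rl.
lia.
Qed.

Lemma row_bound S r c : straight S -> letters p q S -> S (r, c) != 0 ->
  p + r <= q.+1.
Proof.
move=> Y L; suff lo : S (r, c) != 0 -> p + r <= S (r, c).
  by move=> nz; have := lo nz; have := L _ nz; lia.
elim: r => [|r IH] nz; first by have := L _ nz; lia.
have nz1 := straight_in Y (leqnSn r) (leqnn c) nz.
by have := IH nz1; have := young_col Y (ltnSn r) nz1 nz; lia.
Qed.

(** The letter p+r fills exactly row r. *)
Lemma weight_highest S r : straight S -> letters p q S ->
  (forall j, J j -> ep N j S = 0) -> weight N S (p + r) = row_len S r.
Proof.
move=> Y L hi; apply: eq_count => c; apply/occursP/idP => [[r' r'N E]|nz].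
  have nz : S (r', c) != 0 by rewrite E; lia.
  have Er : r' = r by have := highest_row Y L hi nz; lia.
  by rewrite Er in nz.
by exists r; [have [] := filled_box Y nz | exact: highest_row].
Qed.

(** A column contains the letter q+1-r exactly when its length exceeds r. *)
Lemma weight_lowest S r : straight S -> letters p q S ->
  (forall j, J j -> ph N j S = 0) -> r <= q -> weight N S (q.+1 - r) = row_len S r.
Proof.
move=> Y L lo rq; apply: eq_in_count => c _; apply/occursP/idP => [[r' r'N E]|nz].
  case: (eqVneq (S (r', c)) 0) => [z|nz].
    by exfalso; move: E; rewrite z; lia.
  have [l [rl nzl] lmax] := last_in_col Y nz.
  have := lowest_col Y L lo nzl lmax rl; rewrite E => El.
  by apply: (straight_in Y _ (leqnn c) nzl); lia.
have [l [rl nzl] lmax] := last_in_col Y nz.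
have [lN _] := filled_box Y nzl.
exists (l - r); first by lia.
by have := lowest_col Y L lo nzl lmax (leq_subr r l); lia.
Qed.

End Straight.

(** * Evacuation *)

Definition opp_cell h w (x : cell) : cell := (h.-1 - x.1, w.-1 - x.2).

(** Rotation by 180 degrees of a h by w rectangle with complementation of
    the letters in p, ..., q+1. *)
Definition half_turn h w p q (S : filling) : filling := fun x =>
  if (x.1 < h) && (x.2 < w) then
    let v := S (opp_cell h w x) in if v == 0 then 0 else p + q + 1 - v
  else 0.

(** The empty cells of the rectangle come first after the rotation, and
    form the inner shape. *)
Definition rot_inner h w (S : filling) : pred cell := fun x =>
  [&& x.1 < h, x.2 < w & S (opp_cell h w x) == 0].

(** Reversing a sequence of columns and exchanging the signs exchanges
    epsilon and phi. *)
Lemma eps_below_rev (g g' : nat -> option bool) w k : k <= w ->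
  (forall d, d < w -> g' d = omap negb (g (w.-1 - d))) ->
  eps_below g' k = phi_from g (w - k) k.
Proof.
move=> + H; elim: k => [|k IH] kw //.
rewrite /= IH; last exact: ltnW.
have -> : w - k = (w - k.+1).+1 by lia.
rewrite H //; have -> : w.-1 - k = w - k.+1 by lia.
by case: (g _) => [[]|].
Qed.

Lemma phi_from_rev (g g' : nat -> option bool) w k : k <= w ->
  (forall d, d < w -> g' d = omap negb (g (w.-1 - d))) ->
  phi_from g' (w - k) k = eps_below g k.
Proof.
move=> kw H; apply/esym/eps_below_rev => // d dw.
rewrite H; last by lia.
have -> : w.-1 - (w.-1 - d) = d by lia.
by case: (g d) => [[]|].
Qed.

Lemma phi_from_trunc g c d e : (forall b, c + d <= b < c + d + e -> g b = None) ->
  phi_from g c (d + e) = phi_from g c d.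
Proof.
elim: d c => [|d IH] c H /=.
  by rewrite phi_from_None // => b Hb; apply: H; rewrite addn0.
by rewrite IH // => b Hb; apply: H; lia.
Qed.

(** Letters are counted by weights, which rectification preserves. *)
Lemma weight_letters N p q mu (S R : filling) : 0 < p -> skewt N mu R ->
  (forall a, 0 < a -> weight N R a = weight N S a) -> letters p q S -> letters p q R.
Proof.
move=> p0 Y Ew L [r c] nz; have [rN cN] := filled_box Y nz.
have : 0 < weight N R (R (r, c)).
  rewrite /weight -has_count; apply/hasP; exists c; first by rewrite mem_iota.
  by apply/occursP; exists r.
rewrite Ew ?lt0n // -lt0n -has_count => /hasP [d _ /occursP [r' _ E]].
by rewrite -E; apply: L; rewrite E.
Qed.

Lemma theta_J p q j : interval p q j -> interval p q (p + q - j).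
Proof. by rewrite /interval; lia. Qed.

Section Rot.
Variables (N p q h w : nat).
Hypothesis p_gt0 : 0 < p.
Hypotheses (hN : h <= N) (wN : w <= N).
Implicit Types (S : filling).
Notation J := (interval p q).
Notation straight := (skewt N pred0).

Definition within S := forall r c, S (r, c) != 0 -> r < h /\ c < w.

Lemma half_turnE S x : half_turn h w p q S x =
  if (x.1 < h) && (x.2 < w) then
    if S (opp_cell h w x) == 0 then 0 else p + q + 1 - S (opp_cell h w x)
  else 0.
Proof. by []. Qed.

Lemma opp_cellK x : x.1 < h -> x.2 < w -> opp_cell h w (opp_cell h w x) = x.
Proof. by case: x => r c /= rh cw; rewrite /opp_cell /=; congr pair; lia. Qed.

Lemma rot_neq0 S x : letters p q S ->
  (half_turn h w p q S x != 0) = [&& x.1 < h, x.2 < w & S (opp_cell h w x) != 0].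
Proof.
move=> L; rewrite half_turnE andbA; case: (_ && _) => //=.
by case: (eqVneq (S (opp_cell h w x)) 0) => //= nz; have := L _ nz; lia.
Qed.

Lemma rot_skewt S : straight S -> letters p q S ->
  skewt N (rot_inner h w S) (half_turn h w p q S).
Proof.
move=> Y L; have nz := rot_neq0 _ L; split.
- move=> r c r' c' rr cc /and3P /= [rh cw z]; apply/and3P; split=> /=; try lia.
  rewrite /opp_cell /= in z *; apply: contraTT z => z.
  by apply: (straight_in Y _ _ z); lia.
- by move=> x /and3P [_ _ z]; rewrite half_turnE z; case: ifP.
- have E x : [|| rot_inner h w S x, half_turn h w p q S x != 0 | pred0 x] =
     (x.1 < h) && (x.2 < w).
    rewrite nz /rot_inner orbF; case: (x.1 < h) => //=; case: (x.2 < w) => //=.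
    by case: (_ == 0).
  by move=> r c r' c' rr cc; rewrite !E /=; lia.
- move=> r c c' lt; rewrite !nz /= => /and3P [rh cw n1] /and3P [_ cw' n2].
  rewrite !half_turnE /= rh cw cw' /= (negPf n1) (negPf n2) /opp_cell /=.
  rewrite /opp_cell /= in n1 n2.
  have le : w.-1 - c' <= w.-1 - c by lia.
  by have := row_le Y le n2 n1; lia.
- move=> r r' c lt; rewrite !nz /= => /and3P [rh cw n1] /and3P [rh' _ n2].
  rewrite !half_turnE /= rh rh' cw /= (negPf n1) (negPf n2) /opp_cell /=.
  rewrite /opp_cell /= in n1 n2; have := L _ n1; have := L _ n2.
  have lt' : h.-1 - r' < h.-1 - r by lia.
  by have := young_col Y lt' n2 n1; lia.
- by move=> r c; rewrite nz /= => /and3P [rh cw _]; lia.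
Qed.

Lemma rot_occurs S c a : within S -> letters p q S -> c < w -> p <= a <= q.+1 ->
  occurs N (half_turn h w p q S) c a = occurs N S (w.-1 - c) (p + q + 1 - a).
Proof.
move=> W L cw pa; apply/occursP/occursP => -[r rN E].
  have nz : half_turn h w p q S (r, c) != 0 by rewrite E; lia.
  move: nz E; rewrite rot_neq0 // => /and3P [/= rh _ nz].
  rewrite half_turnE /= rh cw /= (negPf nz) => E; have := L _ nz.
  by exists (h.-1 - r); [lia | rewrite /opp_cell /= in E *; lia].
have nz : S (r, w.-1 - c) != 0 by rewrite E; lia.
have [rh _] := W _ _ nz; exists (h.-1 - r); first by lia.
rewrite half_turnE /= cw andbT; have -> : h.-1 - r < h by lia.
rewrite /opp_cell /=; have -> : h.-1 - (h.-1 - r) = r by lia.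
by rewrite (negPf nz) E; lia.
Qed.

Lemma rot_occurs_out S c a : w <= c -> 0 < a -> occurs N (half_turn h w p q S) c a = false.
Proof.
move=> wc a0; apply/occursP => -[r _]; rewrite half_turnE /=.
by rewrite [c < w]ltnNge wc andbF => E; rewrite -E in a0.
Qed.

Lemma occurs_out S c a : within S -> w <= c -> 0 < a -> occurs N S c a = false.
Proof.
move=> W wc a0; apply/occursP => -[r _ E].
have nz : S (r, c) != 0 by rewrite E -lt0n.
by have [_] := W _ _ nz; lia.
Qed.

Lemma rot_sign S j d : within S -> letters p q S -> J j -> d < w ->
  col_sign N (p + q - j) (half_turn h w p q S) d = omap negb (col_sign N j S (w.-1 - d)).
Proof.
move=> W L /andP [pj jq] dw; rewrite /col_sign /sign_of !rot_occurs //; try lia.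
have -> : p + q + 1 - (p + q - j) = j.+1 by lia.
have -> : p + q + 1 - (p + q - j).+1 = j by lia.
by case: (occurs _ _ _ j); case: (occurs _ _ _ j.+1).
Qed.

Lemma rot_sign_out S j d : within S -> J j -> w <= d ->
  col_sign N (p + q - j) (half_turn h w p q S) d = None /\ col_sign N j S d = None.
Proof.
move=> W /andP [pj jq] wd; rewrite /col_sign /sign_of.
by rewrite !rot_occurs_out ?occurs_out //; lia.
Qed.

Lemma rot_ph S j : within S -> letters p q S -> J j ->
  ph N (p + q - j) (half_turn h w p q S) = ep N j S.
Proof.
move=> W L Jj; rewrite /ph /ep.
have E : w + (N - w) = N by lia.
have -> : phi_from (col_sign N (p + q - j) (half_turn h w p q S)) 0 N =
          phi_from (col_sign N (p + q - j) (half_turn h w p q S)) 0 w.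
  rewrite -[X in phi_from _ 0 X = _]E phi_from_trunc // => b Hb.
  have wb : w <= b by lia.
  by have [] := rot_sign_out W Jj wb.
have -> : eps_below (col_sign N j S) N = eps_below (col_sign N j S) w.
  rewrite -[X in eps_below _ X = _]E eps_below_None // => b Hb.
  have wb : w <= b by lia.
  by have [] := rot_sign_out W Jj wb.
have := phi_from_rev (leqnn w) (fun d dw => rot_sign W L Jj dw).
by rewrite subnn.
Qed.

Lemma rot_weight S a : within S -> letters p q S -> p <= a <= q.+1 ->
  weight N (half_turn h w p q S) a = weight N S (p + q + 1 - a).
Proof.
move=> W L pa; rewrite /weight; have E : N = w + (N - w) by lia.
have cut (P : pred nat) : (forall c, w <= c -> P c = false) ->
    count P (iota 0 N) = count P (iota 0 w).
  move=> H; rewrite [in LHS]E iotaD count_cat add0n -[RHS]addn0; congr addn.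
  rewrite (eq_in_count (a2 := pred0)) ?count_pred0 // => c.
  by rewrite mem_iota => /andP [wc _]; apply: H.
rewrite !cut; first last.
- by move=> c wc; apply: rot_occurs_out => //; lia.
- by move=> c wc; apply: occurs_out => //; lia.
have -> : count (fun c => occurs N (half_turn h w p q S) c a) (iota 0 w) =
  count (fun c => occurs N S (w.-1 - c) (p + q + 1 - a)) (iota 0 w).
  by apply: eq_in_count => c; rewrite mem_iota => cw; rewrite rot_occurs.
have rv : [seq w.-1 - c | c <- iota 0 w] = rev (iota 0 w).
  apply: (@eq_from_nth _ 0); rewrite ?size_rev size_map ?size_iota // => k kw.
  rewrite (nth_map 0) ?size_iota // nth_rev ?size_iota // !nth_iota; lia.
by rewrite -[RHS]count_rev -rv count_map; apply: eq_count => c.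
Qed.

(** The half turn reverses the order of the columns and exchanges the signs
    of f_j with those of f_(p+q-j), so it turns f_j into e_(p+q-j). *)
Lemma rot_raises S S1 j : straight S -> letters p q S -> within S -> J j ->
  raises N j S S1 -> raises N (p + q - j) (half_turn h w p q S1) (half_turn h w p q S).
Proof.
move=> Y L W Jj [r [c [rN E A ES1]]]; have /andP [pj jq] := Jj.
have j0 : 0 < j by lia.
have nz : S (r, c) != 0 by rewrite E -lt0n.
have [rh cw] := W _ _ nz; have [cN gc p0 e0] := A.
set x' := opp_cell h w (r, c).
have ox : opp_cell h w x' = (r, c) by rewrite opp_cellK.
have xh : x'.1 < h by rewrite /x' /=; lia.
have xw : x'.2 < w by rewrite /x' /=; lia.
have Lx : lowers_at N (p + q - j) (half_turn h w p q S) x'.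
  split; first by rewrite half_turnE xh xw /= ox (negPf nz) E; lia.
  split; first by lia.
  - by rewrite rot_sign //= (_ : w.-1 - (w.-1 - c) = c) ?gc //; lia.
  - have E1 : N - x'.2.+1 = c + (N - w) by rewrite /x' /=; lia.
    rewrite E1 phi_from_trunc => [|b Hb]; last first.
      have wb : w <= b by move: Hb; rewrite /x' /=; lia.
      by have [] := rot_sign_out W Jj wb.
    have -> : x'.2.+1 = w - c by rewrite /x' /=; lia.
    by rewrite (phi_from_rev (g := col_sign N j S) (ltnW cw)) // => d dw; rewrite rot_sign.
  - rewrite (eps_below_rev (g := col_sign N j S) (w := w)) => [||d dw].
    + have -> : w - x'.2 = c.+1 by rewrite /x' /=; lia.
      rewrite -(phi_from_trunc (e := N - w)) => [|b Hb].
        by move: p0; congr (phi_from _ _ _ = 0); rewrite /x' /=; lia.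
      have wb : w <= b by move: Hb; rewrite /x' /=; lia.
      by have [] := rot_sign_out W Jj wb.
    + by rewrite /x' /=; lia.
    + by rewrite rot_sign.
have -> : half_turn h w p q S1 = upd (half_turn h w p q S) x' (p + q - j).
  apply: functional_extensionality => z; rewrite updE.
  case: (z =P x') => [->|ne].
    by rewrite half_turnE xh xw /= ox ES1 updE eqxx /=; lia.
  rewrite !half_turnE; case: ifP => // /andP [zh zw]; rewrite ES1 updE.
  case: (opp_cell h w z =P (r, c)) => // Ez.
  by case: ne; rewrite -(opp_cellK zh zw) Ez.
by apply: (lowers_raises _ (rot_skewt Y L) Lx); lia.
Qed.

End Rot.

Section Evac.
Variables (N p q h w : nat) (zs : seq cell).
Hypothesis p_gt0 : 0 < p.
Hypotheses (hN : h <= N) (wN : w <= N).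
Implicit Types (S R : filling).
Notation J := (interval p q).
Notation straight := (skewt N pred0).

(** The fillings whose evacuation is computed in the fixed rectangle with
    the fixed order of slides zs; this is a property of the shape alone,
    hence constant on components ([boxed_conn]). *)
Definition boxed S :=
  [/\ straight S, letters p q S, within h w S & peels (rot_inner h w S) zs].

Lemma peels_ext (mu mu' : pred cell) xs : mu =1 mu' -> peels mu xs -> peels mu' xs.
Proof.
elim: xs mu mu' => [|x xs IH] mu mu' E /=; first by move=> H x; rewrite -E.
have E' : del mu x =1 del mu' x by move=> y; rewrite /del E.
by move=> [mx dc pl]; split; [rewrite -E | apply: (eq_down_closed E' dc) | apply: (IH _ _ E' pl)].
Qed.

Lemma boxed_support S S' : boxed S -> straight S' -> letters p q S' ->
  same_support S S' -> boxed S'.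
Proof.
move=> [Y L W pl] Y' L' E; split=> //.
  by move=> r c; rewrite -E; apply: W.
apply: peels_ext pl => x; rewrite /rot_inner.
by have := E (opp_cell h w x); do 2!case: eqP.
Qed.

Lemma boxed_conn S S' : boxed S -> conn N pred0 J S S' -> boxed S'.
Proof.
move=> B C; have [Y L W pl] := B; apply: (boxed_support B).
- by apply: (conn_skewt (J_gt0 p_gt0) C).
- exact: (conn_letters p_gt0 C).
- exact: (conn_support p_gt0 C).
Qed.

Lemma evac_raises S S1 R R1 ys ys1 j : boxed S -> J j -> raises N j S S1 ->
  rects zs (half_turn h w p q S) R ys -> rects zs (half_turn h w p q S1) R1 ys1 ->
  raises N (p + q - j) R1 R.
Proof.
move=> B Jj Rs rc rc1; have [Y L W pl] := B.
have B1 : boxed S1 by apply: (boxed_conn B (conn_up (conn0 _ _ _ _) Jj Rs)).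
have [Y1 L1 W1 pl1] := B1.
have Rs' := rot_raises p_gt0 hN wN Y L W Jj Rs.
have j0 := J_gt0 p_gt0 (theta_J Jj).
have Yr1 := rot_skewt p_gt0 hN wN Y1 L1.
have [R' rc' Rs''] := rects_lowered j0 Yr1 Rs' pl1 rc.
by have [-> _] := rects_det rc1 rc'.
Qed.

Lemma evac_exists S : boxed S -> exists R ys, rects zs (half_turn h w p q S) R ys.
Proof.
by move=> [Y L W pl]; apply: (rects_exists (rot_skewt p_gt0 hN wN Y L) pl).
Qed.

Lemma evac_straight S R ys : boxed S -> rects zs (half_turn h w p q S) R ys ->
  straight R.
Proof.
by move=> [Y L W pl]; apply: (rects_skewt (rot_skewt p_gt0 hN wN Y L) pl).
Qed.

Lemma evac_conn S S1 R R1 ys ys1 : boxed S -> conn N pred0 J S S1 ->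
  rects zs (half_turn h w p q S) R ys -> rects zs (half_turn h w p q S1) R1 ys1 ->
  conn N pred0 J R R1.
Proof.
move=> B C; elim: C R1 ys1 => [|j S1' S2 C1 IH Jj Rs|j S1' S2 C1 IH Jj Y2 Rs] R1 ys1 rc rc1.
- by have [-> _] := rects_det rc rc1; apply: conn0.
- have B1 := boxed_conn B C1; have [R' [ys' rc']] := evac_exists B1.
  have C' := IH _ _ rc rc'.
  have Rs' := evac_raises B1 Jj Rs rc' rc1.
  have B2 := boxed_conn B1 (conn_up (conn0 _ _ _ _) Jj Rs).
  exact: (conn_down C' (theta_J Jj) (evac_straight B2 rc1) Rs').
- have B1 := boxed_conn B C1; have [R' [ys' rc']] := evac_exists B1.
  have B2 := boxed_conn B1 (conn_down (conn0 _ _ _ _) Jj Y2 Rs).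
  have Rs' := evac_raises B2 Jj Rs rc1 rc'.
  exact: (conn_up (IH _ _ rc rc') (theta_J Jj) Rs').
Qed.

Lemma evac_letters S R ys : boxed S -> rects zs (half_turn h w p q S) R ys ->
  letters p q R.
Proof.
move=> B rc; have [Y L W pl] := B.
have Yr := rot_skewt p_gt0 hN wN Y L.
have [_ _ Ew] := rects_weight Yr pl rc.
apply: (weight_letters p_gt0 (evac_straight B rc) Ew) => x.
rewrite (rot_neq0 p_gt0 hN wN _ L) => /and3P [rh dw n].
by rewrite half_turnE rh dw /= (negPf n); have := L _ n; lia.
Qed.

(** Evacuation turns a highest weight filling into a lowest weight one,
    whose row lengths are given by its weight read backwards. The half turn
    reverses the weight as well, so the shape is the same. Other fillings
    are reached by operators, which do not change shapes. *)
Lemma evac_support S R ys : boxed S -> rects zs (half_turn h w p q S) R ys ->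
  same_support R S.
Proof.
move=> B rc; have [Y L W pl] := B.
have [H C hi] := to_highest q p_gt0 Y.
have BH := boxed_conn B C; have [YH LH WH plH] := BH.
have [RH [yH rcH]] := evac_exists BH.
have CR := evac_conn B C rc rcH.
have YRH := evac_straight BH rcH; have LRH := evac_letters BH rcH.
have Yr := rot_skewt p_gt0 hN wN YH LH.
have [_ Eph Ew] := rects_weight Yr plH rcH.
have lo j : J j -> ph N j RH = 0.
  move=> Jj; have Jt := theta_J Jj; rewrite Eph; last exact: (J_gt0 p_gt0 Jj).
  have {1}-> : j = p + q - (p + q - j) by have := Jj; rewrite /interval; lia.
  by rewrite (rot_ph p_gt0 hN wN WH LH Jt) hi.
suff E : same_support RH H.
  by move=> x; rewrite (conn_support p_gt0 CR) E (conn_support p_gt0 C).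
apply: (same_row_len YRH YH) => r.
have [le|gt] := leqP (p + r) q.+1; last first.
  have z S' : straight S' -> letters p q S' -> row_len N S' r = 0.
    move=> Y' L'; apply/eqP; rewrite -leqn0 leqNgt; apply/negP.
    rewrite -(row_lenP r 0 Y') => /(row_bound p_gt0 Y' L'); lia.
  by rewrite !z.
rewrite -(weight_lowest p_gt0 YRH LRH lo); last by lia.
rewrite Ew; last by lia.
rewrite (rot_weight p_gt0 hN wN WH LH); last by lia.
by rewrite -(weight_highest p_gt0 r YH LH hi); congr weight; lia.
Qed.

(** The shapes are the same, so [conn_straight] applies. *)
Lemma evac_connected S R ys : boxed S -> rects zs (half_turn h w p q S) R ys ->
  conn N pred0 J S R.
Proof.
move=> B rc; have [Y L _ _] := B.
apply: (conn_straight p_gt0 Y (evac_straight B rc) L (evac_letters B rc)).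
by move=> x; rewrite (evac_support B rc).
Qed.

End Evac.

(** * Reversal of skew fillings *)

Section Reversal.
Variables (N p q h w : nat) (zs xs : seq cell) (mu : pred cell).
Hypothesis p_gt0 : 0 < p.
Hypotheses (hN : h <= N) (wN : w <= N).
Hypothesis pl : peels mu xs.
Implicit Types (S R : filling).
Notation J := (interval p q).
Let J0 := @J_gt0 p q p_gt0.

(** [S'] is obtained from S by rectifying, evacuating, and undoing the
    slides: [S'] is the filling with the same vacated cells ys whose
    rectification is the evacuation. *)
Definition reversed S S' := exists R ys R' ys',
  [/\ rects xs S R ys, rects zs (half_turn h w p q R) R' ys' & rects xs S' R' ys].

Definition reversible S := [/\ skewt N mu S, letters p q S
  & forall R ys, rects xs S R ys -> boxed N p q h w zs R].

Lemma reversible_conn S S' : reversible S -> conn N mu J S S' -> reversible S'.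
Proof.
move=> [Y L B] C; have Y' := conn_skewt J0 C Y; split=> //.
  exact: (conn_letters p_gt0 C).
move=> R' ys' rc'; have [R [ys rc]] := rects_exists Y pl.
have [R1 rc1 C1] := rects_conn J0 Y pl rc C.
have [-> _] := rects_det rc' rc1.
exact: (boxed_conn p_gt0 (B _ _ rc) C1).
Qed.

(** The evacuation is connected to the rectification, and the path lifts. *)
Lemma reversed_exists S : reversible S ->
  exists2 S', reversed S S' & conn N mu J S S'.
Proof.
move=> [Y L B]; have [R [ys rc]] := rects_exists Y pl.
have BR := B _ _ rc; have [R' [ys' ev]] := evac_exists p_gt0 hN wN BR.
have C := evac_connected p_gt0 hN wN BR ev.
have [S' rc' C'] := rects_conn_rev J0 Y pl rc C.
by exists S' => //; exists R, ys, R', ys'.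
Qed.

(** Rectification commutes with operators, evacuation exchanges f_j and
    e_(p+q-j). *)
Lemma reversed_raises S S1 S' S1' j : reversible S -> skewt N mu S' ->
  skewt N mu S1' -> J j -> raises N j S S1 -> reversed S S' -> reversed S1 S1' ->
  raises N (p + q - j) S1' S'.
Proof.
move=> [Y L B] Y' Y1' Jj Rs [R [ys [R' [ys' [rc ev rc']]]]].
move=> [R1 [zs1 [R1' [zs' [rc1 ev1 rc1']]]]].
have [Q1 rcQ RsR] := rects_raised (J0 Jj) Y Rs pl rc.
have [E1 E2] := rects_det rc1 rcQ; subst Q1 zs1.
have BR := B _ _ rc.
have Rs1 := evac_raises p_gt0 hN wN BR Jj RsR ev ev1.
have Jt := theta_J Jj; have j0 := J0 Jt.
have YR' := rects_skewt Y' pl rc'; have YR1' := rects_skewt Y1' pl rc1'.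
have [_ Eph _] := rects_weight Y1' pl rc1'.
have [S2 Rs2] : exists S2, raises N (p + q - j) S1' S2.
  apply/(raisesP _ Y1'); rewrite -Eph //; apply/(raisesP _ YR1'); by exists R'.
have [R2 rc2 Rs2'] := rects_raised j0 Y1' Rs2 pl rc1'.
have E2 := raises_fun j0 YR1' Rs1 Rs2'; subst R2.
have Y2 := raises_skewt j0 Y1' Rs2.
by rewrite (rects_inj Y' Y2 pl rc' rc2).
Qed.

Lemma reversed_lowest S S' : reversible S -> skewt N mu S' ->
  (forall j, J j -> ep N j S = 0) -> reversed S S' ->
  forall j, J j -> ph N j S' = 0.
Proof.
move=> [Y L B] Y' hi [R [ys [R' [ys' [rc ev rc']]]]] j Jj.
have BR := B _ _ rc; have [YR LR WR plR] := BR.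
have [_ E1 _] := rects_weight Y' pl rc'.
have [E2 _ _] := rects_weight Y pl rc.
have [_ E3 _] := rects_weight (rot_skewt p_gt0 hN wN YR LR) plR ev.
have Jt := theta_J Jj; have j0 := J0 Jj.
rewrite -E1 // E3 //.
have {1}-> : j = p + q - (p + q - j) by have := Jj; rewrite /interval; lia.
by rewrite (rot_ph p_gt0 hN wN WR LR Jt) E2 ?hi //; apply: J0.
Qed.

(** Connected lowest weight fillings have rectifications of the same shape
    that are lowest, hence equal; the vacated cells agree along a
    component, so the slides can be undone. *)
Lemma lowest_conn_uniq S S' : skewt N mu S -> letters p q S -> conn N mu J S S' ->
  (forall j, J j -> ph N j S = 0) -> (forall j, J j -> ph N j S' = 0) -> S = S'.
Proof.
move=> Y L C lo lo'; have [R [ys rc]] := rects_exists Y pl.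
have [R' rc' CR] := rects_conn J0 Y pl rc C.
have Y' := conn_skewt J0 C Y; have L' := conn_letters p_gt0 C L.
have YR := rects_skewt Y pl rc; have YR' := rects_skewt Y' pl rc'.
apply: (rects_inj Y Y' pl rc).
suff -> : R = R' by [].
have [_ E W] := rects_weight Y pl rc; have [_ E' W'] := rects_weight Y' pl rc'.
apply: (lowest_uniq p_gt0 YR YR').
- exact: (weight_letters p_gt0 YR W L).
- exact: (weight_letters p_gt0 YR' W' L').
- by move=> j Jj; rewrite E ?lo //; apply: J0.
- by move=> j Jj; rewrite E' ?lo' //; apply: J0.
- exact: (conn_support p_gt0 CR).
Qed.

End Reversal.

(** * Tableaux as fillings *)

Definition colh (T : tableau) (c : nat) : nat := count (fun r => c < size r) T.
Definition column (T : tableau) (c : nat) : seq nat :=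
  [seq entry T (r, c) | r <- iota 0 (colh T c)].
Definition width (T : tableau) : nat := size (head [::] T).

Lemma sorted_geq_all a s : sorted geq (a :: s) -> all (fun b => b <= a) s.
Proof.
rewrite /= path_sortedE; last by move=> x y z /= yx zy; apply: leq_trans yx.
by move=> /andP [H _]; apply: sub_all H => x.
Qed.

Lemma nth_geq_count s c r : sorted geq s ->
  (c < nth 0 s r) = (r < count (fun l => c < l) s).
Proof.
elim: s r => [|a s IH] r so; first by rewrite nth_nil.
have al := sorted_geq_all so; have {}IH := IH _ (path_sorted so).
have [ca|ca] := boolP (c < a).
  by case: r IH => [|r] IH /=; rewrite ca // IH.
rewrite /= (negPf ca) add0n; rewrite -leqNgt in ca.
have -> : count (fun l => c < l) s = 0.
  apply/eqP; rewrite -leqn0 leqNgt -has_count; apply/hasP => -[b bs].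
  by have := allP al b bs; lia.
case: r {IH} => [|r] /=; first by rewrite ltnNge ca.
apply/negbTE; rewrite -leqNgt; have [lt|ge] := ltnP r (size s).
  by apply: leq_trans ca; apply: (allP al); apply: mem_nth.
by rewrite nth_default.
Qed.

Lemma filter_iota_ltn k n : k <= n -> [seq r <- iota 0 n | r < k] = iota 0 k.
Proof.
move=> kn; have -> : n = k + (n - k) by lia.
rewrite iotaD filter_cat add0n.
rewrite (eq_in_filter (a2 := predT)) ?filter_predT; last first.
  by move=> r; rewrite mem_iota.
rewrite (eq_in_filter (a2 := pred0)) ?filter_pred0 ?cats0 // => r.
by rewrite mem_iota => /andP [kr _]; rewrite ltnNge kr.
Qed.

Section Shape.
Variable T : tableau.
Hypothesis pT : is_partition (shape T).

Lemma in_rowE r c : (c < size (nth [::] T r)) = (r < colh T c).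
Proof.
have [so _] := andP pT.
have -> : size (nth [::] T r) = nth 0 (shape T) r.
  have [lt|ge] := ltnP r (size T); first by rewrite (nth_map [::]).
  by rewrite !nth_default // size_map.
by rewrite nth_geq_count // count_map.
Qed.

Lemma nth_shape r : nth 0 (shape T) r = size (nth [::] T r).
Proof.
have [lt|ge] := ltnP r (size T); first by rewrite (nth_map [::]).
by rewrite !nth_default // size_map.
Qed.

Lemma colh_size c : colh T c <= size T.
Proof. exact: count_size. Qed.

Lemma colh_mono c c' : c <= c' -> colh T c' <= colh T c.
Proof. by move=> le; apply: sub_count => r /=; apply: leq_ltn_trans. Qed.

Lemma colh_width c : (0 < colh T c) = (c < width T).
Proof. by rewrite -in_rowE /width nth0. Qed.

Lemma entry_out r c : colh T c <= r -> entry T (r, c) = 0.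
Proof. by rewrite leqNgt -in_rowE -leqNgt => ge; rewrite /entry nth_default. Qed.

Lemma transposeE : transpose T = mkseq (column T) (width T).
Proof.
apply: eq_map => c; rewrite /column.
rewrite -{1}[T](mkseq_nth [::]) /mkseq filter_map -map_comp.
rewrite (eq_filter (a2 := fun r => r < colh T c)); last by move=> r /=; rewrite in_rowE.
by rewrite filter_iota_ltn // colh_size.
Qed.

Lemma size_column c : size (column T c) = colh T c.
Proof. by rewrite size_map size_iota. Qed.

Lemma nth_column c r : nth 0 (column T c) r = entry T (r, c).
Proof.
have [lt|ge] := ltnP r (colh T c); last first.
  by rewrite nth_default ?size_column // entry_out.
by rewrite (nth_map 0) ?size_iota // nth_iota.
Qed.

Lemma nth_transpose c : nth [::] (transpose T) c = column T c.
Proof.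
rewrite transposeE; have [lt|ge] := ltnP c (width T); first by rewrite nth_mkseq.
rewrite nth_default ?size_mkseq // /column.
have -> // : colh T c = 0.
by apply/eqP; rewrite -leqn0 leqNgt colh_width -leqNgt.
Qed.

Lemma reading_cellsE N : width T <= N -> reading_cells T =
  flatten [seq [seq (r, c) | r <- iota 0 (colh T c)] | c <- rev (iota 0 N)].
Proof.
move=> wN; rewrite /reading_cells -/(width T).
have E c : [seq (r, c) | r <- [seq r <- iota 0 (size T) | c < size (nth [::] T r)]]
    = [seq (r, c) | r <- iota 0 (colh T c)].
  rewrite (eq_filter (a2 := fun r => r < colh T c)) ?filter_iota_ltn ?colh_size //.
  by move=> r /=; rewrite in_rowE.
rewrite (eq_map E); have -> : N = width T + (N - width T) by lia.
rewrite iotaD rev_cat map_cat flatten_cat add0n.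
rewrite [X in X ++ _](_ : _ = [::]) //; apply/nilP; rewrite /nilp size_flatten.
rewrite /shape -map_comp sumnE big_map big_seq big1 // => c.
rewrite mem_rev mem_iota => /andP [wc _] /=; rewrite size_map size_iota.
by apply/eqP; rewrite -leqn0 leqNgt colh_width -leqNgt.
Qed.

Lemma rowsP (lt : rel nat) : transitive lt ->
  all (sorted lt) T <->
  (forall r c c', c < c' -> r < colh T c' -> lt (entry T (r, c)) (entry T (r, c'))).
Proof.
move=> tr; split=> [H1|H1].
  move=> r c c' cc'; rewrite -in_rowE => c'r.
  have rT : r < size T.
    by rewrite ltnNge; apply/negP => ge; rewrite nth_default in c'r.
  have := allP H1 _ (mem_nth [::] rT).
  rewrite (sorted_pairwise tr) => /(pairwiseP 0) H.
  by apply: H => //; rewrite inE //; apply: ltn_trans c'r.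
apply/allP => s /(nthP [::]) [r rT <-]; rewrite (sorted_pairwise tr).
apply/(pairwiseP 0) => c c' /= _; rewrite inE => c'r lt'.
by apply: H1 => //; rewrite -in_rowE.
Qed.

Lemma colsP : all (sorted ltn) (transpose T) <->
  (forall r r' c, r < r' -> r' < colh T c -> entry T (r, c) < entry T (r', c)).
Proof.
split=> [H2|H2].
  move=> r r' c lt rc.
  have cw : c < width T by rewrite -colh_width; apply: leq_ltn_trans rc.
  have := allP H2 (column T c); rewrite transposeE map_f ?mem_iota // => /(_ isT).
  rewrite (sorted_pairwise ltn_trans) => /(pairwiseP 0) H.
  rewrite -!nth_column; apply: H => //; rewrite inE size_column //.
  exact: ltn_trans rc.
rewrite transposeE; apply/allP => s /mapP [c _ ->]; rewrite (sorted_pairwise ltn_trans).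
apply/(pairwiseP 0) => r r' /= _; rewrite inE size_column => r'c lt.
by rewrite !nth_column; apply: H2.
Qed.

Lemma semistandardP : semistandard T <->
  (forall r c c', c < c' -> r < colh T c' -> entry T (r, c) <= entry T (r, c')) /\
  (forall r r' c, r < r' -> r' < colh T c -> entry T (r, c) < entry T (r', c)).
Proof.
rewrite /semistandard; split=> [/andP [/(rowsP leq_trans) ? /colsP ?] //|[H1 H2]].
by apply/andP; split; [apply/(rowsP leq_trans) | apply/colsP].
Qed.

End Shape.

Lemma eq_tableau T T' : shape T = shape T' -> entry T =1 entry T' -> T = T'.
Proof.
move=> Es E; have sz : size T = size T' by have := congr1 size Es; rewrite !size_map.
apply: (@eq_from_nth _ [::]) => // r rT.
have sr : size (nth [::] T r) = size (nth [::] T' r).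
  by rewrite -!(nth_map _ 0 size) -?sz // -/(shape T) Es.
by apply: (@eq_from_nth _ 0) => // c cr; apply: (E (r, c)).
Qed.

Lemma entry_set T x a : entry (set_entry T x a) = upd (entry T) x a.
Proof.
apply: functional_extensionality => y; rewrite updE /entry /set_entry.
rewrite nth_set_nth /=; case: x y => r c [r' c'] /=; rewrite xpair_eqE.
by case: (r' =P r) => [->|] //=; rewrite nth_set_nth.
Qed.

Lemma shape_set T r c a : c < size (nth [::] T r) ->
  shape (set_entry T (r, c) a) = shape T.
Proof.
move=> cr; have rT : r < size T.
  by rewrite ltnNge; apply/negP => ge; rewrite nth_default in cr.
have sz : size (set_entry T (r, c) a) = size T.
  by rewrite size_set_nth; apply/maxn_idPr.
apply: (@eq_from_nth _ 0); rewrite !size_map // => r' r'T.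
rewrite !(nth_map [::]) -?sz // nth_set_nth /=; case: (r' =P r) => [->|] //.
by rewrite size_set_nth; apply/maxn_idPr.
Qed.

(** The word l may be replaced by the single sign o in every count of
    uncancelled signs. *)
Definition acts_as (l : seq (option bool)) (o : option bool) : Prop :=
  (forall e, foldr push_left e l = push_left o e) /\
  (forall p, foldl (fun p o => push_right o p) p l = push_right o p).

Lemma acts_as_signA i L : sorted ltn L ->
  acts_as [seq signA i x | x <- L] (sign_of i (mem L)).
Proof.
elim: L => [|a L IH] so; first by split.
have al : all (ltn a) L by move: so; rewrite /= path_sortedE; [case/andP | exact: ltn_trans].
have {IH} [E1 E2] := IH (path_sorted so).
have notin b : b <= a -> (b \in L) = false.
  by move=> ba; apply/negP => /(allP al) /=; lia.
suff [H1 H2] : (forall e, push_left (signA i a) (push_left (sign_of i (mem L)) e) =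
     push_left (sign_of i (mem (a :: L))) e) /\
  (forall e, push_right (sign_of i (mem L)) (push_right (signA i a) e) =
     push_right (sign_of i (mem (a :: L))) e).
  by split=> e /=; rewrite ?E1 ?E2.
rewrite /sign_of /signA !inE ![_ == a]eq_sym.
case: (a =P i) => [Ea|ne] /=.
  rewrite -Ea notin // eqnS /=.
  by case: (a.+1 \in L).
case: (a =P i.+1) => [Ea|ne'] /=; first by rewrite -Ea !notin //; lia.
by split.
Qed.

Lemma eps_flatten (ws : nat -> seq (option bool)) g k :
  (forall s, s < k -> acts_as (ws s) (g s)) ->
  eps (flatten [seq ws s | s <- rev (iota 0 k)]) = eps_below g k.
Proof.
elim: k => [|k IH] H //; have -> : iota 0 k.+1 = iota 0 k ++ [:: k].
  by rewrite -addn1 iotaD.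
rewrite rev_cat /= -IH; last by move=> s sk; apply: H; apply: ltnW.
by rewrite /eps foldr_cat; have [-> _] := H k (ltnSn k).
Qed.

Lemma phi_flatten (ws : nat -> seq (option bool)) g c d :
  (forall s, c <= s < c + d -> acts_as (ws s) (g s)) ->
  phi (flatten [seq ws s | s <- rev (iota c d)]) = phi_from g c d.
Proof.
elim: d c => [|d IH] c H //=.
rewrite rev_cons map_rcons flatten_rcons /phi foldl_cat.
have [_ ->] := H c ltac:(lia); congr push_right.
by apply: IH => s Hs; apply: H; lia.
Qed.

Lemma signs_cat sg S u v : signs sg S (u ++ v) = signs sg S u ++ signs sg S v.
Proof. exact: map_cat. Qed.

Lemma signs_column sg T c k : 
  signs sg (entry T) [seq (r, c) | r <- iota 0 k] =
  [seq sg x | x <- [seq entry T (r, c) | r <- iota 0 k]].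
Proof. by rewrite /signs -!map_comp. Qed.

Lemma signs_columns sg T s :
  signs sg (entry T) (flatten [seq [seq (r, c) | r <- iota 0 (colh T c)] | c <- s]) =
  flatten [seq [seq sg x | x <- column T c] | c <- s].
Proof.
rewrite /signs map_flatten -map_comp; congr flatten; apply: eq_map => c /=.
by rewrite -!map_comp.
Qed.

Section Bridge.
Variables (N : nat) (T : tableau).
Hypothesis pT : is_partition (shape T).
Hypothesis wN : width T <= N.

(** The cells read before a cell are those of the columns at its right and
    those above it in its column, so the reading word is cut at any cell. *)
Lemma balanced_column sg r c : r < colh T c ->
  phi (flatten [seq [seq sg x | x <- column T c'] | c' <- rev (iota c.+1 (N - c.+1))]
       ++ [seq sg x | x <- take r (column T c)]) = 0 ->
  eps ([seq sg x | x <- drop r.+1 (column T c)] ++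
       flatten [seq [seq sg x | x <- column T c'] | c' <- rev (iota 0 c)]) = 0 ->
  balanced_at sg (entry T) (reading_cells T) (r, c).
Proof.
move=> rc p0 e0; have cw : c < width T by rewrite -colh_width //; apply: leq_ltn_trans rc.
pose cc c' := [seq (r, c') | r <- iota 0 (colh T c')].
exists (flatten [seq cc c' | c' <- rev (iota c.+1 (N - c.+1))] ++ take r (cc c)).
exists (drop r.+1 (cc c) ++ flatten [seq cc c' | c' <- rev (iota 0 c)]).
have sz : size (cc c) = colh T c by rewrite size_map size_iota.
split.
- rewrite (reading_cellsE pT wN) -/cc.
  have -> : iota 0 N = iota 0 c ++ c :: iota c.+1 (N - c.+1).
    by rewrite -[_ :: _]/(iota c (N - c.+1).+1) -iotaD; congr iota; lia.
  rewrite rev_cat rev_cons map_cat map_rcons flatten_cat flatten_rcons -!catA.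
  congr (_ ++ _); rewrite -cat_cons catA; congr (_ ++ _).
  rewrite -{1}[cc c](cat_take_drop r); congr (_ ++ _).
  rewrite (drop_nth (0, 0)) ?sz // (nth_map 0) ?size_iota //.
  by rewrite nth_iota.
- by rewrite signs_cat signs_columns /signs map_take -/(signs _ _ _) signs_column -map_take.
- by rewrite signs_cat signs_columns /signs map_drop -/(signs _ _ _) signs_column -map_drop.
Qed.

Lemma signs_reading sg :
  signs sg (entry T) (reading_cells T) =
  flatten [seq [seq sg x | x <- column T c'] | c' <- rev (iota 0 N)].
Proof. by rewrite (reading_cellsE pT wN) signs_columns. Qed.

End Bridge.

(** Bounds that make a tableau of shape mu a filling of the square of size
    N. *)
Definition fits N (mu : seq nat) := size mu <= N /\ nth 0 mu 0 <= N.

Section SSYT.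
Variables (N m : nat) (mu : seq nat).
Hypothesis pmu : is_partition mu.
Hypothesis fN : fits N mu.

Section Tableau.
Variable T : tableau.
Hypothesis sT : ssyt mu m T.

Lemma ssyt_shape : shape T = mu.
Proof. by have /and3P [/eqP] := sT. Qed.

Lemma ssyt_part : is_partition (shape T).
Proof. by rewrite ssyt_shape. Qed.

Lemma ssyt_width : width T <= N.
Proof.
rewrite /width -nth0 -(nth_shape T 0) ssyt_shape.
by have [] := fN.
Qed.

Lemma ssyt_range r c : r < colh T c -> 1 <= entry T (r, c) <= m.
Proof.
rewrite -in_rowE ?ssyt_part // => cr.
have rT : r < size T by rewrite ltnNge; apply/negP => ge; rewrite nth_default in cr.
have /and3P [_ /allP H _] := sT; apply: H.
by apply/flattenP; exists (nth [::] T r); apply: mem_nth.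
Qed.

Lemma ssyt_neq0 r c : (entry T (r, c) != 0) = (r < colh T c).
Proof.
case: ltnP => [/ssyt_range|ge]; first by case: (entry _ _).
by rewrite entry_out ?ssyt_part.
Qed.

Lemma ssyt_box r c : r < colh T c -> r < N /\ c < N.
Proof.
move=> rc; split.
  apply: (leq_trans rc); apply: (leq_trans (colh_size _ _)).
  by rewrite -(size_map size) -/(shape T) ssyt_shape; case: fN.
apply: leq_trans ssyt_width; rewrite -colh_width ?ssyt_part //.
exact: leq_ltn_trans rc.
Qed.

Lemma ssyt_skewt : skewt N pred0 (entry T).
Proof.
have /and3P [_ _ ss] := sT; have [Hr Hc] := (semistandardP ssyt_part).1 ss.
split=> //.
- move=> r c r' c' rr cc; rewrite /= !orbF !ssyt_neq0 => lt.
  exact: (leq_ltn_trans rr (leq_trans lt (colh_mono T cc))).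
- by move=> r c c' lt; rewrite !ssyt_neq0 => _ rc'; apply: Hr.
- by move=> r r' c lt; rewrite !ssyt_neq0 => _ rc'; apply: Hc.
- by move=> r c; rewrite ssyt_neq0; apply: ssyt_box.
Qed.

Lemma column_sorted c : sorted ltn (column T c).
Proof.
have /and3P [_ _ ss] := sT; have [Hr Hc] := (semistandardP ssyt_part).1 ss.
rewrite (sorted_pairwise ltn_trans); apply/(pairwiseP 0) => r r' /= _.
rewrite inE size_column => rc lt; rewrite !nth_column ?ssyt_part //; exact: Hc.
Qed.

Lemma occurs_column c a : 0 < a -> occurs N (entry T) c a = (a \in column T c).
Proof.
move=> a0; apply/occursP/idP => [[r rN E]|/mapP [r]].
  apply/mapP; exists r => //; rewrite mem_iota /= add0n.
  by rewrite -ssyt_neq0 E -lt0n.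
by rewrite mem_iota add0n => /= rc ->; exists r => //; have [] := ssyt_box rc.
Qed.

Lemma column_acts i c : 0 < i ->
  acts_as [seq signA i x | x <- column T c] (col_sign N i (entry T) c).
Proof.
move=> i0; have := acts_as_signA i (column_sorted c).
by rewrite /col_sign /sign_of !occurs_column.
Qed.

(** A column that acts for the sequence of column signs contains exactly
    one letter with sign b, and its other letters have no sign. *)
Lemma acts_balanced i r c b : 0 < i ->
  acts_at N (col_sign N i (entry T)) b c ->
  entry T (r, c) = (if b then i else i.+1) ->
  balanced_at (signA i) (entry T) (reading_cells T) (r, c) /\
  signA i (entry T (r, c)) = Some b.
Proof.
move=> i0 [cN gc p0 e0] E; split; last first.
  by rewrite E /signA; case: b {gc E} => /=; rewrite ?eqSn eqxx.
have nz : entry T (r, c) != 0 by rewrite E; case: b {gc E} => //; rewrite -lt0n.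
have rc : r < colh T c by rewrite -ssyt_neq0.
have Y := ssyt_skewt.
have so := column_sorted c.
have Etd : column T c = take r (column T c) ++ entry T (r, c) :: drop r.+1 (column T c).
  rewrite -{1}[column T c](cat_take_drop r); congr (_ ++ _).
  by rewrite (drop_nth 0) ?size_column // nth_column ?ssyt_part.
have : pairwise ltn (column T c) by rewrite -(sorted_pairwise ltn_trans).
rewrite Etd pairwise_cat /= => /and3P [/allrelP Hlt _ /andP [/allP Hgt _]].
have lt_take a : a \in take r (column T c) -> a < entry T (r, c).
  by move=> ta; apply: Hlt; rewrite ?mem_head.
have gt_drop a : a \in drop r.+1 (column T c) -> entry T (r, c) < a.
  by move=> /Hgt.
have so_t : sorted ltn (take r (column T c)) := take_sorted r so.
have so_d : sorted ltn (drop r.+1 (column T c)) := drop_sorted r.+1 so.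
have memE a : a \in column T c = [|| a \in take r (column T c),
    a == entry T (r, c) | a \in drop r.+1 (column T c)].
  by rewrite {1}Etd mem_cat inE.
have gcE : sign_of i (mem (column T c)) = Some b.
  by move: gc; rewrite /col_sign /sign_of !occurs_column.
have none_t : sign_of i (mem (take r (column T c))) = None.
  apply: sign_of_None => /=; transitivity false; [|apply/esym]; apply/negbTE/negP => mt.
    have := lt_take _ mt; rewrite E; case: b {gc} E gcE => E gcE; first by rewrite ltnn.
    have [_ /negP[]] : sign_of i (mem (column T c)) = Some false /\ ~~ (i \in column T c).
      by split=> //; apply/negP; have [_ /= ->] := sign_of_minus gcE.
    by rewrite memE mt.
  by have := lt_take _ mt; rewrite E; case: b {gc E gcE}; lia.
have none_d : sign_of i (mem (drop r.+1 (column T c))) = None.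
  apply: sign_of_None => /=; transitivity false; [|apply/esym]; apply/negbTE/negP => md.
    by have := gt_drop _ md; rewrite E; case: b {gc E gcE}; lia.
  have := gt_drop _ md; rewrite E; case: b {gc} E gcE => E gcE; last by rewrite ltnn.
  have [_ /=] := sign_of_plus gcE; by rewrite memE md !orbT.
apply: (balanced_column ssyt_part ssyt_width rc).
  rewrite phi_cat; have [At1 At2] := acts_as_signA i so_t.
  rewrite (phi_flatten (g := col_sign N i (entry T))); last by move=> s _; apply: column_acts.
  by rewrite p0 sub0n addn0 /phi At2 none_t.
rewrite eps_cat; have [Ad1 Ad2] := acts_as_signA i so_d.
rewrite (eps_flatten (g := col_sign N i (entry T))); last by move=> s _; apply: column_acts.
by rewrite e0 sub0n addn0 /eps Ad1 none_d.
Qed.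

Lemma ssyt_phi i : 0 < i ->
  phi (signs (signA i) (entry T) (reading_cells T)) = ph N i (entry T).
Proof.
move=> i0; rewrite (signs_reading ssyt_part ssyt_width).
by apply: phi_flatten => s _; apply: column_acts.
Qed.

Lemma ssyt_eps i : 0 < i ->
  eps (signs (signA i) (entry T) (reading_cells T)) = ep N i (entry T).
Proof.
move=> i0; rewrite (signs_reading ssyt_part ssyt_width).
by apply: eps_flatten => s _; apply: column_acts.
Qed.

End Tableau.

Lemma skewt_ssyt T : shape T = mu -> skewt N pred0 (entry T) ->
  (forall r c, r < colh T c -> 1 <= entry T (r, c) <= m) -> ssyt mu m T.
Proof.
move=> Es Y L; have pT : is_partition (shape T) by rewrite Es.
apply/and3P; split; first by apply/eqP.
  apply/allP => a /flattenP [s /(nthP [::]) [r rT <-]] /(nthP 0) [c cr <-].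
  by apply: L; rewrite -in_rowE.
have nz r c : r < colh T c -> entry T (r, c) != 0 by move=> /L; case: (entry _ _).
apply/(semistandardP pT); split=> [r c c' lt rc|r r' c lt rc].
  apply: (young_row Y lt); last exact: nz.
  by apply: nz; apply: (leq_trans rc (colh_mono _ (ltnW lt))).
by apply: (young_col Y lt); apply: nz => //; apply: ltn_trans rc.
Qed.

Lemma ssyt_set T r c a : ssyt mu m T -> r < colh T c -> 1 <= a <= m ->
  skewt N pred0 (upd (entry T) (r, c) a) -> ssyt mu m (set_entry T (r, c) a).
Proof.
move=> sT rc am Y; have pT := ssyt_part sT.
have cr : c < size (nth [::] T r) by rewrite in_rowE.
have Es := shape_set a cr.
have hE d : colh (set_entry T (r, c) a) d = colh T d.
  by rewrite /colh -!(count_map size (fun l => d < l)) -!/(shape _) Es.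
apply: skewt_ssyt; rewrite ?entry_set //; first by rewrite Es (ssyt_shape sT).
move=> r' c'; rewrite hE updE; case: eqP => // _; exact: ssyt_range.
Qed.

(** The two rules choose balanced cells with the same sign, so they agree
    by [balanced_uniq]. *)
Lemma leftmost_plus_raises T i : ssyt mu m T -> 0 < i ->
  match leftmost_plus (signA i) T with
  | Some x => raises N i (entry T) (upd (entry T) x i.+1) /\ entry T x = i
  | None => forall S', ~ raises N i (entry T) S'
  end.
Proof.
move=> sT i0; have := leftmost_plusP (signA i) T; have Y := ssyt_skewt sT.
case: (leftmost_plus _ _) => [x [sx B]|p0 S' Rs]; last first.
  have : 0 < ph N i (entry T) by apply/(raisesP i Y); exists S'.
  by rewrite -(ssyt_phi sT i0) p0.
have : 0 < ph N i (entry T).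
  have [u [v [E pu ev]]] := B; rewrite -(ssyt_phi sT i0) E.
  by rewrite signs_cat phi_cat /= phi_cons eps_cons -/(signs _ _ v) sx pu ev /=; lia.
move=> /(raisesP i Y) [S' [r [c [rN E A _]]]].
have [B' s'] := acts_balanced sT i0 A E.
have <- := balanced_uniq s' sx B' B; split=> //.
by exists r, c.
Qed.

Lemma rightmost_minus_lowers T i : ssyt mu m T -> 0 < i ->
  match rightmost_minus (signA i) T with
  | Some x => lowers_at N i (entry T) x
  | None => forall x, ~ lowers_at N i (entry T) x
  end.
Proof.
move=> sT i0; have := rightmost_minusP (signA i) T; have Y := ssyt_skewt sT.
case: (rightmost_minus _ _) => [x [sx B]|e0 x [Ex A]]; last first.
  have : 0 < ep N i (entry T) by apply/acts_minusP; exists x.2.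
  by rewrite -(ssyt_eps sT i0) e0.
have : 0 < ep N i (entry T).
  have [u [v [E pu ev]]] := B; rewrite -(ssyt_eps sT i0) E.
  by rewrite signs_cat eps_cat /= eps_cons -/(signs _ _ v) sx pu ev /=; lia.
move=> /acts_minusP [c A]; have [cN gc _ _] := A.
have [/occursP [r rN E] _] := sign_of_minus gc.
have [B' s'] := acts_balanced sT i0 A E.
by have <- := balanced_uniq s' sx B' B.
Qed.

Lemma fA_raises T T' i : ssyt mu m T -> 0 < i < m -> fA i T = Some T' ->
  ssyt mu m T' /\ raises N i (entry T) (entry T').
Proof.
move=> sT /andP [i0 im]; rewrite /fA /act.
have := leftmost_plus_raises sT i0.
case: (leftmost_plus _ _) => [[r c] [Rs E]|//] [<-]; rewrite E entry_set.
split=> //; apply: ssyt_set => //; last exact: (raises_skewt i0 (ssyt_skewt sT) Rs).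
by rewrite -(ssyt_neq0 sT) E -lt0n.
Qed.

Lemma raises_fA T S' i : ssyt mu m T -> 0 < i -> raises N i (entry T) S' ->
  exists2 T', fA i T = Some T' & entry T' = S'.
Proof.
move=> sT i0 Rs; have := leftmost_plus_raises sT i0; rewrite /fA /act.
case: (leftmost_plus _ _) => [x [Rs' E]|/(_ S')//].
exists (set_entry T x (entry T x).+1) => //.
by rewrite entry_set E; apply: (raises_fun i0 (ssyt_skewt sT) Rs' Rs).
Qed.

Lemma eA_raises T T' i : ssyt mu m T -> 0 < i -> eA i T = Some T' ->
  ssyt mu m T' /\ raises N i (entry T') (entry T).
Proof.
move=> sT i0; rewrite /eA /act; have := rightmost_minus_lowers sT i0.
case: (rightmost_minus _ _) => [[r c] L|//] [<-]; have [E A] := L.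
have Y := ssyt_skewt sT.
rewrite E entry_set /=; split; last exact: (lowers_raises i0 Y L).
have rc : r < colh T c by rewrite -(ssyt_neq0 sT) E.
apply: ssyt_set => //; last exact: (skewt_lower i0 Y L).
by have := ssyt_range sT rc; rewrite E; lia.
Qed.

Lemma raises_eA T S' i : ssyt mu m T -> 0 < i -> skewt N pred0 S' ->
  raises N i S' (entry T) -> exists2 T', eA i T = Some T' & entry T' = S'.
Proof.
move=> sT i0 Y' Rs; have := rightmost_minus_lowers sT i0; rewrite /eA /act.
have [p L ->] := raises_lowers i0 Y' Rs.
case: (rightmost_minus _ _) => [x L'|/(_ p)//].
have Y := ssyt_skewt sT.
exists (set_entry T x (entry T x).-1) => //.
rewrite entry_set; have [-> _] := L' => /=.
apply: (raises_inj i0 _ _ (lowers_raises i0 Y L') (lowers_raises i0 Y L)).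
  exact: (skewt_lower i0 Y L').
exact: (skewt_lower i0 Y L).
Qed.

End SSYT.

(** * Slides of arrays *)

(** Empty cells are 0 in fillings and [None] in arrays. *)
Definition opt (a : nat) : option nat := if a == 0 then None else Some a.

Definition represents (Sf : skew) (F : filling) : Prop :=
  forall x, sget Sf x = opt (F x).
(** During a slide the array still has an outdated letter in the hole. *)
Definition represents_off (h : cell) (Sf : skew) (F : filling) : Prop :=
  forall x, x <> h -> sget Sf x = opt (F x).

Lemma sget_sset S x o y : sget (sset S x o) y = if y == x then o else sget S y.
Proof.
rewrite /sget /sset nth_set_nth /=; case: x y => r c [r' c'] /=.
rewrite xpair_eqE; case: (r' =P r) => [->|] //=.
by rewrite nth_set_nth.
Qed.

Lemma opt_neq0 a : a != 0 -> opt a = Some a.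
Proof. by rewrite /opt => /negPf ->. Qed.

Lemma represents_sset Sf F h : represents_off h Sf F -> F h = 0 ->
  represents (sset Sf h None) F.
Proof.
move=> H h0 x; rewrite sget_sset; case: eqP => [->|ne]; first by rewrite h0.
exact: H.
Qed.

Lemma represents_shift Sf F h d : represents_off h Sf F -> d <> h -> F d != 0 ->
  represents_off d (sset Sf h (Some (F d))) (shift F h d).
Proof.
move=> H dh d0 x xd; rewrite sget_sset shiftE; move/eqP/negPf: (xd) => ->.
by case: eqP => [_|ne]; [rewrite opt_neq0 | apply: H].
Qed.

Lemma slides_sum S h R y : slides S h R y -> h.1 + h.2 <= y.1 + y.2.
Proof. by elim=> // {S h R y} S h R y _ _ _ /=; lia. Qed.

Lemma slide_rec_slides F h R y Sf fuel : slides F h R y ->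
  represents_off h Sf F -> F h = 0 -> y.1 + y.2 <= fuel + (h.1 + h.2) ->
  exists2 Rf, slide_rec fuel Sf h = (Rf, y) & represents Rf R.
Proof.
move=> sl; elim: sl Sf fuel => {F h R y} [F h a0 b0|F h R y a0 ab sl IH|F h R y b0 ab sl IH] Sf fuel H h0 lef.
- exists (sset Sf h None); last exact: represents_sset.
  case: fuel {lef} => // fuel /=.
  rewrite -[(h.1.+1, h.2)]/(below h) -[(h.1, h.2.+1)]/(right h).
  by rewrite !H ?a0 ?b0 //; [apply: neq_right | apply: neq_below].
- have := slides_sum sl; case: fuel lef => [|fuel] lef /= ls; first by lia.
  rewrite -[(h.1.+1, h.2)]/(below h) -[(h.1, h.2.+1)]/(right h).
  have nb := @neq_below h; have nr := @neq_right h.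
  have [|||Rf E rp] := IH (sset Sf h (Some (F (below h)))) fuel.
  + exact: represents_shift.
  + by rewrite shiftE eqxx.
  + by move: lef; rewrite /below /=; lia.
  exists Rf => //; rewrite !H // (opt_neq0 a0) /opt.
  by case: eqP ab => [//|ne] [//|->].
- have := slides_sum sl; case: fuel lef => [|fuel] lef /= ls; first by lia.
  rewrite -[(h.1.+1, h.2)]/(below h) -[(h.1, h.2.+1)]/(right h).
  have nb := @neq_below h; have nr := @neq_right h.
  have [|||Rf E rp] := IH (sset Sf h (Some (F (right h)))) fuel.
  + exact: represents_shift.
  + by rewrite shiftE eqxx.
  + by move: lef; rewrite /right /=; lia.
  exists Rf => //; rewrite !H // (opt_neq0 b0) /opt.
  by case: eqP ab => [//|ne] [//|lt]; rewrite leqNgt lt.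
Qed.

Lemma count_lt (T : eqType) (a b : pred T) (P : seq T) d :
  (forall z, a z -> b z) -> d \in P -> b d -> ~~ a d -> count a P < count b P.
Proof.
move=> ab; elim: P => // z P IH; rewrite inE => /orP [/eqP <-|dP] bd ad /=.
  by rewrite bd (negPf ad) add0n add1n ltnS; apply: sub_count.
have := IH dP bd ad; have := ab z; case: (a z); case: (b z) => //=; lia.
Qed.

(** Each step of the hole passes a filled position, so the number of
    positions of the array is enough fuel. *)
Lemma slides_length F h R y (P : seq cell) : slides F h R y ->
  (forall z, h.1 <= z.1 -> h.2 <= z.2 -> F z != 0 -> z \in P) ->
  y.1 + y.2 <= count (fun z => [&& h.1 <= z.1, h.2 <= z.2 & F z != 0]) P + (h.1 + h.2).
Proof.
have step F' h' d : (d = below h' \/ d = right h') -> F' d != 0 ->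
    (forall z, h'.1 <= z.1 -> h'.2 <= z.2 -> F' z != 0 -> z \in P) ->
    (forall z, d.1 <= z.1 -> d.2 <= z.2 -> shift F' h' d z != 0 -> z \in P) /\
    count (fun z => [&& d.1 <= z.1, d.2 <= z.2 & shift F' h' d z != 0]) P <
    count (fun z => [&& h'.1 <= z.1, h'.2 <= z.2 & F' z != 0]) P.
  move=> Ed nz H.
  have sub z : [&& d.1 <= z.1, d.2 <= z.2 & shift F' h' d z != 0] ->
      [&& h'.1 <= z.1, h'.2 <= z.2 & F' z != 0].
    rewrite shiftE; case: (z =P d) => [->|_]; first by rewrite !andbF.
    case: (z =P h') => [->|_]; last by case: Ed => -> /=; lia.
    by case: Ed => -> /=; lia.
  split; first by move=> z z1 z2 n; have /and3P [? ? ?] := sub z (introT and3P (And3 z1 z2 n)); apply: H.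
  apply: (count_lt (d := d) sub).
  - by apply: H => //; case: Ed => -> /=; lia.
  - by rewrite nz; case: Ed => -> /=; lia.
  - by rewrite shiftE !eqxx !andbF.
move=> sl; elim: sl => {F h R y} [F h a0 b0|F h R y a0 ab sl IH|F h R y b0 ab sl IH] H.
- exact: leq_addl.
- have [H' lt] := step F h (below h) (or_introl erefl) a0 H.
  by apply: leq_trans (IH H') _; move: lt; rewrite /below /=; lia.
- have [H' lt] := step F h (right h) (or_intror erefl) b0 H.
  by apply: leq_trans (IH H') _; move: lt; rewrite /right /=; lia.
Qed.

Definition positions (Sf : skew) : seq cell :=
  flatten [seq [seq (r, c) | c <- iota 0 (size (nth [::] Sf r))] | r <- iota 0 (size Sf)].

Lemma size_positions Sf : size (positions Sf) = size (flatten Sf).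
Proof.
rewrite !size_flatten /shape -map_comp; congr sumn.
rewrite -[in RHS](mkseq_nth [::] Sf) -[in RHS]map_comp; apply: eq_map => r /=.
by rewrite size_map size_iota.
Qed.

Lemma mem_positions Sf x : sget Sf x != None -> x \in positions Sf.
Proof.
case: x => r c; rewrite /sget /= => nz.
have cr : c < size (nth [::] Sf r).
  by rewrite ltnNge; apply/negP => ge; rewrite nth_default in nz.
have rS : r < size Sf by rewrite ltnNge; apply/negP => ge; rewrite nth_default in cr.
apply/flattenP; exists [seq (r, c) | c <- iota 0 (size (nth [::] Sf r))].
  by apply/mapP; exists r => //; rewrite mem_iota.
by apply/mapP; exists c => //; rewrite mem_iota.
Qed.

Lemma slide_slides F h R y Sf : slides F h R y -> represents Sf F -> F h = 0 ->
  exists2 Rf, slide Sf h = (Rf, y) & represents Rf R.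
Proof.
move=> sl rp h0; apply: (slide_rec_slides sl) => //.
have H : forall z, h.1 <= z.1 -> h.2 <= z.2 -> F z != 0 -> z \in positions Sf.
  by move=> z _ _ nz; apply: mem_positions; rewrite rp opt_neq0.
have le := count_size (fun z => [&& h.1 <= z.1, h.2 <= z.2 & F z != 0]) (positions Sf).
by have := slides_length sl H; rewrite size_positions in le; lia.
Qed.

Lemma sget_up Sf F h : represents_off h Sf F ->
  (if 0 < h.1 then sget Sf (h.1.-1, h.2) else None) = opt (up_val F h).
Proof.
rewrite /up_val => H; case: ifP => // h1; apply: H.
by case: h h1 => a b /= a0 [] E; move: a0; rewrite -E; lia.
Qed.

Lemma sget_left Sf F h : represents_off h Sf F ->
  (if 0 < h.2 then sget Sf (h.1, h.2.-1) else None) = opt (left_val F h).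
Proof.
rewrite /left_val => H; case: ifP => // h1; apply: H.
by case: h h1 => a b /= a0 [] E; move: a0; rewrite -E; lia.
Qed.

Lemma unslide_rec_unslides F h R x Sf fuel : unslides F h R x ->
  represents_off h Sf F -> F h = 0 -> h.1 + h.2 < fuel ->
  represents (unslide_rec fuel Sf h) R.
Proof.
move=> us; elim: us Sf fuel => {F h R x} [F h a0 b0|F h R x a0 ab us IH|F h R x b0 ab us IH] Sf [//|fuel] H h0 lef /=; rewrite (sget_up H) (sget_left H).
- by rewrite a0 b0 /=; apply: represents_sset.
- have h1 : 0 < h.1 by move: a0; rewrite /up_val; case: ifP.
  have nd : (h.1.-1, h.2) <> h by case: h h1 {IH us H h0 lef a0 ab} => a b /= a0 []; lia.
  have Ev : F (h.1.-1, h.2) = up_val F h by rewrite /up_val h1.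
  have rp : represents (unslide_rec fuel (sset Sf h (Some (up_val F h))) (h.1.-1, h.2)) R.
    apply: IH; rewrite ?shiftE ?eqxx // -?Ev.
      by apply: represents_shift; rewrite // Ev.
    by move: lef h1 => /=; lia.
  rewrite (opt_neq0 a0) /opt; case: eqP ab => [//|ne] [//|->//].
- have h1 : 0 < h.2 by move: b0; rewrite /left_val; case: ifP.
  have nd : (h.1, h.2.-1) <> h by case: h h1 {IH us H h0 lef b0 ab} => a b /= a0 []; lia.
  have Ev : F (h.1, h.2.-1) = left_val F h by rewrite /left_val h1.
  have rp : represents (unslide_rec fuel (sset Sf h (Some (left_val F h))) (h.1, h.2.-1)) R.
    apply: IH; rewrite ?shiftE ?eqxx // -?Ev.
      by apply: represents_shift; rewrite // Ev.
    by move: lef h1 => /=; lia.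
  by rewrite (opt_neq0 b0) /opt; case: eqP ab => [//|ne] [//|lt]; rewrite leqNgt lt.
Qed.

Lemma unslide_unslides F h R x Sf : unslides F h R x ->
  represents Sf F -> F h = 0 -> represents (unslide Sf h) R.
Proof.
by move=> us rp h0; apply: (unslide_rec_unslides us) => // y _; apply: rp.
Qed.

Definition slide_step (st : skew * seq cell) (x : cell) :=
  let: (S', y) := slide st.1 x in (S', y :: st.2).

Lemma rectify_rects N mu xs F R ys Sf acc : skewt N mu F -> peels mu xs ->
  rects xs F R ys -> represents Sf F ->
  exists2 Rf, foldl slide_step (Sf, acc) xs = (Rf, rev ys ++ acc) & represents Rf R.
Proof.
move=> + + rc; elim: rc mu Sf acc => {xs F R ys} [F|x xs F F' R y ys sl rc IH] mu Sf acc Y /=.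
  by move=> _ rp; exists Sf.
move=> [mx dc pl] rp.
have [Sf' E rp'] := slide_slides sl rp (young_disj Y mx).
rewrite /slide_step /= E.
have [Rf ER rpR] := IH _ Sf' (y :: acc) (skewt_slides Y mx dc sl) pl rp'.
by exists Rf => //; rewrite ER rev_cons cat_rcons.
Qed.

Lemma unslides_rects N mu xs F R ys Rf : skewt N mu F -> peels mu xs ->
  rects xs F R ys -> represents Rf R ->
  represents (foldl unslide Rf (rev ys)) F.
Proof.
move=> + + rc; elim: rc mu Rf => {xs F R ys} [F|x xs F F' R y ys sl rc IH] mu Rf Y //=.
move=> [mx dc pl] rp; rewrite rev_cons foldl_rcons.
have rp' := IH _ _ (skewt_slides Y mx dc sl) pl rp.
apply: (unslide_unslides (unslides_corner Y mx dc sl) rp').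
by have [[]] := slides_holed sl (skewt_holed Y mx dc).
Qed.

(** * Standard fillings *)

Lemma flatten_entry (Q : tableau) r c : c < size (nth [::] Q r) ->
  nth 0 (flatten Q) (flatten_index (shape Q) r c) = entry Q (r, c).
Proof.
move=> cr; have cr' : c < nth 0 (shape Q) r.
  by rewrite nth_shape.
by rewrite nth_flatten flatten_indexKl // flatten_indexKr.
Qed.

Section Standard.
Variables (nu : seq nat) (Q : tableau).
Hypothesis pnu : is_partition nu.
Hypothesis sQ : standard_filling nu Q.

Let shQ : shape Q = nu. Proof. by have /and4P [/eqP] := sQ. Qed.
Let pQ : is_partition (shape Q). Proof. by rewrite shQ. Qed.
Let perQ : perm_eq (flatten Q) (iota 1 (sumn nu)).
Proof. by have /and4P [] := sQ. Qed.

Lemma standard_row r c c' : c < c' -> r < colh Q c' -> entry Q (r, c) < entry Q (r, c').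
Proof. by have /and4P [_ _ H _] := sQ; apply: (rowsP pQ ltn_trans).1 H r c c'. Qed.

Lemma standard_col r r' c : r < r' -> r' < colh Q c -> entry Q (r, c) < entry Q (r', c).
Proof. by have /and4P [_ _ _ H] := sQ; apply: (colsP pQ).1 H r r' c. Qed.

Lemma standard_mono r c r' c' : r' <= r -> c' <= c -> r < colh Q c ->
  entry Q (r', c') <= entry Q (r, c).
Proof.
move=> rr cc rc; have rc' : r < colh Q c' := leq_trans rc (colh_mono Q cc).
apply: (@leq_trans (entry Q (r, c'))).
  move: rr; rewrite leq_eqVlt => /orP [/eqP -> //|lt].
  exact/ltnW/standard_col.
move: cc; rewrite leq_eqVlt => /orP [/eqP -> //|lt].
exact/ltnW/standard_row.
Qed.

Lemma standard_mem r c : r < colh Q c -> 0 < entry Q (r, c) <= sumn nu.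
Proof.
rewrite -(in_rowE pQ) => cr.
have : entry Q (r, c) \in flatten Q.
  apply/flattenP; exists (nth [::] Q r); last exact: mem_nth.
  by apply: mem_nth; rewrite ltnNge; apply/negP => ge; rewrite nth_default in cr.
by rewrite (perm_mem perQ) mem_iota add1n ltnS.
Qed.

Lemma standard_inj r c r' c' : r < colh Q c -> r' < colh Q c' ->
  entry Q (r, c) = entry Q (r', c') -> (r, c) = (r', c').
Proof.
rewrite -!(in_rowE pQ) => cr cr'; rewrite -!flatten_entry // => /eqP.
have lt a b : b < size (nth [::] Q a) -> b < nth 0 (shape Q) a by rewrite nth_shape.
rewrite nth_uniq ?(perm_uniq perQ) ?iota_uniq ?size_flatten ?flatten_indexP ?lt //.
move=> /eqP E; congr pair.
  by rewrite -(flatten_indexKl (lt _ _ cr)) E flatten_indexKl ?lt.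
by rewrite -(flatten_indexKr (lt _ _ cr)) E flatten_indexKr ?lt.
Qed.

Lemma cell_ofP a : 0 < a <= sumn nu ->
  let x := cell_of Q a in x.1 < colh Q x.2 /\ entry Q x = a.
Proof.
move=> aM; have : a \in flatten Q by rewrite (perm_mem perQ) mem_iota add1n ltnS.
move=> /flattenP [s sQs as_].
have hs : has (fun row => a \in row) Q by apply/hasP; exists s.
rewrite /cell_of /= -(in_rowE pQ) index_mem (nth_find [::] hs).
by rewrite /entry /= nth_index ?(nth_find [::] hs).
Qed.

(** The entries of a standard filling at most k form a partition shape, so
    its cells are corners from the largest entry down. *)
Lemma peels_standard : peels (fun x => x.2 < nth 0 nu x.1) (slide_order Q).
Proof.
have szQ : size (flatten Q) = sumn nu by rewrite size_flatten shQ.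
pose mu k : pred cell := fun x => 0 < entry Q x <= k.
have inE r c : (c < nth 0 nu r) = (r < colh Q c).
  by rewrite -(in_rowE pQ) -nth_shape shQ.
have pos r c k : mu k (r, c) -> r < colh Q c.
  by rewrite /mu; case: (ltnP r (colh Q c)) => // ge; rewrite (entry_out pQ ge).
have dc k : down_closed (mu k).
  move=> r c r' c' rr cc H; have rc := pos _ _ _ H.
  have rc' : r' < colh Q c' := leq_ltn_trans rr (leq_trans rc (colh_mono Q cc)).
  have := standard_mono rr cc rc; have := standard_mem rc'; move: H; rewrite /mu; lia.
have key k : k <= sumn nu -> peels (mu k) [seq cell_of Q a | a <- rev (iota 1 k)].
  elim: k => [|k IH] kM; first by move=> x; rewrite /mu; case: (entry Q x).
  have -> : iota 1 k.+1 = iota 1 k ++ [:: k.+1].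
    by rewrite -[in LHS](addn1 k) iotaD add1n.
  have [xin xE] := cell_ofP (introT andP (conj (ltn0Sn k) kM)).
  have Ed : mu k =1 del (mu k.+1) (cell_of Q k.+1).
    move=> x; rewrite /del /mu; case: (x =P cell_of Q k.+1) => [->|ne].
      by rewrite xE; lia.
    case: (eqVneq (entry Q x) k.+1) => [E|]; last by lia.
    case: ne; case: x E => r c E; rewrite [cell_of _ _]surjective_pairing.
    apply: standard_inj; rewrite ?E -?surjective_pairing ?xE //.
    by apply: (pos _ _ k.+1); rewrite /mu E; lia.
  rewrite rev_cat /=; split; first by rewrite /mu xE; lia.
    exact: (eq_down_closed Ed (dc k)).
  by apply: (peels_ext Ed); apply: IH; apply: ltnW.
rewrite /slide_order szQ; apply: peels_ext (key _ (leqnn _)) => -[r c].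
rewrite /mu inE; apply/idP/idP; first exact: (pos r c (sumn nu)).
exact: standard_mem.
Qed.

End Standard.

(** * From fillings back to tableaux *)

Lemma geq_trans : transitive geq.
Proof. by move=> y x z /= yx zy; apply: leq_trans yx. Qed.

Lemma nth_filter_pos s r : sorted geq s ->
  nth 0 [seq l <- s | 0 < l] r = nth 0 s r.
Proof.
elim: s r => // a s IH r so; have al := sorted_geq_all so.
case: (posnP a) => [a0|a0] /=.
  rewrite a0 /=; have z x : x \in s -> x = 0 by move=> /(allP al); lia.
  rewrite (eq_in_filter (a2 := pred0)) ?filter_pred0 ?nth_nil; last first.
    by move=> x /z ->.
  case: r => //= r; have [lt|ge] := ltnP r (size s); last by rewrite nth_default.
  by rewrite [RHS]z // mem_nth.
by rewrite a0; case: r => //= r; rewrite IH // (path_sorted so).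
Qed.

Lemma partition_filter s : sorted geq s -> is_partition [seq l <- s | 0 < l].
Proof.
by move=> so; rewrite /is_partition (sorted_filter geq_trans) // filter_all.
Qed.

Lemma count_lt_sorted p s c : sorted leq s ->
  (c < count (fun x => x < p) s) = (c < size s) && (nth 0 s c < p).
Proof.
elim: s c => // a s IH c so; have {}IH := IH _ (path_sorted so).
have al : all (leq a) s by move: so; rewrite /= (path_sortedE leq_trans) => /andP [].
have [ap|pa] := boolP (a < p).
  by case: c => [|c]; rewrite /= ap // add1n !ltnS IH.
have z : count (fun x => x < p) s = 0.
  apply/eqP; rewrite -leqn0 leqNgt -has_count; apply/hasP => -[b bs].
  by have := allP al b bs; rewrite /=; lia.
rewrite /= (negPf pa) z; case: c => [|c] /=; first by rewrite (negPf pa).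
apply/esym/negP => /andP [cs]; have := allP al _ (mem_nth 0 cs); rewrite /=; lia.
Qed.

Lemma mkseq_cat (T : Type) (f : nat -> T) k n : k <= n ->
  mkseq f n = mkseq f k ++ [seq f c | c <- iota k (n - k)].
Proof. by move=> kn; rewrite /mkseq -map_cat -[X in iota X _]add0n -iotaD subnKC. Qed.

Lemma pmap_row (row : seq (option nat)) f k :
  (forall c, nth None row c = opt (f c)) -> (forall c, (f c != 0) = (c < k)) ->
  pmap id row = mkseq f k.
Proof.
move=> H Hk; have ks : k <= size row.
  rewrite leqNgt; apply/negP => lt; have := H (size row).
  by rewrite nth_default // opt_neq0 ?Hk.
rewrite -[row](mkseq_nth None) (mkseq_cat _ ks) pmap_cat.
rewrite [X in _ ++ X](_ : _ = [::]) ?cats0; last first.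
  apply/nilP; rewrite /nilp size_pmap -leqn0 leqNgt -has_count.
  apply/hasP => -[o /mapP [c]]; rewrite mem_iota => /andP [kc _] ->.
  have : f c = 0 by apply/eqP; rewrite -[_ == _]negbK Hk -leqNgt.
  by rewrite H => ->.
rewrite /mkseq -[iota 0 k]/(iota 0 k).
have : forall c, c \in iota 0 k -> nth None row c = Some (f c).
  by move=> c; rewrite mem_iota add0n => /= ck; rewrite H opt_neq0 ?Hk.
elim: (iota 0 k) => //= c s IH Hs; rewrite Hs ?mem_head //= IH // => d ds.
by apply: Hs; rewrite inE ds orbT.
Qed.

Section TabOf.
Variable N : nat.
Implicit Types (R : filling).
Notation straight := (skewt N pred0).

Definition height R := count (fun r => R (r, 0) != 0) (iota 0 N).

Definition tab_of R : tableau :=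
  mkseq (fun r => mkseq (fun c => R (r, c)) (row_len N R r)) (height R).

Lemma heightP R r : straight R -> (R (r, 0) != 0) = (r < height R).
Proof.
move=> Y; rewrite /height.
have [k kN Hk] : exists2 k, k <= N & forall r, (R (r, 0) != 0) = (r < k).
  have [z|nz] := eqVneq (R (0, 0)) 0.
    exists 0 => // d; apply/negbTE/negP => nzd.
    by have := straight_in Y (leq0n d) (leqnn 0) nzd; rewrite z.
  have [d [_ nzd] dmax] := last_in_col Y nz; have [dN _] := filled_box Y nzd.
  exists d.+1 => // d'; rewrite ltnS; case: (leqP d' d) => [le|lt].
    exact: (straight_in Y le (leqnn 0) nzd).
  by rewrite dmax.
by rewrite (eq_count Hk) count_ltn.
Qed.

Lemma size_tab_row R r : straight R -> size (nth [::] (tab_of R) r) = row_len N R r.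
Proof.
move=> Y; have [lt|ge] := ltnP r (height R); first by rewrite nth_mkseq // size_mkseq.
rewrite nth_default ?size_mkseq //=; apply/esym/eqP; rewrite -leqn0 leqNgt.
by rewrite -(row_lenP r 0 Y) heightP // -leqNgt.
Qed.

Lemma entry_tab R : straight R -> entry (tab_of R) = R.
Proof.
move=> Y; apply: functional_extensionality => -[r c]; rewrite /entry /=.
have [lt|ge] := ltnP c (row_len N R r); last first.
  rewrite nth_default ?size_tab_row //; apply/esym/eqP.
  by rewrite -[_ == _]negbK (row_lenP r c Y) -leqNgt.
have rh : r < height R by rewrite -heightP // (row_lenP r 0 Y) (leq_ltn_trans _ lt).
by rewrite nth_mkseq // nth_mkseq.
Qed.

Lemma row_len_mono R r r' : straight R -> r <= r' -> row_len N R r' <= row_len N R r.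
Proof.
move=> Y rr; rewrite leqNgt; apply/negP; rewrite -(row_lenP _ _ Y) => nz.
by have := straight_in Y rr (leqnn _) nz; rewrite (row_lenP _ _ Y) ltnn.
Qed.

(** Rectification leaves no empty cell before a letter, so deleting empty
    cells only trims the rows. *)
Lemma straight_of_skewE Sf R : straight R -> represents Sf R ->
  straight_of_skew Sf = tab_of R.
Proof.
move=> Y rp; rewrite /straight_of_skew.
have E r : pmap id (nth [::] Sf r) = mkseq (fun c => R (r, c)) (row_len N R r).
  apply: pmap_row => c; last exact: row_lenP.
  exact: (rp (r, c)).
have hS : height R <= size Sf.
  rewrite leqNgt; apply/negP; rewrite -heightP // => nz.
  by have := rp (size Sf, 0); rewrite opt_neq0 // /sget /= [nth _ Sf _]nth_default.
rewrite -[Sf in LHS](mkseq_nth [::]) /mkseq -map_comp (eq_map E) -/(mkseq _ _).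
rewrite (mkseq_cat _ hS) filter_cat [X in _ ++ X](_ : _ = [::]) ?cats0; last first.
  apply/eqP; rewrite -[_ == _]negbK -has_filter; apply/hasP => -[s /mapP [r]].
  rewrite mem_iota => /andP [hr _] ->.
  by rewrite -size_eq0 size_mkseq -lt0n -(row_lenP r 0 Y) heightP // ltnNge hr.
apply/all_filterP/allP => s /mapP [r]; rewrite mem_iota /= => rh ->.
by rewrite -size_eq0 size_mkseq -lt0n -(row_lenP r 0 Y) heightP.
Qed.

Lemma represents_straight R : straight R -> represents (skew_of_straight (tab_of R)) R.
Proof.
move=> Y [r c]; rewrite /sget /= /skew_of_straight.
have -> : nth [::] (map (map Some) (tab_of R)) r = map Some (nth [::] (tab_of R) r).
  have [lt|ge] := ltnP r (size (tab_of R)); first by rewrite (nth_map [::]).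
  by rewrite !nth_default // size_map.
have [lt|ge] := ltnP c (row_len N R r).
  rewrite (nth_map 0) ?size_tab_row // -/(entry (tab_of R) (r, c)) entry_tab //.
  by rewrite opt_neq0 // (row_lenP _ _ Y).
rewrite nth_default ?size_map ?size_tab_row //.
suff -> : R (r, c) = 0 by [].
by apply/eqP; rewrite -[_ == _]negbK (row_lenP r c Y) -leqNgt.
Qed.

End TabOf.

Lemma row_filling_row nu r : nth [::] (row_filling nu) r =
  iota (sumn (take r nu)).+1 (nth 0 nu r).
Proof.
rewrite /row_filling nth_reshape.
have [lt|ge] := ltnP r (size nu); last by rewrite [nth 0 nu r]nth_default // take0.
have le : sumn (take r nu) + nth 0 nu r <= sumn nu.
  rewrite -[in X in _ <= X](cat_take_drop r nu) sumn_cat leq_add2l (drop_nth 0) //=.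
  exact: leq_addr.
by rewrite drop_iota take_iota add1n; congr iota; lia.
Qed.

Lemma row_filling_standard nu : is_partition nu -> standard_filling nu (row_filling nu).
Proof.
move=> pnu; have sh : shape (row_filling nu) = nu by rewrite reshapeKl // size_iota.
have pQ : is_partition (shape (row_filling nu)) by rewrite sh.
have E r c : r < colh (row_filling nu) c ->
    entry (row_filling nu) (r, c) = (sumn (take r nu)).+1 + c /\ c < nth 0 nu r.
  rewrite -(in_rowE pQ) row_filling_row size_iota => cr.
  by rewrite /entry /= row_filling_row nth_iota.
apply/and4P; split.
- by rewrite sh.
- by rewrite reshapeKr // size_iota.
- apply/(rowsP pQ ltn_trans) => r c c' lt rc.
  have [-> _] := E _ _ rc; have [|-> _] := E r c; last by lia.
  exact: (leq_trans rc (colh_mono _ (ltnW lt))).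
apply/(colsP pQ) => r r' c lt rc.
have [-> _] := E _ _ rc; have [|-> cr] := E r c; first exact: ltn_trans rc.
suff : sumn (take r nu) + nth 0 nu r <= sumn (take r' nu) by lia.
have rs : r < size nu by rewrite ltnNge; apply/negP => ge; rewrite nth_default in cr.
have -> : take r' nu = take r nu ++ nth 0 nu r :: drop r.+1 (take r' nu).
  rewrite -{1}[take r' nu](cat_take_drop r) take_takel ?(ltnW lt) //.
  rewrite [drop r _](drop_nth 0) ?nth_take // size_take_min leq_min lt //.
by rewrite sumn_cat /= addnA leq_addr.
Qed.

Section Evac.
Variables (N p q : nat) (R : filling).
Hypothesis p_gt0 : 0 < p.
Hypothesis Y : skewt N pred0 R.
Hypothesis L : letters p q R.

Let U := tab_of N R.
Let h := size U.
Let w := size (head [::] U).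

Lemma heightE : h = height N R.
Proof. by rewrite /h size_mkseq. Qed.

Lemma widthE : w = row_len N R 0.
Proof. by rewrite /w -nth0 size_tab_row. Qed.

Lemma tab_hN : h <= N.
Proof. by rewrite heightE -[X in _ <= X](size_iota 0); apply: count_size. Qed.

Lemma tab_wN : w <= N.
Proof. by rewrite widthE -[X in _ <= X](size_iota 0); apply: count_size. Qed.

Lemma tab_within : within h w R.
Proof.
move=> r c nz; rewrite heightE widthE -(heightP r Y) -(row_lenP 0 c Y).
by split; [apply: (straight_in Y _ _ nz) | apply: (straight_in Y _ _ nz)].
Qed.

Lemma nth_rev_tab r : r < h -> size (nth [::] (rev U) r) = row_len N R (h.-1 - r).
Proof. by move=> rh; rewrite nth_rev // -/h size_tab_row //; congr row_len; lia. Qed.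

Lemma rotate_represents : represents (rotate p q U) (half_turn h w p q R).
Proof.
move=> [r c]; rewrite /sget /rotate -/w half_turnE /=.
have [rh|hr] := ltnP r h; last by rewrite [nth [::] _ r]nth_default ?nth_nil // size_map size_rev.
have Er : nth [::] (rev U) r = nth [::] U (h.-1 - r).
  by rewrite nth_rev //; congr nth; rewrite -/h; lia.
rewrite (nth_map [::]) ?size_rev // nth_cat size_nseq Er size_tab_row //.
set l := row_len N R (h.-1 - r).
have lw : l <= w by rewrite widthE; apply: row_len_mono.
have [cw|wc] := ltnP c w; last first.
  rewrite ltnNge (leq_trans (leq_subr _ _) wc) /= nth_default //.
  by rewrite size_map size_rev size_tab_row // -/l; lia.
rewrite /opp_cell /=.
have Ez : (R (h.-1 - r, w.-1 - c) == 0) = (c < w - l).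
  by rewrite -[_ == 0]negbK (row_lenP _ _ Y) -/l -leqNgt; lia.
rewrite Ez; case: ltnP => lt; first by rewrite nth_nseq lt.
rewrite (nth_map 0) ?size_rev ?size_tab_row // -/l; last by lia.
rewrite nth_rev size_tab_row // -/l; last by lia.
have -> : l - (c - (w - l)).+1 = w.-1 - c by lia.
rewrite -/(entry U (h.-1 - r, w.-1 - c)) entry_tab //.
have nz : R (h.-1 - r, w.-1 - c) != 0 by rewrite Ez -leqNgt.
by rewrite opt_neq0 //; have := L nz; lia.
Qed.

Lemma rotate_innerE x : rot_inner h w R x = (x.2 < nth 0 (rotate_inner U) x.1).
Proof.
case: x => r c; rewrite /rotate_inner -/w nth_filter_pos /rot_inner /opp_cell /=; last first.
  apply/(sortedP 0) => s; rewrite size_map size_rev -/h => lt.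
  rewrite !(nth_map [::]) ?size_rev ?(ltnW lt) //= !nth_rev_tab ?(ltnW lt) //.
  by apply: leq_sub2l; apply: row_len_mono => //; lia.
have [rh|hr] := ltnP r h; last by rewrite nth_default // size_map size_rev.
rewrite (nth_map [::]) ?size_rev // nth_rev_tab //.
have lw : row_len N R (h.-1 - r) <= w by rewrite widthE; apply: row_len_mono.
have [cw|wc] /= := ltnP c w; last by apply/esym/negbTE; lia.
by rewrite -[_ == 0]negbK (row_lenP _ _ Y) -leqNgt; lia.
Qed.

Lemma rotate_inner_partition : is_partition (rotate_inner U).
Proof.
apply: partition_filter; apply/(sortedP 0) => s; rewrite size_map size_rev -/h => lt.
rewrite !(nth_map [::]) ?size_rev ?(ltnW lt) //= !nth_rev_tab ?(ltnW lt) //.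
by apply: leq_sub2l; apply: row_len_mono => //; lia.
Qed.

Definition evac_order := slide_order (row_filling (rotate_inner U)).

Lemma tab_boxed : boxed N p q h w evac_order R.
Proof.
split=> //; first exact: tab_within.
have st := row_filling_standard rotate_inner_partition.
apply: peels_ext (peels_standard rotate_inner_partition st) => x.
exact/esym/rotate_innerE.
Qed.

Lemma evacE R' ys : rects evac_order (half_turn h w p q R) R' ys ->
  evac p q U = tab_of N R'.
Proof.
move=> rc; have [_ _ _ pl] := tab_boxed.
have Yr := rot_skewt p_gt0 tab_hN tab_wN Y L.
have [Rf E rp] := rectify_rects [::] Yr pl rc rotate_represents.
rewrite /evac /rect /rectify -/slide_step -/evac_order E /=.
by apply: straight_of_skewE rp; apply: (rects_skewt Yr pl rc).
Qed.

End Evac.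

(** * The involutions of type A are reversals *)

Definition restrict (p q : nat) (F : filling) : filling :=
  fun x => if p <= F x <= q.+1 then F x else 0.

Definition merge (p q : nat) (X S : filling) : filling :=
  fun x => if p <= X x <= q.+1 then S x else X x.

(** The cells of letters below p are the inner shape of the subfilling on
    p, ..., q+1. *)
Definition lower_cells (p : nat) (F : filling) : pred cell := fun x => 0 < F x < p.

Lemma skewt_ext N (mu mu' : pred cell) S : mu =1 mu' -> skewt N mu S -> skewt N mu' S.
Proof.
move=> E Y; split; try by case: Y.
- exact: (eq_down_closed E (young_inner Y)).
- by move=> x; rewrite -E; apply: (young_disj Y).
- by apply: eq_down_closed (young_outer Y) => x; rewrite E.
Qed.

Section Restrict.
Variables (N p q : nat).
Hypothesis p_gt0 : 0 < p.
Implicit Types (F : filling).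

Lemma restrict_neq0 F x : (restrict p q F x != 0) = (p <= F x <= q.+1).
Proof. by rewrite /restrict; case: ifP => // /andP [pF _]; rewrite -lt0n (leq_trans p_gt0). Qed.

Lemma restrictE F x : p <= F x <= q.+1 -> restrict p q F x = F x.
Proof. by rewrite /restrict => ->. Qed.

Lemma restrict_letters F : letters p q (restrict p q F).
Proof. by move=> x; rewrite restrict_neq0 => H; rewrite restrictE. Qed.

(** The letters below p fill a partition shape by the conditions on rows
    and columns. *)
Lemma restrict_skewt F : skewt N pred0 F -> skewt N (lower_cells p F) (restrict p q F).
Proof.
move=> Y.
have mono r c r' c' : r' <= r -> c' <= c -> F (r, c) != 0 ->
    0 < F (r', c') <= F (r, c).
  move=> rr cc nz; have nz1 := straight_in Y rr (leqnn c) nz.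
  have nz2 := straight_in Y rr cc nz; rewrite lt0n nz2 /=.
  apply: (leq_trans (row_le Y cc nz2 nz1)).
  move: rr; rewrite leq_eqVlt => /orP [/eqP -> //|lt].
  exact/ltnW/(young_col Y lt).
split.
- move=> r c r' c' rr cc /andP [F0 Fp]; rewrite lt0n in F0.
  by have := mono _ _ _ _ rr cc F0; rewrite /lower_cells; lia.
- by move=> x /andP [_ Fp]; rewrite /restrict leqNgt Fp.
- have E x : [|| lower_cells p F x, restrict p q F x != 0 | pred0 x] =
      (0 < F x < maxn p q.+2).
    by rewrite restrict_neq0 /lower_cells orbF; lia.
  move=> r c r' c' rr cc; rewrite !E => /andP [F0 Fp]; rewrite lt0n in F0.
  by have := mono _ _ _ _ rr cc F0; lia.
- move=> r c c' lt; rewrite !restrict_neq0 => n1 n2; rewrite !restrictE //.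
  by apply: (young_row Y lt); lia.
- move=> r r' c lt; rewrite !restrict_neq0 => n1 n2; rewrite !restrictE //.
  by apply: (young_col Y lt); lia.
- by move=> r c; rewrite restrict_neq0 => n; apply: (young_box Y); lia.
Qed.

Lemma restrict_occurs F c a : p <= a <= q.+1 ->
  occurs N (restrict p q F) c a = occurs N F c a.
Proof.
move=> pa; apply: eq_has => r; rewrite /restrict.
by case: ifP => // out; apply/eqP/eqP => E; move: out; rewrite -?E; lia.
Qed.

Lemma restrict_sign F j c : interval p q j ->
  col_sign N j (restrict p q F) c = col_sign N j F c.
Proof. by rewrite /interval => Jj; rewrite /col_sign /sign_of !restrict_occurs //; lia. Qed.

Lemma restrict_ph F j : interval p q j -> ph N j (restrict p q F) = ph N j F.
Proof. by move=> Jj; apply: eq_phi_from => c _; apply: restrict_sign. Qed.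

Lemma restrict_ep F j : interval p q j -> ep N j (restrict p q F) = ep N j F.
Proof. by move=> Jj; apply: eq_eps_below => c _; apply: restrict_sign. Qed.

Lemma restrict_raises F F' j : interval p q j -> raises N j F F' ->
  raises N j (restrict p q F) (restrict p q F') /\
  (exists x, [/\ F x = j, F' x = j.+1 & forall y, y <> x -> F' y = F y]).
Proof.
move=> Jj [r [c [rN E A ->]]]; split; last first.
  exists (r, c); split=> //; first by rewrite updE eqxx.
  by move=> y /eqP/negPf yx; rewrite updE yx.
have /andP [pj jq] := Jj; exists r, c; split=> //.
- by rewrite restrictE E //; lia.
- by apply: eq_acts_at A => d; rewrite restrict_sign.
- apply: functional_extensionality => y; rewrite /restrict !updE.
  by case: eqP => // _; rewrite (leqW pj) ltnS jq.
Qed.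

End Restrict.

Lemma subtableau_represents p q X : 0 < p ->
  represents (subtableau p q X) (restrict p q (entry X)).
Proof.
move=> p0 [r c]; rewrite /sget /subtableau /restrict /entry /=.
have z : opt (if p <= 0 <= q.+1 then 0 else 0) = None by case: ifP.
have [rX|Xr] := ltnP r (size X); last first.
  by rewrite [nth [::] _ r]nth_default ?size_map // [nth [::] X r]nth_default // !nth_nil z.
rewrite (nth_map [::]) //; have [cr|rc] := ltnP c (size (nth [::] X r)); last first.
  by rewrite nth_default ?size_map // [nth 0 _ c]nth_default // z.
rewrite (nth_map 0) //; case: ifP => // /andP [pe _].
by rewrite opt_neq0 // -lt0n (leq_trans p0).
Qed.

Section TypeA.
Variables (N m p q : nat) (mu : seq nat) (X Q : tableau).
Hypothesis pmu : is_partition mu.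
Hypothesis fN : fits N mu.
Hypothesis p_gt0 : 0 < p.
Hypothesis qm : q < m.
Hypothesis sX : ssyt mu m X.

Notation J := (interval p q).
Notation res U := (restrict p q (entry U)).
Notation mu0 := (lower_cells p (entry X)).
Let J0 := @J_gt0 p q p_gt0.

Lemma inner_rows r c :
  (c < count (fun x => x < p) (nth [::] X r)) = mu0 (r, c).
Proof.
have /and3P [_ _ /andP [/allP so _]] := sX.
have sr : sorted leq (nth [::] X r).
  have [lt|ge] := ltnP r (size X); last by rewrite nth_default.
  by apply: so; apply: mem_nth.
rewrite count_lt_sorted // in_rowE ?(ssyt_part pmu sX) //.
by rewrite -(ssyt_neq0 pmu sX) /lower_cells lt0n.
Qed.

Lemma inner_counts_sorted :
  sorted geq [seq count (fun x => x < p) r | r <- X].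
Proof.
apply/(sortedP 0) => r; rewrite size_map => lt.
rewrite !(nth_map [::]) ?(ltnW lt) //= leqNgt; apply/negP.
rewrite inner_rows => /andP [nz lep]; rewrite lt0n in nz.
have Y := ssyt_skewt pmu fN sX.
have nz' := straight_in Y (leqnSn r) (leqnn _) nz.
have : mu0 (r, count (fun x => x < p) (nth [::] X r)).
  rewrite /lower_cells lt0n nz' /=; apply: leq_ltn_trans lep.
  exact/ltnW/(young_col Y).
by rewrite -inner_rows ltnn.
Qed.

Lemma inner_shapeE : (fun x => x.2 < nth 0 (inner_shape p X) x.1) =1 mu0.
Proof.
move=> [r c]; rewrite /inner_shape nth_filter_pos /=; last exact: inner_counts_sorted.
rewrite -inner_rows; have [lt|ge] := ltnP r (size X); first by rewrite (nth_map [::]).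
by rewrite !nth_default // size_map.
Qed.

Lemma inner_partition : is_partition (inner_shape p X).
Proof. exact: partition_filter inner_counts_sorted. Qed.

Hypothesis sQ : standard_filling (inner_shape p X) Q.
Notation xs := (slide_order Q).

Lemma inner_peels : peels mu0 xs.
Proof. exact: peels_ext inner_shapeE (peels_standard inner_partition sQ). Qed.

Lemma base_skewt : skewt N mu0 (res X).
Proof. by apply: restrict_skewt => //; apply: (ssyt_skewt pmu fN sX). Qed.

(** What operators with index in J preserve, starting from X. It links
    components of the crystal of tableaux to components of skew fillings. *)
Definition good U := [/\ ssyt mu m U, conn N mu0 J (res X) (res U)
  & entry U = merge p q (entry X) (res U)].

Lemma good_base : good X.
Proof.
split=> //; first exact: conn0.
apply: functional_extensionality => x; rewrite /merge /restrict.
by case: ifP => // ->.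
Qed.

Lemma good_skewt U : good U -> skewt N mu0 (res U).
Proof. by move=> [_ C _]; apply: (conn_skewt J0 C base_skewt). Qed.

Lemma good_support U x : good U -> (p <= entry X x <= q.+1) = (p <= entry U x <= q.+1).
Proof.
move=> [_ C _]; rewrite -!(restrict_neq0 q p_gt0).
exact: (conn_support p_gt0 C).
Qed.

Lemma good_inj U V : good U -> good V -> res U = res V -> U = V.
Proof.
move=> [sU _ EU] [sV _ EV] E; apply: eq_tableau.
  by rewrite (ssyt_shape sU) (ssyt_shape sV).
by move=> x; rewrite EU EV E.
Qed.

Lemma interval_m j : J j -> 0 < j < m.
Proof. by rewrite /interval => /andP [pj jq]; lia. Qed.

Lemma merge_raises U V j : good U -> J j ->
  raises N j (entry U) (entry V) \/ raises N j (entry V) (entry U) ->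
  entry V = merge p q (entry X) (res V).
Proof.
move=> gU Jj H; have /andP [pj jq] := Jj.
have [x [xU xV E]] : exists x, [/\ p <= entry U x <= q.+1, p <= entry V x <= q.+1
    & forall y, y <> x -> entry V y = entry U y].
  case: H => /(restrict_raises p_gt0 Jj) [_ [x [E1 E2 E3]]]; exists x.
    by rewrite E1 E2; split=> //; lia.
  by rewrite E1 E2; split; [lia | lia | move=> y /E3].
apply: functional_extensionality => y; rewrite /merge (good_support y gU).
case: (y =P x) => [->|ne]; first by rewrite xU restrictE.
have [_ _ EU] := gU; have := congr1 (fun f => f y) EU.
by rewrite /merge (good_support y gU) E // /restrict E.
Qed.

Lemma good_fA U V j : good U -> J j -> fA j U = Some V ->
  good V /\ raises N j (res U) (res V).
Proof.
move=> gU Jj; have [sU C EU] := gU.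
move=> /(fA_raises pmu fN sU (interval_m Jj)) [sV Rs].
have [Rs' _] := restrict_raises p_gt0 Jj Rs.
do 2!split=> //; first exact: (conn_up C Jj Rs').
by apply: (merge_raises gU Jj); left.
Qed.

Lemma lower_cells_merge V : entry V = merge p q (entry X) (res V) ->
  lower_cells p (entry V) =1 mu0.
Proof.
move=> E x; rewrite /lower_cells E /merge; case: ifP => // H.
have : p <= res V x \/ res V x = 0.
  by rewrite /restrict; case: ifP => [/andP [? _]|]; [left | right].
by lia.
Qed.

Lemma good_eA U V j : good U -> J j -> eA j U = Some V ->
  good V /\ raises N j (res V) (res U).
Proof.
move=> gU Jj; have [sU C EU] := gU; have j0 := J0 Jj.
move=> /(eA_raises pmu fN sU j0) [sV Rs].
have [Rs' _] := restrict_raises p_gt0 Jj Rs.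
have EV : entry V = merge p q (entry X) (res V).
  by apply: (merge_raises gU Jj); right.
do 2!split=> //; apply: (conn_down C Jj _ Rs').
apply: skewt_ext (lower_cells_merge EV) _.
by apply: restrict_skewt => //; apply: (ssyt_skewt pmu fN sV).
Qed.

Lemma good_raise U S' j : good U -> J j -> raises N j (res U) S' ->
  exists2 V, fA j U = Some V & good V /\ res V = S'.
Proof.
move=> gU Jj Rs; have [sU C EU] := gU; have j0 := J0 Jj.
have YU := ssyt_skewt pmu fN sU.
have : 0 < ph N j (res U) by apply/(raisesP j (good_skewt gU)); exists S'.
rewrite restrict_ph // => /(raisesP j YU) [S'' Rs''].
have [V EV Es] := raises_fA pmu fN sU j0 Rs''; exists V => //.
have [gV RsV] := good_fA gU Jj EV; split=> //.
exact: (raises_fun j0 (good_skewt gU) RsV Rs).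
Qed.

Lemma good_lower U S' j : good U -> J j -> skewt N mu0 S' -> raises N j S' (res U) ->
  exists2 V, eA j U = Some V & good V /\ res V = S'.
Proof.
move=> gU Jj Y' Rs; have [sU C EU] := gU; have j0 := J0 Jj.
have YU := ssyt_skewt pmu fN sU.
have : 0 < ep N j (res U) by apply/(lowersP j0 (good_skewt gU)); exists S'.
rewrite restrict_ep // => /(lowersP j0 YU) [S'' Y'' Rs''].
have [V EV Es] := raises_eA pmu fN sU j0 Y'' Rs''; exists V => //.
have [gV RsV] := good_eA gU Jj EV; split=> //.
exact: (raises_inj j0 (good_skewt gV) Y' RsV Rs).
Qed.

Lemma good_highest U : good U -> (forall j, J j -> eA j U = None) ->
  forall j, J j -> ep N j (res U) = 0.
Proof.
move=> gU hi j Jj; apply/eqP; rewrite -leqn0 leqNgt; apply/negP.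
move=> /(lowersP (J0 Jj) (good_skewt gU)) [S' Y' Rs].
by have [V] := good_lower gU Jj Y' Rs; rewrite hi.
Qed.

Lemma good_lowest U : good U -> (forall j, J j -> fA j U = None) ->
  forall j, J j -> ph N j (res U) = 0.
Proof.
move=> gU lo j Jj; apply/eqP; rewrite -leqn0 leqNgt; apply/negP.
move=> /(raisesP j (good_skewt gU)) [S' Rs].
by have [V] := good_raise gU Jj Rs; rewrite lo.
Qed.

Notation B := (SSYT_crystal mu m).

Lemma connected_good U V : good U -> connected B J U V ->
  good V /\ conn N mu0 J (res U) (res V).
Proof.
move=> gU; elim=> {V} [|j V W _ [gV C] Jj /= E|j V W _ [gV C] Jj /= E].
- by split=> //; apply: conn0.
- have [gW Rs] := good_fA gV Jj E; split=> //; exact: (conn_up C Jj Rs).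
- have [gW Rs] := good_eA gV Jj E; split=> //.
  exact: (conn_down C Jj (good_skewt gW) Rs).
Qed.

Lemma conn_connected U S' : good U -> conn N mu0 J (res U) S' ->
  exists V, [/\ connected B J U V, good V & res V = S'].
Proof.
move=> gU; elim=> [|j S1 S2 _ [V [C gV <-]] Jj Rs|j S1 S2 _ [V [C gV <-]] Jj Y2 Rs].
- by exists U; split=> //; apply: conn_refl.
- have [W EW [gW <-]] := good_raise gV Jj Rs; exists W; split=> //.
  exact: (conn_f C Jj EW).
- have [W EW [gW <-]] := good_lower gV Jj Y2 Rs; exists W; split=> //.
  exact: (conn_e C Jj EW).
Qed.

Lemma apply_ops_rcons g js j u :
  apply_ops g (rcons js j) u = obind (g j) (apply_ops g js u).
Proof. by rewrite /apply_ops foldl_rcons. Qed.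

Lemma apply_ops_ssyt js u U : all J js -> ssyt mu m u ->
  apply_ops fA js u = Some U -> ssyt mu m U.
Proof.
elim/last_ind: js U => [|js j IH] U; first by move=> _ su [<-].
rewrite all_rcons apply_ops_rcons => /andP [Jj Js] su.
case E: (apply_ops fA js u) => [V|] //= EU.
by have [] := fA_raises pmu fN (IH _ Js su E) (interval_m Jj) EU.
Qed.

Lemma apply_ops_good js u U : all J js -> ssyt mu m u ->
  apply_ops fA js u = Some U -> good U -> good u.
Proof.
elim/last_ind: js U => [|js j IH] U; first by move=> _ su [<-].
rewrite all_rcons apply_ops_rcons => /andP [Jj Js] su.
case E: (apply_ops fA js u) => [V|] //= EU gU.
have sV := apply_ops_ssyt Js su E.
have [_ Rs] := fA_raises pmu fN sV (interval_m Jj) EU.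
have [sU _ _] := gU.
have [V' E' Ev] := raises_eA pmu fN sU (J0 Jj) (ssyt_skewt pmu fN sV) Rs.
have [sV' _] := eA_raises pmu fN sU (J0 Jj) E'.
have EV : V' = V.
  by apply: eq_tableau => [|x]; rewrite ?Ev // (ssyt_shape sV) (ssyt_shape sV').
by apply: (IH _ Js su E); rewrite -EV; have [] := good_eA gU Jj E'.
Qed.

Lemma highest_path U : good U -> exists u js,
  [/\ good u, all J js, apply_ops fA js u = Some U & forall j, J j -> eA j u = None].
Proof.
move: {2}(letter_sum N (res U)) (leqnn (letter_sum N (res U))) => k; elim: k U => [|k IH] U le gU.
  exists U, [::]; split=> // j Jj; case E: (eA j U) => [V|] //.
  have [gV Rs] := good_eA gU Jj E.
  by have := raises_total p_gt0 (J0 Jj) (good_skewt gV) Rs; lia.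
case: (classic (exists j V, J j /\ eA j U = Some V)) => [[j [V [Jj E]]]|no].
  have [gV Rs] := good_eA gU Jj E.
  have tot := raises_total p_gt0 (J0 Jj) (good_skewt gV) Rs.
  have [|u [js [gu Js E' hi]]] := IH V _ gV; first by lia.
  exists u, (rcons js j); split=> //; first by rewrite all_rcons Jj.
  rewrite apply_ops_rcons E' /=.
  have [U' EU' [gU' Er]] := good_raise gV Jj Rs.
  by rewrite EU' (good_inj gU' gU Er).
exists U, [::]; split=> // j Jj; case E: (eA j U) => [V|] //.
by case: no; exists j, V.
Qed.

Section Fixed.
Variables (R : filling) (ys : seq cell).
Hypothesis rc : rects xs (res X) R ys.
Let h := size (tab_of N R).
Let w := size (head [::] (tab_of N R)).
Let zs := evac_order N R.
Notation rev_rel := (reversed p q h w zs xs).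

Let YR : skewt N pred0 R.
Proof. exact: (rects_skewt base_skewt inner_peels rc). Qed.

Let LR : letters p q R.
Proof.
have [_ _ E] := rects_weight base_skewt inner_peels rc.
exact: (weight_letters p_gt0 YR E (@restrict_letters p q p_gt0 (entry X))).
Qed.

Let hN : h <= N := tab_hN N R.
Let wN : w <= N := tab_wN YR.

Lemma good_reversible U : good U -> reversible N p q h w zs xs mu0 (res U).
Proof.
move=> [_ C _]; apply: (reversible_conn p_gt0 inner_peels) C.
split; [exact: base_skewt | exact: restrict_letters |].
move=> R' ys' rc'; have [-> _] := rects_det rc' rc.
exact: tab_boxed.
Qed.

Lemma ops_reversed js u l U : all J js -> good u -> good l ->
  rev_rel (res u) (res l) -> apply_ops fA js u = Some U ->
  exists U', [/\ apply_ops eA (map (fun j => p + q - j) js) l = Some U',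
    good U, good U' & rev_rel (res U) (res U')].
Proof.
move=> + gu gl Rv; elim/last_ind: js U => [|js j IH] U; first by move=> _ [<-]; exists l.
rewrite all_rcons map_rcons !apply_ops_rcons => /andP [Jj Js].
case E: (apply_ops fA js u) => [V|] //= EU.
have [V' [-> gV gV' RvV]] := IH _ Js E.
have [gU Rs] := good_fA gV Jj EU; have rU := good_reversible gU.
have [S' RvU CS] := reversed_exists p_gt0 hN wN inner_peels rU.
have YS := conn_skewt J0 CS (good_skewt gU).
have Rs' := reversed_raises p_gt0 hN wN inner_peels (good_reversible gV)
  (good_skewt gV') YS Jj Rs RvV RvU.
have [U' EU' [gU' Er]] := good_lower gV' (theta_J Jj) YS Rs'.
by exists U'; split=> //=; rewrite Er.
Qed.

(** Follow a path from a highest weight element to X; reversal sends the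
    highest weight element to a lowest weight one and every step to the
    opposite step. *)
Lemma is_xi_exists : exists X', [/\ good X', rev_rel (res X) (res X')
  & is_xi B J (fun j => p + q - j) X X'].
Proof.
have [u [js [gu Js E hi]]] := highest_path good_base.
have [S' Rv C] := reversed_exists p_gt0 hN wN inner_peels (good_reversible gu).
have [l [Cl gl El]] := conn_connected gu C; subst S'.
have [X' [E' _ gX' RvX]] := ops_reversed Js gu gl Rv E.
exists X'; split=> //; exists u, l, js; split=> //; first by case: gu.
split; first by case: gl.
move=> j Jj; case Ej: (fA j l) => [V|] //.
have [gV Rs] := good_fA gl Jj Ej.
have := reversed_lowest p_gt0 hN wN inner_peels (good_reversible gu) (good_skewt gl)
  (good_highest gu hi) Rv Jj.
by have : 0 < ph N j (res l) by [apply/(raisesP j (good_skewt gl)); exists (res V)]; lia.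
Qed.

(** Any choice of the highest and lowest weight elements and of the path
    yields the reversal: the lowest weight element is unique in the
    component. *)
Lemma xi_path u l js : highest B J u -> lowest B J l -> connected B J u l -> all J js ->
  apply_ops fA js u = Some X ->
  exists X', [/\ apply_ops eA (map (fun j => p + q - j) js) l = Some X', good X'
    & rev_rel (res X) (res X')].
Proof.
move=> [su hi] [sl lo] C Js E.
have gu := apply_ops_good Js su E good_base.
have [gl Cl] := connected_good gu C.
have [S' Rv CS] := reversed_exists p_gt0 hN wN inner_peels (good_reversible gu).
have YS := conn_skewt J0 CS (good_skewt gu).
have lS := reversed_lowest p_gt0 hN wN inner_peels (good_reversible gu) YS
  (good_highest gu hi) Rv.
have [_ Lu _] := good_reversible gu.
have ES : res l = S'.
  apply: (lowest_conn_uniq p_gt0 inner_peels (good_skewt gl)).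
  - exact: (conn_letters p_gt0 Cl).
  - exact: (conn_trans (conn_sym J0 (good_skewt gu) Cl) CS).
  - exact: good_lowest.
  - exact: lS.
rewrite -ES in Rv; have [U' [EU' _ gU' RvU]] := ops_reversed Js gu gl Rv E.
by exists U'.
Qed.

Lemma is_xi_reversed X' : is_xi B J (fun j => p + q - j) X X' ->
  good X' /\ rev_rel (res X) (res X').
Proof.
move=> [u [l [js [hu hl C Js [E E']]]]].
have [U' [EU' gU' RvU]] := xi_path hu hl C Js E.
by move: E'; rewrite /= EU' => -[<-].
Qed.

(** The lists computed by [reversal] represent the fillings related by
    [reversed]. *)
Lemma reversal_eq S' : skewt N mu0 S' -> rev_rel (res X) S' ->
  shape (reversal p q Q X) = mu /\
  entry (reversal p q Q X) = merge p q (entry X) S'.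
Proof.
move=> Y' [R1 [ys1 [R' [ys' [rc1 ev rc']]]]].
have [E1 E2] := rects_det rc rc1; subst R1 ys1.
have rp := subtableau_represents q X p_gt0.
have [Rf ER rpR] := rectify_rects [::] base_skewt inner_peels rc rp.
have Esk : represents (skew_reversal p q Q (subtableau p q X)) S'.
  rewrite /skew_reversal /rectify -/slide_step ER cats0.
  rewrite (straight_of_skewE YR rpR) (evacE p_gt0 YR LR ev).
  apply: (unslides_rects Y' inner_peels rc').
  by apply: represents_straight; apply: (rects_skewt Y' inner_peels rc').
have pX := ssyt_part pmu sX.
have sh : shape (reversal p q Q X) = mu.
  rewrite -(ssyt_shape sX) /shape /reversal -map_comp.
  rewrite -[X in RHS](mkseq_nth [::]) -[RHS]map_comp.
  by apply: eq_map => r /=; rewrite size_map size_iota.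
split=> //; apply: functional_extensionality => -[r c].
have pr : is_partition (shape (reversal p q Q X)) by rewrite sh.
have [cr|rc0] := ltnP c (size (nth [::] X r)); last first.
  rewrite entry_out //; last first.
    by rewrite leqNgt -in_rowE // -nth_shape sh -(ssyt_shape sX) nth_shape -leqNgt.
  by rewrite /merge [entry X _]nth_default // leqn0 (gtn_eqF p_gt0).
have rX : r < size X by rewrite ltnNge; apply/negP => ge; rewrite nth_default in cr.
rewrite {1}/entry /reversal /= (nth_map 0) ?size_iota // nth_iota //.
rewrite (nth_map 0) ?size_iota // nth_iota // !add0n /merge Esk.
by case: ifP => // _; rewrite /opt; case: eqP.
Qed.

End Fixed.

(** Used to know that the word in the operators e that defines the
    involution does not vanish in type C. *)
Lemma xi_path_exists u l js : highest B J u -> lowest B J l -> connected B J u l ->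
  all J js -> apply_ops fA js u = Some X ->
  exists X', apply_ops eA (map (fun j => p + q - j) js) l = Some X'.
Proof.
have [R [ys rc]] := rects_exists base_skewt inner_peels.
by move=> hu hl C Js E; have [X' [EX' _ _]] := xi_path rc hu hl C Js E; exists X'.
Qed.

Theorem xi_reversal : is_xi B J (fun j => p + q - j) X (reversal p q Q X) /\
  forall X', is_xi B J (fun j => p + q - j) X X' -> X' = reversal p q Q X.
Proof.
have [R [ys rc]] := rects_exists base_skewt inner_peels.
have eqr X' : good X' ->
    reversed p q (size (tab_of N R)) (size (head [::] (tab_of N R)))
      (evac_order N R) xs (res X) (res X') -> X' = reversal p q Q X.
  move=> gX' Rv; have [sh E] := reversal_eq rc (good_skewt gX') Rv.
  have [sX' _ E'] := gX'; apply: eq_tableau; first by rewrite sh (ssyt_shape sX').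
  by move=> x; rewrite E -E'.
split=> [|X' /(is_xi_reversed rc) [gX' Rv]]; last exact: eqr.
by have [X' [gX' Rv xX']] := is_xi_exists rc; rewrite -(eqr _ gX' Rv).
Qed.

End TypeA.

(** * Admissible columns as bracketings *)

Lemma sub_count_in (T : eqType) (a b : pred T) s :
  {in s, forall x, a x -> b x} -> count a s <= count b s.
Proof.
move=> H; rewrite (eq_in_count (a2 := predI a b)).
  by apply: sub_count => x /andP [].
by move=> x xs /=; case ax: (a x) => //=; rewrite H.
Qed.

Section Column.
Variable n : nat.
Implicit Types (C : seq nat) (p : nat).

Definition paired C p := (p \in C) && (bar n p \in C).
Definition free C p := (p \notin C) && (bar n p \notin C).
(** The bracketing of the letters n, ..., 1: the pairs z, bar z open
    ([true]), the letters free to be chosen as t close ([false]). *)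
Definition mark C p : option bool :=
  if paired C p then Some true else if free C p then Some false else None.
(** The number of brackets opened by letters larger than p that are still
    open at p. *)
Definition pending C p : nat := phi_from (mark C) p.+1 (n - p).
Definition matched C p := free C p && (0 < pending C p).
Definition matches C := [seq t <- rev (iota 1 n) | matched C t].

Lemma pending_n C : pending C n = 0.
Proof. by rewrite /pending subnn. Qed.

Lemma pendingE C p : 0 < p <= n -> pending C p.-1 = push_right (mark C p) (pending C p).
Proof.
case: p => // p /=; rewrite /pending => pn.
by have -> : n - p = (n - p.+1).+1 by lia.
Qed.

Lemma paired_free C p : paired C p -> free C p = false.
Proof. by rewrite /paired /free => /andP [-> _]. Qed.

Lemma matched_step C p : 0 < p <= n ->
  pending C p.-1 + matched C p = pending C p + paired C p.
Proof.
move=> pn; rewrite pendingE // /mark /matched.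
case: (boolP (paired C p)) => [/paired_free ->|_] /=; first by lia.
by case: (free C p) => /=; lia.
Qed.

(** Every opening bracket is closed by a matched one or still pending. *)
Lemma pending_count C p : p <= n ->
  pending C p + count (matched C) (iota p.+1 (n - p)) =
  count (paired C) (iota p.+1 (n - p)).
Proof.
move=> pn; rewrite -(subKn pn); move: (n - p) (leq_subr p n) => k {pn}.
elim: k => [|k IH] kn; first by rewrite subn0 pending_n subnn.
have := IH (ltnW kn); have E1 : (n - k.+1).+1 = n - k by lia.
have E2 : n - (n - k.+1) = (n - (n - k)).+1 by lia.
rewrite E2 /= E1.
have pos : 0 < n - k <= n by lia.
have := matched_step C pos; have -> : (n - k).-1 = n - k.+1 by lia.
by lia.
Qed.

Lemma rev_iota_split t : 0 < t <= n ->
  rev (iota 1 n) = rev (iota t.+1 (n - t)) ++ t :: rev (iota 1 t.-1).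
Proof.
case: t => // t /= tn; have -> : iota 1 n = iota 1 t ++ t.+1 :: iota t.+2 (n - t.+1).
  rewrite -[_ :: _]/(iota t.+1 (n - t.+1).+1) -[t.+1 in RHS]add1n -iotaD.
  by congr iota; lia.
by rewrite rev_cat rev_cons cat_rcons.
Qed.

Lemma filter_head (P : pred nat) b t : 0 < t <= n -> t < b -> P t ->
  (forall s, t < s -> s < b -> ~~ P s) ->
  [seq s <- rev (iota 1 n) | (s < b) && P s] =
  t :: [seq s <- rev (iota 1 n) | (s < t) && P s].
Proof.
move=> tn tb Pt H; rewrite (rev_iota_split tn) !filter_cat /= tb Pt ltnn /=.
rewrite (eq_in_filter (a2 := pred0)) ?filter_pred0 /=; last first.
  move=> s; rewrite mem_rev mem_iota => /andP [ts _].
  by case: (ltnP s b) => // sb; apply/negbTE/H.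
rewrite [X in _ = _ :: X ++ _](eq_in_filter (a2 := pred0)) ?filter_pred0 /=; last first.
  by move=> s; rewrite mem_rev mem_iota => /andP [ts _]; rewrite ltnNge ltnW.
congr cons; apply: eq_in_filter => s; rewrite mem_rev mem_iota => Hs.
by have [-> ->] : s < b /\ s < t by lia.
Qed.

Lemma largest_freeP C b :
  match largest_free n C b with
  | Some t => [/\ 0 < t <= n, t < b, free C t & forall s, t < s <= n -> s < b -> ~~ free C s]
  | None => forall s, 0 < s <= n -> s < b -> ~~ free C s
  end.
Proof.
rewrite /largest_free.
have E : [seq t <- rev (iota 1 n) | [&& t < b, t \notin C & bar n t \notin C]] =
         [seq t <- rev (iota 1 n) | (t < b) && free C t] by [].
rewrite E; case Ef: [seq _ <- _ | _] => [|t s] /=.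
  move=> s s0 sb; apply/negP => fs; have : s \in [::] by rewrite -Ef mem_filter sb fs mem_rev mem_iota; lia.
  by [].
have : t \in t :: s by rewrite mem_head.
rewrite -{1}Ef mem_filter mem_rev mem_iota => /andP [/andP [tb ft] tn].
have tn' : 0 < t <= n by lia.
split=> // u tu ub; apply/negP => fu.
have so : sorted gtn (t :: s).
  rewrite -Ef; apply: sorted_filter; first by move=> x y z /= ? ?; lia.
  by rewrite rev_sorted; apply: iota_ltn_sorted.
have : u \in t :: s by rewrite -Ef mem_filter ub fu mem_rev mem_iota; lia.
rewrite inE => /orP [/eqP E'|us]; first by lia.
move: so; rewrite /= path_sortedE; last by move=> x y z /= ? ?; lia.
by move=> /andP [/allP H _]; have := H _ us => /=; lia.
Qed.

Lemma col_z_sorted C : sorted gtn (col_z n C).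
Proof.
apply: sorted_filter; first by move=> x y z /= ? ?; lia.
by rewrite rev_sorted; apply: iota_ltn_sorted.
Qed.

Lemma count_above (P : pred nat) p : p <= n ->
  count (fun z => p < z) [seq z <- rev (iota 1 n) | P z] = count P (iota p.+1 (n - p)).
Proof.
move=> pn; rewrite filter_rev count_rev count_filter.
have -> : n = p + (n - p) by lia.
rewrite iotaD count_cat; have -> : p + (n - p) - p = n - p by lia.
rewrite (eq_in_count (a2 := pred0)) ?count_pred0; last first.
  by move=> s; rewrite mem_iota => Hs /=; apply/negbTE; rewrite negb_and -leqNgt; apply/orP; left; lia.
rewrite add0n add1n; apply: eq_in_count => s; rewrite mem_iota => /andP [ps _].
by rewrite /= ps.
Qed.

(** The greedy choice matches brackets. When t_1, ..., t_(i-1) are chosen,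
    they are the matched closing brackets so far. The next choice is the
    largest free letter below both z_i and t_(i-1), and no matched letter
    is skipped: a matched letter above z_i would be one of the previous
    i-1. *)
Lemma col_t_fromE C pre zs b : col_z n C = pre ++ zs -> 0 < b <= n.+1 ->
  size pre = count (matched C) (iota b (n.+1 - b)) ->
  col_t_from n C b zs =
  if pending C 0 == 0 then Some [seq t <- rev (iota 1 n) | (t < b) && matched C t]
  else None.
Proof.
elim: zs pre b => [|z zs IH] pre b Ez bn Ep.
  rewrite cats0 in Ez; rewrite /=.
  have := pending_count C (leq0n n); rewrite -(count_above (paired C) (leq0n n)).
  rewrite -/(col_z n C) Ez -(count_above (matched C) (leq0n n)).
  have -> : count (fun z => 0 < z) pre = size pre.
    apply/eqP; rewrite -all_count; apply/allP => z zp.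
    have : z \in col_z n C by rewrite Ez.
    by rewrite mem_filter mem_rev mem_iota; lia.
  rewrite Ep; have bn' : b.-1 <= n by lia.
  have -> : iota b (n.+1 - b) = iota b.-1.+1 (n - b.-1) by congr iota; lia.
  rewrite -(count_above (matched C) bn') => H.
  have sub : count (fun z => b.-1 < z) [seq z <- rev (iota 1 n) | matched C z] +
     size [seq t <- rev (iota 1 n) | (t < b) && matched C t] <=
     count (fun z => 0 < z) [seq z <- rev (iota 1 n) | matched C z].
    rewrite size_filter !count_filter -count_predUI [X in _ + X](_ : _ = 0) ?addn0; last first.
      rewrite (eq_count (a2 := pred0)) ?count_pred0 // => s /=; apply/negbTE; lia.
    apply: sub_count_in => s; rewrite mem_rev mem_iota /= => s0; lia.
  have s0 : size [seq t <- rev (iota 1 n) | (t < b) && matched C t] = 0 by lia.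
  have -> : pending C 0 = 0 by lia.
  by rewrite eqxx (size0nil s0).
have so := col_z_sorted C; rewrite Ez in so.
have pz : all (fun y => z < y) pre /\ all (fun y => y < z) zs.
  have tr : transitive gtn by move=> x y w /= ? ?; lia.
  move: so; rewrite (sorted_pairwise tr) pairwise_cat /= => /and3P [/allrelP H _ /andP [H' _]].
  by split=> //; apply/allP => y yp; apply: H; rewrite ?mem_head.
have {pz} [pz zz] := pz.
have zin : z \in col_z n C by rewrite Ez mem_cat mem_head orbT.
move: zin; rewrite mem_filter mem_rev mem_iota => /andP [prz zn].
have Zz : paired C z by [].
(* no matched letter lies between the next choice and b *)
have between s : 0 < s <= n -> s < b -> matched C s -> s < z.
  move=> sn sb ms; rewrite ltnNge; apply/negP => zs'.
  have ne : s <> z by move=> E; move: ms; rewrite E /matched paired_free.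
  have sn' : s <= n by lia.
  have := pending_count C sn'; rewrite -(count_above (paired C) sn').
  rewrite -/(col_z n C) Ez count_cat.
  have -> : count (fun y => s < y) (z :: zs) = 0.
    apply/eqP; rewrite -leqn0 leqNgt -has_count; apply/hasP => -[y].
    rewrite inE => /orP [/eqP -> /=|yz]; first by lia.
    by have := allP zz _ yz; rewrite /=; lia.
  have le1 := count_size (fun y => s < y) pre.
  have le2 : count (matched C) (iota b (n.+1 - b)) <= count (matched C) (iota s.+1 (n - s)).
    have -> : iota s.+1 (n - s) = iota s.+1 (b - s.+1) ++ iota b (n.+1 - b).
      have {2}-> : b = s.+1 + (b - s.+1) by lia.
      by rewrite -iotaD; congr iota; lia.
    by rewrite count_cat leq_addl.
  by have /andP [_ p0] := ms; lia.
rewrite [col_t_from _ _ _ _]/=; have := largest_freeP C (minn b z).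
case: (largest_free n C (minn b z)) => [t [tn tmin ft tmax]|none].
  have tb : t < b by lia.
  have tz : t < z by lia.
  have no s : t < s -> s < b -> ~~ matched C s.
    move=> ts sb; apply/negP => ms.
    have [sn|sn] := leqP s n; last first.
      by move: ms; rewrite /matched /pending (_ : n - s = 0) ?andbF //; lia.
    have sz : s < z by apply: between => //; lia.
    have : ~~ free C s by apply: tmax; lia.
    by have /andP [-> _] := ms.
  have tn' : t <= n by lia.
  have cnt : count (matched C) (iota t.+1 (n - t)) = size pre.
    rewrite Ep.
    have -> : iota t.+1 (n - t) = iota t.+1 (b - t.+1) ++ iota b (n.+1 - b).
      have {2}-> : b = t.+1 + (b - t.+1) by lia.
      by rewrite -iotaD; congr iota; lia.
    rewrite count_cat (eq_in_count (a2 := pred0)) ?count_pred0 // => s.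
    by rewrite mem_iota => Hs; apply/negbTE/no; lia.
  have mt : matched C t.
    rewrite /matched ft /=; have := pending_count C tn'.
    rewrite -(count_above (paired C) tn') -/(col_z n C) Ez count_cat cnt /= tz.
    have -> : count (fun y => t < y) pre = size pre.
      apply/eqP; rewrite -all_count; apply: sub_all pz => y /=; lia.
    by lia.
  rewrite (IH (rcons pre z) t) ?cat_rcons //; last 2 first.
  - by lia.
  - rewrite size_rcons; have -> : iota t (n.+1 - t) = t :: iota t.+1 (n - t).
      by have -> : n.+1 - t = (n - t).+1 by lia.
    by rewrite /= mt cnt.
  by case: eqP => //= _; rewrite (filter_head tn tb mt no).
case: eqP => // p0; exfalso.
have := pending_count C (leq0n n); rewrite p0 add0n.
rewrite -(count_above (paired C) (leq0n n)) -/(col_z n C) Ez.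
have -> : count (fun y => 0 < y) (pre ++ z :: zs) = size (pre ++ z :: zs).
  apply/eqP; rewrite -all_count; apply/allP => y; rewrite -Ez.
  by rewrite mem_filter mem_rev mem_iota; lia.
have -> : count (matched C) (iota 1 (n - 0)) = size pre.
  rewrite subn0 Ep; have En : iota 1 n = iota 1 b.-1 ++ iota b (n.+1 - b).
    have {2}-> : b = 1 + b.-1 by lia.
    by rewrite -iotaD; congr iota; lia.
  rewrite En count_cat (eq_in_count (a2 := pred0)) ?count_pred0 // => s.
  rewrite mem_iota => Hs; apply/negbTE/negP => ms.
  have sz : s < z by apply: between => //; lia.
  have : ~~ free C s by apply: none; lia.
  by have /andP [-> _] := ms.
by rewrite size_cat /=; lia.
Qed.

(** The letters t exist if and only if all brackets are closed, and they
    are the matched closing brackets. *)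
Lemma col_tE C : col_t n C = if pending C 0 == 0 then Some (matches C) else None.
Proof.
rewrite /col_t (col_t_fromE (pre := [::])) //.
- case: eqP => // _; congr Some; apply: eq_in_filter => t.
  by rewrite mem_rev mem_iota => Ht; have -> : t < n.+1 by lia.
- by lia.
- by rewrite subnn.
Qed.

End Column.

(** Sorting makes the result depend only on the sets of old and new
    letters. *)
Lemma replace_lettersP (old new C : seq nat) :
  uniq C -> uniq old -> uniq new -> size old = size new ->
  {subset old <= C} -> {in new, forall y, y \notin C} ->
  [/\ sorted ltn (replace_letters old new C), size (replace_letters old new C) = size C
    & forall y, (y \in replace_letters old new C) = (y \in C) && (y \notin old) || (y \in new)].
Proof.
move=> uC uo un sz sub dis.
pose f x := if x \in old then nth 0 new (index x old) else x.
have fnew x : x \in old -> f x \in new.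
  by move=> xo; rewrite /f xo mem_nth // -sz index_mem.
have mem y : (y \in map f C) = (y \in C) && (y \notin old) || (y \in new).
  apply/mapP/idP => [[x xC ->]|/orP [/andP [yC yo]|yn]].
  - have [xo|xo] := boolP (x \in old); first by rewrite fnew ?orbT.
    by rewrite /f (negPf xo) xC xo.
  - by exists y; rewrite // /f (negPf yo).
  have yi : index y new < size old by rewrite sz index_mem.
  exists (nth 0 old (index y new)); first by apply: sub; apply: mem_nth.
  by rewrite /f mem_nth // index_uniq // nth_index.
have inj : {in C &, injective f}.
  move=> x y xC yC; rewrite /f.
  case: ifP => xo; case: ifP => yo //.
  - move=> /eqP; rewrite nth_uniq // -?sz ?index_mem // => /eqP E.
    by rewrite -(nth_index 0 xo) E nth_index.
  - by move=> E; have := dis _ (mem_nth 0 (_ : index x old < size new)); rewrite -sz index_mem E yC => /(_ xo).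
  - by move=> E; have := dis _ (mem_nth 0 (_ : index y old < size new)); rewrite -sz index_mem -E xC => /(_ yo).
have um : uniq (map f C) by rewrite map_inj_in_uniq.
split.
- by rewrite ltn_sorted_uniq_leq sort_uniq um sort_sorted //; apply: leq_total.
- by rewrite size_sort size_map.
- by move=> y; rewrite mem_sort mem.
Qed.

(** The admissibility of a column in terms of brackets ([admissibleP]). *)
Definition col_ok n (C : seq nat) :=
  [/\ sorted ltn C, all (fun x => 1 <= x <= 2 * n) C, size C <= n & pending n C 0 = 0].

Section Column.
Variable n : nat.
Implicit Types (C : seq nat) (p : nat).

Lemma admissibleP C : reflect (col_ok n C) (admissible n C).
Proof.
rewrite /admissible col_tE; apply: (iffP and4P) => [[? ? ? H]|[? ? ? ->]] //.
by split=> //; move: H; case: eqP.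
Qed.

Lemma barK p : 1 <= p <= 2 * n -> bar n (bar n p) = p.
Proof. by rewrite /bar; lia. Qed.

Lemma mem_col_z C z : (z \in col_z n C) = (0 < z <= n) && paired n C z.
Proof. by rewrite mem_filter mem_rev mem_iota andbC; congr (_ && _); lia. Qed.

Lemma mem_matches C z : (z \in matches n C) = (0 < z <= n) && matched n C z.
Proof. by rewrite mem_filter mem_rev mem_iota andbC; congr (_ && _); lia. Qed.

Lemma size_matches C : pending n C 0 = 0 -> size (col_z n C) = size (matches n C).
Proof.
move=> p0; have := pending_count C (leq0n n); rewrite p0 add0n subn0.
by rewrite !size_filter !count_rev => ->.
Qed.

Section Ok.
Variable C : seq nat.
Hypothesis okC : col_ok n C.

Lemma col_uniq : uniq C.
Proof. by case: okC => so _ _ _; apply: sorted_uniq so; [apply: ltn_trans | apply: ltnn]. Qed.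

Lemma col_range x : x \in C -> 1 <= x <= 2 * n.
Proof. by case: okC => _ /allP H _ _ /H. Qed.

(** lC trades the unbarred letters of the pairs for the matched letters; rC
    trades the barred ones ([rcolP]). *)
Lemma lcolP :
  [/\ sorted ltn (lcol n C), size (lcol n C) = size C
    & forall y, (y \in lcol n C) =
      (y \in C) && ~~ ((y <= n) && paired n C y) || [&& 0 < y, y <= n & matched n C y]].
Proof.
have [so ra sz p0] := okC.
have [||||||H1 H2 H3] := @replace_lettersP (col_z n C) (matches n C) C.
- exact: col_uniq.
- by rewrite filter_uniq // rev_uniq iota_uniq.
- by rewrite filter_uniq // rev_uniq iota_uniq.
- exact: size_matches.
- by move=> z; rewrite mem_col_z => /andP [_ /andP []].
- by move=> z; rewrite mem_matches => /andP [_ /andP [/andP []]].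
rewrite /lcol col_tE p0 eqxx /=; split=> // y; rewrite H3 mem_col_z mem_matches.
case yC: (y \in C) => //=; last by rewrite andbA.
by have := col_range yC; case: (paired n C y); case: (matched n C y); lia.
Qed.

Lemma rcolP :
  [/\ sorted ltn (rcol n C), size (rcol n C) = size C
    & forall y, 1 <= y <= 2 * n -> (y \in rcol n C) =
      (y \in C) && ~~ ((n < y) && paired n C (bar n y)) || (n < y) && matched n C (bar n y)].
Proof.
have [so ra sz p0] := okC.
have inj s : all (fun x => 0 < x <= n) s -> uniq s -> uniq (map (bar n) s).
  move=> /allP H us; rewrite map_inj_in_uniq // => x y /H Hx /H Hy; rewrite /bar; lia.
have az : all (fun x => 0 < x <= n) (col_z n C).
  by apply/allP => z; rewrite mem_col_z => /andP [].
have am : all (fun x => 0 < x <= n) (matches n C).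
  by apply/allP => z; rewrite mem_matches => /andP [].
have mb (P : pred nat) s y : (forall z, (z \in s) = (0 < z <= n) && P z) -> 1 <= y <= 2 * n ->
    (y \in map (bar n) s) = (n < y) && P (bar n y).
  move=> H yn; apply/mapP/andP => [[z]|[ny Py]].
    rewrite H => /andP [zn Pz] ->; rewrite barK ?Pz; last by lia.
    by split=> //; rewrite /bar; lia.
  by exists (bar n y); rewrite ?barK // H Py andbT /bar; lia.
have [||||||H1 H2 H3] := @replace_lettersP (map (bar n) (col_z n C)) (map (bar n) (matches n C)) C.
- exact: col_uniq.
- by apply: inj az _; rewrite filter_uniq // rev_uniq iota_uniq.
- by apply: inj am _; rewrite filter_uniq // rev_uniq iota_uniq.
- by rewrite !size_map; apply: size_matches.
- by move=> z /mapP [y]; rewrite mem_col_z => /andP [_ /andP [_ yC]] ->.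
- by move=> z /mapP [y]; rewrite mem_matches => /andP [_ /andP [/andP [_ yC] _]] ->.
rewrite /rcol col_tE p0 eqxx /=; split=> // y yn.
rewrite H3 (mb (paired n C)) // ?(mb (matched n C)) //.
  exact: mem_matches.
exact: mem_col_z.
Qed.

Lemma mem_lcol p : 0 < p <= n ->
  (p \in lcol n C) = (p \in C) && ~~ paired n C p || matched n C p.
Proof. by move=> /andP [p0 pn]; have [_ _ ->] := lcolP; rewrite p0 pn. Qed.

Lemma mem_lcol_bar p : 0 < p <= n -> (bar n p \in lcol n C) = (bar n p \in C).
Proof.
move=> pn; have [_ _ ->] := lcolP; have -> : (bar n p <= n) = false by rewrite /bar; lia.
by rewrite andbF orbF andbT.
Qed.

Lemma mem_rcol p : 0 < p <= n -> (p \in rcol n C) = (p \in C).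
Proof.
move=> pn; have [_ _ ->] := rcolP; last by lia.
have -> : (n < p) = false by lia.
by rewrite /= andbT orbF.
Qed.

Lemma mem_rcol_bar p : 0 < p <= n ->
  (bar n p \in rcol n C) = (bar n p \in C) && ~~ paired n C p || matched n C p.
Proof.
move=> pn; have [_ _ ->] := rcolP; last by rewrite /bar; lia.
rewrite barK; last by lia.
by have -> : n < bar n p by rewrite /bar; lia.
Qed.

Lemma lcol_range x : x \in lcol n C -> 1 <= x <= 2 * n.
Proof.
have [_ _ H] := lcolP; rewrite H; case/orP; first by case/andP => /col_range.
by case/and3P => x0 xn _; lia.
Qed.

Lemma rcol_range x : x \in rcol n C -> 1 <= x <= 2 * n.
Proof.
rewrite /rcol col_tE; case: okC => _ _ _ ->; rewrite eqxx /= mem_sort => /mapP [y yC ->].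
case: ifP => yz; last exact: col_range.
have sz : size (map (bar n) (col_z n C)) = size (map (bar n) (matches n C)).
  by rewrite !size_map size_matches //; case: okC.
have : nth 0 (map (bar n) (matches n C)) (index y (map (bar n) (col_z n C))) \in map (bar n) (matches n C).
  by rewrite mem_nth // -sz index_mem.
by move=> /mapP [t]; rewrite mem_matches => /andP [tn _] ->; rewrite /bar; lia.
Qed.

End Ok.

End Column.

(** * Neighbouring columns of Kashiwara-Nakashima tableaux *)

(** Comparing columns entry by entry amounts to comparing how many letters
    at most a they have, which only depends on their sets of letters. *)
Definition count_upto (X : seq nat) (a : nat) : nat := count (fun x => x \in X) (iota 1 a).

Lemma count_uptoS X a : count_upto X a.+1 = count_upto X a + (a.+1 \in X).
Proof. by rewrite /count_upto -[in LHS](addn1 a) iotaD count_cat /= addn0 add1n. Qed.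

Lemma eq_count_upto X Y a : (forall x, 0 < x <= a -> (x \in X) = (x \in Y)) -> count_upto X a = count_upto Y a.
Proof.
move=> H; apply: eq_in_count => x; rewrite mem_iota => Hx; apply: H; lia.
Qed.

Definition col_le (X Y : seq nat) : Prop := forall a, count_upto Y a <= count_upto X a.

Lemma col_le_trans X Y Z : col_le X Y -> col_le Y Z -> col_le X Z.
Proof. by move=> H1 H2 a; apply: leq_trans (H2 a) (H1 a). Qed.

Lemma count_upto_ltn X a : sorted ltn X -> all (ltn 0) X ->
  count_upto X a = count (fun x => x < a.+1) X.
Proof.
elim: a => [|a IH] so pos.
  rewrite /count_upto /=; apply/esym/eqP; rewrite -leqn0 leqNgt -has_count.
  by apply/hasP => -[x xX]; have := allP pos x xX; rewrite /=; lia.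
rewrite count_uptoS IH //; have uX : uniq X.
  by apply: sorted_uniq so; [apply: ltn_trans | apply: ltnn].
rewrite -(count_uniq_mem a.+1 uX).
rewrite -count_predUI [X in _ + X](_ : _ = 0) ?addn0; last first.
  by rewrite (eq_count (a2 := pred0)) ?count_pred0 // => x /=; apply/negbTE; lia.
by apply: eq_count => x /=; lia.
Qed.

(** The r-th entry is at most a exactly when more than r letters are at
    most a. *)
Lemma col_leP X Y : sorted ltn X -> all (ltn 0) X -> sorted ltn Y -> all (ltn 0) Y ->
  col_le X Y <-> (forall r, r < size Y -> r < size X /\ nth 0 X r <= nth 0 Y r).
Proof.
move=> sX pX sY pY.
have lt_leq s : sorted ltn s -> sorted leq s by rewrite ltn_sorted_uniq_leq => /andP [].
have cX a r : (r < count_upto X a) = (r < size X) && (nth 0 X r <= a).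
  by rewrite count_upto_ltn // count_lt_sorted ?lt_leq.
have cY a r : (r < count_upto Y a) = (r < size Y) && (nth 0 Y r <= a).
  by rewrite count_upto_ltn // count_lt_sorted ?lt_leq.
split=> [H r rY|H a].
  have : r < count_upto X (nth 0 Y r) by apply: leq_trans (H _); rewrite cY rY leqnn.
  by rewrite cX => /andP [].
rewrite leqNgt; apply/negP => lt; have := lt; rewrite cY => /andP [rY le].
have [rX le'] := H _ rY.
have : count_upto X a < count_upto X a by rewrite {1}cX rX (leq_trans le' le).
by rewrite ltnn.
Qed.

Section Split.
Variables (n : nat) (C : seq nat).
Hypothesis okC : col_ok n C.

(** lC and rC differ by the brackets that are still open. *)
Lemma count_upto_split a : a <= 2 * n ->
  count_upto (lcol n C) a = count_upto (rcol n C) a + pending n C (minn a (2 * n - a)).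
Proof.
elim: a => [|a IH] an; first by rewrite min0n; case: okC => _ _ _ ->.
rewrite !count_uptoS IH; last exact: ltnW.
have [lt|ge] := ltnP a n.
  have pos : 0 < a.+1 <= n by lia.
  rewrite (mem_lcol okC pos) (mem_rcol okC pos).
  have := matched_step C pos; have -> : minn a (2 * n - a) = a by lia.
  have -> : minn a.+1 (2 * n - a.+1) = a.+1 by lia.
  rewrite /matched /paired /free /=.
  by case: (a.+1 \in C) => /=; case: (bar n a.+1 \in C) => /=; lia.
pose p := 2 * n - a.
have pos : 0 < p <= n by rewrite /p; lia.
have -> : a.+1 = bar n p by rewrite /bar /p; lia.
rewrite (mem_lcol_bar okC pos) (mem_rcol_bar okC pos).
have := matched_step C pos; have -> : minn a (2 * n - a) = p by rewrite /p; lia.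
have -> : minn (bar n p) (2 * n - bar n p) = p.-1 by rewrite /bar /p; lia.
rewrite /matched /paired /free /=.
by case: (p \in C) => /=; case: (bar n p \in C) => /=; lia.
Qed.

Lemma count_upto_out X a : (forall x, x \in X -> 1 <= x <= 2 * n) -> 2 * n <= a ->
  count_upto X a = count_upto X (2 * n).
Proof.
move=> H; elim: a => [|a IH] an; first by congr count_upto; lia.
move: an; rewrite leq_eqVlt => /orP [/eqP -> //|an].
rewrite count_uptoS IH // (_ : (a.+1 \in X) = false) ?addn0 //.
by apply/negbTE/negP => /H; lia.
Qed.

(** Counts of open brackets are nonnegative. *)
Lemma lcol_le_rcol : col_le (lcol n C) (rcol n C).
Proof.
move=> a; have [le|gt] := leqP a (2 * n); first by rewrite count_upto_split // leq_addr.
rewrite !(count_upto_out _ (ltnW gt)); [|exact: lcol_range|exact: rcol_range].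
by rewrite count_upto_split // leq_addr.
Qed.

Lemma count_upto_low a : a <= n -> count_upto C a = count_upto (rcol n C) a.
Proof. by move=> an; apply: eq_count_upto => x Hx; rewrite (mem_rcol okC) //; lia. Qed.

Lemma count_upto_high a : n <= a <= 2 * n -> count_upto C a = count_upto (lcol n C) a.
Proof.
have sz X : sorted ltn X -> (forall x, x \in X -> 1 <= x <= 2 * n) ->
    count_upto X (2 * n) = size X.
  move=> so H; rewrite count_upto_ltn //; last by apply/allP => x /H /=; lia.
  by apply/eqP; rewrite -all_count; apply/allP => x /H /=; lia.
have [so ra _ _] := okC; have [sl szl _] := lcolP okC.
have top : count_upto C (2 * n) = count_upto (lcol n C) (2 * n).
  by rewrite !sz // => x; [apply: (lcol_range okC) | apply: (col_range okC)].
move=> /andP [na an]; rewrite -(subKn an).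
have : 2 * n - a <= n by lia.
elim: (2 * n - a) => [|k IH] kn; first by rewrite subn0.
have E : 2 * n - k = (2 * n - k.+1).+1 by lia.
have := IH (ltnW kn); rewrite E !count_uptoS.
have pos : 0 < k.+1 <= n by lia.
have -> : (2 * n - k.+1).+1 = bar n k.+1 by rewrite /bar; lia.
by rewrite (mem_lcol_bar okC pos) => /addIn.
Qed.

End Split.

(** rC has the unbarred letters of C and lC has the barred ones, so C lies
    between lC and rC in the comparison, and rC below lD puts C below D. *)
Lemma col_le_split n C D : col_ok n C -> col_ok n D ->
  col_le (rcol n C) (lcol n D) -> col_le C D.
Proof.
move=> okC okD H a.
have main b : b <= 2 * n -> count_upto D b <= count_upto C b.
  move=> bn; have [le|gt] := leqP b n.
    rewrite (count_upto_low okC le) (count_upto_low okD le); apply: leq_trans (H b).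
    exact: lcol_le_rcol.
  have bb : n <= b <= 2 * n by lia.
  rewrite (count_upto_high okC bb) (count_upto_high okD bb); apply: leq_trans (H b) _.
  exact: lcol_le_rcol.
have [le|gt] := leqP a (2 * n); first exact: main.
rewrite (count_upto_out (col_range okC) (ltnW gt)) (count_upto_out (col_range okD) (ltnW gt)).
exact: main.
Qed.

Lemma transpose_semistandard (cols : seq (seq nat)) : is_partition (shape cols) ->
  semistandard (transpose cols) <->
  (forall c c' r, c < c' -> r < size (nth [::] cols c') ->
     nth 0 (nth [::] cols c) r <= nth 0 (nth [::] cols c') r) /\
  all (sorted ltn) cols.
Proof.
move=> pc; pose T := transpose cols.
have ET : T = mkseq (column cols) (width cols) by exact: transposeE.
have nT r : nth [::] T r = column cols r by exact: nth_transpose.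
have shT : shape T = mkseq (colh cols) (width cols).
  by rewrite ET /shape -map_comp; apply: eq_map => r; apply: size_column.
have pT : is_partition (shape T).
  rewrite shT; apply/andP; split.
    apply/(sortedP 0) => r; rewrite size_mkseq => lt.
    by rewrite !nth_mkseq ?(ltnW lt) //; apply: colh_mono.
  by apply/allP => l /mapP [r]; rewrite mem_iota /= => rw ->; rewrite colh_width.
have inT r c : (r < colh T c) = (r < size (nth [::] cols c)).
  by rewrite -(in_rowE pT) nT size_column -(in_rowE pc).
have eT r c : entry T (r, c) = nth 0 (nth [::] cols c) r.
  by rewrite /entry /= nT nth_column.
rewrite -/T (semistandardP pT); split=> -[H1 H2]; split.
- by move=> c c' r lt rc; have := H1 r c c' lt; rewrite inT !eT; apply.
- apply/allP => C /(nthP [::]) [c cc <-].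
  rewrite (sorted_pairwise ltn_trans); apply/(pairwiseP 0) => r r' /= _.
  by rewrite inE => rc lt; have := H2 r r' c lt; rewrite inT !eT; apply.
- by move=> r c c' lt; rewrite inT !eT; apply: H1.
- move=> r r' c lt; rewrite inT !eT => rc.
  have cc : c < size cols by rewrite ltnNge; apply/negP => ge; rewrite nth_default in rc.
  have := allP H2 _ (mem_nth [::] cc).
  rewrite (sorted_pairwise ltn_trans) => /(pairwiseP 0); apply=> //.
  by rewrite inE; apply: ltn_trans rc.
Qed.

Lemma nth_pairs (f g : seq nat -> seq nat) (L : seq (seq nat)) c :
  c < size L ->
  nth [::] (flatten [seq [:: f C; g C] | C <- L]) c.*2 = f (nth [::] L c) /\
  nth [::] (flatten [seq [:: f C; g C] | C <- L]) c.*2.+1 = g (nth [::] L c).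
Proof.
elim: L c => // C L IH [|c] //= H; have [<- <-] := IH c H.
by [].

Qed.

Lemma size_pairs (f g : seq nat -> seq nat) (L : seq (seq nat)) :
  size (flatten [seq [:: f C; g C] | C <- L]) = (size L).*2.
Proof. by elim: L => //= C L ->. Qed.

Lemma partition_nthP (s : seq nat) :
  (forall c, c.+1 < size s -> nth 0 s c.+1 <= nth 0 s c) -> (forall c, c < size s -> 0 < nth 0 s c) ->
  is_partition s.
Proof.
move=> H1 H2; apply/andP; split; first by apply/(sortedP 0) => c /H1.
by apply/(all_nthP 0).
Qed.

Section KN.
Variables (n : nat) (lam : seq nat).
Hypothesis plam : is_partition lam.

Definition kn_cols T :=
  [/\ shape T = lam, forall c, c < width T -> col_ok n (column T c)
    & forall c, c.+1 < width T -> col_le (rcol n (column T c)) (lcol n (column T c.+1))].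

Lemma kn_part T : kn_cols T -> is_partition (shape T).
Proof. by case=> ->. Qed.

Lemma column_out T c : is_partition (shape T) -> width T <= c -> column T c = [::].
Proof.
move=> pT wc; rewrite /column (_ : colh T c = 0) //; apply/eqP.
by rewrite -leqn0 leqNgt colh_width // -leqNgt.
Qed.

Lemma pos_range X m : (forall x, x \in X -> 1 <= x <= m) -> all (ltn 0) X.
Proof. by move=> H; apply/allP => x /H /andP []. Qed.

Section Split.
Variable T : tableau.
Hypothesis pT : is_partition (shape T).
Hypothesis ok : forall c, c < width T -> col_ok n (column T c).

Definition split_cols := flatten [seq [:: lcol n C; rcol n C] | C <- transpose T].

Lemma size_split : size split_cols = (width T).*2.
Proof. by rewrite size_pairs transposeE // size_mkseq. Qed.

Lemma nth_split s : s < (width T).*2 -> nth [::] split_cols s =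
  (if odd s then rcol n else lcol n) (column T s./2).
Proof.
move=> sw; have sz : size (transpose T) = width T by rewrite transposeE // size_mkseq.
have H : s./2 < size (transpose T) by rewrite sz; lia.
have [E0 E1] := nth_pairs (lcol n) (rcol n) H.
rewrite -[s in LHS]odd_double_half -nth_transpose //.
by case: (odd s); rewrite ?add1n ?add0n.
Qed.

Lemma split_col s : s < (width T).*2 ->
  [/\ sorted ltn (nth [::] split_cols s), all (ltn 0) (nth [::] split_cols s)
    & size (nth [::] split_cols s) = colh T s./2].
Proof.
move=> sw; rewrite nth_split //; have cw : s./2 < width T by lia.
have [sr szr _] := rcolP (ok cw); have [sl szl _] := lcolP (ok cw).
case: (odd s); split=> //; rewrite ?szr ?szl ?size_column //.
  exact: pos_range (rcol_range (ok cw)).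
exact: pos_range (lcol_range (ok cw)).
Qed.

Lemma split_partition : is_partition (shape split_cols).
Proof.
apply: partition_nthP => s; rewrite size_map size_split => sw.
  rewrite !(nth_map [::]) ?size_split ?(ltnW sw) //.
  have [_ _ ->] := split_col sw; have [_ _ ->] := split_col (ltnW sw).
  by apply: colh_mono; lia.
rewrite (nth_map [::]) ?size_split //; have [_ _ ->] := split_col sw.
by rewrite colh_width //; lia.
Qed.

(** Inside a pair lC is below rC, so only the comparison of rC with the
    next lC is a condition. *)
Lemma split_semistandard : semistandard (split_tableau n T) <->
  forall c, c.+1 < width T -> col_le (rcol n (column T c)) (lcol n (column T c.+1)).
Proof.
rewrite /split_tableau -/split_cols (transpose_semistandard split_partition).
have leP s s' : s' < (width T).*2 -> s < (width T).*2 -> s <= s' ->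
    col_le (nth [::] split_cols s) (nth [::] split_cols s') <->
    (forall r, r < size (nth [::] split_cols s') ->
      nth 0 (nth [::] split_cols s) r <= nth 0 (nth [::] split_cols s') r).
  move=> sw' sw le; have [so po sz] := split_col sw; have [so' po' sz'] := split_col sw'.
  rewrite (col_leP so po so' po'); split=> H r rs; first by case: (H r rs).
  by split; [rewrite sz; rewrite sz' in rs; apply: leq_trans rs (colh_mono _ _); lia | exact: H].
split=> [[H _] c cw|H].
  have sw : c.*2.+1 < (width T).*2 by lia.
  have sw' : c.*2.+2 < (width T).*2 by lia.
  have := (leP _ _ sw' sw (leqnSn _)).2 (fun r => H _ _ r (ltnSn _)).
  rewrite !nth_split // ?oddS /= ?odd_double /=.
  by rewrite ?uphalf_double ?doubleK.
split; last first.
  by apply/(all_nthP [::]) => s; rewrite size_split => /split_col [].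
have step s : s.+1 < (width T).*2 ->
    col_le (nth [::] split_cols s) (nth [::] split_cols s.+1).
  move=> sw; rewrite !nth_split ?(ltnW sw) //=.
  case os : (odd s) => /=; rewrite ?uphalf_half os /=.
    by apply: H; lia.
  by apply: lcol_le_rcol; apply: ok; lia.
move=> s s' r lt rs.
have sw' : s' < (width T).*2.
  by rewrite ltnNge; apply/negP => ge; rewrite nth_default ?size_split in rs.
apply: (leP s s' sw' (ltn_trans lt sw') (ltnW lt)).1 r rs.
elim: s' lt sw' => // s' IH; rewrite ltnS leq_eqVlt => /orP [/eqP ->|lt] sw'; first exact: step.
by apply: col_le_trans (IH lt (ltnW sw')) _; apply: step.
Qed.

End Split.

(** The entries of T itself are compared by [col_le_split], so
    semistandardness of T follows from that of the split tableau. *)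
Lemma KNP T : KN lam n T <-> kn_cols T.
Proof.
split.
  move=> /and3P [ss /allP ad sp]; have sh : shape T = lam by have /and3P [/eqP] := ss.
  have pT : is_partition (shape T) by rewrite sh.
  have ok c : c < width T -> col_ok n (column T c).
    move=> cw; apply/admissibleP/ad; rewrite transposeE //; apply/mapP.
    by exists c; rewrite // mem_iota.
  by split=> //; apply/(split_semistandard pT ok).
move=> K; have pT := kn_part K; have [sh ok le] := K.
apply/and3P; split; last by apply/split_semistandard.
  apply/and3P; split; first exact/eqP.
    apply/allP => x /flattenP [row /(nthP [::]) [r rT <-]] /(nthP 0) [c cr <-].
    have rc : r < colh T c by rewrite -in_rowE.
    have cw : c < width T by rewrite -colh_width //; apply: leq_ltn_trans rc.
    apply: (col_range (ok c cw)); rewrite -[nth 0 _ c]/(entry T (r, c)) -nth_column //.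
    by rewrite mem_nth // size_column.
  apply/semistandardP => //; split=> [r c c' lt rc|r r' c lt rc].
    have cw' : c' < width T by rewrite -colh_width //; apply: leq_ltn_trans rc.
    have cle : col_le (column T c) (column T c').
      elim: c' lt cw' {rc} => // d IH; rewrite ltnS leq_eqVlt => lt dw.
      have st : col_le (column T d) (column T d.+1).
        by apply: (col_le_split (ok _ (ltnW dw)) (ok _ dw)); apply: le.
      case/orP: lt => [/eqP -> //|lt]; exact: col_le_trans (IH lt (ltnW dw)) st.
    have cw : c < width T by apply: ltn_trans cw'.
    have [so _ _ _] := ok _ cw; have [so' _ _ _] := ok _ cw'.
    have := (col_leP so (pos_range (col_range (ok _ cw))) so' (pos_range (col_range (ok _ cw')))).1 cle r.
    by rewrite size_column !nth_column // => /(_ rc) [].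
  have cw : c < width T by rewrite -colh_width //; apply: leq_ltn_trans rc.
  have [so _ _ _] := ok _ cw; move: so.
  rewrite (sorted_pairwise ltn_trans) => /(pairwiseP 0) /(_ r r').
  by rewrite !inE size_column !nth_column //; apply => //; apply: ltn_trans rc.
apply/allP => C; rewrite transposeE // => /mapP [c]; rewrite mem_iota => /= cw ->.
by apply/admissibleP; apply: ok.
Qed.

End KN.

(** * The type C operators on half columns *)

Lemma flatten_pairs (T : Type) (w ws : nat -> seq T) a d :
  (forall c, w c = ws c.*2.+1 ++ ws c.*2) ->
  flatten [seq w c | c <- rev (iota a d)] = flatten [seq ws s | s <- rev (iota a.*2 d.*2)].
Proof.
move=> H; elim: d a => //= d IH a.
by rewrite !rev_cons !map_rcons !flatten_rcons -doubleS IH H -catA.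
Qed.

Lemma sorted_split n (C : seq nat) : sorted ltn C ->
  C = [seq x <- C | x <= n] ++ [seq x <- C | n < x].
Proof.
elim: C => //= a C IH so; have so' := path_sorted so.
have al : all (ltn a) C by move: so; rewrite path_sortedE; [case/andP | exact: ltn_trans].
have [an|an] := leqP a n; first by rewrite {1}IH.
have -> : [seq x <- C | x <= n] = [::].
  apply/eqP; rewrite -size_eq0 size_filter -leqn0 leqNgt -has_count.
  by apply/hasP => -[x /(allP al) /=]; lia.
by rewrite /= [in RHS](eq_in_filter (a2 := predT)) ?filter_predT // => x /(allP al) /=; lia.
Qed.

Section Half.
Variables (n i : nat).
Hypothesis i_pos : 0 < i <= n.
Implicit Types (C : seq nat) (D : nat -> seq nat).

(** For i < n the letters at most n and the larger ones of a column are two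
    independent words for signs: in the first only i and i+1 have signs, in
    the second only bar(i+1) = 2n-i and bar i = 2n-i+1. For i = n the
    letters n and n+1 = bar n are the only ones, and the column is kept
    whole in the first half. *)
Definition half (s : nat) C : seq nat :=
  if odd s then (if i < n then [seq x <- C | x <= n] else C)
  else (if i < n then [seq x <- C | n < x] else [::]).
(** In either half the sign + is that of [letter s] and the sign - that of
    its successor, as in type A. *)
Definition letter (s : nat) : nat := if odd s then i else 2 * n - i.
Definition half_sign D (s : nat) : option bool :=
  if odd s || (i < n) then sign_of (letter s) (mem (D s./2)) else None.

Lemma cat_half c C : sorted ltn C -> half c.*2.+1 C ++ half c.*2 C = C.
Proof.
move=> so; rewrite /half /= odd_double; case: (i < n); first by rewrite -sorted_split.
by rewrite /= cats0.
Qed.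

Lemma half_letter s C x : sorted ltn C -> x \in half s C ->
  x <> letter s -> x <> (letter s).+1 -> signC n i x = None.
Proof.
move=> so; rewrite /half /letter /signC /bar.
by case: ltnP => lt; case: (odd s); rewrite ?mem_filter => Hx; do ![case: eqP => //=]; lia.
Qed.

Lemma mem_half s C a : odd s || (i < n) ->
  (letter s <= a <= (letter s).+1) -> (a \in half s C) = (a \in C).
Proof.
rewrite /half /letter; case: ltnP => lt; case: (odd s); rewrite ?mem_filter //= => _ Ha.
  by have -> : a <= n by lia.
by have -> : n < a by lia.
Qed.

Lemma signC_letter s : signC n i (letter s) = Some true /\ signC n i (letter s).+1 = Some false.
Proof.
rewrite /signC /letter /bar.
by case: (odd s); split; do ![case: eqP => //=]; lia.
Qed.

Lemma half_acts s C : sorted ltn C ->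
  acts_as [seq signC n i x | x <- half s C]
    (if odd s || (i < n) then sign_of (letter s) (mem C) else None).
Proof.
move=> so; case: ifP => Hs; last first.
  have -> : half s C = [::] by move: Hs; rewrite /half; case: (odd s); case: (i < n).
  by split.
have E : sign_of (letter s) (mem C) = sign_of (letter s) (mem (half s C)).
  by rewrite /sign_of /= !mem_half // leqnn leqnSn.
rewrite E; have -> : [seq signC n i x | x <- half s C] = [seq signA (letter s) x | x <- half s C].
  apply/eq_in_map => x xh; rewrite /signA; have [S1 S2] := signC_letter s.
  case: (x =P letter s) => [->//|ne]; case: (x =P (letter s).+1) => [->//|ne'].
  exact: half_letter xh ne ne'.
apply: acts_as_signA; rewrite /half.
by case: (odd s); case: (i < n) => //; apply: sorted_filter => //; apply: ltn_trans.
Qed.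

(** The acting letter is the only letter of its half with a sign. *)
Lemma half_at s C b : sorted ltn C -> odd s || (i < n) ->
  sign_of (letter s) (mem C) = Some b ->
  exists U V, let a := if b then letter s else (letter s).+1 in
    [/\ half s C = U ++ a :: V, signC n i a = Some b &
        forall x, x \in U ++ V -> signC n i x = None].
Proof.
move=> so Hs sg; set a := if b then _ else _.
have Ea : letter s <= a <= (letter s).+1 by rewrite /a; case: (b); rewrite leqnn ?leqnSn.
have aC : a \in C.
  by rewrite /a; case: (b) sg => [/sign_of_plus []|/sign_of_minus []].
have ah : a \in half s C by rewrite mem_half.
have uC : uniq (half s C).
  apply: (subseq_uniq (s2 := C)); last by apply: sorted_uniq so; [apply: ltn_trans | apply: ltnn].
  by rewrite /half; case: (odd s); case: (i < n); rewrite ?filter_subseq ?sub0seq.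
have [U [V EC]] : exists U V, half s C = U ++ a :: V.
  by case: (path.splitPr ah) => U V; exists U, V.
exists U, V; split=> //=.
  by rewrite /a; have [? ?] := signC_letter s; case: (b).
move=> x xUV; rewrite EC in uC.
have xa : x <> a.
  by move=> E; move: uC; rewrite -cat_rcons -cats1 -catA uniq_catCA /= -E xUV.
have xh : x \in half s C by rewrite EC mem_cat inE; move: xUV; rewrite mem_cat => /orP [->|->]; rewrite ?orbT.
have other : (if b then (letter s).+1 else letter s) \notin C.
  by case: (b) sg => [/sign_of_plus []|/sign_of_minus []] /= _ /negbT.
have xC : x \in C.
  by move: xh; rewrite /half; case: (odd s); case: (i < n); rewrite ?mem_filter //= => /andP [].
apply: (half_letter so xh) => E; move: other xa; rewrite /a; case: (b); rewrite -?E //.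
  by rewrite xC.
by rewrite xC.
Qed.

End Half.

Definition subst (a b : nat) (C : seq nat) : seq nat :=
  [seq (if x == a then b else x) | x <- C].

Section Action.
Variables (n i M : nat) (T : tableau).
Hypothesis i_pos : 0 < i <= n.
Hypothesis pT : is_partition (shape T).
Hypothesis wM : width T <= M.
Hypothesis so : forall c, sorted ltn (column T c).

Notation g := (half_sign n i (column T)).
Notation word := (signs (signC n i) (entry T) (reading_cells T)).

Lemma half_word a d :
  flatten [seq [seq signC n i x | x <- column T c] | c <- rev (iota a d)] =
  flatten [seq [seq signC n i x | x <- half n i s (column T s./2)] | s <- rev (iota a.*2 d.*2)].
Proof.
apply: (flatten_pairs (ws := fun s => [seq signC n i x | x <- half n i s (column T s./2)])) => c.
by rewrite -map_cat /= uphalf_double doubleK cat_half.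
Qed.

Lemma phi_half a d :
  phi (flatten [seq [seq signC n i x | x <- column T c] | c <- rev (iota a d)]) =
  phi_from g a.*2 d.*2.
Proof. by rewrite half_word; apply: phi_flatten => s _; apply: half_acts. Qed.

Lemma eps_half d :
  eps (flatten [seq [seq signC n i x | x <- column T c] | c <- rev (iota 0 d)]) =
  eps_below g d.*2.
Proof. by rewrite half_word; apply: eps_flatten => s _; apply: half_acts. Qed.

Lemma phi_word : phi word = phi_from g 0 M.*2.
Proof. by rewrite (signs_reading pT wM) phi_half. Qed.

Lemma eps_word : eps word = eps_below g M.*2.
Proof. by rewrite (signs_reading pT wM) eps_half. Qed.

Lemma phi_Nones (l : seq (option bool)) x : (forall o, o \in l -> o = None) ->
  foldl (fun p o => push_right o p) x l = x.
Proof.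
elim: l x => //= o l IH x H; rewrite IH; first by rewrite (H o) // mem_head.
by move=> o' o'l; apply: H; rewrite inE o'l orbT.
Qed.

Lemma eps_Nones (l : seq (option bool)) x : (forall o, o \in l -> o = None) ->
  foldr push_left x l = x.
Proof.
elim: l => //= o l IH H; rewrite IH; first by rewrite (H o) // mem_head.
by move=> o' o'l; apply: H; rewrite inE o'l orbT.
Qed.

(** The counterpart of [acts_balanced] for halves of columns. *)
Lemma half_balanced b s : acts_at M.*2 g b s ->
  let a := if b then letter n i s else (letter n i s).+1 in
  exists r, [/\ r < colh T s./2, entry T (r, s./2) = a, signC n i a = Some b
    & balanced_at (signC n i) (entry T) (reading_cells T) (r, s./2)].
Proof.
move=> [sM gs p0 e0] a; set c := s./2; set C := column T c.
have Hs : odd s || (i < n) by move: gs; rewrite /half_sign; case: ifP.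
have sgs : sign_of (letter n i s) (mem C) = Some b by move: gs; rewrite /half_sign Hs.
have [U [V [EC sa none]]] := half_at i_pos (so c) Hs sgs.
rewrite -/a in EC sa.
pose pre := if odd s then [::] else half n i c.*2.+1 C.
pose post := if odd s then half n i c.*2 C else [::].
have Ecol : C = (pre ++ U) ++ a :: (V ++ post).
  rewrite -[LHS](cat_half n i c (so c)) /pre /post.
  have [os|os] := boolP (odd s).
    have Es : s = c.*2.+1 by rewrite /c; lia.
    by rewrite /= -Es EC -catA.
  have Es : s = c.*2 by rewrite /c; lia.
  by rewrite -[X in _ ++ X]/(half n i c.*2 C) -Es EC cats0 -catA.
pose r := size (pre ++ U).
have rc : r < colh T c by rewrite -(size_column T) -/C Ecol size_cat /= -/r; lia.
have Er : entry T (r, c) = a by rewrite -nth_column // -/C Ecol nth_cat ltnn subnn.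
exists r; split=> //; apply: (balanced_column pT wM rc).
  rewrite -/C [X in take _ X]Ecol take_size_cat // map_cat.
  rewrite /phi !foldl_cat -/(phi _) phi_half.
  rewrite [LHS]phi_Nones; last by move=> o /mapP [x xU ->]; apply: none; rewrite mem_cat xU.
  have [os|os] := boolP (odd s).
    rewrite /pre os /=; have -> : c.+1.*2 = s.+1 by rewrite /c; lia.
    by rewrite -[RHS]p0; congr phi_from; lia.
  have Es : s = c.*2 by rewrite /c; lia.
  rewrite /pre (negPf os); have [_ ->] := half_acts i_pos c.*2.+1 (so c).
  rewrite -[RHS]p0.
  have -> : M.*2 - s.+1 = (M - c.+1).*2.+1 by rewrite /c; lia.
  rewrite Es /=; congr push_right.
  by rewrite /half_sign /= uphalf_double.
rewrite -/C [X in drop _ X]Ecol -cat_rcons drop_size_cat; last by rewrite size_rcons.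
rewrite map_cat -catA /eps foldr_cat eps_Nones; last first.
  by move=> o /mapP [x xV ->]; apply: none; rewrite mem_cat xV orbT.
rewrite foldr_cat -/(eps _) eps_half.
have [os|os] := boolP (odd s).
  have Es : s = c.*2.+1 by rewrite /c; lia.
  rewrite /post os; have [-> _] := half_acts i_pos c.*2 (so c).
  by rewrite -[RHS]e0 Es /= /half_sign doubleK.
have Es : s = c.*2 by rewrite /c; lia.
by rewrite /post (negPf os) /= -Es.
Qed.

Lemma column_set r c a : r < colh T c ->
  shape (set_entry T (r, c) a) = shape T /\
  forall c', column (set_entry T (r, c) a) c' =
    if c' == c then subst (entry T (r, c)) a (column T c) else column T c'.
Proof.
move=> rc; have cr : c < size (nth [::] T r) by rewrite in_rowE.
have Es := shape_set a cr; split=> // c'.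
have hE d : colh (set_entry T (r, c) a) d = colh T d.
  by rewrite /colh -!(count_map size (fun l => d < l)) -!/(shape _) Es.
rewrite /column hE; case: eqP => [->|ne].
  rewrite /subst -map_comp; apply/eq_in_map => r'; rewrite mem_iota => /= r'c.
  rewrite entry_set updE xpair_eqE eqxx andbT.
  have u : uniq (column T c) by apply: sorted_uniq (so c); [apply: ltn_trans | apply: ltnn].
  rewrite -(nth_column pT c r') -(nth_column pT c r) nth_uniq ?size_column //.
apply/eq_in_map => r' _; rewrite entry_set updE xpair_eqE.
by have /eqP/negPf -> := ne; rewrite andbF.
Qed.

(** f_i raises the letter of the half column at which the sequence of signs
    of half columns acts. *)
Lemma fC_step : match fC n i T with
  | Some T' => shape T' = shape T /\ exists2 s, acts_at M.*2 g true s &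
      forall c, column T' c = if c == s./2
        then subst (letter n i s) (letter n i s).+1 (column T c) else column T c
  | None => forall s, ~ acts_at M.*2 g true s
  end.
Proof.
rewrite /fC /act; have := leftmost_plusP (signC n i) T.
case: (leftmost_plus _ _) => [x [sx B]|p0 s A]; last first.
  have : 0 < phi_from g 0 M.*2 by apply/acts_plusP; exists s.
  by rewrite -phi_word p0.
have : 0 < phi_from g 0 M.*2.
  have [u [v [E pu ev]]] := B; rewrite -phi_word E.
  by rewrite signs_cat phi_cat /= phi_cons eps_cons -/(signs _ _ v) sx pu ev /=; lia.
move=> /acts_plusP [s A]; have [r [rc Er sa B']] := half_balanced A.
rewrite -Er in sa; have <- := balanced_uniq sa sx B' B.
have [Es Ec] := column_set (entry T (r, s./2)).+1 rc; split=> //.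
by exists s => // c; rewrite Ec Er; case: eqP => // ->.
Qed.

Lemma eC_step : match eC n i T with
  | Some T' => shape T' = shape T /\ exists2 s, acts_at M.*2 g false s &
      forall c, column T' c = if c == s./2
        then subst (letter n i s).+1 (letter n i s) (column T c) else column T c
  | None => forall s, ~ acts_at M.*2 g false s
  end.
Proof.
rewrite /eC /act; have := rightmost_minusP (signC n i) T.
case: (rightmost_minus _ _) => [x [sx B]|p0 s A]; last first.
  have : 0 < eps_below g M.*2 by apply/acts_minusP; exists s.
  by rewrite -eps_word p0.
have : 0 < eps_below g M.*2.
  have [u [v [E pu ev]]] := B; rewrite -eps_word E.
  by rewrite signs_cat eps_cat /= eps_cons -/(signs _ _ v) sx pu ev /=; lia.
move=> /acts_minusP [s A]; have [r [rc Er sa B']] := half_balanced A.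
rewrite -Er in sa; have <- := balanced_uniq sa sx B' B.
have [Es Ec] := column_set (entry T (r, s./2)).-1 rc; split=> //.
by exists s => // c; rewrite Ec Er; case: eqP => // ->.
Qed.

End Action.

(** * Moving one letter of an admissible column *)

Definition moved (a : nat) (X X' : seq nat) : Prop :=
  [/\ a \in X, a.+1 \notin X & forall x, (x \in X') = (x == a.+1) || (x \in X) && (x != a)].

Lemma mem_subst a b X x : (x \in subst a b X) =
  (x \in X) && (x != a) || (x == b) && (a \in X).
Proof.
apply/mapP/orP => [[y yX ->]|[/andP [xX /negPf xa]|/andP [/eqP -> aX]]].
- by case: (y =P a) yX => [->|/eqP ya] yX; [right; rewrite eqxx | left; rewrite yX].
- by exists x; rewrite ?xa.
- by exists a; rewrite ?eqxx.
Qed.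

Lemma sorted_subst a b X : sorted ltn X -> (b = a.+1 \/ a = b.+1) -> b \notin X ->
  sorted ltn (subst a b X).
Proof.
move=> so ab bX; have so' : pairwise ltn X by rewrite -(sorted_pairwise ltn_trans).
rewrite (sorted_pairwise ltn_trans) pairwise_map.
elim: X bX so' {so} => //= y X IH; rewrite inE negb_or => /andP [by' bX] /andP [al so].
rewrite IH // andbT; apply/allP => x xX; have := allP al x xX => /= yx.
have xb : x <> b by move=> E; rewrite -E xX in bX.
by case: eqP => ya; case: eqP => xa; move: by'; lia.
Qed.

Lemma size_subst a b X : size (subst a b X) = size X.
Proof. exact: size_map. Qed.

Lemma subst_moved a X : a \in X -> a.+1 \notin X -> moved a X (subst a a.+1 X).
Proof.
by move=> aX aX'; split=> // x; rewrite mem_subst aX andbT orbC.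
Qed.

(** [subst] on a column that does not contain the new letter is invertible. *)
Lemma subst_back a b X : a \in X -> b \notin X -> subst b a (subst a b X) = X.
Proof.
move=> aX bX; rewrite /subst -map_comp -[RHS]map_id; apply/eq_in_map => x xX /=.
case: (x =P a) => [->|ne]; first by rewrite eqxx.
by case: eqP => // E; rewrite -E xX in bX.
Qed.

Lemma moved_subst a X X' : sorted ltn X -> sorted ltn X' -> moved a X X' -> X' = subst a a.+1 X.
Proof.
move=> so so' [aX aX' H]; apply: (irr_sorted_eq ltn_trans ltnn so').
  by apply: sorted_subst => //; left.
by move=> x; rewrite H mem_subst aX andbT orbC.
Qed.

Lemma moved_at a X X' : moved a X X' -> [/\ (a \in X) = true, (a.+1 \in X) = false,
  (a \in X') = false & (a.+1 \in X') = true].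
Proof.
by move=> [aX /negPf aX' H]; split=> //; rewrite H ?eqxx // andbF orbF; lia.
Qed.

Lemma moved_other a X X' x : moved a X X' -> x <> a -> x <> a.+1 -> (x \in X') = (x \in X).
Proof.
move=> [_ _ H] xa xa1; rewrite H; have -> : (x == a.+1) = false by lia.
by have -> : x != a by [lia]; rewrite andbT.
Qed.

Lemma subst_ok n C C' a b : col_ok n C -> (b = a.+1 \/ a = b.+1) -> 0 < b <= 2 * n -> b \notin C ->
  C' = subst a b C -> pending n C 0 = pending n C' 0 -> col_ok n C'.
Proof.
move=> okC ab bn bC E Ep; have [so /allP ra sz p0] := okC; split; last first.
- by rewrite -Ep.
- by rewrite E size_subst.
- apply/allP => x; rewrite E mem_subst => /orP [/andP [/ra //]|/andP [/eqP -> _]].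
  by [].
- by rewrite E; apply: sorted_subst.
Qed.

Section Local.
Variables (n : nat).
Implicit Types (C X : seq nat).

(** The complement of the bars of X, a column of height 2n minus that of X;
    moving 2n-a in X moves a in it. *)
Definition dual X : seq nat := [seq x <- iota 1 (2 * n) | bar n x \notin X].

Lemma mem_dual X x : (x \in dual X) = (0 < x <= 2 * n) && (bar n x \notin X).
Proof. by rewrite mem_filter mem_iota andbC; congr (_ && _); lia. Qed.

Lemma sorted_dual X : sorted ltn (dual X).
Proof. by apply: sorted_filter; [apply: ltn_trans | apply: iota_ltn_sorted]. Qed.

Lemma pending_below C C' p q : p <= q <= n -> pending n C q = pending n C' q ->
  (forall s, p < s <= q -> mark n C s = mark n C' s) -> pending n C p = pending n C' p.
Proof.
move=> /andP [pq qn] E; rewrite -(subKn pq).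
elim: (q - p) (leq_subr p q) => [|k IH] kq H; first by rewrite subn0.
have pos : 0 < q - k <= n by lia.
have -> : q - k.+1 = (q - k).-1 by lia.
rewrite !pendingE // H; last by lia.
by rewrite IH //; [lia | move=> s Hs; apply: H; lia].
Qed.

Lemma pending_above C C' p : p <= n ->
  (forall s, p < s <= n -> mark n C s = mark n C' s) -> pending n C p = pending n C' p.
Proof. by move=> pn; apply: pending_below; rewrite ?pending_n // pn leqnn. Qed.

Variable i : nat.
Hypothesis i_pos : 0 < i < n.

(** The letters that f_i and f_(2n-i) can see: i, i+1 and their bars 2n-i+1
    and 2n-i. The rest of the column only matters through the number of
    pending brackets. *)
Definition window X : seq bool :=
  [:: i \in X; i.+1 \in X; 2 * n - i \in X; (2 * n - i).+1 \in X].

Definition away x := [&& x != i, x != i.+1, x != 2 * n - i & x != (2 * n - i).+1].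
Definition agree_away X X' := forall x, away x -> (x \in X) = (x \in X').

Lemma window_cases x : ~~ away x ->
  [\/ x = i, x = i.+1, x = 2 * n - i | x = (2 * n - i).+1].
Proof.
rewrite /away; case: (x =P i) => [?|_]; first by constructor 1.
case: (x =P i.+1) => [?|_]; first by constructor 2.
case: (x =P 2 * n - i) => [?|_]; first by constructor 3.
by case: (x =P (2 * n - i).+1) => [?|_] // _; constructor 4.
Qed.

Lemma window_eq X X' : agree_away X X' -> window X = window X' -> X =i X'.
Proof.
move=> ag [E1 E2 E3 E4] x; have [/ag //|/window_cases] := boolP (away x).
by case=> ->.
Qed.

Lemma window_moved_low X X' b c : agree_away X X' ->
  window X = [:: true; false; b; c] -> window X' = [:: false; true; b; c] -> moved i X X'.
Proof.
move=> ag [E1 E2 E3 E4] [F1 F2 F3 F4]; split=> [||x]; rewrite ?E1 ?E2 //.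
have [aw|/window_cases] := boolP (away x).
  by rewrite -ag //; have /and4P [/negPf -> /negPf -> _ _] := aw; rewrite andbT.
by case=> ->; rewrite ?E1 ?E2 ?E3 ?E4 ?F1 ?F2 ?F3 ?F4; case: b {E3 F3}; case: c {E4 F4}; lia.
Qed.

Lemma window_moved_high X X' b c : agree_away X X' ->
  window X = [:: b; c; true; false] -> window X' = [:: b; c; false; true] ->
  moved (2 * n - i) X X'.
Proof.
move=> ag [E1 E2 E3 E4] [F1 F2 F3 F4]; split=> [||x]; rewrite ?E3 ?E4 //.
have [aw|/window_cases] := boolP (away x).
  by rewrite -ag //; have /and4P [_ _ /negPf -> /negPf ->] := aw; rewrite andbT.
by case=> ->; rewrite ?E1 ?E2 ?E3 ?E4 ?F1 ?F2 ?F3 ?F4; case: b {E1 F1}; case: c {E2 F2}; lia.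
Qed.

(** The moves of i and of 2n-i are independent, and are listed in the order
    in which the operators are applied. *)
Lemma window_moved_both X X' : agree_away X X' ->
  window X = [:: true; false; true; false] -> window X' = [:: false; true; false; true] ->
  let X1 := subst (2 * n - i) (2 * n - i).+1 X in
  moved (2 * n - i) X X1 /\ moved i X1 X'.
Proof.
move=> ag FX FX'; set X1 := subst _ _ X; have [E1 E2 E3 E4] := FX.
have ag1 : agree_away X X1.
  move=> x /and4P [_ _ /negPf xi /negPf xi1]; rewrite mem_subst xi xi1 /=.
  by rewrite andbT orbF.
have F1 : window X1 = [:: true; false; false; true].
  rewrite /window !mem_subst E1 E2 E3 E4 !andbT /=.
  by congr [:: _; _; _; _]; lia.
split; first exact: (window_moved_high ag1 FX F1).
by apply: (window_moved_low _ F1 FX') => x aw; rewrite -ag1 ?ag.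
Qed.

(** The letters of rC among i, i+1, 2n-i, 2n-i+1 as a function of those of
    C, called a1, a2, b2, b1, and of the number p of brackets pending at
    i+1; [p1] is the number pending at i. *)
Definition rcol_window (a1 a2 b2 b1 : bool) (p : nat) : seq bool :=
  let p1 := if a2 && b2 then p.+1 else if ~~ a2 && ~~ b2 then p.-1 else p in
  [:: a1; a2; b2 && ~~ a2 || [&& ~~ a2, ~~ b2 & 0 < p];
      b1 && ~~ a1 || [&& ~~ a1, ~~ b1 & 0 < p1]].
(** The same for the complement of the bars of lC. *)
Definition dual_window (a1 a2 b2 b1 : bool) (p : nat) : seq bool :=
  let p1 := if a2 && b2 then p.+1 else if ~~ a2 && ~~ b2 then p.-1 else p in
  [:: ~~ b1; ~~ b2; ~~ (a2 && ~~ b2 || [&& ~~ a2, ~~ b2 & 0 < p]);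
      ~~ (a1 && ~~ b1 || [&& ~~ a1, ~~ b1 & 0 < p1])].

Lemma bar_low : bar n i = (2 * n - i).+1 /\ bar n i.+1 = 2 * n - i.
Proof. by rewrite /bar; lia. Qed.

Lemma bar_high : bar n (2 * n - i).+1 = i /\ bar n (2 * n - i) = i.+1.
Proof. by rewrite /bar; lia. Qed.

Section Columns.
Variable C : seq nat.
Hypothesis okC : col_ok n C.

Lemma pending_pred : pending n C i =
  if (i.+1 \in C) && (2 * n - i \in C) then (pending n C i.+1).+1
  else if (i.+1 \notin C) && (2 * n - i \notin C) then (pending n C i.+1).-1
  else pending n C i.+1.
Proof.
have pos : 0 < i.+1 <= n by lia.
have := pendingE C pos; rewrite /= => ->; rewrite /mark /paired /free.
have [_ ->] := bar_low.
by case: (i.+1 \in C); case: (_ \in C).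
Qed.

Lemma window_rcol : window (rcol n C) =
  rcol_window (i \in C) (i.+1 \in C) (2 * n - i \in C) ((2 * n - i).+1 \in C) (pending n C i.+1).
Proof.
have pos : 0 < i <= n by lia.
have pos1 : 0 < i.+1 <= n by lia.
have := mem_rcol_bar okC pos; have := mem_rcol_bar okC pos1.
rewrite /matched /paired /free pending_pred; have [-> ->] := bar_low => E1 E2.
rewrite /window /rcol_window (mem_rcol okC pos) (mem_rcol okC pos1) E1 E2.
case: (i \in C); case: (i.+1 \in C); case: (2 * n - i \in C);
  case: ((2 * n - i).+1 \in C) => //=.
Qed.

Lemma window_dual : window (dual (lcol n C)) =
  dual_window (i \in C) (i.+1 \in C) (2 * n - i \in C) ((2 * n - i).+1 \in C) (pending n C i.+1).
Proof.
have pos : 0 < i <= n by lia.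
have pos1 : 0 < i.+1 <= n by lia.
have := mem_lcol okC pos; have := mem_lcol okC pos1.
have := mem_lcol_bar okC pos; have := mem_lcol_bar okC pos1.
rewrite /matched /paired /free pending_pred.
have [Eb Eb1] := bar_low; have [Eh Eh1] := bar_high; rewrite !Eb !Eb1 => E1 E2 E3 E4.
rewrite /window /dual_window !mem_dual Eb Eb1 Eh Eh1 E1 E2 E3 E4.
have -> : 0 < i <= 2 * n by lia.
have -> : 0 < i.+1 <= 2 * n by lia.
have -> : 0 < 2 * n - i <= 2 * n by lia.
have -> : 0 < (2 * n - i).+1 <= 2 * n by lia.
by case: (i \in C); case: (i.+1 \in C); case: (2 * n - i \in C);
  case: ((2 * n - i).+1 \in C).
Qed.

(** For f_(2n-i) the signs of rC and of the complement of the bars of lC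
    leave the same uncancelled signs as those of the two halves of C: the
    pairs differ at most by a cancellation of + followed by -. *)
Lemma pair_signs :
  (forall e, push_left (sign_of (2 * n - i) (mem (rcol n C)))
      (push_left (sign_of (2 * n - i) (mem (dual (lcol n C)))) e) =
    push_left (sign_of i (mem C)) (push_left (sign_of (2 * n - i) (mem C)) e)) /\
  (forall e, push_right (sign_of (2 * n - i) (mem (dual (lcol n C))))
      (push_right (sign_of (2 * n - i) (mem (rcol n C))) e) =
    push_right (sign_of (2 * n - i) (mem C)) (push_right (sign_of i (mem C)) e)).
Proof.
have [_ _ R1 R2] := window_rcol; have [_ _ L1 L2] := window_dual.
rewrite /sign_of /= R1 R2 L1 L2.
by case: (i \in C); case: (i.+1 \in C); case: (2 * n - i \in C);
  case: ((2 * n - i).+1 \in C); case: (pending n C i.+1) => [|[|p]]; split=> e //=; lia.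
Qed.

(** rC has the unbarred letters of C, and lC the barred ones. *)
Lemma sign_split : sign_of i (mem (rcol n C)) = sign_of i (mem C) /\
  sign_of i (mem (dual (lcol n C))) = sign_of (2 * n - i) (mem C).
Proof.
have [R1 R2 _ _] := window_rcol; have [L1 L2 _ _] := window_dual.
rewrite /sign_of /= R1 R2 L1 L2; split=> //.
by case: (2 * n - i \in C); case: ((2 * n - i).+1 \in C).
Qed.

End Columns.

Section Moves.
Variables C C' : seq nat.
Hypothesis ag : agree_away C C'.

Lemma away_low p : 0 < p <= n -> p <> i -> p <> i.+1 -> away p /\ away (bar n p).
Proof. by rewrite /away /bar => pn pi pi1; split; apply/and4P; split; apply/eqP; lia. Qed.

Lemma mark_away p : 0 < p <= n -> p <> i -> p <> i.+1 -> mark n C p = mark n C' p.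
Proof.
move=> pn pi pi1; have [aw aw'] := away_low pn pi pi1.
by rewrite /mark /paired /free !ag.
Qed.

Hypothesis marks : forall P,
  push_right (mark n C i) (push_right (mark n C i.+1) P) =
  push_right (mark n C' i) (push_right (mark n C' i.+1) P).

(** Only the brackets at i+1 and i change, and together they have the same
    effect. *)
Lemma pending_eq p : p <= n -> p <> i -> pending n C p = pending n C' p.
Proof.
have up q : i < q <= n -> pending n C q = pending n C' q.
  by move=> Hq; apply: pending_above; [lia | move=> s Hs; apply: mark_away; lia].
move=> pn pi; have [lt|ge] := ltnP i p; first by apply: up; lia.
have pos : 0 < i <= n by lia.
have pos1 : 0 < i.+1 <= n by lia.
have E : pending n C i.-1 = pending n C' i.-1.
  have := pendingE C pos1; have := pendingE C' pos1 => /= E1 E2.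
  rewrite !pendingE // E1 E2 (up i.+1) ?marks //; lia.
apply: (pending_below (q := i.-1)) => //; first by lia.
by move=> s Hs; apply: mark_away; lia.
Qed.

Hypotheses (okC : col_ok n C) (okC' : col_ok n C').

Lemma agree_rcol : agree_away (rcol n C) (rcol n C').
Proof.
move=> x aw; have [xn|xn] := boolP (0 < x <= 2 * n); last first.
  by apply/idP/idP => /rcol_range H; exfalso; apply: (negP xn); apply: H.
have [le|gt] := leqP x n.
  by rewrite !mem_rcol ?ag //; lia.
have -> : x = bar n (bar n x) by rewrite barK.
have pos : 0 < bar n x <= n by rewrite /bar; lia.
rewrite !mem_rcol_bar // /matched /paired /free barK // (ag aw).
move: aw; rewrite /away => aw.
have [Hi Hi1] : bar n x <> i /\ bar n x <> i.+1 by rewrite /bar; lia.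
by rewrite (pending_eq _ Hi) ?(ag (proj1 (away_low pos Hi Hi1))) //; lia.
Qed.

Lemma agree_dual : agree_away (dual (lcol n C)) (dual (lcol n C')).
Proof.
move=> y aw; rewrite !mem_dual; have [yn|//] := boolP (0 < y <= 2 * n).
congr (~~ _); have [le|gt] := leqP y n.
  by rewrite !mem_lcol_bar ?ag //; [move: aw; rewrite /away /bar; lia | lia | lia].
set p := bar n y; have pos : 0 < p <= n by rewrite /p /bar; lia.
have [Hi Hi1] : p <> i /\ p <> i.+1 by move: aw; rewrite /p /away /bar; lia.
have [aw1 aw2] := away_low pos Hi Hi1.
by rewrite !mem_lcol // /matched /paired /free !(ag aw1) !(ag aw2) (pending_eq _ Hi) //; lia.
Qed.

End Moves.

Section Step.
Variables C C' : seq nat.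
Hypothesis okC : col_ok n C.

Notation A := (rcol n C).
Notation A' := (rcol n C').
Notation B := (dual (lcol n C)).
Notation B' := (dual (lcol n C')).
Notation i' := (2 * n - i).

Lemma marksE X : mark n X i = (if (i \in X) && (i'.+1 \in X) then Some true else
    if (i \notin X) && (i'.+1 \notin X) then Some false else None) /\
  mark n X i.+1 = (if (i.+1 \in X) && (i' \in X) then Some true else
    if (i.+1 \notin X) && (i' \notin X) then Some false else None).
Proof. by rewrite /mark /paired /free; have [-> ->] := bar_low. Qed.

(** Replacing i by i+1 moves a bracket between i and i+1, or creates an
    opening bracket at i+1 matched by a closing one at i. The hypothesis
    excludes the removal of a closing bracket at i+1 and of an opening one
    at i, which do not match each other. *)
Lemma low_marks b2 b1 : window C = [:: true; false; b2; b1] ->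
  window C' = [:: false; true; b2; b1] -> ~~ (b1 && ~~ b2) ->
  forall P, push_right (mark n C i) (push_right (mark n C i.+1) P) =
    push_right (mark n C' i) (push_right (mark n C' i.+1) P).
Proof.
move=> [E1 E2 E3 E4] [F1 F2 F3 F4] H P; have [-> ->] := marksE C; have [-> ->] := marksE C'.
rewrite E1 E2 E3 E4 F1 F2 F3 F4 /=.
by case: b1 {E4 F4} H; case: b2 {E3 F3}.
Qed.

Lemma high_marks a1 a2 : window C = [:: a1; a2; true; false] ->
  window C' = [:: a1; a2; false; true] -> ~~ (a1 && ~~ a2) ->
  forall P, push_right (mark n C i) (push_right (mark n C i.+1) P) =
    push_right (mark n C' i) (push_right (mark n C' i.+1) P).
Proof.
move=> [E1 E2 E3 E4] [F1 F2 F3 F4] H P; have [-> ->] := marksE C; have [-> ->] := marksE C'.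
rewrite E1 E2 E3 E4 F1 F2 F3 F4 /=.
by case: a1 {E1 F1} H; case: a2 {E2 F2}.
Qed.

(** f_i on a low letter. Let A = rC and let B be the complement of the bars
    of lC. Either lC is unchanged and rC undergoes both moves, or lC and rC
    undergo one move each; the latter happens when i+1 is free with no
    bracket to match. The hypothesis on the sign of the other half excludes
    that the signs of the two halves cancel. *)
Lemma low_move (ag : agree_away C C') (okC' : col_ok n C') :
  i \in C -> i.+1 \notin C -> moved i C C' -> sign_of i' (mem C) <> Some false ->
  [/\ B =i B', moved i' A (subst i' i'.+1 A), moved i (subst i' i'.+1 A) A' &
      sign_of i' (mem B) = sign_of i' (mem C)] \/
  [/\ moved i' B B', moved i A A', sign_of i' (mem C) = None &
      sign_of i' (mem A) = None].
Proof.
move=> iC i1C [_ _ H] sg.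
have F : window C = [:: true; false; i' \in C; i'.+1 \in C] by rewrite /window iC (negPf i1C).
have F' : window C' = [:: false; true; i' \in C; i'.+1 \in C].
  rewrite /window !H iC (negPf i1C); congr [:: _; _; _; _].
  - by rewrite ltn_eqF ?eqxx.
  - by rewrite eqxx.
  - have [-> ->] : (i' == i.+1) = false /\ i' != i by split; lia.
    by rewrite andbT.
  - have [-> ->] : (i'.+1 == i.+1) = false /\ i'.+1 != i by split; lia.
    by rewrite andbT.
have sg' : ~~ ((i'.+1 \in C) && (i' \notin C)).
  by apply/negP => /andP [H1 /negPf H2]; apply: sg; rewrite /sign_of /= H1 H2.
have marks := low_marks F F' sg'.
have agr := agree_rcol ag marks okC okC'; have agl := agree_dual ag marks okC okC'.
have Ep : pending n C' i.+1 = pending n C i.+1.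
  by apply/esym/(pending_eq ag marks); lia.
have := window_rcol okC; have := window_rcol okC'; have := window_dual okC; have := window_dual okC'.
have [F1 F2 F3 F4] := F'; rewrite F1 F2 F3 F4 Ep iC (negPf i1C).
rewrite [sign_of i' (mem C)]/sign_of /=.
(* the bars of i and i+1 and a pending bracket at i+1 decide between the cases *)
case: (i' \in C) sg'; case: (i'.+1 \in C) => //= _;
  case: (pending n C i.+1) => [|p] L' L R' R.
all: try (by right; split; [exact: (window_moved_high agl L L')|exact: (window_moved_low agr R R')|by []
  |by rewrite /sign_of; case: R => _ _ /= -> ->]).
all: left; have [M1 M2] := window_moved_both agr R R'; split=> //; try exact: (window_eq agl (etrans L (esym L'))).
all: by rewrite /sign_of; case: L => _ _ /= -> ->.
Qed.

(** The mirror image: either rC is unchanged and lC undergoes both moves,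
    or each undergoes one. *)
Lemma high_move (ag : agree_away C C') (okC' : col_ok n C') :
  i' \in C -> i'.+1 \notin C -> moved i' C C' -> sign_of i (mem C) <> Some true ->
  [/\ A =i A', moved i' B (subst i' i'.+1 B), moved i (subst i' i'.+1 B) B' &
      sign_of i' (mem A) = sign_of i (mem C)] \/
  [/\ moved i B B', moved i' A A', sign_of i (mem C) = None &
      sign_of i' (mem B) = None].
Proof.
move=> iC i1C [_ _ H] sg.
have F : window C = [:: i \in C; i.+1 \in C; true; false] by rewrite /window iC (negPf i1C).
have F' : window C' = [:: i \in C; i.+1 \in C; false; true].
  rewrite /window !H iC (negPf i1C); congr [:: _; _; _; _].
  - have [-> ->] : (i == i'.+1) = false /\ i != i' by split; lia.
    by rewrite andbT.
  - have [-> ->] : (i.+1 == i'.+1) = false /\ i.+1 != i' by split; lia.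
    by rewrite andbT.
  - by rewrite ltn_eqF ?eqxx.
  - by rewrite eqxx.
have sg' : ~~ ((i \in C) && (i.+1 \notin C)).
  by apply/negP => /andP [H1 /negPf H2]; apply: sg; rewrite /sign_of /= H1 H2.
have marks := high_marks F F' sg'.
have agr := agree_rcol ag marks okC okC'; have agl := agree_dual ag marks okC okC'.
have Ep : pending n C' i.+1 = pending n C i.+1.
  by apply/esym/(pending_eq ag marks); lia.
have := window_rcol okC; have := window_rcol okC'; have := window_dual okC; have := window_dual okC'.
have [F1 F2 F3 F4] := F'; rewrite F1 F2 F3 F4 Ep iC (negPf i1C).
rewrite [sign_of i (mem C)]/sign_of /=.
(* the letters i and i+1 and a pending bracket at i+1 decide between the cases *)
case: (i \in C) sg'; case: (i.+1 \in C) => //= _;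
  case: (pending n C i.+1) => [|p] L' L R' R.
all: try (by right; split; [exact: (window_moved_low agl L L')|exact: (window_moved_high agr R R')|by []
  |by rewrite /sign_of; case: L => _ _ /= -> ->]).
all: left; have [M1 M2] := window_moved_both agl L L'; split=> //; try exact: (window_eq agr (etrans R (esym R'))).
all: by rewrite /sign_of; case: R => _ _ /= -> ->.
Qed.

End Step.

End Local.

Section Agree.
Variables (n i : nat) (C C' : seq nat).
Hypothesis i_pos : 0 < i < n.

Lemma moved_low_agree : moved i C C' -> agree_away n i C C'.
Proof.
by move=> [_ _ H] x /and4P [/negPf xi /negPf xi1 _ _]; rewrite H xi xi1 andbT.
Qed.

Lemma moved_high_agree : moved (2 * n - i) C C' -> agree_away n i C C'.
Proof.
by move=> [_ _ H] x /and4P [_ _ /negPf xi /negPf xi1]; rewrite H xi xi1 andbT.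
Qed.

Lemma low_pending : moved i C C' -> sign_of (2 * n - i) (mem C) <> Some false ->
  pending n C 0 = pending n C' 0.
Proof.
move=> mv sg; have ag := moved_low_agree mv; have [E1 E2 E3 E4] := moved_at mv.
apply: (pending_eq i_pos ag) => //; last by lia.
apply: (low_marks i_pos (b2 := 2 * n - i \in C) (b1 := (2 * n - i).+1 \in C)).
- by rewrite /window E1 E2.
- rewrite /window E3 E4 (moved_other mv) ?(moved_other (x := (2 * n - i).+1) mv) //; lia.
- by apply/negP => /andP [H1 /negPf H2]; apply: sg; rewrite /sign_of /= H1 H2.
Qed.

Lemma high_pending : moved (2 * n - i) C C' -> sign_of i (mem C) <> Some true ->
  pending n C 0 = pending n C' 0.
Proof.
move=> mv sg; have ag := moved_high_agree mv; have [E1 E2 E3 E4] := moved_at mv.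
apply: (pending_eq i_pos ag) => //; last by lia.
apply: (high_marks i_pos (a1 := i \in C) (a2 := i.+1 \in C)).
- by rewrite /window E1 E2.
- rewrite /window E3 E4 (moved_other mv) ?(moved_other (x := i.+1) mv) //; lia.
- by apply/negP => /andP [H1 /negPf H2]; apply: sg; rewrite /sign_of /= H1 H2.
Qed.

End Agree.

Section Last.
Variables (n : nat) (C : seq nat).
Hypothesis n_pos : 0 < n.
Hypothesis okC : col_ok n C.

Notation A := (rcol n C).
Notation B := (dual n (lcol n C)).

Lemma bar_last : bar n n = n.+1 /\ bar n n.+1 = n.
Proof. by rewrite /bar; lia. Qed.

Lemma mem_last_split :
  [/\ (n \in A) = (n \in C), (n.+1 \in A) = (n.+1 \in C) && (n \notin C),
    (n \in B) = (n.+1 \notin C) & (n.+1 \in B) = ~~ ((n \in C) && (n.+1 \notin C))].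
Proof.
have pos : 0 < n <= n by lia.
have := mem_rcol_bar okC pos; have := mem_lcol_bar okC pos; have := mem_lcol okC pos.
have := mem_rcol okC pos.
rewrite /matched pending_n andbF !orbF /paired; have [E1 E2] := bar_last; rewrite E1 => R L Lb Rb.
rewrite !mem_dual E1 E2 R Rb L Lb; have -> : 0 < n <= 2 * n by lia.
have -> : 0 < n.+1 <= 2 * n by lia.
by split=> //; case: (n \in C); case: (n.+1 \in C).
Qed.

(** f_n has the sign of C in both columns, or the pair +- when both n and
    bar n are in C. *)
Lemma pair_signs_last :
  (forall e, push_left (sign_of n (mem A)) (push_left (sign_of n (mem B)) e.*2) =
    (push_left (sign_of n (mem C)) e).*2) /\
  (forall e, push_right (sign_of n (mem B)) (push_right (sign_of n (mem A)) e.*2) =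
    (push_right (sign_of n (mem C)) e).*2).
Proof.
have [E1 E2 E3 E4] := mem_last_split.
rewrite /sign_of /= E1 E2 E3 E4.
by case: (n \in C); case: (n.+1 \in C); split=> e /=; lia.
Qed.

Variable C' : seq nat.
Hypothesis mv : moved n C C'.

Lemma last_mark p : 0 < p <= n -> mark n C p = mark n C' p.
Proof.
move=> pn; have [nC n1C H] := mv; have [E1 _] := bar_last.
rewrite /mark /paired /free; have [->|pn'] := p =P n.
  rewrite E1 !H nC (negPf n1C) eqxx eqxx /= andbF orbF.
  by have -> : (n == n.+1) = false by lia.
rewrite !H; have -> : (p == n.+1) = false by lia.
have -> : p != n by lia.
have -> : (bar n p == n.+1) = false by rewrite /bar; lia.
have -> : bar n p != n by rewrite /bar; lia.
by rewrite !andbT.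
Qed.

Lemma last_pending p : p <= n -> pending n C p = pending n C' p.
Proof. by move=> pn; apply: pending_above => // s Hs; apply: last_mark; lia. Qed.

Hypothesis okC' : col_ok n C'.

(** n is never matched, as no letter is larger; so both lC and rC replace n
    by bar n. *)
Lemma last_move : moved n A (rcol n C') /\ moved n B (dual n (lcol n C')).
Proof.
have [nC n1C H] := mv; have [E1 E2] := bar_last.
have [A1 A2 B1 B2] := mem_last_split.
rewrite nC (negPf n1C) /= in A1 A2 B1 B2.
have pos : 0 < n <= n by lia.
have nC' : n \in C' = false by rewrite H nC eqxx andbF orbF; lia.
have n1C' : n.+1 \in C' by rewrite H eqxx.
have other p : 0 < p < n -> [/\ (p \in C') = (p \in C), (bar n p \in C') = (bar n p \in C),
    paired n C' p = paired n C p & matched n C' p = matched n C p].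
  move=> pn; have Ep : (p \in C') = (p \in C).
    by apply: (moved_other mv); clear -pn; lia.
  have Eb : (bar n p \in C') = (bar n p \in C).
    by apply: (moved_other mv); rewrite /bar; clear -pn; lia.
  have pn' : p <= n by case/andP: pn => _ /ltnW.
  by rewrite /matched /paired /free Ep Eb (last_pending pn').
split; split=> [||x]; rewrite ?A1 ?A2 ?B1 ?B2 //.
  have [xn|xn] := boolP (0 < x <= 2 * n); last first.
    have -> : (x \in A) = false by apply/negP => /(rcol_range okC) Hx; apply: (negP xn).
    have -> : (x \in rcol n C') = false by apply/negP => /(rcol_range okC') Hx; apply: (negP xn).
    by lia.
  have [->|ne] := x =P n.
    by rewrite mem_rcol // nC' andbF orbF; lia.
  have [->|ne1] := x =P n.+1.
    by rewrite -E1 mem_rcol_bar // /paired E1 nC' n1C'.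
  rewrite andbT; have [le|gt] := leqP x n.
    have p1 : 0 < x <= n by lia.
    have p2 : 0 < x < n by lia.
    by rewrite !mem_rcol //; have [-> _ _ _] := other _ p2.
  have -> : x = bar n (bar n x) by rewrite barK.
  have p1 : 0 < bar n x <= n by rewrite /bar; lia.
  have p2 : 0 < bar n x < n by rewrite /bar; lia.
  by rewrite !mem_rcol_bar //; have [_ -> -> ->] := other _ p2.
have [xn|xn] := boolP (0 < x <= 2 * n); last first.
  rewrite !mem_dual (negPf xn) /=; lia.
have [->|ne] := x =P n.
  by rewrite mem_dual E1 -E1 mem_lcol_bar // E1 n1C' andbF; clear; lia.
have [->|ne1] := x =P n.+1.
  rewrite mem_dual E2 mem_lcol // /paired nC' /matched pending_n andbF /=.
  by apply/idP; lia.
rewrite andbT !mem_dual xn /=; congr (~~ _); have [le|gt] := leqP x n.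
  have p1 : 0 < x <= n by lia.
  have p2 : 0 < x < n by lia.
  by rewrite !mem_lcol_bar //; have [_ -> _ _] := other _ p2.
have p1 : 0 < bar n x <= n by rewrite /bar; lia.
have p2 : 0 < bar n x < n by rewrite /bar; lia.
by rewrite !mem_lcol //; have [-> _ -> ->] := other _ p2.
Qed.

End Last.

(** * The type C operators on split columns *)

(** The counts may be computed two columns at a time. *)
Lemma eps_below_pairs g g' (f : nat -> nat) c : f 0 = 0 ->
  (forall d e, d < c -> push_left (g' d.*2.+1) (push_left (g' d.*2) (f e)) =
     f (push_left (g d.*2.+1) (push_left (g d.*2) e))) ->
  eps_below g' c.*2 = f (eps_below g c.*2).
Proof.
move=> f0; elim: c => //= c IH H; rewrite IH ?H // => d e dc.
by apply: H; apply: ltnW.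
Qed.

Lemma phi_from_pairs g g' (f : nat -> nat) a d : f 0 = 0 ->
  (forall c e, push_right (g' c.*2) (push_right (g' c.*2.+1) (f e)) =
     f (push_right (g c.*2) (push_right (g c.*2.+1) e))) ->
  phi_from g' a.*2 d.*2 = f (phi_from g a.*2 d.*2).
Proof.
by move=> f0 H; elim: d a => //= d IH a; rewrite -doubleS IH H.
Qed.

Lemma count_upto_moved a X X' x : 0 < a -> moved a X X' -> count_upto X' x + (x == a) = count_upto X x.
Proof.
move=> a0 mv; have [E1 E2 E3 E4] := moved_at mv.
elim: x => [|x IH]; first by rewrite /count_upto /=; lia.
rewrite !count_uptoS; have [Ex|ne] := x =P a.
  by move: IH; rewrite Ex E4 E2 eqxx; lia.
have [Ex|ne'] := x.+1 =P a; first by move: IH; rewrite Ex E1 E3; lia.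
by rewrite (moved_other mv ne') //; move: IH; lia.
Qed.

Lemma col_le_nil X : col_le X [::].
Proof. by move=> a; rewrite /count_upto (eq_count (a2 := pred0)) ?count_pred0. Qed.

Lemma col_le_eq X X' Y Y' : X =i X' -> Y =i Y' -> col_le X Y -> col_le X' Y'.
Proof.
move=> EX EY H a; have -> : count_upto X' a = count_upto X a by apply: eq_count_upto => x _; rewrite EX.
by have -> : count_upto Y' a = count_upto Y a by apply: eq_count_upto => x _; rewrite EY.
Qed.

Lemma col_le_right a X Y Y' : 0 < a -> moved a Y Y' -> col_le X Y -> col_le X Y'.
Proof. by move=> a0 mv H x; apply: leq_trans (H x); rewrite -(count_upto_moved x a0 mv) leq_addr. Qed.

Lemma col_le_left a X X' Y : 0 < a -> moved a X X' -> col_le X' Y -> col_le X Y.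
Proof. by move=> a0 mv H x; apply: leq_trans (H x) _; rewrite -(count_upto_moved x a0 mv) leq_addr. Qed.

(** The comparison can only fail for the letters at most a, and it was
    strict there unless Y contains a and not a+1. *)
Lemma col_le_raise a X X' Y : 0 < a -> moved a X X' ->
  sign_of a (mem Y) <> Some true -> col_le X Y -> col_le X' Y.
Proof.
move=> a0 mv sg H x; have := count_upto_moved x a0 mv; case: eqP => [->|_] E; last first.
  by rewrite addn0 in E; rewrite E.
have [E1 E2 _ _] := moved_at mv; have := H a.-1; have := H a.+1.
have := count_uptoS X a; have := count_uptoS Y a; have := count_uptoS X a.-1; have := count_uptoS Y a.-1.
rewrite (prednK a0) E1 E2; move: sg; rewrite /sign_of /=.
by case: (a \in Y); case: (a.+1 \in Y) => //= _; clear -E; lia.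
Qed.

(** The mirror image of [col_le_raise]. *)
Lemma col_le_lower a X Y Y' : 0 < a -> moved a Y Y' ->
  sign_of a (mem X) <> Some false -> col_le X Y' -> col_le X Y.
Proof.
move=> a0 mv sg H x; have := count_upto_moved x a0 mv; case: eqP => [->|_] E; last first.
  by rewrite addn0 in E; rewrite -E.
have [_ _ E1 E2] := moved_at mv; have := H a.-1; have := H a.+1.
have := count_uptoS X a; have := count_uptoS Y' a; have := count_uptoS X a.-1; have := count_uptoS Y' a.-1.
rewrite (prednK a0) E1 E2; move: sg; rewrite /sign_of /=.
by case: (a \in X); case: (a.+1 \in X) => //= _; clear -E; lia.
Qed.

Section Dual.
Variable n : nat.

(** a in Y means that bar a = 2n-a+1 is not in the complement of the bars. *)
Lemma sign_dual a Y : 0 < a < 2 * n ->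
  sign_of (2 * n - a) (mem (dual n Y)) = sign_of a (mem Y).
Proof.
move=> an; rewrite /sign_of /= !mem_dual /bar.
have -> : (2 * n).+1 - (2 * n - a) = a.+1 by lia.
have -> : (2 * n).+1 - (2 * n - a).+1 = a by lia.
have -> : 0 < 2 * n - a <= 2 * n by lia.
have -> : 0 < (2 * n - a).+1 <= 2 * n by lia.
by rewrite /=; case: (a \in Y); case: (a.+1 \in Y).
Qed.

Lemma dual_inj Y Y' : (forall x, x \in Y -> 0 < x <= 2 * n) ->
  (forall x, x \in Y' -> 0 < x <= 2 * n) -> dual n Y =i dual n Y' -> Y =i Y'.
Proof.
move=> rY rY' H x; have [xn|xn] := boolP (0 < x <= 2 * n); last first.
  by apply/idP/idP => [/rY|/rY'] Hx; rewrite Hx in xn.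
have := H (bar n x); rewrite !mem_dual barK //.
have -> : 0 < bar n x <= 2 * n by rewrite /bar; lia.
by move=> /negb_inj.
Qed.

Lemma moved_dual a Y Y' : 0 < a < 2 * n -> (forall x, x \in Y -> 0 < x <= 2 * n) ->
  (forall x, x \in Y' -> 0 < x <= 2 * n) -> moved a (dual n Y) (dual n Y') ->
  moved (2 * n - a) Y Y'.
Proof.
move=> an rY rY' mv; have [E1 E2 E3 E4] := moved_at mv; move: E1 E2 E3 E4.
rewrite !mem_dual; have -> : 0 < a <= 2 * n by lia.
have -> : 0 < a.+1 <= 2 * n by lia.
have -> : bar n a = (2 * n - a).+1 by rewrite /bar; lia.
have -> : bar n a.+1 = 2 * n - a by rewrite /bar; lia.
move=> /= E1 E2 E3 E4; split=> [|//|x]; first by apply/negPn/negP => H; rewrite H in E2.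
have [->|xa1] := x =P (2 * n - a).+1; first by move: E3; case: (_ \in Y').
have [->|xa] := x =P 2 * n - a; first by rewrite andbF; apply/negbTE.
rewrite /= andbT; have [xn|xn] := boolP (0 < x <= 2 * n); last first.
  by apply/idP/idP => [/rY'|/rY] Hx; rewrite Hx in xn.
have := @moved_other a _ _ (bar n x) mv; rewrite !mem_dual barK //.
have -> : 0 < bar n x <= 2 * n by rewrite /bar; lia.
by move=> /= H; apply: negb_inj; apply: H; rewrite /bar; lia.
Qed.

End Dual.

(** Families of columns are indexed with the columns of a pair at 2c+1 and
    2c, so that the one of odd index is read first. This is rC, then the
    complement of the bars of lC. *)
Definition split_family (n : nat) (D : nat -> seq nat) (s : nat) : seq nat :=
  if odd s then rcol n (D s./2) else dual n (lcol n (D s./2)).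
Definition fam_sign (j : nat) (F : nat -> seq nat) (s : nat) : option bool :=
  sign_of j (mem (F s)).

(** f_i on the sequence D of columns of a tableau. *)
Definition columns_step (n M i : nat) (D D' : nat -> seq nat) (s : nat) : Prop :=
  acts_at M.*2 (half_sign n i D) true s /\
  forall c, D' c = if c == s./2 then subst (letter n i s) (letter n i s).+1 (D c) else D c.

Definition raises_fam (N j : nat) (F F' : nat -> seq nat) : Prop :=
  exists2 s, acts_at N (fam_sign j F) true s &
    forall t, F' t = if t == s then subst j j.+1 (F t) else F t.

Lemma half_pair c : (c.*2)./2 = c /\ (c.*2.+1)./2 = c.
Proof. by rewrite /= doubleK uphalf_double. Qed.

Section Signs.
Variables (n M i : nat) (D : nat -> seq nat).
Hypothesis i_pos : 0 < i <= n.
Hypothesis okD : forall c, col_ok n (D c).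

Notation g := (half_sign n i D).
Notation g' := (fam_sign (2 * n - i) (split_family n D)).

Lemma fam_sign_low : i < n -> forall s, fam_sign i (split_family n D) s = g s.
Proof.
move=> lt s; have ii : 0 < i < n by lia.
rewrite /fam_sign /split_family /half_sign lt orbT /letter.
by have [R L] := sign_split ii (okD s./2); case: (odd s).
Qed.

Lemma letter_last : i = n -> 2 * n - i = n.
Proof. by lia. Qed.

(** The signs of the split columns for f_(2n-i) are those of the half
    columns, twice if i = n. *)
Lemma eps_split c : eps_below g' c.*2 =
  if i < n then eps_below g c.*2 else (eps_below g c.*2).*2.
Proof.
case: ltnP => lt.
  apply: (eps_below_pairs (f := id)) => // d e _; have ii : 0 < i < n by lia.
  have [H _] := pair_signs ii (okD d).
  by rewrite /fam_sign /split_family /half_sign lt /letter /= odd_double /= uphalf_double doubleK; apply: H.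
have Ei : i = n by lia.
apply: (eps_below_pairs (f := double)) => // d e _; have n0 : 0 < n by lia.
have [H _] := pair_signs_last n0 (okD d).
rewrite (letter_last Ei) /fam_sign /split_family /half_sign Ei ltnn /letter /= odd_double /= uphalf_double doubleK.
exact: H.
Qed.

Lemma phi_split a d : phi_from g' a.*2 d.*2 =
  if i < n then phi_from g a.*2 d.*2 else (phi_from g a.*2 d.*2).*2.
Proof.
case: ltnP => lt.
  apply: (phi_from_pairs (f := id)) => // c e; have ii : 0 < i < n by lia.
  have [_ H] := pair_signs ii (okD c).
  by rewrite /fam_sign /split_family /half_sign lt /letter /= odd_double /= uphalf_double doubleK; apply: H.
have Ei : i = n by lia.
apply: (phi_from_pairs (f := double)) => // c e; have n0 : 0 < n by lia.
have [_ H] := pair_signs_last n0 (okD c).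
rewrite (letter_last Ei) /fam_sign /split_family /half_sign Ei ltnn /letter /= odd_double /= uphalf_double doubleK.
exact: H.
Qed.

Lemma half_last s : i = n -> ~~ odd s -> g s = None.
Proof. by move=> Ei os; rewrite /half_sign (negPf os) Ei ltnn. Qed.

Lemma phi_from_sign h c d : phi_from h c d.+1 = 0 -> h c <> Some true.
Proof. by move=> /= H E; rewrite E in H. Qed.

Lemma eps_below_sign h c : eps_below h c.+1 = 0 -> h c <> Some false.
Proof. by move=> /= H E; rewrite E in H. Qed.

(** If the columns from c on leave no sign +, then the column read last,
    which is the complement of the bars of lC, has none, neither for
    f_(2n-i) nor for f_i. In terms of lC the two indices are exchanged. *)
Lemma signs_above c d : phi_from g c.*2 d.+1.*2 = 0 ->
  sign_of i (mem (lcol n (D c))) <> Some true /\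
  sign_of (2 * n - i) (mem (lcol n (D c))) <> Some true.
Proof.
move=> p0; have := phi_split c d.+1; rewrite p0 if_same => p0'.
have E j : 0 < j < 2 * n -> sign_of j (mem (lcol n (D c))) =
    fam_sign (2 * n - j) (split_family n D) c.*2.
  move=> jn; rewrite /fam_sign /split_family odd_double (half_pair c).1.
  exact/esym/sign_dual.
have [lt|ge] := ltnP i n.
  rewrite !E; [|lia|lia]; split; first exact: phi_from_sign p0'.
  have -> : 2 * n - (2 * n - i) = i by lia.
  by rewrite fam_sign_low //; apply: phi_from_sign p0.
have Ei : i = n by lia.
have H : sign_of i (mem (lcol n (D c))) <> Some true.
  by rewrite E; [apply: phi_from_sign p0' | lia].
by split=> //; rewrite (letter_last Ei) -[X in sign_of X]Ei.
Qed.

(** The first column read among those below is rC. *)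
Lemma signs_below c : eps_below g c.+1.*2 = 0 ->
  sign_of i (mem (rcol n (D c))) <> Some false /\
  sign_of (2 * n - i) (mem (rcol n (D c))) <> Some false.
Proof.
move=> e0; have := eps_split c.+1; rewrite e0 if_same => e0'.
have E j : sign_of j (mem (rcol n (D c))) = fam_sign j (split_family n D) c.*2.+1.
  by rewrite /fam_sign /split_family (half_pair c).2 /= odd_double.
have H : sign_of (2 * n - i) (mem (rcol n (D c))) <> Some false.
  by rewrite E; apply: eps_below_sign e0'.
split=> //; have [lt|ge] := ltnP i n.
  by rewrite E fam_sign_low //; apply: eps_below_sign e0.
have Ei : i = n by lia.
by move: H; rewrite (letter_last Ei) -[X in sign_of X]Ei.
Qed.

End Signs.

Section Step.
Variables (n M i : nat) (D D' : nat -> seq nat) (s : nat).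
Hypothesis i_pos : 0 < i <= n.
Hypothesis st : columns_step n M i D D' s.

Notation g := (half_sign n i D).
Notation c := (s./2).
Notation i' := (2 * n - i).

Lemma step_active : odd s || (i < n).
Proof. by have [[_ gs _ _] _] := st; move: gs; rewrite /half_sign; case: ifP. Qed.

Lemma step_sign : sign_of (letter n i s) (mem (D c)) = Some true.
Proof. by have [[_ gs _ _] _] := st; move: gs; rewrite /half_sign step_active. Qed.

Lemma step_at : D' c = subst (letter n i s) (letter n i s).+1 (D c).
Proof. by have [_ ->] := st; rewrite eqxx. Qed.

Lemma step_other d : d <> c -> D' d = D d.
Proof. by have [_ ->] := st; case: eqP. Qed.

Lemma step_moved : moved (letter n i s) (D c) (D' c).
Proof.
have [aX aX'] := sign_of_plus step_sign.
by rewrite step_at; apply: subst_moved => //; apply/negbT.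
Qed.

(** Nothing uncancelled comes from the columns at the right, nor from what
    is read after the acting half column. *)
Lemma step_low : odd s -> [/\ s = c.*2.+1, c < M,
  push_left (g c.*2) (eps_below g c.*2) = 0 &
  phi_from g c.+1.*2 (M - c.+1).*2 = 0].
Proof.
move=> os; have Es : s = c.*2.+1 by lia.
have [[sM _ p0 e0] _] := st; rewrite {1}Es /= in e0; split=> //; first by lia.
by rewrite -[RHS]p0; congr phi_from; lia.
Qed.

Lemma step_high : ~~ odd s -> [/\ s = c.*2, c < M, eps_below g c.*2 = 0 &
  push_right (g c.*2.+1) (phi_from g c.+1.*2 (M - c.+1).*2) = 0].
Proof.
move=> os; have Es : s = c.*2 by lia.
have [[sM _ p0 e0] _] := st; split=> //; [by lia | by rewrite -Es |].
rewrite -[RHS]p0; have -> : M.*2 - s.+1 = (M - c.+1).*2.+1 by lia.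
by rewrite /= doubleS -Es.
Qed.

Lemma half_sign_low d : g d.*2.+1 = sign_of i (mem (D d)).
Proof. by rewrite /half_sign /letter /= odd_double uphalf_double. Qed.

Lemma half_sign_high d : i < n -> g d.*2 = sign_of i' (mem (D d)).
Proof. by move=> lt; rewrite /half_sign /letter odd_double lt doubleK. Qed.

(** The acting half column is not cancelled by the other half, which is the
    hypothesis of [low_pending] and [high_pending]. *)
Lemma step_pending : pending n (D c) 0 = pending n (D' c) 0.
Proof.
have mv := step_moved; have [os|os] := boolP (odd s).
  have [lt|ge] := ltnP i n; last first.
    have Ei : i = n by lia.
    by apply: last_pending => //; [lia | move: mv; rewrite /letter os Ei].
  have ii : 0 < i < n by lia.
  have [_ _ e0 _] := step_low os.
  apply: (low_pending ii); first by move: mv; rewrite /letter os.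
  by rewrite -half_sign_high // => E; rewrite E in e0.
have lt : i < n by have := step_active; rewrite (negPf os).
have ii : 0 < i < n by lia.
have [_ _ _ p0] := step_high os.
apply: (high_pending ii); first by move: mv; rewrite /letter (negPf os).
by rewrite -half_sign_low => E; rewrite E in p0.
Qed.

Lemma letter_range : 0 < letter n i s < 2 * n.
Proof. by rewrite /letter; case: (odd s); lia. Qed.

Lemma step_ok : (forall d, col_ok n (D d)) -> forall d, col_ok n (D' d).
Proof.
move=> ok d; have [->|/step_other -> //] := d =P c.
have [_ /negbT aX'] := sign_of_plus step_sign; have rg := letter_range.
apply: (subst_ok (ok c) _ _ aX' step_at step_pending); first by left.
by lia.
Qed.

Lemma step_ok_back : (forall d, col_ok n (D' d)) -> forall d, col_ok n (D d).
Proof.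
move=> ok d; have [->|ne] := d =P c; last by rewrite -(step_other ne).
have [aX /negbT aX'] := sign_of_plus step_sign; have rg := letter_range.
have [_ _ /negbT E _] := moved_at step_moved.
apply: (subst_ok (a := (letter n i s).+1) (b := letter n i s) (ok c) _ _ E _ (esym step_pending)).
- by right.
- by lia.
- by rewrite step_at subst_back.
Qed.

Hypotheses (okD : forall d, col_ok n (D d)) (okD' : forall d, col_ok n (D' d)).

Notation A := (rcol n (D c)).
Notation A' := (rcol n (D' c)).
Notation B := (dual n (lcol n (D c))).
Notation B' := (dual n (lcol n (D' c))).
Notation g' := (fam_sign i' (split_family n D)).

(** At most the two moves that f_(2n-i) and f_i can do. *)
Definition chain X X' := exists2 X1, moved i' X X1 \/ X =i X1 & moved i X1 X' \/ X1 =i X'.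

Lemma sorted_rcol d : sorted ltn (rcol n (D d)).
Proof. by case: (rcolP (okD d)). Qed.

Lemma sorted_split_family d : sorted ltn (split_family n D d).
Proof. by rewrite /split_family; case: (odd d); [apply: sorted_rcol | apply: sorted_dual]. Qed.

Lemma split_odd F d : split_family n F d.*2.+1 = rcol n (F d).
Proof. by rewrite /split_family /= odd_double /= uphalf_double. Qed.

Lemma split_even F d : split_family n F d.*2 = dual n (lcol n (F d)).
Proof. by rewrite /split_family odd_double doubleK. Qed.

Lemma mem_sign j X X' : moved j X X' -> sign_of j (mem X) = Some true.
Proof. by move=> /moved_at [H1 H2 _ _]; rewrite /sign_of /= H1 H2. Qed.

Lemma cut_low d : d < M -> M.*2 - d.*2.+2 = (M - d.+1).*2.
Proof. by lia. Qed.

Lemma cut_high d : d < M -> M.*2 - d.*2.+1 = (M - d.+1).*2.+1.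
Proof. by lia. Qed.

Lemma fam_odd j d : fam_sign j (split_family n D) d.*2.+1 = sign_of j (mem (rcol n (D d))).
Proof. by rewrite /fam_sign split_odd. Qed.

Lemma fam_even j d : fam_sign j (split_family n D) d.*2 = sign_of j (mem (dual n (lcol n (D d)))).
Proof. by rewrite /fam_sign split_even. Qed.

(** The position t of the operator f_(2n-i) in the pair may differ from the
    position s of f_i. *)
Definition raise_both (t : nat) :=
  [/\ acts_at M.*2 g' true t, t./2 = c &
   forall u, u./2 = c ->
     let X := if u == t then subst i' i'.+1 (split_family n D u) else split_family n D u in
     (u = s -> moved i X (split_family n D' u)) /\ (u <> s -> X =i split_family n D' u)].

Lemma moved_mem j X X' : moved j X X' -> subst j j.+1 X =i X'.
Proof. by move=> [jX _ H] x; rewrite H mem_subst jX andbT orbC. Qed.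

(** The bounds on signs are kept with the columns that change, because they
    are what makes the comparison with the neighbours persist: rC with the
    next lC if rC changes, lC with the previous rC if lC changes. *)
Lemma step_split : i < n ->
  [/\ A =i A' \/ chain A A' /\ phi_from g c.+1.*2 (M - c.+1).*2 = 0,
      B =i B' \/ chain B B' /\ eps_below g c.*2 = 0 &
      exists t, raise_both t].
Proof.
move=> lt; have ii : 0 < i < n by lia.
have mv := step_moved; have pos u : u./2 = c -> u = c.*2.+1 \/ u = c.*2 by lia.
have p0' := phi_split i_pos okD c.+1 (M - c.+1); rewrite lt in p0'.
have e0' := eps_split i_pos okD c; rewrite lt in e0'.
have neq : (c.*2.+1 == c.*2) = false /\ (c.*2 == c.*2.+1) = false by lia.
have [neq1 neq2] := neq.
have [os|os] := boolP (odd s).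
  have [Es cM e0 p0] := step_low os; rewrite p0 in p0'.
  rewrite half_sign_high // in e0.
  move: mv; rewrite /letter os => mv.
  have ag := moved_low_agree (n := n) mv; have [iC /negbT i1C _ _] := moved_at mv.
  have ng : sign_of i' (mem (D c)) <> Some false by move=> E; rewrite E in e0.
  have [[EB M1 M2 Es']|[MB MA sC sA]] := low_move ii (okD c) ag (okD' c) iC i1C mv ng.
    split; [right; split=> // | by left |].
      by exists (subst i' i'.+1 A); left.
    exists c.*2.+1; split; last 1 first.
    - move=> u /pos [->|->]; rewrite ?eqxx ?split_odd ?split_even ?neq1 ?neq2 /=.
        by split=> // H; exfalso; apply: H.
      by split=> [E|//]; exfalso; move: Es; rewrite -E; lia.
    - split; first by lia.
      + by rewrite fam_odd (mem_sign M1).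
      + by rewrite cut_low.
      + by rewrite /= fam_even Es' e0'.
    by rewrite /= uphalf_double.
  rewrite sC /= in e0; rewrite e0 in e0'.
  split; [right; split=> // | right; split=> // |].
  - by exists A; [right | left].
  - by exists B'; [left | right].
  exists c.*2; split; last 1 first.
  - move=> u /pos [->|->]; rewrite ?eqxx ?split_odd ?split_even ?neq1 ?neq2 /=.
      by split=> // H; exfalso; apply: H.
    split=> [E|_]; last exact: moved_mem.
    by exfalso; move: Es; rewrite -E; lia.
  - split; first by lia.
    + by rewrite fam_even (mem_sign MB).
    + by rewrite cut_high //= fam_odd sA -doubleS p0'.
    + by [].
  by rewrite doubleK.
have [Es cM e0 p0] := step_high os; rewrite e0 in e0'.
rewrite half_sign_low in p0.
move: mv; rewrite /letter (negPf os) => mv.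
have ag := moved_high_agree mv; have [iC /negbT i1C _ _] := moved_at mv.
have ng : sign_of i (mem (D c)) <> Some true by move=> E; rewrite E in p0.
have [[EA M1 M2 Es']|[MB MA sC sB]] := high_move ii (okD c) ag (okD' c) iC i1C mv ng.
  split; [by left | right; split=> // |].
    by exists (subst i' i'.+1 B); left.
  exists c.*2; split; last 1 first.
  - move=> u /pos [->|->]; rewrite ?eqxx ?split_odd ?split_even ?neq1 ?neq2 /=.
      by split=> [E|//]; exfalso; move: Es; rewrite -E; lia.
    by split=> // H; exfalso; apply: H; rewrite -Es.
  - split; first by lia.
    + by rewrite fam_even (mem_sign M1).
    + by rewrite cut_high //= fam_odd Es' -doubleS p0'.
    + by [].
  by rewrite doubleK.
rewrite sC /= in p0; rewrite p0 in p0'.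
split; [right; split=> // | right; split=> // |].
- by exists A'; [left | right].
- by exists B; [right | left].
exists c.*2.+1; split; last 1 first.
- move=> u /pos [->|->]; rewrite ?eqxx ?split_odd ?split_even ?neq1 ?neq2 /=.
    split=> [E|_]; last exact: moved_mem.
    by exfalso; move: Es; rewrite -E; lia.
  by split=> // H; exfalso; apply: H; rewrite -Es.
- split; first by lia.
  + by rewrite fam_odd (mem_sign MA).
  + by rewrite cut_low.
  + by rewrite /= fam_even sB e0'.
by rewrite /= uphalf_double.
Qed.

Lemma step_split_last : i = n ->
  [/\ s = c.*2.+1, c < M, moved n A A', moved n B B' &
      phi_from g c.+1.*2 (M - c.+1).*2 = 0 /\ eps_below g c.*2 = 0].
Proof.
move=> Ei; have os : odd s by have := step_active; rewrite Ei ltnn orbF.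
have [Es cM e0 p0] := step_low os.
have n0 : 0 < n by lia.
have mv := step_moved; rewrite /letter os Ei in mv.
have [MA MB] := last_move n0 (okD c) mv (okD' c).
by rewrite half_last ?odd_double //= in e0.
Qed.

(** The last clause makes the comparison with the next column persist when
    rC changes. *)
Lemma step_above : A =i A' \/ chain A A' /\ phi_from g c.+1.*2 (M - c.+1).*2 = 0.
Proof.
have [lt|ge] := ltnP i n; first by have [] := step_split lt.
have Ei : i = n by lia.
have [_ _ MA _ [p0 _]] := step_split_last Ei; right; split=> //.
by exists A; [right | left; rewrite Ei].
Qed.

Lemma step_below : B =i B' \/ chain B B' /\ eps_below g c.*2 = 0.
Proof.
have [lt|ge] := ltnP i n; first by have [] := step_split lt.
have Ei : i = n by lia.
have [_ _ _ MB [_ e0]] := step_split_last Ei; right; split=> //.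
by exists B; [right | left; rewrite Ei].
Qed.

Lemma fam_sorted j F t : (forall u, sorted ltn (F u)) -> fam_sign j F t = Some true ->
  forall u, sorted ltn (if u == t then subst j j.+1 (F u) else F u).
Proof.
move=> so sg u; case: eqP => [->|//]; have [jF jF'] := sign_of_plus sg.
by apply: sorted_subst => //; [left | apply/negbT].
Qed.

Lemma sorted_split_family' u : sorted ltn (split_family n D' u).
Proof. by rewrite /split_family; case: (odd u); [case: (rcolP (okD' u./2)) | apply: sorted_dual]. Qed.

Lemma split_family_other u : u./2 <> c -> split_family n D' u = split_family n D u.
Proof. by move=> /step_other E; rewrite /split_family E. Qed.

(** f_i on T is f_i f_(2n-i) on the split columns. For i = n the operator
    f_n first raises rC, then the complement of the bars of lC, since both
    have a sign +. *)
Theorem step_raises : exists2 F1, raises_fam M.*2 i' (split_family n D) F1 &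
  raises_fam M.*2 i F1 (split_family n D').
Proof.
have [lt|ge] := ltnP i n; last first.
  have Ei : i = n by lia.
  have [Es cM MA MB [p0 e0]] := step_split_last Ei.
  have Ein : i' = n by lia.
  have p0' := phi_split i_pos okD c.+1 (M - c.+1); rewrite p0 if_same in p0'.
  have e0' := eps_split i_pos okD c; rewrite e0 if_same in e0'.
  have sA : g' c.*2.+1 = Some true by rewrite fam_odd Ein (mem_sign MA).
  have sB : g' c.*2 = Some true by rewrite fam_even Ein (mem_sign MB).
  pose F1 u := if u == c.*2.+1 then subst n n.+1 (split_family n D u) else split_family n D u.
  have E1 u : u <> c.*2.+1 -> fam_sign n F1 u = g' u.
    by move=> ne; rewrite /fam_sign /F1 Ein; case: eqP.
  exists F1.
    exists c.*2.+1; last by move=> u; rewrite /F1 Ein.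
    by split=> //; [lia | rewrite cut_low | rewrite /= sB e0'].
  (* the sign of rC is - by now, so f_n acts on the other column of the pair *)
  exists c.*2; rewrite Ei.
    split; first by lia.
    - by rewrite E1 //; lia.
    - rewrite cut_high //=.
      have -> : fam_sign n F1 c.*2.+1 = Some false.
        rewrite /fam_sign /F1 eqxx split_odd /sign_of /= !(moved_mem MA).
        by have [_ _ -> ->] := moved_at MA.
      rewrite (eq_phi_from (g' := g')); first by rewrite -doubleS p0'.
      by move=> b Hb; apply: E1; lia.
    - rewrite -[RHS]e0'; apply: eq_eps_below => b Hb; apply: E1; lia.
  move=> u; rewrite /F1; have [->|n1] := u =P c.*2.+1.
    have -> : (c.*2.+1 == c.*2) = false by lia.
    rewrite !split_odd; apply: moved_subst MA; first exact: sorted_rcol.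
    by case: (rcolP (okD' c)).
  have [->|n2] := u =P c.*2.
    by rewrite !split_even; apply: moved_subst MB; apply: sorted_dual.
  by apply: split_family_other; lia.
have [_ _ [t [At tc H]]] := step_split lt.
pose F1 u := if u == t then subst i' i'.+1 (split_family n D u) else split_family n D u.
exists F1; first by exists t => // u; rewrite /F1.
have soF := fam_sorted sorted_split_family (let: And4 _ x _ _ := At in x).
exists s.
  have [Ag _] := st; apply: eq_acts_at Ag => u.
  rewrite -(fam_sign_low i_pos okD) // /fam_sign /F1; case: eqP => // _.
  rewrite /sign_of /= !mem_subst.
  have -> : (i == i'.+1) = false by lia.
  have -> : (i.+1 == i'.+1) = false by lia.
  have -> : i != i' by lia.
  have -> : i.+1 != i' by lia.
  by rewrite !andbT !orbF.
move=> u; have [uc|uc] := u./2 =P c; last first.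
  have -> : (u == s) = false by apply/eqP => E; apply: uc; rewrite E.
  rewrite /F1; have -> : (u == t) = false by apply/eqP => E; apply: uc; rewrite E.
  exact: split_family_other.
have [H1 H2] := H u uc; case: eqP => [us|us].
  by apply: moved_subst (H1 us); [apply: soF | apply: sorted_split_family'].
apply: (irr_sorted_eq ltn_trans ltnn); [apply: sorted_split_family' | apply: soF |].
by move=> x; rewrite -(H2 us).
Qed.

Notation knD D := (forall d, col_le (rcol n (D d)) (lcol n (D d.+1))).
Hypothesis emptyD : forall d, M <= d -> D d = [::].

Lemma moved_eq a X X' Y Y' : X =i Y -> X' =i Y' -> moved a X X' -> moved a Y Y'.
Proof. by move=> E E' [H1 H2 H]; split=> [||x]; rewrite -?E -?E'. Qed.

Lemma dual_dual Y : (forall x, x \in Y -> 0 < x <= 2 * n) -> dual n (dual n Y) =i Y.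
Proof.
move=> rY x; rewrite !mem_dual; have [xn|xn] := boolP (0 < x <= 2 * n); last first.
  by apply/idP/idP => // /rY Hx; rewrite Hx in xn.
have -> : 0 < bar n x <= 2 * n by rewrite /bar; lia.
by rewrite barK ?negbK.
Qed.

(** A move of a in the complement of the bars is a move of 2n-a in lC. *)
Lemma chain_dual : chain B B' -> exists2 Y,
  moved i (lcol n (D c)) Y \/ lcol n (D c) =i Y & moved i' Y (lcol n (D' c)) \/ Y =i lcol n (D' c).
Proof.
move=> [X1 H1 H2]; have r1 x : x \in X1 -> 0 < x <= 2 * n.
  case: H1 => [[_ _ ->] /orP [/eqP ->|/andP []]|<-]; rewrite ?mem_dual; try by case/andP.
  by lia.
have rY x : x \in dual n X1 -> 0 < x <= 2 * n by rewrite mem_dual => /andP [].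
have rl := lcol_range (okD c); have rl' := lcol_range (okD' c).
have E1 := dual_dual r1.
exists (dual n X1).
  case: H1 => [mv|E]; [left | right].
    have -> : i = 2 * n - i' by lia.
    apply: moved_dual => //; first by lia.
    by apply: moved_eq mv => // x; rewrite E1.
  by apply: (dual_inj rl rY) => x; rewrite E1 E.
case: H2 => [mv|E]; [left | right].
  apply: moved_dual => //; first by lia.
  by apply: moved_eq mv => // x; rewrite E1.
by apply: (dual_inj rY rl') => x; rewrite E1 E.
Qed.

Lemma lcol_same : B =i B' -> lcol n (D c) =i lcol n (D' c).
Proof. by apply: dual_inj; [apply: (lcol_range (okD c)) | apply: (lcol_range (okD' c))]. Qed.

Lemma lcol_nil d : M <= d -> lcol n (D d) = [::].
Proof.
move=> Md; apply/nilP; have [_ sz _] := lcolP (okD d).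
by rewrite /nilp sz emptyD.
Qed.

Lemma i'_pos : 0 < i'. Proof. by lia. Qed.

Lemma above_le Y : col_le A Y -> chain A A' ->
  sign_of i (mem Y) <> Some true -> sign_of i' (mem Y) <> Some true -> col_le A' Y.
Proof.
have i0 : 0 < i by case/andP: i_pos.
move=> le [X H1 H2] s1 s2.
have le1 : col_le X Y.
  case: H1 => [mv|E]; last exact: (col_le_eq E (fun x => erefl)).
  exact: (col_le_raise i'_pos mv s2).
case: H2 => [mv|E]; last exact: (col_le_eq E (fun x => erefl)).
exact: (col_le_raise i0 mv s1).
Qed.

Lemma above_le_back Y : chain A A' -> col_le A' Y -> col_le A Y.
Proof.
have i0 : 0 < i by case/andP: i_pos.
move=> [X H1 H2] le.
have le1 : col_le X Y.
  case: H2 => [mv|E]; last exact: (col_le_eq (fun x => esym (E x)) (fun x => erefl)).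
  exact: (col_le_left i0 mv).
case: H1 => [mv|E]; last exact: (col_le_eq (fun x => esym (E x)) (fun x => erefl)).
exact: (col_le_left i'_pos mv).
Qed.

Lemma below_le X : chain B B' -> col_le X (lcol n (D c)) -> col_le X (lcol n (D' c)).
Proof.
have i0 : 0 < i by case/andP: i_pos.
move=> /chain_dual [Y H1 H2] le.
have le1 : col_le X Y.
  case: H1 => [mv|E]; last exact: (col_le_eq (fun x => erefl) E).
  exact: (col_le_right i0 mv).
case: H2 => [mv|E]; last exact: (col_le_eq (fun x => erefl) E).
exact: (col_le_right i'_pos mv).
Qed.

Lemma below_le_back X : chain B B' -> sign_of i (mem X) <> Some false ->
  sign_of i' (mem X) <> Some false -> col_le X (lcol n (D' c)) -> col_le X (lcol n (D c)).
Proof.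
have i0 : 0 < i by case/andP: i_pos.
move=> /chain_dual [Y H1 H2] s1 s2 le.
have le1 : col_le X Y.
  case: H2 => [mv|E]; last exact: (col_le_eq (fun x => erefl) (fun x => esym (E x))).
  exact: (col_le_lower i'_pos mv s2).
case: H1 => [mv|E]; last exact: (col_le_eq (fun x => erefl) (fun x => esym (E x))).
exact: (col_le_lower i0 mv s1).
Qed.

(** Raising lC only helps the comparison with the column before; raising rC
    is possible as the next lC has no sign + ([signs_above]). *)
Lemma step_kn : knD D -> knD D'.
Proof.
move=> K d; have [Ed|nd] := d =P c.
  rewrite (@step_other d.+1); last by lia.
  rewrite Ed; have K' := K c; have [EA|[ch p0]] := step_above.
    exact: (col_le_eq EA (fun x => erefl)).
  have [ge|lt] := leqP M c.+1; first by rewrite lcol_nil //; apply: col_le_nil.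
  have Ek : M - c.+1 = (M - c.+2).+1 by lia.
  rewrite Ek in p0; have [s1 s2] := signs_above i_pos okD p0.
  exact: above_le.
rewrite (@step_other d nd); have [Ed|nd1] := d.+1 =P c; last by rewrite step_other.
have K' := K d; rewrite Ed in K' *.
by have [EB|[ch e0]] := step_below; [exact: (col_le_eq (fun x => erefl) (lcol_same EB)) | apply: below_le].
Qed.

(** Lowering rC only helps; lowering lC is possible as the rC before has no
    sign - ([signs_below]). *)
Lemma step_kn_back : knD D' -> knD D.
Proof.
move=> K d; have [Ed|nd] := d =P c.
  rewrite -(@step_other d.+1); last by lia.
  rewrite Ed; have K' := K c; have [EA|[ch p0]] := step_above.
    exact: (col_le_eq (fun x => esym (EA x)) (fun x => erefl)).
  exact: above_le_back.
rewrite -(@step_other d nd); have [Ed|nd1] := d.+1 =P c; last by rewrite -step_other.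
have K' := K d; rewrite Ed in K' *.
have [EB|[ch e0]] := step_below.
  exact: (col_le_eq (fun x => erefl) (fun x => esym (lcol_same EB x))).
rewrite -Ed in e0; have [s1 s2] := signs_below i_pos okD e0.
by rewrite (@step_other d nd) in K' *; apply: below_le_back.
Qed.

End Step.

Section Lower.
Variables (n M i : nat) (D D' : nat -> seq nat) (s : nat).
Hypothesis i_pos : 0 < i <= n.
Hypothesis At : acts_at M.*2 (half_sign n i D) false s.
Hypothesis low : forall c, D' c =
  if c == s./2 then subst (letter n i s).+1 (letter n i s) (D c) else D c.

(** e_i is inverse to f_i: the signs of the other half columns do not
    change. *)
Lemma lower_step : columns_step n M i D' D s.
Proof.
have [sM gs p0 e0] := At; have act : odd s || (i < n) by move: gs; rewrite /half_sign; case: ifP.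
have sg : sign_of (letter n i s) (mem (D s./2)) = Some false by move: gs; rewrite /half_sign act.
have [aX aX'] := sign_of_minus sg.
rewrite /= in aX aX'.
have D's : D' s./2 = subst (letter n i s).+1 (letter n i s) (D s./2) by rewrite low eqxx.
have other u : u <> s -> half_sign n i D' u = half_sign n i D u.
  move=> us; rewrite /half_sign low; case: eqP => // uc.
  case: ifP => // actu; have od : odd u = ~~ odd s by clear -us uc; lia.
  have lt : i < n by move: act actu; rewrite od; case: (odd s).
  rewrite /sign_of /= !mem_subst uc.
  rewrite /letter od.
  by case: (odd s) => /=; do ![case: eqP => /=]; rewrite ?andbT ?orbF //; lia.
split.
  split=> //.
  - rewrite /half_sign act D's /sign_of /= !mem_subst.
    by rewrite aX !eqxx orbT andbF /= gtn_eqF.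
  - by rewrite -[RHS]p0; apply: eq_phi_from => u Hu; apply: other; lia.
  - by rewrite -[RHS]e0; apply: eq_eps_below => u Hu; apply: other; lia.
move=> c; rewrite low; case: eqP => // ->.
by rewrite subst_back //; apply/negbT.
Qed.

End Lower.

(** * The crystal of Kashiwara-Nakashima tableaux *)

Lemma col_ok_nil n : col_ok n [::].
Proof.
split=> //; rewrite /pending subn0.
by elim: n 1 => //= n IH a; rewrite IH.
Qed.

(** The signs - to the left can only be cancelled by the signs + that
    survive in the columns read before. *)
Lemma eps_below_phi g a d : eps_below g a <= eps_below g (a + d) + phi_from g a d.
Proof.
elim: d a => [|d IH] a; first by rewrite addn0 leq_addr.
rewrite addnS -addSn; have := IH a.+1; rewrite /=.
by case: (g a) => [[]|] /=; lia.
Qed.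

Lemma phi_from_noplus g a d : (forall b, a <= b < a + d -> g b <> Some true) ->
  phi_from g a d = 0.
Proof.
elim: d a => //= d IH a H; rewrite IH; last by move=> b Hb; apply: H; lia.
by have := H a; case: (g a) => [[]|] //= H'; exfalso; apply: H' => //; lia.
Qed.

Lemma minus_eps g N s : s < N -> g s = Some false ->
  (forall b, s < b < N -> g b <> Some true) -> 0 < eps_below g N.
Proof.
move=> sN gs H; have := eps_below_phi g s.+1 (N - s.+1).
rewrite (phi_from_noplus (d := N - s.+1)); last by move=> b Hb; apply: H; lia.
have -> : s.+1 + (N - s.+1) = N by lia.
by rewrite /= gs /= addn0; lia.
Qed.

(** r is the last letter before the first gap, x the first letter after it. *)
Lemma column_gap m C : sorted ltn C -> all (fun x => 1 <= x <= m) C ->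
  C = iota 1 (size C) \/
  exists r x, [/\ forall y, 0 < y <= r -> y \in C, r.+1 < x, x \in C &
    forall y, r < y < x -> y \notin C].
Proof.
move=> so /allP ra; have ex : exists r, r.+1 \notin C.
  by exists m; apply/negP => /ra; lia.
case: (ex_minnP ex) => r nr rmin.
have below y : 0 < y <= r -> y \in C.
  by move=> yr; apply/negPn/negP => H; have := rmin y.-1; rewrite prednK ?H; lia.
have [|none] := boolP (has (fun x => r.+1 < x) C).
  move=> /hasP [x0 x0C lt]; right.
  have ex2 : exists x, (x \in C) && (r.+1 < x) by exists x0; rewrite x0C.
  case: (ex_minnP ex2) => x /andP [xC rx] xmin; exists r, x; split=> // y ry.
  apply/negP => yC; have [E|ne] := y =P r.+1; first by rewrite -E yC in nr.
  by have := xmin y; rewrite yC /=; lia.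
left; have E : C =i iota 1 r.
  move=> y; rewrite mem_iota; apply/idP/idP => [yC|]; last by move=> H; apply: below; lia.
  have := ra _ yC; have : ~~ (r.+1 < y) by apply: contra none => H; apply/hasP; exists y.
  have : y <> r.+1 by move=> E; rewrite -E yC in nr.
  by lia.
have EC : C = iota 1 r by apply: (irr_sorted_eq ltn_trans ltnn so (iota_ltn_sorted 1 r)).
by rewrite {2}EC size_iota.
Qed.

Section Highest.
Variables (n M : nat) (D : nat -> seq nat).
Hypothesis okD : forall c, col_ok n (D c).
Hypothesis leD : forall c, col_le (D c) (D c.+1).
Hypothesis emptyD : forall c, M <= c -> D c = [::].
Hypothesis hi : forall i, 0 < i <= n -> eps_below (half_sign n i D) M.*2 = 0.

Lemma count_upto_iota h a : count_upto (iota 1 h) a = minn h a.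
Proof.
elim: a => [|a IH]; first by rewrite /count_upto /= minn0.
by rewrite count_uptoS IH mem_iota; lia.
Qed.

Lemma col_le_far c d : c <= d -> col_le (D c) (D d).
Proof.
elim: d => [|d IH]; first by rewrite leqn0 => /eqP ->.
rewrite leq_eqVlt => /orP [/eqP <- //|cd]; exact: (col_le_trans (IH cd) (leD d)).
Qed.

Lemma count_upto_gap C r a : (forall y, 0 < y <= r -> y \in C) -> r.+1 \notin C -> a = r.+1 -> count_upto C a = r.
Proof.
move=> H H' ->; rewrite count_uptoS (negPf H') addn0 (eq_count_upto (Y := iota 1 r)) ?count_upto_iota ?minnn // => x xr.
by rewrite H // mem_iota; lia.
Qed.

(** By induction from right to left. If a column departs from 1, 2, 3, ...
    at x after r, the columns to its right have height at most r by the
    comparison of columns. If x is unbarred, it gives an uncancelled - for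
    e_(x-1). If x = bar q with q > r, it gives one for e_q. If q <= r, the
    bracket of q stays open since all smaller letters are in the column. *)
Lemma highest_column c : D c = iota 1 (size (D c)).
Proof.
suff H k : forall c, M <= c + k -> D c = iota 1 (size (D c)) by apply: (H M); lia.
elim: k => [|k IHk] {}c Mk; first by rewrite emptyD //; lia.
have IH d : c < d -> D d = iota 1 (size (D d)) by move=> cd; apply: IHk; lia.
have [ge|cM] := leqP M c; first by rewrite emptyD.
have [so ra sz p0] := okD c.
have [//|[r [x [Hr rx xC gap]]]] := column_gap so ra; exfalso.
have xn := col_range (okD c) xC.
have nr : r.+1 \notin D c by apply: gap; lia.
have hd d : c < d -> size (D d) <= r.
  move=> cd; have le : count_upto (D d) r.+1 <= r.
    by apply: leq_trans (col_le_far (ltnW cd) _) _; rewrite (count_upto_gap Hr nr).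
  by move: le; rewrite {1}(IH _ cd) count_upto_iota; lia.
have memd d y : c < d -> y \in D d -> y <= r.
  by move=> cd; rewrite (IH _ cd) mem_iota; have := hd _ cd; lia.
(* a sign - at the half column s is not cancelled *)
have bad i s : 0 < i <= n -> r < i -> s./2 = c -> half_sign n i D s = Some false ->
    (~~ odd s -> half_sign n i D s.+1 <> Some true) -> False.
  move=> iN ri sc gs H; have := hi iN; apply/eqP; rewrite -lt0n.
  apply: (minus_eps (s := s)) => //; first by lia.
  move=> b /andP [sb bM]; have [Eb|ne] := b./2 =P c.
    have -> : b = s.+1 by lia.
    by apply: H; lia.
  have cb : c < b./2 by lia.
  rewrite /half_sign; case: ifP => // _; rewrite /sign_of /=.
  case lD : (_ \in D _); last by case: (_ \in D _).
  have := memd _ _ cb lD; rewrite /letter; case: (odd b); first by lia.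
  have : size (D b./2) <= n by case: (okD b./2).
  by have := lD; rewrite IH // mem_iota /letter; have := hd _ cb; case: (odd b); lia.
have [xle|xgt] := leqP x n.
  have x1 : x.-1 \notin D c by apply: gap; lia.
  apply: (bad x.-1 c.*2.+1); rewrite ?odd_double /= ?odd_double //; [lia | lia | by rewrite uphalf_double | ].
  rewrite /half_sign /letter /= odd_double /= uphalf_double /sign_of /= (negPf x1).
  by rewrite prednK ?xC //; lia.
pose q := bar n x; have Ex : x = bar n q by rewrite barK.
have qn : 0 < q <= n by rewrite /q /bar; lia.
have rn : r < n.
  rewrite ltnNge; apply/negP => nr'; have : n.+1 <= size (D c).
    have := uniq_leq_size (s1 := rcons (iota 1 n) x) (s2 := D c).
    rewrite size_rcons size_iota; apply.
      by rewrite rcons_uniq iota_uniq mem_iota andbT; lia.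
    by move=> y; rewrite mem_rcons inE mem_iota => /orP [/eqP -> //|Hy]; apply: Hr; lia.
  by lia.
have [qr|qr] := leqP q r; last first.
  have [Eq|ne] := q =P n.
    have nC : n \notin D c by apply: gap; lia.
    apply: (bad n c.*2.+1); rewrite /= ?odd_double ?uphalf_double //; first by lia.
    rewrite /half_sign /letter /= odd_double /= uphalf_double /sign_of /= (negPf nC).
    by have -> : n.+1 = x by [rewrite Ex Eq /bar; lia]; rewrite xC.
  have x1 : 2 * n - q \notin D c by apply: gap; rewrite /q /bar; lia.
  have qC : q \notin D c by apply: gap; lia.
  have lt : q < n by lia.
  apply: (bad q c.*2); rewrite ?doubleK //.
    rewrite /half_sign /letter odd_double lt doubleK /sign_of /= (negPf x1).
    by have -> : (2 * n - q).+1 = x by [rewrite Ex /bar; lia]; rewrite xC.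
  move=> _; rewrite /half_sign /letter /= odd_double /= uphalf_double /sign_of /= (negPf qC).
  by case: (_ \in _).
have pq : paired n (D c) q by rewrite /paired -Ex xC Hr //; lia.
have : 0 < pending n (D c) q.-1.
  rewrite pendingE // /mark pq; by [].
suff H t : t < q -> 0 < pending n (D c) (q.-1 - t).
  by have := H q.-1; rewrite subnn p0; lia.
elim: t => [|t IHt] tq; first by rewrite subn0 pendingE // /mark pq.
have pos : 0 < q.-1 - t <= n by lia.
have -> : q.-1 - t.+1 = (q.-1 - t).-1 by lia.
rewrite pendingE // /mark; have tr : q.-1 - t \in D c by apply: Hr; lia.
have pt := IHt (ltnW tq).
by case: ifP => // _; rewrite /free tr.
Qed.

End Highest.

Section Crystal.
Variables (n : nat) (lam : seq nat).
Hypothesis plam : is_partition lam.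

Notation M := (nth 0 lam 0).
Notation D T := (column T).

Lemma kn_width T : KN lam n T -> width T = M.
Proof.
by move=> /(KNP n plam) [sh _ _]; rewrite /width -nth0 -(nth_shape T 0) sh.
Qed.

Lemma kn_partition T : KN lam n T -> is_partition (shape T).
Proof. by move=> /(KNP n plam) [-> _ _]. Qed.

Lemma kn_empty T c : KN lam n T -> M <= c -> D T c = [::].
Proof. by move=> K Mc; apply: column_out; [apply: kn_partition | rewrite kn_width]. Qed.

Lemma kn_ok T c : KN lam n T -> col_ok n (D T c).
Proof.
move=> K; have /(KNP n plam) [_ ok _] := K; have [/ok //|wc] := ltnP c (width T).
by rewrite (column_out (kn_partition K) wc); apply: col_ok_nil.
Qed.

Lemma lcol_nil_nil : lcol n [::] = [::].
Proof. by apply/nilP; rewrite /nilp; have [_ -> _] := lcolP (col_ok_nil n). Qed.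

Lemma kn_le T c : KN lam n T -> col_le (rcol n (D T c)) (lcol n (D T c.+1)).
Proof.
move=> K; have /(KNP n plam) [_ _ le] := K; have [/le //|wc] := ltnP c.+1 (width T).
by rewrite (column_out (kn_partition K) wc) lcol_nil_nil; apply: col_le_nil.
Qed.

Lemma knD_KN T : shape T = lam -> (forall c, col_ok n (D T c)) ->
  (forall c, col_le (rcol n (D T c)) (lcol n (D T c.+1))) -> KN lam n T.
Proof. by move=> sh ok le; apply/(KNP n plam); split. Qed.

Lemma kn_sorted T c : KN lam n T -> sorted ltn (D T c).
Proof. by move=> /kn_ok ok; case: (ok c). Qed.

(** The arrows of the crystal of Kashiwara-Nakashima tableaux. *)
Definition stepKN i T T' := [/\ KN lam n T, KN lam n T' & exists s, columns_step n M i (D T) (D T') s].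

Lemma fC_KN i T T' : 0 < i <= n -> KN lam n T -> fC n i T = Some T' -> stepKN i T T'.
Proof.
move=> iN K E; have pT := kn_partition K.
have wM : width T <= M by rewrite kn_width.
have := fC_step iN pT wM (fun c => kn_sorted c K); rewrite E => -[sh [s A ED]].
have st : columns_step n M i (D T) (D T') s by [].
have ok := step_ok iN st (fun c => kn_ok c K).
split=> //; last by exists s.
apply: knD_KN => //; first by rewrite sh; case/(KNP n plam): K.
apply: (step_kn iN st (fun c => kn_ok c K) ok (fun c => @kn_empty T c K) (fun c => kn_le c K)).
Qed.

Lemma eC_KN i T T' : 0 < i <= n -> KN lam n T -> eC n i T = Some T' -> stepKN i T' T.
Proof.
move=> iN K E; have pT := kn_partition K.
have wM : width T <= M by rewrite kn_width.
have := eC_step iN pT wM (fun c => kn_sorted c K); rewrite E => -[sh [s A ED]].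
have st := lower_step iN A ED.
have ok := step_ok_back iN st (fun c => kn_ok c K).
have sh' : shape T' = lam by rewrite sh; case/(KNP n plam): K.
split=> //; last by exists s.
apply: knD_KN => //.
apply: (step_kn_back iN st ok (fun c => kn_ok c K) (fun c => kn_le c K)).
Qed.

Lemma eq_columns T T' : is_partition (shape T) -> shape T = shape T' -> D T =1 D T' -> T = T'.
Proof.
move=> pT sh E; apply: eq_tableau => // -[r c].
by rewrite -!nth_column // -?sh // E.
Qed.

Lemma stepKN_f i T T' : 0 < i <= n -> stepKN i T T' -> fC n i T = Some T'.
Proof.
move=> iN [K K' [s [A ED]]]; have pT := kn_partition K.
have wM : width T <= M by rewrite kn_width.
have := fC_step iN pT wM (fun c => kn_sorted c K).
case: (fC n i T) => [T1 [sh [s1 A1 ED1]]|/(_ s) //].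
congr Some; apply: eq_columns; first by rewrite sh.
  by rewrite sh; case/(KNP n plam): K => -> _ _; case/(KNP n plam): K' => ->.
by move=> c; rewrite ED1 ED (acts_at_uniq A1 A).
Qed.

(** Grows by one with each f_i, which bounds the length of paths. *)
Definition column_sum T := \sum_(c < M) \sum_(x <- D T c) x.

Lemma sum_subst a b C : uniq C -> a \in C ->
  \sum_(x <- subst a b C) x + a = \sum_(x <- C) x + b.
Proof.
move=> u aC; rewrite /subst big_map (bigD1_seq a) //= eqxx.
rewrite (eq_bigr id) => [|x /negPf ->] //; rewrite [in RHS](bigD1_seq a) //=.
by lia.
Qed.

Lemma column_sum_step i T T' : 0 < i <= n -> stepKN i T T' -> column_sum T' = (column_sum T).+1.
Proof.
move=> iN [K K' [s st]]; have [[sM _ _ _] ED] := st.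
have cM : s./2 < M by lia.
rewrite /column_sum (bigD1 (Ordinal cM)) //= [in RHS](bigD1 (Ordinal cM)) //= -addSn; congr (_ + _).
  rewrite ED eqxx; have [aC _] := sign_of_plus (step_sign st).
  apply: (@addIn (letter n i s)).
  by rewrite (sum_subst (letter n i s).+1 (col_uniq (kn_ok s./2 K)) aC) addSn addnS.
apply: eq_bigr => c /eqP ne; rewrite ED; case: eqP => // E; exfalso; apply: ne.
exact: val_inj.
Qed.

Lemma column_sum_bound T : KN lam n T -> column_sum T <= M * (n * (2 * n)).
Proof.
move=> K; rewrite /column_sum -[in X in _ <= X](card_ord M) -sum_nat_const; apply: leq_sum => c _.
have [_ /allP ra sz _] := kn_ok c K.
apply: (@leq_trans (size (D T c) * (2 * n))); last by rewrite leq_mul2r sz orbT.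
rewrite -sum1_size big_distrl /= big_seq [X in _ <= X]big_seq.
by apply: leq_sum => x /ra; rewrite mul1n => /andP [].
Qed.

Lemma eC_None i T : 0 < i <= n -> KN lam n T ->
  eC n i T = None <-> eps_below (half_sign n i (D T)) M.*2 = 0.
Proof.
move=> iN K; have pT := kn_partition K; have wM : width T <= M by rewrite kn_width.
have := eC_step iN pT wM (fun c => kn_sorted c K).
case: (eC n i T) => [T1 [_ [s A _]]|H]; split=> //.
  by move=> e0; have : 0 < eps_below (half_sign n i (D T)) M.*2 by [apply/acts_minusP; exists s]; rewrite e0.
by move=> _; apply/eqP; rewrite -leqn0 leqNgt; apply/negP => /acts_minusP [s] /H.
Qed.

Lemma fC_None i T : 0 < i <= n -> KN lam n T ->
  fC n i T = None <-> phi_from (half_sign n i (D T)) 0 M.*2 = 0.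
Proof.
move=> iN K; have pT := kn_partition K; have wM : width T <= M by rewrite kn_width.
have := fC_step iN pT wM (fun c => kn_sorted c K).
case: (fC n i T) => [T1 [_ [s A _]]|H]; split=> //.
  by move=> e0; have : 0 < phi_from (half_sign n i (D T)) 0 M.*2 by [apply/acts_plusP; exists s]; rewrite e0.
by move=> _; apply/eqP; rewrite -leqn0 leqNgt; apply/negP => /acts_plusP [s] /H.
Qed.

Lemma hw_shape (mu : seq nat) : shape (hw_tableau mu) = mu.
Proof.
apply: (@eq_from_nth _ 0); first by rewrite size_map size_mkseq.
move=> r; rewrite size_map size_mkseq => rm.
by rewrite (nth_map [::]) ?size_mkseq // nth_mkseq // size_nseq.
Qed.

Lemma hw_column (mu : seq nat) c : is_partition mu ->
  D (hw_tableau mu) c = iota 1 (colh (hw_tableau mu) c).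
Proof.
move=> pmu; rewrite /column -[in RHS](addn0 1) iotaDl; apply/eq_in_map => r.
rewrite mem_iota /= add1n => rc.
have pT : is_partition (shape (hw_tableau mu)) by rewrite hw_shape.
rewrite -in_rowE // -nth_shape hw_shape in rc.
have rm : r < size mu by rewrite ltnNge; apply/negP => ge; rewrite nth_default in rc.
by rewrite /entry /= nth_mkseq // nth_nseq rc.
Qed.

Lemma colh_shape T T' c : shape T = shape T' -> colh T c = colh T' c.
Proof. by move=> E; rewrite /colh -!(count_map size (fun l => c < l)) -!/(shape _) E. Qed.

Lemma kn_shape T : KN lam n T -> shape T = lam.
Proof. by case/(KNP n plam). Qed.

(** Uniqueness of the highest weight element of the whole crystal, so every
    tableau is obtained from it by operators f. *)
Lemma highest_hw T : KN lam n T -> (forall i, 0 < i <= n -> eC n i T = None) ->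
  T = hw_tableau lam.
Proof.
move=> K hi; apply: eq_columns; [exact: kn_partition | by rewrite hw_shape kn_shape |].
have sh : shape T = shape (hw_tableau lam) by rewrite hw_shape kn_shape.
move=> c; rewrite hw_column // -(colh_shape c sh) -(size_column T).
apply: (@highest_column n M) => //.
- by move=> d; apply: kn_ok.
- by move=> d; apply: (col_le_split (kn_ok d K) (kn_ok d.+1 K)); apply: kn_le.
- by move=> d; apply: kn_empty.
- by move=> i iN; apply/eC_None => //; apply: hi.
Qed.

Lemma to_highest_KN (J : pred nat) T : (forall j, J j -> 0 < j <= n) -> KN lam n T ->
  exists u js, [/\ KN lam n u, forall j, J j -> eC n j u = None, all J js
    & apply_ops (fC n) js u = Some T].
Proof.
move=> Jn; move: {2}(column_sum T) (erefl (column_sum T)) => k.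
elim: k T => [|k IH] T Ek K.
  exists T, [::]; split=> // j /Jn jn; case E: (eC n j T) => [T'|] //.
  by have := column_sum_step jn (eC_KN jn K E); rewrite Ek.
have [[j [Jj ne]]|none] := excluded_middle_informative (exists j, J j /\ eC n j T <> None); last first.
  exists T, [::]; split=> // j Jj; case E: (eC n j T) => [T'|] //.
  by exfalso; apply: none; exists j; rewrite E.
case E: (eC n j T) ne => [T'|] // _; have st := eC_KN (Jn _ Jj) K E.
have [K' _ _] := st; have := column_sum_step (Jn _ Jj) st; rewrite Ek => -[Ek'].
have [u [js [Ku hu Jjs Ejs]]] := IH T' (esym Ek') K'.
exists u, (rcons js j); split=> //; first by rewrite all_rcons Jj.
rewrite /apply_ops foldl_rcons -/(apply_ops _ _ _) Ejs /=.
exact: (stepKN_f (Jn _ Jj) st).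
Qed.

Lemma to_lowest_KN (J : pred nat) T : (forall j, J j -> 0 < j <= n) -> KN lam n T ->
  exists u js, [/\ KN lam n u, forall j, J j -> fC n j u = None, all J js
    & apply_ops (fC n) js T = Some u].
Proof.
move=> Jn; move: {2}(M * (n * (2 * n)) - column_sum T) (erefl (M * (n * (2 * n)) - column_sum T)) => k.
elim: k T => [|k IH] T Ek K.
  exists T, [::]; split=> // j /Jn jn; case E: (fC n j T) => [T'|] //.
  have st := fC_KN jn K E; have [_ K' _] := st.
  by have := column_sum_bound K'; have := column_sum_step jn st; lia.
have [[j [Jj ne]]|none] := excluded_middle_informative (exists j, J j /\ fC n j T <> None); last first.
  exists T, [::]; split=> // j Jj; case E: (fC n j T) => [T'|] //.
  by exfalso; apply: none; exists j; rewrite E.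
case E: (fC n j T) ne => [T'|] // _; have st := fC_KN (Jn _ Jj) K E.
have [_ K' _] := st; have Ek' := column_sum_step (Jn _ Jj) st.
have [|u [js [Ku hu Jjs Ejs]]] := IH T' _ K'; first by lia.
exists u, (j :: js); split=> //=; first by rewrite Jj.
by rewrite /apply_ops /= E.
Qed.

End Crystal.

(** * Disjoint columns as a skew filling *)

Lemma phi_from_tail g c d e : (forall b, c + d <= b -> g b = None) ->
  phi_from g c (d + e) = phi_from g c d.
Proof.
elim: d c => [|d IH] c H.
  by rewrite add0n /=; apply: phi_from_None => b Hb; apply: H; lia.
by rewrite addSn /= IH // => b Hb; apply: H; lia.
Qed.

Lemma strip_lt d c L : (d + c).+1 = L -> [/\ d < L, c < L & d = L - c.+1].
Proof. by move=> <-; split; lia. Qed.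

Section Pile.
Variables (N L K : nat).
Hypothesis K_pos : 0 < K.
Hypothesis LK : L * K <= N.
Hypothesis LN : L <= N.

(** The column c of the family is put in the strip of K rows with number
    L-1-c, so no two columns meet a row and the only condition is that
    columns increase. The column signs are those of the family. *)
Definition pile (F : nat -> seq nat) : filling := fun x =>
  if (x.1 %/ K + x.2).+1 == L then nth 0 (F x.2) (x.1 %% K) else 0.
Definition pile_inner : pred cell := fun x => (x.1 %/ K + x.2).+1 < L.
Definition pile_shape := mkseq (fun r => L.-1 - r %/ K) (K * L.-1).

(** The strip b has the inner shape of L-1-b cells per row. *)
Lemma pile_peels : exists xs, peels pile_inner xs.
Proof.
have nthE r : nth 0 pile_shape r = L.-1 - r %/ K.
  have [lt|ge] := ltnP r (K * L.-1); first by rewrite nth_mkseq.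
  rewrite nth_default ?size_mkseq //; apply/esym/eqP; rewrite subn_eq0.
  by rewrite leq_divRL // mulnC.
have pnu : is_partition pile_shape.
  apply: partition_nthP => r; rewrite ?size_mkseq !nthE => lt.
    by rewrite leq_sub2l // leq_div2r.
  by rewrite subn_gt0 ltn_divLR // mulnC.
exists (slide_order (row_filling pile_shape)).
apply: peels_ext (peels_standard pnu (row_filling_standard pnu)) => -[r c].
by rewrite /pile_inner /= nthE; move: (r %/ K) => d; clear; apply/idP/idP; lia.
Qed.

(** K rows are enough for every column. *)
Definition stacked (F : nat -> seq nat) := forall u, [/\ sorted ltn (F u), all (ltn 0) (F u) & size (F u) <= K].

Section Family.
Variable F : nat -> seq nat.
Hypothesis stF : stacked F.

Lemma pile_in r c : pile F (r, c) != 0 ->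
  (r %/ K + c).+1 = L /\ r %% K < size (F c).
Proof.
rewrite /pile /=; case: (_.+1 =P L) => [<- nz|//]; split=> //.
by rewrite ltnNge; apply/negP => ge; rewrite nth_default in nz.
Qed.

Lemma pile_neq0 r c : (r %/ K + c).+1 = L -> r %% K < size (F c) -> pile F (r, c) != 0.
Proof.
move=> E lt; rewrite /pile /= E eqxx -lt0n; have [_ /allP pos _] := stF c.
by apply: pos; apply: mem_nth.
Qed.

Lemma pile_skewt : skewt N pile_inner (pile F).
Proof.
split.
- move=> r c r' c' rr cc; rewrite /pile_inner /=; have := leq_div2r K rr; lia.
- by move=> [r c]; rewrite /pile_inner /pile /= => lt; rewrite ltn_eqF.
- move=> r c r' c' rr cc; rewrite /= !orbF /pile_inner /= => H.
  have dd := leq_div2r K rr.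
  have le : (r %/ K + c).+1 <= L by case/orP: H => [/ltnW //|/pile_in [<-]].
  have [lt|ge] := ltnP (r' %/ K + c').+1 L => //=.
  have [Ec Er] : c' = c /\ r' %/ K = r %/ K by lia.
  case/orP: H => [H|/pile_in [EL lt]]; first by lia.
  subst c'; apply: pile_neq0; first by rewrite Er.
  by apply: leq_ltn_trans lt; have := divn_eq r K; have := divn_eq r' K; rewrite Er; lia.
- by move=> r c c' lt /pile_in [E _] /pile_in [E' _]; lia.
- move=> r r' c lt nz nz'; have [E s1] := pile_in nz; have [E' s2] := pile_in nz'.
  rewrite /pile /= E E' eqxx; have [so _ _] := stF c.
  have rr : r %% K < r' %% K.
    have Er : r %/ K = r' %/ K by move: E E'; move: (r %/ K) (r' %/ K) => a b; lia.
    have lt2 : r %/ K * K + r %% K < r' %/ K * K + r' %% K by rewrite -!divn_eq.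
    by rewrite Er ltn_add2l in lt2.
  by apply: (sorted_ltn_nth ltn_trans 0 so).
- move=> r c nz; have [E _] := pile_in nz; have [H cL _] := strip_lt E.
  split; last exact: leq_trans LN.
  apply: leq_trans LK.
  by rewrite -ltn_divLR.
Qed.

Lemma pile_occurs c a : 0 < a -> occurs N (pile F) c a = (c < L) && (a \in F c).
Proof.
move=> a0; apply/occursP/andP => [[r rN E]|[cL aF]].
  have nz : pile F (r, c) != 0 by rewrite E -lt0n.
  have [EL lt] := pile_in nz; split; first by have [] := strip_lt EL.
  by rewrite -E /pile /= EL eqxx mem_nth.
have [_ _ szF] := stF c.
have lt : index a (F c) < K by apply: leq_trans szF; rewrite index_mem.
have Ed : ((L - c.+1) * K + index a (F c)) %/ K = L - c.+1.
  by rewrite divnMDl // divn_small ?addn0.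
exists ((L - c.+1) * K + index a (F c)).
  apply: leq_trans LK; rewrite -ltn_divLR // Ed; lia.
rewrite /pile /= Ed modnMDl modn_small // nth_index //.
by have -> : ((L - c.+1 + c).+1 == L) by lia.
Qed.

Lemma pile_sign j c : 0 < j -> col_sign N j (pile F) c =
  if c < L then fam_sign j F c else None.
Proof.
move=> j0; rewrite /col_sign /fam_sign /sign_of !pile_occurs //.
by case: (c < L).
Qed.

Lemma pile_phi j c : 0 < j -> c <= L ->
  phi_from (col_sign N j (pile F)) c (N - c) = phi_from (fam_sign j F) c (L - c).
Proof.
move=> j0 cL; have -> : N - c = (L - c) + (N - L) by lia.
rewrite phi_from_tail => [|b Hb]; last by rewrite pile_sign // ltnNge; have -> : L <= b by lia.
by apply: eq_phi_from => b Hb; rewrite pile_sign //; have -> : b < L by lia.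
Qed.

Lemma pile_eps j c : 0 < j -> c <= L ->
  eps_below (col_sign N j (pile F)) c = eps_below (fam_sign j F) c.
Proof.
move=> j0 cL; apply: eq_eps_below => b Hb; rewrite pile_sign //.
by have -> : b < L by lia.
Qed.

Lemma pile_ph j : 0 < j -> ph N j (pile F) = phi_from (fam_sign j F) 0 L.
Proof. by move=> j0; have := pile_phi j0 (leq0n L); rewrite !subn0. Qed.

Lemma pile_ep j : 0 < j -> ep N j (pile F) = eps_below (fam_sign j F) L.
Proof.
move=> j0; rewrite -(pile_eps j0 (leqnn L)) /ep.
have -> : N = L + (N - L) by lia.
apply: eps_below_None => b /andP [Lb _]; rewrite subnKC // pile_sign //.
by rewrite ltnNge Lb.
Qed.

Lemma pile_weight a : 0 < a -> weight N (pile F) a = count (fun c => a \in F c) (iota 0 L).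
Proof.
move=> a0; rewrite /weight; have -> : iota 0 N = iota 0 L ++ iota L (N - L).
  by rewrite -[L in iota L _]add0n -iotaD; congr iota; lia.
rewrite count_cat [X in _ + X](_ : _ = 0) ?addn0; last first.
  rewrite (eq_in_count (a2 := pred0)) ?count_pred0 // => c; rewrite mem_iota => /andP [Lc _].
  by rewrite pile_occurs // ltnNge Lc.
by apply: eq_in_count => c; rewrite mem_iota pile_occurs // => /andP [_ /= ->].
Qed.

Lemma pile_raises j F' : 0 < j -> raises_fam L j F F' -> raises N j (pile F) (pile F').
Proof.
move=> j0 [s [sL gs p0 e0] EF].
have [jF jF'] := sign_of_plus gs; rewrite /= in jF jF'.
have [so _ szF] := stF s.
have lt : index j (F s) < K by apply: leq_trans szF; rewrite index_mem.
pose r := (L - s.+1) * K + index j (F s).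
have Ed : r %/ K = L - s.+1 by rewrite divnMDl // divn_small ?addn0.
have Em : r %% K = index j (F s) by rewrite modnMDl modn_small.
have Es : (r %/ K + s).+1 = L by rewrite Ed; lia.
exists r, s; split.
- by apply: leq_trans LK; rewrite -ltn_divLR // Ed; lia.
- by rewrite /pile /= Es eqxx Em nth_index.
- split; first by lia.
  + by rewrite pile_sign // sL.
  + by rewrite pile_phi.
  + by rewrite pile_eps // ltnW.
apply: functional_extensionality => -[r' c]; rewrite updE xpair_eqE /pile /= EF.
have [->|ne] := c =P s; last by rewrite andbF.
rewrite andbT; case: (r' =P r) => [->|ner].
  rewrite Es eqxx Em; have ii : index j (F s) < size (F s) by rewrite index_mem.
  by rewrite (nth_map 0) // nth_index // eqxx.
case: eqP => // Es'; have Eq : r' %/ K = r %/ K.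
  by have [_ _ ->] := strip_lt Es'; have [_ _ ->] := strip_lt Es.
have [ge|rs] := leqP (size (F s)) (r' %% K).
  by rewrite !nth_default ?size_map.
rewrite (nth_map 0) //; case: eqP => // Ej; exfalso; apply: ner.
have u : uniq (F s) by apply: sorted_uniq so; [apply: ltn_trans | apply: ltnn].
have := index_uniq 0 rs u; rewrite Ej -Em => Emod.
by rewrite (divn_eq r' K) (divn_eq r K) Eq Emod.
Qed.

End Family.
End Pile.

(** * The shape of the virtual tableaux *)

Lemma iota_rcons m : iota 1 m.+1 = iota 1 m ++ [:: m.+1].
Proof. by rewrite -[in LHS](addn1 m) iotaD add1n. Qed.

Section Weights.
Variables (n : nat) (lam : seq nat).
Hypothesis plam : is_partition lam.
Hypothesis n_pos : 0 < n.
Hypothesis lam_n : size lam <= n.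

Notation M := (nth 0 lam 0).
Notation a i := (nth 0 lam i).

Lemma part_mono i j : i <= j -> a j <= a i.
Proof.
move=> ij; have [so _] := andP plam; have [jl|jl] := ltnP j (size lam); last by rewrite nth_default.
by apply: (sorted_leq_nth geq_trans (leqnn : reflexive geq) 0 so); rewrite ?inE //; apply: leq_ltn_trans jl.
Qed.

Lemma part_zero i : n <= i -> a i = 0.
Proof. by move=> ni; rewrite nth_default //; apply: leq_trans ni. Qed.

(** The coefficients of lambda on the fundamental weights telescope. *)
Lemma sum_low r m : 0 < r ->
  sumn [seq omega_coef lam i * (r <= i) | i <- iota 1 m] = a (minn r.-1 m) - a m.
Proof.
move=> r0; elim: m => [|m IH]; first by rewrite minn0 subnn.
rewrite iota_rcons.
rewrite map_cat sumn_cat IH /= addn0 /omega_coef /=.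
have le := part_mono (leqnSn m).
have [rm|rm] := leqP r m.+1; last first.
  by have [-> ->] : minn r.-1 m = m /\ minn r.-1 m.+1 = m.+1 by [split; lia]; lia.
have [-> ->] : minn r.-1 m = r.-1 /\ minn r.-1 m.+1 = r.-1 by split; lia.
have rm' : r.-1 <= m by lia.
by have := part_mono rm'; lia.
Qed.

Lemma sum_high r m : m <= n -> 
  sumn [seq omega_coef lam i * (r <= 2 * n - i) | i <- iota 1 m] = a 0 - a (minn m (2 * n - r)).
Proof.
elim: m => [|m IH] mn; first by rewrite min0n subnn.
rewrite iota_rcons.
rewrite map_cat sumn_cat IH /=; last exact: ltnW.
rewrite addn0 /omega_coef /=.
have le := part_mono (leqnSn m); have le0 := part_mono (leq0n m).
have [rm|rm] := leqP r (2 * n - m.+1); last first.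
  by have -> : minn m.+1 (2 * n - r) = minn m (2 * n - r) by [lia]; lia.
have [-> ->] : minn m (2 * n - r) = m /\ minn m.+1 (2 * n - r) = m.+1 by split; lia.
by lia.
Qed.

(** The part of index r of lambda^A: the row r of lambda, followed by the
    complement of lambda turned around in a box with 2n rows. *)
Definition partA r := a r + (a 0 - a (2 * n - r.+1)).

(** Both sums are telescoping, and lambda has no part beyond the n-th. *)
Lemma lamA_parts : lamA n lam = [seq l <- mkseq partA (2 * n) | 0 < l].
Proof.
rewrite /lamA; congr filter.
have -> : iota 1 (2 * n) = map (addn 1) (iota 0 (2 * n)) by rewrite -iotaDl.
rewrite -map_comp.
apply/eq_in_map => r0; rewrite mem_iota /= => rn; rewrite add1n /partA; set r := r0.+1.
have E : sumn [seq omega_coef lam i * ((r <= i) + (r <= 2 * n - i)) | i <- iota 1 n.-1] =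
    sumn [seq omega_coef lam i * (r <= i) | i <- iota 1 n.-1] +
    sumn [seq omega_coef lam i * (r <= 2 * n - i) | i <- iota 1 n.-1].
  by elim: (iota 1 n.-1) => //= i s ->; rewrite mulnDr; lia.
rewrite E; have r1 : 0 < r by [].
have := sum_low n r1; have := sum_high r (leqnn n).
have -> : iota 1 n = iota 1 n.-1 ++ [:: n].
  by rewrite -{1}(prednK n_pos) iota_rcons (prednK n_pos).
rewrite !map_cat !sumn_cat /= !addn0.
have -> : (r <= 2 * n - n) = (r <= n) by congr (r <= _); lia.
rewrite (part_zero (leqnn n)) subn0 => H1 H2.
have -> : a r0 = a (minn r.-1 n).
  have [le|gt] := leqP r.-1 n; first by [].
  by rewrite (part_zero (ltnW gt)) part_zero.
have -> : a (2 * n - r) = a (minn n (2 * n - r)).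
  have [le|gt] := leqP n (2 * n - r); last by [].
  by rewrite !part_zero.
by rewrite -H1 -H2; lia.
Qed.

Lemma partA_sorted : sorted geq (mkseq partA (2 * n)).
Proof.
apply/(sortedP 0) => r; rewrite size_mkseq => lt; rewrite !nth_mkseq ?(ltnW lt) //=.
rewrite /partA; have l1 := part_mono (leqnSn r).
have l2 : a (2 * n - r.+1) <= a (2 * n - r.+2) by apply: part_mono; lia.
by lia.
Qed.

Lemma lamA_partition : is_partition (lamA n lam).
Proof. by rewrite lamA_parts; apply: partition_filter partA_sorted. Qed.

Lemma nth_lamA r : nth 0 (lamA n lam) r = if r < 2 * n then partA r else 0.
Proof.
rewrite lamA_parts nth_filter_pos ?partA_sorted //; case: ltnP => lt.
  by rewrite nth_mkseq.
by rewrite nth_default ?size_mkseq.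
Qed.

End Weights.

(** * The map E is a rectification *)

Lemma count_pairs (P : pred nat) M : count P (iota 0 M.*2) =
  count (fun c => P c.*2.+1) (iota 0 M) + count (fun c => P c.*2) (iota 0 M).
Proof.
elim: M => // M IH; have E k : iota 0 k.+1 = iota 0 k ++ [:: k].
  by rewrite -[in LHS](addn1 k) iotaD.
rewrite doubleS !E !count_cat IH /=.
by rewrite !addn0; lia.
Qed.

Lemma eps_below_nominus g c : (forall b, b < c -> g b <> Some false) -> eps_below g c = 0.
Proof.
elim: c => //= c IH H; rewrite IH; last by move=> b bc; apply: H; apply: ltnW.
by have := H c (ltnSn c); case: (g c) => [[]|] //= H'; exfalso; apply: H'.
Qed.

Section InitialColumn.
Variables (n h : nat).
Hypothesis hn : h <= n.
Hypothesis okC : col_ok n (iota 1 h).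

Lemma iota_unpaired p : 0 < p <= n -> paired n (iota 1 h) p = false.
Proof. by move=> pn; rewrite /paired !mem_iota /bar; lia. Qed.

Lemma iota_unmatched p : 0 < p <= n -> matched n (iota 1 h) p = false.
Proof.
move=> pn; rewrite /matched /pending phi_from_noplus ?andbF // => b Hb.
by rewrite /mark iota_unpaired; [case: ifP | lia].
Qed.

(** The columns of the highest weight tableau have no pair, so lC = rC = C. *)
Lemma mem_rcol_iota x : (x \in rcol n (iota 1 h)) = (0 < x <= h).
Proof.
have [xn|xn] := boolP (0 < x <= 2 * n); last first.
  by apply/idP/idP => [/(rcol_range okC)|] Hx; lia.
have [le|gt] := leqP x n.
  by rewrite mem_rcol // ?mem_iota; lia.
have p1 : 0 < bar n x <= n by rewrite /bar; lia.
have -> : x = bar n (bar n x) by rewrite barK.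
rewrite mem_rcol_bar // iota_unmatched // iota_unpaired // mem_iota barK //.
by lia.
Qed.

Lemma mem_dual_iota x : (x \in dual n (lcol n (iota 1 h))) = (0 < x <= 2 * n) && (h < bar n x).
Proof.
rewrite mem_dual; have [xn|//] := boolP (0 < x <= 2 * n); rewrite /=.
have [le|gt] := leqP x n.
  have p1 : 0 < x <= n by lia.
  by rewrite mem_lcol_bar // mem_iota /bar; lia.
have p1 : 0 < bar n x <= n by rewrite /bar; lia.
by rewrite mem_lcol // iota_unmatched // iota_unpaired // mem_iota /bar; lia.
Qed.

End InitialColumn.

Lemma split_family_stacked n D : 0 < n -> (forall d, col_ok n (D d)) -> stacked (2 * n) (split_family n D).
Proof.
move=> n0 ok u; rewrite /split_family; case: (odd u).
  have [so sz _] := rcolP (ok u./2); have [_ _ szn _] := ok u./2; split=> //; last by lia.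
  exact: pos_range (rcol_range (ok u./2)).
split; first exact: sorted_dual.
  by apply/allP => x; rewrite mem_dual => /andP [/andP []].
by rewrite size_filter; apply: leq_trans (count_size _ _) _; rewrite size_iota.
Qed.

Section Base.
Variables (n : nat) (lam : seq nat).
Hypothesis plam : is_partition lam.
Hypothesis n_pos : 0 < n.
Hypothesis lam_n : size lam <= n.
Hypothesis hwK : KN lam n (hw_tableau lam).

Notation M := (nth 0 lam 0).
Notation D T := (column T).
Notation hw := (hw_tableau lam).
Notation F0 := (split_family n (D hw)).

Lemma hw_height c r : (r < colh hw c) = (c < nth 0 lam r).
Proof. by rewrite -in_rowE ?hw_shape // -nth_shape hw_shape. Qed.

Lemma hw_height_n c : colh hw c <= n.
Proof. by apply: leq_trans (colh_size _ _) _; rewrite size_mkseq. Qed.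

Lemma hw_ok c : col_ok n (iota 1 (colh hw c)).
Proof. by rewrite -hw_column //; apply: (kn_ok plam). Qed.

Lemma mem_hw_odd c x : (x \in F0 c.*2.+1) = (0 < x) && (c < nth 0 lam x.-1).
Proof.
rewrite split_odd hw_column // (mem_rcol_iota (hw_height_n c) (hw_ok c)).
by case: x => //= x; rewrite hw_height.
Qed.

Lemma mem_hw_even c x : (x \in F0 c.*2) = (0 < x <= 2 * n) && ~~ (c < nth 0 lam (2 * n - x)).
Proof.
rewrite split_even hw_column // (mem_dual_iota (hw_height_n c) (hw_ok c)).
have [xn|//] := boolP (0 < x <= 2 * n); rewrite /= -hw_height -leqNgt /bar.
by have -> : (2 * n).+1 - x = (2 * n - x).+1 by [lia]; rewrite ltnS.
Qed.

(** The weight of the split columns of the highest weight tableau is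
    lambda^A. *)
Lemma hw_weight r : count (fun c => r.+1 \in F0 c) (iota 0 M.*2) =
  if r < 2 * n then partA n lam r else 0.
Proof.
rewrite count_pairs (eq_count (a2 := fun c => c < nth 0 lam r)); last first.
  by move=> c; rewrite mem_hw_odd.
rewrite count_ltn; last exact: (part_mono plam (leq0n r)).
case: ltnP => lt; last first.
  rewrite (part_zero lam_n) //; last by lia.
  rewrite (eq_count (a2 := pred0)) ?count_pred0 // => c.
  by rewrite mem_hw_even /= ltnNge lt.
rewrite (eq_count (a2 := predC (fun c => c < nth 0 lam (2 * n - r.+1)))); last first.
  by move=> c; rewrite mem_hw_even /= lt.
have := count_predC (fun c => c < nth 0 lam (2 * n - r.+1)) (iota 0 M).
have le : nth 0 lam (2 * n - r.+1) <= nth 0 lam 0 by apply: part_mono.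
by rewrite size_iota (count_ltn le) /partA; lia.
Qed.

(** The split columns are 1, 2, ..., h and 1, 2, ..., 2n-h, without sign -. *)
Lemma hw_signs j u : 0 < j -> j < 2 * n -> fam_sign j F0 u <> Some false.
Proof.
move=> j0 jn H; have [/= H1 H2] := sign_of_minus H; have := odd_double_half u.
move: H1 H2; case: (odd u) => /= + + E; rewrite -E ?add1n ?add0n.
  rewrite !mem_hw_odd /= j0 /= => H1 /negbT/negP; apply.
  by apply: leq_trans H1 (part_mono plam _); lia.
rewrite !mem_hw_even => /andP [H1 H2] /negbT/negP; apply.
rewrite j0 ltnW //= -leqNgt; rewrite -leqNgt in H2.
by apply: leq_trans H2; apply: part_mono => //; lia.
Qed.

Variables (N : nat) (xs : seq cell).
Hypothesis LK : M.*2 * (2 * n) <= N.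
Hypothesis LN : M.*2 <= N.
Hypothesis fN : fits N (lamA n lam).
Hypothesis pl : peels (pile_inner M.*2 (2 * n)) xs.

Let K0 : 0 < 2 * n. Proof. by rewrite muln_gt0. Qed.

Lemma kn_pile_skewt T : KN lam n T ->
  skewt N (pile_inner M.*2 (2 * n)) (pile M.*2 (2 * n) (split_family n (D T))).
Proof.
move=> K; apply: pile_skewt => //; apply: split_family_stacked => // d.
exact: (kn_ok plam).
Qed.

(** The rectification is a highest weight filling of straight shape; its
    rows are its weights, which are the parts of lambda^A. *)
Lemma base_rect R ys : rects xs (pile M.*2 (2 * n) F0) R ys -> R = entry (hw_tableau (lamA n lam)).
Proof.
move=> rc; have Y := kn_pile_skewt hwK; have YR := rects_skewt Y pl rc.
have [Ee _ Ew] := rects_weight Y pl rc.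
have st : stacked (2 * n) F0 by apply: split_family_stacked => // d; apply: (kn_ok plam).
have W r : weight N R r.+1 = if r < 2 * n then partA n lam r else 0.
  by rewrite Ew // (pile_weight K0 LK LN st) // hw_weight.
have Lt : letters 1 (2 * n).-1 R.
  move=> [r c] nz; have pos : 0 < R (r, c) by rewrite lt0n.
  rewrite pos /=; rewrite prednK //; rewrite leqNgt; apply/negP => gt.
  have := W (R (r, c)).-1; rewrite prednK // leqNgt gt /=.
  move/eqP; rewrite -leqn0 leqNgt => /negP; apply.
  rewrite /weight -has_count; apply/hasP; have [rN cN] := filled_box YR nz.
  exists c; first by rewrite mem_iota.
  by apply/occursP; exists r.
have hi j : interval 1 (2 * n).-1 j -> ep N j R = 0.
  move=> /andP [j0 jn]; rewrite Ee // (pile_ep K0 LK LN st) //.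
  by apply: eps_below_nominus => b _; apply: hw_signs => //; lia.
have one : 0 < 1 by [].
apply: functional_extensionality => -[r c].
have pA : is_partition (lamA n lam) by apply: lamA_partition.
have rl : row_len N R r = nth 0 (lamA n lam) r.
  by rewrite -(weight_highest one r YR Lt hi) add1n W nth_lamA.
have pos : (R (r, c) != 0) = (c < nth 0 (lamA n lam) r) by rewrite (row_lenP r c YR) rl.
have [lt|ge] := ltnP c (nth 0 (lamA n lam) r); last first.
  have -> : R (r, c) = 0 by apply/eqP; rewrite -[_ == _]negbK pos -leqNgt.
  rewrite entry_out ?hw_shape // leqNgt -in_rowE ?hw_shape // -nth_shape hw_shape.
  by rewrite -leqNgt.
rewrite (highest_row one YR Lt hi) ?pos // add1n.
have rm : r < size (lamA n lam).
  by rewrite ltnNge; apply/negP => ge; rewrite nth_default in lt.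
by rewrite /entry /= nth_mkseq // nth_nseq lt.
Qed.

Variable E : tableau -> tableau.
Hypothesis bE : is_baker n lam E.

Lemma baker_ssyt T : KN lam n T -> ssyt (lamA n lam) (2 * n) (E T).
Proof. by case: bE => H _ _; apply: H. Qed.

Let pA : is_partition (lamA n lam). Proof. exact: lamA_partition. Qed.

(** If E(T) is the rectification of the split columns of T, the same holds
    for f_i(T): the operators f_(2n-i) and f_i act in parallel on both, and
    E intertwines. *)
Lemma baker_step i T T' xs' ys : 0 < i <= n -> stepKN n lam i T T' ->
  rects xs' (pile M.*2 (2 * n) (split_family n (D T))) (entry (E T)) ys ->
  peels (pile_inner M.*2 (2 * n)) xs' ->
  rects xs' (pile M.*2 (2 * n) (split_family n (D T'))) (entry (E T')) ys /\
  exists2 X, fA (2 * n - i) (E T) = Some X & fA i X = Some (E T').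
Proof.
move=> iN st rc pl'; have [K K' [s stD]] := st.
have okT d : col_ok n (D T d) by exact: (kn_ok plam).
have okT' d : col_ok n (D T' d) by exact: (kn_ok plam).
have [F1 R1 R2] := step_raises iN stD okT okT'.
have stF : stacked (2 * n) (split_family n (D T)) := split_family_stacked n_pos okT.
have stF1 : stacked (2 * n) F1.
  have [t [_ gt _ _] EF] := R1; have [aF aF'] := sign_of_plus gt.
  move=> u; have [so po sz] := stF u; rewrite EF; case: eqP => [Eu|//]; split.
  - by apply: sorted_subst => //; [left | rewrite Eu; apply/negbT].
  - apply/allP => x; rewrite mem_subst => /orP [/andP [/(allP po)]|/andP [/eqP ->]] //.
  - by rewrite size_subst.
have i0 : 0 < i by lia.
have i'0 : 0 < 2 * n - i by lia.
have Y := kn_pile_skewt K.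
have Rs1 := pile_raises K0 LK LN stF i'0 R1.
have Rs2 := pile_raises K0 LK LN stF1 i0 R2.
have [Y1 rc1 RY1] := rects_raised i'0 Y Rs1 pl' rc.
have [Y2 rc2 RY2] := rects_raised i0 (raises_skewt i'0 Y Rs1) Rs2 pl' rc1.
have sE := baker_ssyt K.
have [X1 EX1 E1] := raises_fA pA fN sE i'0 RY1.
have r1 : 0 < 2 * n - i < 2 * n by lia.
have [sX1 _] := fA_raises pA fN sE r1 EX1.
rewrite -E1 in RY2; have [X2 EX2 E2] := raises_fA pA fN sX1 i0 RY2.
have EE : E T' = X2.
  have [_ _ H] := bE; have := H T i K; rewrite iN (stepKN_f plam iN st) /= => /(_ isT).
  rewrite /fE; case: ltnP => lt; first by rewrite EX1 /= EX2 => -[].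
  have Ei : i = n by lia.
  have En : 2 * n - i = n by lia.
  by rewrite -[in fA n (E T)]En EX1 /= -[X in fA X]Ei EX2 => -[].
split; first by rewrite EE E2.
by exists X1; rewrite // EE.
Qed.

End Base.

(** * Consequences for E *)

Section TypeAOps.
Variables (N m : nat) (mu : seq nat).
Hypothesis pmu : is_partition mu.
Hypothesis fN : fits N mu.

Lemma eA_None X j : ssyt mu m X -> 0 < j -> eA j X = None <-> ep N j (entry X) = 0.
Proof.
move=> sX j0; have Y := ssyt_skewt pmu fN sX; split=> [E|e0].
  apply/eqP; rewrite -leqn0 leqNgt; apply/negP => /(lowersP j0 Y) [S' Y' Rs].
  by have [T' ET' _] := raises_eA pmu fN sX j0 Y' Rs; rewrite ET' in E.
case E: (eA j X) => [X'|] //; have [sX' Rs] := eA_raises pmu fN sX j0 E.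
have : 0 < ep N j (entry X).
  by apply/(lowersP j0 Y); exists (entry X'); first exact: (ssyt_skewt pmu fN sX').
by rewrite e0.
Qed.

Lemma fA_None X j : ssyt mu m X -> 0 < j < m -> fA j X = None <-> ph N j (entry X) = 0.
Proof.
move=> sX jm; have Y := ssyt_skewt pmu fN sX; have j0 : 0 < j by case/andP: jm.
split=> [E|p0].
  apply/eqP; rewrite -leqn0 leqNgt; apply/negP => /(raisesP j Y) [S' Rs].
  by have [T' ET' _] := raises_fA pmu fN sX j0 Rs; rewrite ET' in E.
case E: (fA j X) => [X'|] //; have [sX' Rs] := fA_raises pmu fN sX jm E.
have : 0 < ph N j (entry X) by apply/(raisesP j Y); exists (entry X').
by rewrite p0.
Qed.

Lemma fA_eA X Y j : ssyt mu m X -> 0 < j < m -> fA j X = Some Y -> ssyt mu m Y /\ eA j Y = Some X.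
Proof.
move=> sX jm E; have [sY Rs] := fA_raises pmu fN sX jm E.
have j0 : 0 < j by case/andP: jm.
have [X' EX' Ee] := raises_eA pmu fN sY j0 (ssyt_skewt pmu fN sX) Rs.
have [sX' _] := eA_raises pmu fN sY j0 EX'.
split=> //; rewrite EX'; congr Some; apply: eq_tableau => [|x]; last by rewrite Ee.
by rewrite (ssyt_shape sX) (ssyt_shape sX').
Qed.

End TypeAOps.

Lemma apply_ops_cat g s1 s2 u : apply_ops g (s1 ++ s2) u = obind (apply_ops g s2) (apply_ops g s1 u).
Proof.
rewrite /apply_ops foldl_cat; case: (foldl _ _ s1) => //=.
by elim: s2.
Qed.

Lemma apply_ops_cons g j s u : apply_ops g (j :: s) u = obind (apply_ops g s) (g j u).
Proof. exact: (apply_ops_cat g [:: j] s u). Qed.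

Section Virtual.
Variables (n : nat) (lam : seq nat) (E : tableau -> tableau) (T0 : tableau).
Hypothesis plam : is_partition lam.
Hypothesis n_pos : 0 < n.
Hypothesis lam_n : size lam <= n.
Hypothesis bE : is_baker n lam E.
Hypothesis K0 : KN lam n T0.

Notation M := (nth 0 lam 0).
Notation L := (M.*2).
Notation D T := (column T).
Notation lamE := (lamA n lam).
Notation sw T := (pile L (2 * n) (split_family n (D T))).

(** A bound for the strips of the pile as well as for lambda^A. *)
Let N := L * (2 * n) + L + size lamE + nth 0 lamE 0.
Let LK : L * (2 * n) <= N. Proof. by rewrite /N -!addnA leq_addr. Qed.
Let LN : L <= N. Proof. by rewrite /N; lia. Qed.
Let fN : fits N lamE. Proof. by split; rewrite /N; lia. Qed.
Let pA : is_partition lamE. Proof. exact: lamA_partition. Qed.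
Let H0 : 0 < 2 * n. Proof. by lia. Qed.
Let sE T (K : KN lam n T) := baker_ssyt bE K.
Let okK T d (K : KN lam n T) := kn_ok plam d K.

Lemma hw_KN : KN lam n (hw_tableau lam).
Proof.
have [|u [js [Ku hu _ _]]] := to_highest_KN plam (J := fun j => 0 < j <= n) _ K0; first by [].
by rewrite -(highest_hw plam Ku hu).
Qed.

(** Every T is reached from the highest weight tableau, and one order of
    slides, with the same vacated cells, serves for all T. *)
Lemma baker_rects : exists xs ys, peels (pile_inner L (2 * n)) xs /\
  forall T, KN lam n T -> rects xs (sw T) (entry (E T)) ys.
Proof.
have [xs pl] : exists xs, peels (pile_inner L (2 * n)) xs by apply: pile_peels.
have Y := kn_pile_skewt plam n_pos LK LN hw_KN.
have [R [ys rc]] := rects_exists Y pl.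
exists xs, ys; split=> // T K.
have ER := base_rect plam n_pos lam_n hw_KN LK LN pl rc.
have Ehw : entry (E (hw_tableau lam)) = R by case: bE => _ -> _.
have [|u [js [Ku hu Js Ejs]]] := to_highest_KN plam (J := fun j => 0 < j <= n) _ K; first by [].
move: Ejs; rewrite (highest_hw plam Ku hu) {u Ku hu}.
elim/last_ind: js T K Js => [|js j IH] T K; first by move=> _ [<-]; rewrite Ehw.
rewrite all_rcons apply_ops_rcons => /andP [Jj Js].
case Ej: (apply_ops _ js _) => [T1|] //= ET.
have K1 : KN lam n T1.
  elim/last_ind: js T1 Ej Js {IH ET} => [|js j' IH] T1; first by move=> [<-] _; apply: hw_KN.
  rewrite apply_ops_rcons all_rcons => + /andP [Jj' Js].
  case Ej': (apply_ops _ js _) => [T2|] //= ET1.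
  by have [_ K2 _] := fC_KN plam Jj' (IH _ Ej' Js) ET1.
have st := fC_KN plam Jj K1 ET.
by have [rc' _] := baker_step plam n_pos lam_n hw_KN LK LN fN bE Jj st (IH _ K1 Js Ej) pl.
Qed.

(** The slides can be undone, and lC and rC determine C. *)
Lemma baker_inj T T' : KN lam n T -> KN lam n T' -> E T = E T' -> T = T'.
Proof.
move=> K K' EE; have [xs [ys [pl rc]]] := baker_rects.
have Y := kn_pile_skewt plam n_pos LK LN K; have Y' := kn_pile_skewt plam n_pos LK LN K'.
have rc' := rc T' K'; rewrite -EE in rc'.
have Ep := rects_inj Y Y' pl (rc T K) rc'.
have st := split_family_stacked n_pos (fun d => okK d K).
have st' := split_family_stacked n_pos (fun d => okK d K').
have same u x : u < L -> (x \in split_family n (D T) u) = (x \in split_family n (D T') u).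
  move=> uL; case: (posnP x) => [->|x0].
    have [_ /allP po _] := st u; have [_ /allP po' _] := st' u.
    by apply/idP/idP => [/po|/po'].
  have := pile_occurs H0 LK LN st u x0; have := pile_occurs H0 LK LN st' u x0.
  by rewrite uL /= -Ep => -> ->.
apply: eq_columns; first exact: (kn_partition plam K).
  by rewrite (kn_shape plam K) (kn_shape plam K').
move=> c; have [ge|cM] := leqP M c; first by rewrite (kn_empty plam K ge) (kn_empty plam K' ge).
have ok := okK c K; have ok' := okK c K'.
have [so _ _ _] := ok; have [so' _ _ _] := ok'.
apply: (irr_sorted_eq ltn_trans ltnn so so') => x.
have [xn|xn] := boolP (0 < x <= 2 * n); last first.
  by apply/idP/idP => [/(col_range ok)|/(col_range ok')] Hx; rewrite Hx in xn.
(* rC contains the unbarred letters of C, and lC the barred ones *)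
have [le|gt] := leqP x n.
  have := same c.*2.+1 x; rewrite !split_odd !mem_rcol //; [apply | |]; lia.
have := same c.*2 (bar n x); rewrite !split_even !mem_dual barK //.
have b1 : 0 < bar n x <= n by rewrite /bar; lia.
have -> : 0 < bar n x <= 2 * n by lia.
have := mem_lcol_bar ok b1; have := mem_lcol_bar ok' b1; rewrite barK // => -> ->.
by move=> /= H; apply: negb_inj; apply: H; lia.
Qed.

(** Rectification preserves the number of uncancelled signs, which for
    split columns is that of T, or twice that number. *)
Lemma baker_ep T i : KN lam n T -> 0 < i <= n ->
  [/\ eC n i T = None <-> eA i (E T) = None & eC n i T = None <-> eA (2 * n - i) (E T) = None].
Proof.
move=> K iN; have [xs [ys [pl rc]]] := baker_rects.
have Y := kn_pile_skewt plam n_pos LK LN K; have [Ee _ _] := rects_weight Y pl (rc T K).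
have st := split_family_stacked n_pos (fun d => okK d K).
have i0 : 0 < i by case/andP: iN.
have i'0 : 0 < 2 * n - i by lia.
have e1 := eC_None plam iN K.
have e2 := eA_None pA fN (sE K) i0; have e3 := eA_None pA fN (sE K) i'0.
rewrite Ee // (pile_ep H0 LK LN st) // in e2; rewrite Ee // (pile_ep H0 LK LN st) // in e3.
have := eps_split iN (fun d => okK d K) M => Es; rewrite Es in e3.
have A2 : eC n i T = None <-> eA (2 * n - i) (E T) = None.
  rewrite e1 e3; case: (i < n) => //.
  by case: (eps_below _ _) => [|e]; split.
split=> //; have [lt|ge] := ltnP i n.
  by rewrite e1 e2 (eq_eps_below (g' := half_sign n i (D T))) // => s _; apply: (fam_sign_low iN (fun d => okK d K) lt).
have Ei : i = n by lia.
by have -> : eA i = eA (2 * n - i) by congr eA; lia.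
Qed.

Lemma baker_ph T i : KN lam n T -> 0 < i <= n ->
  [/\ fC n i T = None <-> fA i (E T) = None & fC n i T = None <-> fA (2 * n - i) (E T) = None].
Proof.
move=> K iN; have [xs [ys [pl rc]]] := baker_rects.
have Y := kn_pile_skewt plam n_pos LK LN K; have [_ Ee _] := rects_weight Y pl (rc T K).
have st := split_family_stacked n_pos (fun d => okK d K).
have i0 : 0 < i by case/andP: iN.
have i'0 : 0 < 2 * n - i by lia.
have im : 0 < i < 2 * n by lia.
have i'm : 0 < 2 * n - i < 2 * n by lia.
have e1 := fC_None plam iN K.
have e2 := fA_None pA fN (sE K) im; have e3 := fA_None pA fN (sE K) i'm.
rewrite Ee // (pile_ph H0 LK LN st) // in e2; rewrite Ee // (pile_ph H0 LK LN st) // in e3.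
have Es := phi_split iN (fun d => okK d K) 0 M; rewrite Es in e3.
have A2 : fC n i T = None <-> fA (2 * n - i) (E T) = None.
  rewrite e1 e3; case: (i < n) => //.
  by case: (phi_from _ _ _) => [|e]; split.
split=> //; have [lt|ge] := ltnP i n.
  by rewrite e1 e2 (eq_phi_from (g' := half_sign n i (D T))) // => s _; apply: (fam_sign_low iN (fun d => okK d K) lt).
have Ei : i = n by lia.
by have -> : fA i = fA (2 * n - i) by congr fA; lia.
Qed.

Lemma baker_f i T T' : 0 < i <= n -> stepKN n lam i T T' ->
  exists2 X, fA (2 * n - i) (E T) = Some X & fA i X = Some (E T').
Proof.
move=> iN st; have [K _ _] := st; have [xs [ys [pl rc]]] := baker_rects.
by have [_] := baker_step plam n_pos lam_n hw_KN LK LN fN bE iN st (rc T K) pl.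
Qed.

Lemma baker_e i T T' : 0 < i <= n -> stepKN n lam i T T' ->
  exists2 X, eA i (E T') = Some X & eA (2 * n - i) X = Some (E T).
Proof.
move=> iN st; have [K _ _] := st; have [X E1 E2] := baker_f iN st.
have i'm : 0 < 2 * n - i < 2 * n by lia.
have im : 0 < i < 2 * n by lia.
have [sX E1'] := fA_eA pA fN (sE K) i'm E1.
by have [_ E2'] := fA_eA pA fN sX im E2; exists X.
Qed.

End Virtual.

(** * The involutions correspond *)

Section Involutions.
Variables (n : nat) (lam : seq nat) (k : nat) (E : tableau -> tableau).
Hypothesis plam : is_partition lam.
Hypothesis n_pos : 0 < n.
Hypothesis lam_n : size lam <= n.
Hypothesis kn : 0 < k <= n.
Hypothesis bE : is_baker n lam E.

Notation BC := (KN_crystal lam n).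
Notation BA := (SSYT_crystal (lamA n lam) (2 * n)).
Notation JC := (interval k n).
Notation JA := (interval k (2 * n - k)).
Notation thetaA := (fun j => k + (2 * n - k) - j).

Let JC_pos j : JC j -> 0 < j <= n.
Proof. by rewrite /interval; lia. Qed.

Let JC_JA j : JC j -> JA j /\ JA (2 * n - j).
Proof. by rewrite /interval; lia. Qed.

(** [k,2n-k] consists of the nodes j of [k,n] and their mirror images 2n-j. *)
Lemma JA_JC j : JA j -> exists2 i, JC i & j = i \/ j = 2 * n - i.
Proof.
rewrite /interval => /andP [kj jn]; have [le|gt] := leqP j n.
  by exists j; [rewrite kj | left].
by exists (2 * n - j); [lia | right; lia].
Qed.

(** The words of type A for a word js of type C; the operators of a pair
    come in opposite orders, as the diagram automorphism exchanges them
    ([theta_word]). *)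
Definition f_word js := flatten [seq [:: 2 * n - j; j] | j <- js].
Definition e_word js := flatten [seq [:: j; 2 * n - j] | j <- js].

Lemma theta_word js : all JC js -> map thetaA (f_word js) = e_word js.
Proof.
elim: js => //= j js IH /andP [/JC_pos jn Js]; rewrite -/(f_word js) -/(e_word js) IH //.
by congr [:: _, _ & _]; lia.
Qed.

Lemma all_word js : all JC js -> all JA (f_word js).
Proof. by elim: js => //= j js IH /andP [/JC_JA [-> ->] /IH]. Qed.

Lemma f_word_E js U V : KN lam n U -> all JC js -> apply_ops (fC n) js U = Some V ->
  KN lam n V /\ apply_ops fA (f_word js) (E U) = Some (E V).
Proof.
elim: js U => [|j js IH] U K /=; first by move=> _ [<-].
move=> /andP [/JC_pos jn Js]; rewrite apply_ops_cons; case EU: (fC n j U) => [U1|] //= EV.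
have st := fC_KN plam jn K EU; have [_ K1 _] := st.
have [KV EV'] := IH U1 K1 Js EV; split=> //.
have [X E1 E2] := baker_f plam n_pos lam_n bE K jn st.
by rewrite apply_ops_cons E1 /= apply_ops_cons E2.
Qed.

Lemma e_word_E js U V : KN lam n U -> all JC js -> apply_ops (eC n) js U = Some V ->
  KN lam n V /\ apply_ops eA (e_word js) (E U) = Some (E V).
Proof.
elim: js U => [|j js IH] U K /=; first by move=> _ [<-].
move=> /andP [/JC_pos jn Js]; rewrite apply_ops_cons; case EU: (eC n j U) => [U1|] //= EV.
have st := eC_KN plam jn K EU; have [K1 _ _] := st.
have [KV EV'] := IH U1 K1 Js EV; split=> //.
have [X E1 E2] := baker_e plam n_pos lam_n bE K jn st.
by rewrite apply_ops_cons E1 /= apply_ops_cons E2.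
Qed.

(** e_j kills T if it kills the image, so a word that does not vanish on
    the image does not vanish on T. *)
Lemma e_word_lift js U X : KN lam n U -> all JC js ->
  apply_ops eA (e_word js) (E U) = Some X -> exists V, apply_ops (eC n) js U = Some V.
Proof.
elim: js U => [|j js IH] U K; first by exists U.
move=> /= /andP [/JC_pos jn Js]; rewrite -[e_word _]/[:: j, 2 * n - j & e_word js].
rewrite apply_ops_cons => EX.
have [H _] := baker_ep plam n_pos lam_n bE K K jn.
case EU: (eC n j U) => [U1|]; last by rewrite (H.1 EU) in EX.
have st := eC_KN plam jn K EU; have [K1 _ _] := st.
have [Y E1 E2] := baker_e plam n_pos lam_n bE K jn st.
move: EX; rewrite E1 /= apply_ops_cons E2 /= => EX.
by have [V EV] := IH U1 K1 Js EX; exists V; rewrite apply_ops_cons EU.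
Qed.

Lemma highest_E U : highest BC JC U -> highest BA JA (E U).
Proof.
move=> [/= K hi]; split; first exact: (baker_ssyt bE).
move=> j /JA_JC [i Ji Ej]; have [H1 H2] := baker_ep plam n_pos lam_n bE K K (JC_pos Ji).
have e0 := hi _ Ji.
by case: Ej => ->; [apply/H1 | apply/H2].
Qed.

Lemma lowest_E U : lowest BC JC U -> lowest BA JA (E U).
Proof.
move=> [/= K lo]; split; first exact: (baker_ssyt bE).
move=> j /JA_JC [i Ji Ej]; have [H1 H2] := baker_ph plam n_pos lam_n bE K K (JC_pos Ji).
have e0 := lo _ Ji.
by case: Ej => ->; [apply/H1 | apply/H2].
Qed.

Lemma connected_E U V : KN lam n U -> connected BC JC U V ->
  KN lam n V /\ connected BA JA (E U) (E V).
Proof.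
move=> K; elim=> [|j V1 V2 _ [K1 C1] Jj /= EV|j V1 V2 _ [K1 C1] Jj /= EV].
- by split=> //; apply: conn_refl.
- have jn := JC_pos Jj; have st := fC_KN plam jn K1 EV; have [_ K2 _] := st; split=> //.
  have [X E1 E2] := baker_f plam n_pos lam_n bE K jn st.
  have [J1 J2] := JC_JA Jj.
  exact: (conn_f (B := BA) (conn_f (B := BA) C1 J2 E1) J1 E2).
- have jn := JC_pos Jj; have st := eC_KN plam jn K1 EV; have [K2 _ _] := st; split=> //.
  have [X E1 E2] := baker_e plam n_pos lam_n bE K jn st.
  have [J1 J2] := JC_JA Jj.
  exact: (conn_e (B := BA) (conn_e (B := BA) C1 J1 E1) J2 E2).
Qed.

Lemma is_xi_E T T' : is_xi BC JC id T T' ->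
  KN lam n T' /\ is_xi BA JA thetaA (E T) (E T').
Proof.
move=> [u [l [js [hu hl C Js [/= Ef]]]]]; rewrite map_id => Ee.
have [Ku _] := hu; have [Kl CE] := connected_E Ku C.
have [_ EfE] := f_word_E Ku Js Ef; have [K' EeE] := e_word_E Kl Js Ee.
split=> //; exists (E u), (E l), (f_word js); split=> //.
- exact: highest_E.
- exact: lowest_E.
- exact: all_word.
- by rewrite theta_word.
Qed.

Let N := size (lamA n lam) + nth 0 (lamA n lam) 0.
Let fN : fits N (lamA n lam). Proof. by rewrite /N; split; lia. Qed.
Let pA : is_partition (lamA n lam). Proof. exact: lamA_partition. Qed.
Let k_pos : 0 < k. Proof. by case/andP: kn. Qed.
Let km : 2 * n - k < 2 * n. Proof. by lia. Qed.

Lemma connected_ops (B : crystal) J js u v : all J js -> apply_ops (ff B) js u = Some v ->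
  connected B J u v.
Proof.
elim/last_ind: js v => [|js j IH] v; first by move=> _ [<-]; apply: conn_refl.
rewrite all_rcons apply_ops_rcons => /andP [Jj Js].
by case Ev: (apply_ops _ js u) => [w|] //= Ej; apply: conn_f (IH _ Js Ev) Jj Ej.
Qed.

(** A path from a highest weight element to T exists; the opposite word
    does not vanish on the lowest weight element because its image in type
    A does not ([xi_path_exists]). *)
Lemma is_xi_C T : KN lam n T -> is_xi BC JC id T (xiC lam n k T).
Proof.
move=> K; apply: epsilon_spec.
have [u [js [Ku hi Js Ejs]]] := to_highest_KN plam JC_pos K.
have [l [js' [Kl lo Js' Ejs']]] := to_lowest_KN plam JC_pos K.
have C : connected BC JC u l.
  apply: (connected_ops (js := js ++ js')); first by rewrite all_cat Js.
  by rewrite apply_ops_cat Ejs.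
have hu : highest BC JC u by [].
have hl : lowest BC JC l by [].
have [_ CE] := connected_E Ku C; have [_ EfE] := f_word_E Ku Js Ejs.
have sE := baker_ssyt bE K.
have sQ := row_filling_standard (inner_partition k pA fN sE).
have [X EX] := xi_path_exists pA fN k_pos km sE sQ (highest_E hu) (lowest_E hl) CE (all_word Js) EfE.
rewrite theta_word // in EX.
have [T' ET'] := e_word_lift Kl Js EX.
by exists T', u, l, js; split=> //; rewrite map_id.
Qed.

Theorem xiA_reversal X Q : ssyt (lamA n lam) (2 * n) X -> standard_filling (inner_shape k X) Q ->
  xiA (lamA n lam) (2 * n) k (2 * n - k) X = reversal k (2 * n - k) Q X.
Proof.
move=> sX sQ; have [ex uniq] := xi_reversal pA fN k_pos km sX sQ.
by apply: uniq; apply: epsilon_spec; exists (reversal k (2 * n - k) Q X).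
Qed.

Lemma E_xiC T Q : KN lam n T -> standard_filling (inner_shape k (E T)) Q ->
  E (xiC lam n k T) = reversal k (2 * n - k) Q (E T).
Proof.
move=> K sQ; have [_ xE] := is_xi_E (is_xi_C K).
by have [_ uniq] := xi_reversal pA fN k_pos km (baker_ssyt bE K) sQ; apply: uniq.
Qed.

Theorem E_xi T : KN lam n T ->
  xiA (lamA n lam) (2 * n) k (2 * n - k) (E T) = E (xiC lam n k T).
Proof.
move=> K; have sE := baker_ssyt bE K.
have sQ := row_filling_standard (inner_partition k pA fN sE).
by rewrite (E_xiC K sQ) (xiA_reversal sE sQ).
Qed.

Theorem xiC_reversal T Q : KN lam n T -> standard_filling (inner_shape k (E T)) Q ->
  xiC lam n k T = baker_inv n lam E (reversal k (2 * n - k) Q (E T)).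
Proof.
move=> K sQ; have [K' _] := is_xi_E (is_xi_C K); have EE := E_xiC K sQ.
have [K1 E1] : KN lam n (baker_inv n lam E (reversal k (2 * n - k) Q (E T))) /\
    E (baker_inv n lam E (reversal k (2 * n - k) Q (E T))) = reversal k (2 * n - k) Q (E T).
  by apply: (epsilon_spec (inhabits [::]) (fun T1 => KN lam n T1 /\ E T1 = _)); exists (xiC lam n k T).
apply: (baker_inj plam n_pos lam_n bE K K' K1).
by rewrite EE E1.
Qed.

End Involutions.

Theorem theorem6 (n : nat) (lam : seq nat) (k : nat) (E : tableau -> tableau) :
  1 <= n -> is_partition lam -> size lam <= n -> 1 <= k <= n ->
  is_baker n lam E ->
  [/\ forall T, KN lam n T ->
        xiA (lamA n lam) (2 * n) k (2 * n - k) (E T) = E (xiC lam n k T),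
      forall X Q, ssyt (lamA n lam) (2 * n) X ->
        standard_filling (inner_shape k X) Q ->
        xiA (lamA n lam) (2 * n) k (2 * n - k) X
          = reversal k (2 * n - k) Q X
    & forall T Q, KN lam n T ->
        standard_filling (inner_shape k (E T)) Q ->
        xiC lam n k T
          = baker_inv n lam E (reversal k (2 * n - k) Q (E T))].
Proof.
move=> n_pos plam lam_n kn bE; split.
- by move=> T; apply: E_xi.
- by move=> X Q; apply: xiA_reversal.
- by move=> T Q; apply: xiC_reversal.
Qed.
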